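(* Let $p$ be a prime and $X=\mathbb{P}^1\setminus\{0,1,\infty\}$ over $\mathbb{Q}_p$. Let $$g={}_{t_{01}}e(dR)_{t_{10}}\cdot F_*\big({}_{t_{10}}e(dR)_{t_{01}}\big)\in \pi_{1,dR}(X,t_{01})(\mathbb{Q}_p)\subseteq \mathbb{Q}_p\langle\langle e_0,e_1\rangle\rangle$$ be the element measuring the action of the crystalline frobenius $F_*$ on the canonical de Rham path from $t_{01}$ to $t_{10}$. Then $g\in \mathrm{GRT}_1(\mathbb{Q}_p)$; that is, writing $g=g(e_0,e_1)$: (i) $g(e_1,e_0)\, g(e_0,e_1)=1$; (ii) $g(e_\infty,e_0)\,g(e_1,e_\infty)\,g(e_0,e_1)=1$, where $e_\infty=-e_0-e_1$; (iii) $g(e_{23},e_{34})\, g(e_{40},e_{01})\, g(e_{12},e_{23})\, g(e_{34},e_{40})\, g(e_{01},e_{12})=1$ in the completed associative $\mathbb{Q}_p$-algebra topologically generated by $e_{ij}$, $0\le i,j\le 4$, subject to $e_{ii}=0$, $e_{ij}=e_{ji}$, $\sum_{j}e_{ij}=0$ for all $i$, and $[e_{ij},e_{kl}]=0$ if $\{i,j\}\cap\{k,l\}=\emptyset$.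
   Context: For a field $K$ of characteristic zero, $K\langle\langle A,B\rangle\rangle$ is the ring of associative formal power series in noncommuting variables $A,B$. $\mathrm{GRT}_1(K)$ is the set of $\varphi\in K\langle\langle A,B\rangle\rangle$ with $\varphi(B,A)\varphi(A,B)=1$; $\varphi(C,A)\varphi(B,C)\varphi(A,B)=1$ when $A+B+C=0$; and $\varphi(x_{23},x_{34})\varphi(x_{40},x_{01})\varphi(x_{12},x_{23})\varphi(x_{34},x_{40})\varphi(x_{01},x_{12})=1$ when $x_{ii}=0$, $x_{ij}=x_{ji}$, $\sum_j x_{ij}=0$, and $[x_{ij},x_{kl}]=0$ for $\{i,j\}\cap\{k,l\}=\emptyset$ (indices in $\{0,\dots,4\}$). De Rham side. $\mathrm{Mic}_{uni}(X/\mathbb{Q}_p)$ is the tannakian category of unipotent vector bundles with integrable connection on $X$. Each object $(E,\nabla)$ has a canonical extension $(\overline{E},\nabla)$ to $\mathbb{P}^1$ with logarithmic poles and nilpotent residues at $0,1,\infty$, and $\overline E$ is a trivial bundle. Thus $\omega(dR)(E)=\Gamma(\mathbb{P}^1,\overline{E})$ is a fiber functor. With $z$ the standard coordinate, the tangential basepoint $t_{01}$ is $d/dz$ at $0$, and $t_{10}$ is $-d/dz$ at $1$; their fiber functors are $E\mapsto\overline E(0)$ and $E\mapsto\overline E(1)$. For basepoints $x,y$, the canonical de Rham path ${}_ye(dR)_x$ is the isomorphism of fiber functors $\omega(x)\to\omega(y)$ obtained from $\overline{E}(x)\simeq\Gamma(\mathbb{P}^1,\overline{E})\simeq\overline{E}(y)$.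 Paths compose from right to left. $\pi_{1,dR}(X,t_{01})$ is the pro-unipotent group of tensor automorphisms of the fiber functor at $t_{01}$. Its Lie algebra is freely topologically generated by $e_0,e_1$, the residue elements at $0,1$ (if $\overline E=V\otimes\mathcal{O}$ with $\nabla=d-N_0\frac{dz}{z}-N_1\frac{dz}{z-1}$, then $e_i$ acts on $V$ by $N_i$), and $\pi_{1,dR}(X,t_{01})(\mathbb{Q}_p)$ is identified with the group-like series in $\mathbb{Q}_p\langle\langle e_0,e_1\rangle\rangle$ (with $e_0,e_1$ primitive). Frobenius. Using the model $(\mathbb{P}^1_{\mathbb{Z}_p},\{0,1,\infty\})$, $\mathrm{Mic}_{uni}(X/\mathbb{Q}_p)$ is equivalent to the category of unipotent overconvergent isocrystals on $X_{\mathbb{F}_p}$, and pullback by the absolute Frobenius of $X_{\mathbb{F}_p}$ gives a functor $F^*:\mathrm{Mic}_{uni}(X/\mathbb{Q}_p)\to\mathrm{Mic}_{uni}(X/\mathbb{Q}_p)$. For each basepoint $x$ (ordinary or tangential) with good reduction there is a canonical isomorphism $\iota_x:\omega(x)(F^*E)\to\omega(x)(E)$. For a tangent vector $v$ at a cusp with local parameter $s$ (vanishing at the cusp, and a parameter over $\mathbb{Z}_p$): if $\mathcal{F}$ is a local lifting of Frobenius fixing the cusp, with $\mathcal{F}^*s=as^p(1+\cdots)$, then $\overline{F^*E}$ at the cusp is identified with $\overline{E}$ at the cusp via $\mathcal F$, and $\iota_v=\exp\big(N\log\frac{v}{a v^p}\big)$, where $N$ is the residue, i.e. minus the action of $\nabla_{s\partial_s}$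 on the fiber, and $v$ also denotes $ds(v)$. A path $\gamma$ from $\omega(x)$ to $\omega(y)$ is sent to $F_*(\gamma)$, defined by $F_*(\gamma)_E=\iota_y\circ\gamma_{F^*E}\circ\iota_x^{-1}$. *)

(* Defs.v *)
(* Mathematical Components, with mathcomp-classical for limits and functions. *)
From HB Require Import structures.
From mathcomp Require Import all_boot all_order all_algebra.
From mathcomp Require Import boolp classical_sets functions.

Set Implicit Arguments.
Unset Strict Implicit.
Unset Printing Implicit Defensive.

Import Order.TTheory GRing.Theory Num.Theory.
Local Open Scope ring_scope.

(* Noncommutative formal power series: a series is the family of its          *)
(* coefficients, indexed by words.                                            *)

Record ncseries (K : fieldType) (X : eqType) := NcSeries {
  coef :> seq X -> K
}.

HB.instance Definition _ (K : fieldType) (X : eqType) :=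
  gen_eqMixin (ncseries K X).
HB.instance Definition _ (K : fieldType) (X : eqType) :=
  gen_choiceMixin (ncseries K X).

Section NcSeriesRing.
Variables (K : fieldType) (X : eqType).
Implicit Types (f g h : ncseries K X) (w : seq X).

Lemma ncseriesP f g : f =1 g <-> f = g.
Proof.
split=> [|-> //]; case: f g => [f] [g] /= fg; congr NcSeries.
exact/funext.
Qed.

Definition ncs_zero : ncseries K X := NcSeries (fun=> 0).
Definition ncs_opp f : ncseries K X := NcSeries (fun w => - f w).
Definition ncs_add f g : ncseries K X := NcSeries (fun w => f w + g w).
Definition ncs_one : ncseries K X := NcSeries (fun w => (w == [::])%:R).
Definition ncs_mul f g : ncseries K X :=
  NcSeries (fun w => \sum_(i < (size w).+1) f (take i w) * g (drop i w)).

Let ncs_addA : associative ncs_add.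
Proof. by move=> f g h; apply/ncseriesP => w /=; rewrite addrA. Qed.
Let ncs_addC : commutative ncs_add.
Proof. by move=> f g; apply/ncseriesP => w /=; rewrite addrC. Qed.
Let ncs_add0 : left_id ncs_zero ncs_add.
Proof. by move=> f; apply/ncseriesP => w /=; rewrite add0r. Qed.
Let ncs_addN : left_inverse ncs_zero ncs_opp ncs_add.
Proof. by move=> f; apply/ncseriesP => w /=; rewrite addNr. Qed.

HB.instance Definition _ := GRing.isZmodule.Build (ncseries K X)
  ncs_addA ncs_addC ncs_add0 ncs_addN.

Let der (x : X) f : ncseries K X := NcSeries (fun w => f (x :: w)).
Let scale c f : ncseries K X := NcSeries (fun w => c * f w).

Let ncs_mul0 f g : ncs_mul f g [::] = f [::] * g [::].
Proof. by rewrite /= big_ord1. Qed.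

Let ncs_mulS f g x w :
  ncs_mul f g (x :: w) = f [::] * g (x :: w) + ncs_mul (der x f) g w.
Proof. by rewrite /= big_ord_recl. Qed.

Let ncs_mulDl : left_distributive ncs_mul +%R.
Proof.
move=> f g h; apply/ncseriesP => w /=; rewrite -big_split /=.
by apply: eq_bigr => i _; rewrite mulrDl.
Qed.

Let ncs_mulDr : right_distributive ncs_mul +%R.
Proof.
move=> f g h; apply/ncseriesP => w /=; rewrite -big_split /=.
by apply: eq_bigr => i _; rewrite mulrDr.
Qed.

Let ncs_mulZl c f g w : ncs_mul (scale c f) g w = c * ncs_mul f g w.
Proof. by rewrite /= mulr_sumr; apply: eq_bigr => i _; rewrite mulrA. Qed.

Let ncs_mulA : associative ncs_mul.
Proof.
move=> f g h; apply/ncseriesP => w; elim: w f g => [|x w IHw] f g.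
  by rewrite !ncs_mul0 mulrA.
rewrite !ncs_mulS IHw ncs_mul0 mulrDr -!addrA mulrA; congr (_ + _).
have -> : der x (ncs_mul f g) =
    scale (f [::]) (der x g) + ncs_mul (der x f) g.
  by apply/ncseriesP => v; rewrite [LHS]ncs_mulS.
by rewrite ncs_mulDl -ncs_mulZl.
Qed.

Let ncs_mul1r : left_id ncs_one ncs_mul.
Proof.
move=> f; apply/ncseriesP => -[|x w]; first by rewrite ncs_mul0 mul1r.
by rewrite ncs_mulS mul1r [X in _ + X]big1 ?addr0 // => i _; rewrite mul0r.
Qed.

Let ncs_mulr1 : right_id ncs_one ncs_mul.
Proof.
move=> f; apply/ncseriesP => w; elim: w f => [|x w IHw] f.
  by rewrite ncs_mul0 mulr1.
by rewrite ncs_mulS IHw mulr0 add0r.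
Qed.

Let ncs_one_neq0 : ncs_one != 0.
Proof. by apply/eqP => /ncseriesP /(_ [::]) /eqP; rewrite oner_eq0. Qed.

HB.instance Definition _ := GRing.Zmodule_isNzRing.Build (ncseries K X)
  ncs_mulA ncs_mul1r ncs_mulr1 ncs_mulDl ncs_mulDr ncs_one_neq0.

Definition letter (x : X) : ncseries K X := NcSeries (fun w => (w == [:: x])%:R).

End NcSeriesRing.

(* phi(a, b) for a series phi in two letters: the letter false is the first   *)
(* variable, true is the second. It is meaningful when a and b have no        *)
(* constant term: words longer than w then contribute 0 to the coefficient    *)
(* of w.                                                                      *)
Definition subst (K : fieldType) (X : eqType) (phi : ncseries K bool)
    (a b : ncseries K X) : ncseries K X :=
  NcSeries (fun w => \sum_(k < (size w).+1) \sum_(v : k.-tuple bool)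
    phi v * (\prod_(i <- v) if i then b else a) w).

(* Membership in the closure (for the topology defined by the degree of       *)
(* words) of the two-sided ideal generated by S.                              *)
Inductive two_sided_ideal (R : pzRingType) (S : R -> Prop) : R -> Prop :=
| Ideal0 : two_sided_ideal S 0
| IdealD f g : two_sided_ideal S f -> two_sided_ideal S g ->
    two_sided_ideal S (f + g)
| IdealM f r g : S r -> two_sided_ideal S (f * r * g).

Definition closed_ideal (K : fieldType) (X : eqType)
    (S : ncseries K X -> Prop) (f : ncseries K X) : Prop :=
  forall d : nat, exists g : ncseries K X,
    two_sided_ideal S g /\ forall w, (size w <= d)%N -> f w = g w.

(* The completed algebra on the e_ij (0 <= i, j <= 4) is the quotient of the  *)
(* free one by the closed ideal generated by these elements.                  *)
Definition ee (K : fieldType) (i j : 'I_5) : ncseries K ('I_5 * 'I_5)%type :=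
  letter K (i, j).

Inductive pentagon_rel (K : fieldType) :
    ncseries K ('I_5 * 'I_5)%type -> Prop :=
| PRdiag i : pentagon_rel (ee K i i)
| PRsym i j : pentagon_rel (ee K i j - ee K j i)
| PRsum i : pentagon_rel (\sum_j ee K i j)
| PRcomm i j k l : [disjoint [set i; j] & [set k; l]] ->
    pentagon_rel (ee K i j * ee K k l - ee K k l * ee K i j).

Definition inversion_relation (K : fieldType) (phi : ncseries K bool) : Prop :=
  let A := letter K false in let B := letter K true in
  subst phi B A * subst phi A B = 1.

Definition hexagon_relation (K : fieldType) (phi : ncseries K bool) : Prop :=
  let A := letter K false in let B := letter K true in let C := - A - B in
  subst phi C A * subst phi B C * subst phi A B = 1.

Definition pentagon_relation (K : fieldType) (phi : ncseries K bool) : Prop :=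
  let e (i j : nat) := ee K (inord i) (inord j) in
  closed_ideal (@pentagon_rel K)
    (subst phi (e 2%N 3%N) (e 3%N 4%N) * subst phi (e 4%N 0%N) (e 0%N 1%N) *
     subst phi (e 1%N 2%N) (e 2%N 3%N) * subst phi (e 3%N 4%N) (e 4%N 0%N) *
     subst phi (e 0%N 1%N) (e 1%N 2%N) - 1).

Definition GRT1 (K : fieldType) (phi : ncseries K bool) : Prop :=
  [/\ inversion_relation phi, hexagon_relation phi & pentagon_relation phi].

(* A completion of the field of rational numbers for the p-adic norm; such a  *)
(* field is unique up to a unique isometric isomorphism. The norm takes its   *)
(* values in {0} and the powers of p, so that rat suffices as its codomain.   *)
Definition knorm_cvg (K : fieldType) (nm : K -> rat) (u : nat -> K) (l : K) :=
  forall eps : rat, 0 < eps ->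
    exists N, forall n, (N <= n)%N -> nm (u n - l) < eps.

Definition knorm_cauchy (K : fieldType) (nm : K -> rat) (u : nat -> K) :=
  forall eps : rat, 0 < eps ->
    exists N, forall m n, (N <= m)%N -> (N <= n)%N -> nm (u m - u n) < eps.

Record padicField (p : nat) := PadicField {
  padic_sort :> fieldType;
  pnorm : padic_sort -> rat;
  pnorm_ge0 : forall x, 0 <= pnorm x;
  pnorm_eq0 : forall x, (pnorm x == 0) = (x == 0);
  pnormM : forall x y, pnorm (x * y) = pnorm x * pnorm y;
  pnormD : forall x y, pnorm (x + y) <= Num.max (pnorm x) (pnorm y);
  pnorm_nat : forall n : nat, (0 < n)%N -> pnorm n%:R = p%:R ^- logn p n;
  pnorm_dense : forall x (eps : rat), 0 < eps ->
    exists q : rat, pnorm (x - ratr q) < eps;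
  pnorm_complete : forall u, knorm_cauchy pnorm u ->
    exists l, knorm_cvg pnorm u l
}.

Section Frobenius.
Variables (p : nat) (K : padicField p).

(* The limit of a sequence of elements of K; 0 if there is none. *)
Definition plim (u : nat -> K) : K := xget 0 (knorm_cvg (@pnorm p K) u).

Definition mxlim n (u : nat -> 'M[K]_n) : 'M[K]_n :=
  \matrix_(i, j) plim (fun m => u m i j).

(* Through E |-> (Gamma(P^1, Ebar), residues), a unipotent bundle with        *)
(* connection on P^1 - {0, 1, oo} is the same as a space V = K^n (column      *)
(* vectors) with two matrices N0, N1, which stand for the connection          *)
(*   d - N0 dz/z - N1 dz/(z - 1)                                              *)
(* on the trivial bundle V (x) O, the canonical extension of E. Being an      *)
(* iterated extension of trivial objects means that N0 and N1 become strictly *)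
(* triangular in a common basis of V.                                         *)
Definition strictly_triangular n (A : 'M[K]_n) : Prop :=
  forall i j : 'I_n, (i <= j)%N -> A i j = 0.

Definition unipotent n (N0 N1 : 'M[K]_n) : Prop :=
  exists2 P : 'M[K]_n, P \in unitmx &
    strictly_triangular (P *m N0 *m invmx P) /\
    strictly_triangular (P *m N1 *m invmx P).

Record micUni := MicUni {
  rank : nat;
  res0 : 'M[K]_rank;
  res1 : 'M[K]_rank;
  unipotent_res : unipotent res0 res1
}.

(* Power series in one variable with matrix coefficients. *)
Definition mxseries n := nat -> 'M[K]_n.

Definition smul n (S T : mxseries n) : mxseries n :=
  fun m => \sum_(i < m.+1) S i *m T (m - i)%N.

Definition spoly n (q : {poly K}) (T : mxseries n) : mxseries n :=
  fun m => \sum_(i < m.+1) q`_i *: T (m - i)%N.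

Definition sconst n (A : 'M[K]_n) : mxseries n :=
  fun m => if m == 0%N then A else 0.

(* The derivation u d/du. *)
Definition sEuler n (T : mxseries n) : mxseries n := fun m => m%:R *: T m.

(* Rigid analytic functions on the complement of an open disc of radius < 1   *)
(* around x = 1 in P^1 are the series in u = 1/(x - 1) converging for         *)
(* |u| <= 1/r for some r < 1.                                                 *)
Definition overconvergent n (T : mxseries n) : Prop :=
  exists C r : rat, [/\ 0 < r, r < 1 &
    forall m i j, pnorm (T m i j) <= C * r ^+ m].

(* The value at x = 0, that is at u = -1. *)
Definition value_at_cusp n (T : mxseries n) : 'M[K]_n :=
  mxlim (fun m => \sum_(k < m) (-1) ^+ k *: T k).

(* Let x be z or 1 - z, and let U be the complement in P^1 of the residue     *)
(* disc of x = 1; it contains the cusps x = 0 and x = oo. The map f(x) = x^p  *)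
(* lifts Frobenius on U and fixes these two cusps. For                        *)
(*   E = d - R0 dx/x - R1 dx/(x - 1),  E' = d - S0 dx/x - S1 dx/(x - 1),      *)
(* frob_iso R0 R1 S0 S1 T says that T is an isomorphism E' -> f^*E of         *)
(* logarithmic connections over a strict neighbourhood of U. Horizontality is *)
(*   x dT/dx = p (R0 + R1 x^p/(x^p - 1)) T - T (S0 + S1 x/(x - 1)).           *)
(* With u = 1/(x - 1) and Q = (1 + u)^p - u^p one has                         *)
(*   x d/dx = - (1 + u) u d/du,  x/(x - 1) = 1 + u,                           *)
(*   x^p/(x^p - 1) = (1 + u)^p / Q,                                           *)
(* and the condition below is this equation multiplied by Q.                  *)
Definition frob_horizontal n (R0 R1 S0 S1 : 'M[K]_n) (T : mxseries n) : Prop :=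
  let Q : {poly K} := (1 + 'X) ^+ p - 'X ^+ p in
  forall m,
    - spoly (Q * (1 + 'X)) (sEuler T) m =
      p%:R *: (spoly Q (smul (sconst R0) T) m +
               spoly ((1 + 'X) ^+ p) (smul (sconst R1) T) m)
      - (spoly Q (smul T (sconst S0)) m +
         spoly (Q * (1 + 'X)) (smul T (sconst S1)) m).

Definition frob_iso n (R0 R1 S0 S1 : 'M[K]_n) (T : mxseries n) : Prop :=
  [/\ overconvergent T,
      exists T' : mxseries n, [/\ overconvergent T',
        forall m, smul T T' m = sconst 1%:M m &
        forall m, smul T' T m = sconst 1%:M m] &
      frob_horizontal R0 R1 S0 S1 T].

(* Two liftings of Frobenius are used: F0(z) = z^p, which fixes the cusps 0   *)
(* and oo and lives on U0 = P^1 - ]1[, and F1(z) = 1 - (1 - z)^p, which fixes *)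
(* 1 and oo and lives on U1 = P^1 - ]0[. On the overlap of U0 and U1 the two  *)
(* pullbacks of E are identified by parallel transport, i.e. by the Taylor    *)
(* series                                                                     *)
(*   eps = sum_k (F1 - F0)^k / k! * F0^* C_k,                                 *)
(* where (d/dz)^k v = C_k v for horizontal v. The overlap is connected and    *)
(* contains oo, so functions on it are determined by their expansions in      *)
(* s = 1/z. There (F1 - F0)^k F0^*C_k = (h - 1)^k F0^*B_k, where B_k = z^k C_k *)
(* and h = F1/F0 = s^p - (s - 1)^p, and F0^* is s |-> s^p.                    *)

(* The expansion of N0 + N1 z/(z - 1) = N0 + N1/(1 - s).                      *)
Definition conn_at_oo n (N0 N1 : 'M[K]_n) : mxseries n :=
  fun m => if m == 0%N then N0 + N1 else N1.

(* C_(k+1) = C_k' + C_k (N0/z + N1/(z - 1)), hence                            *)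
(* B_(k+1) = (z d/dz - k) B_k + B_k (N0 + N1 z/(z - 1)).                      *)
Fixpoint taylor_coef n (N0 N1 : 'M[K]_n) (k : nat) : mxseries n :=
  if k is k'.+1 then
    let B := taylor_coef N0 N1 k' in
    fun m => - sEuler B m - k'%:R *: B m + smul B (conn_at_oo N0 N1) m
  else sconst 1%:M.

(* The substitution s |-> s^p. *)
Definition frob_subst n (T : mxseries n) : mxseries n :=
  fun m => if (p %| m)%N then T (m %/ p)%N else 0.

Definition taylor_transport n (N0 N1 : 'M[K]_n) : mxseries n :=
  let h : {poly K} := 'X ^+ p - ('X - 1) ^+ p in
  fun m => mxlim (fun M => \sum_(k < M)
    (k`!)%:R^-1 *: spoly ((h - 1) ^+ k) (frob_subst (taylor_coef N0 N1 k)) m).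

(* Expansions in s = 1/z of functions on U0, given as series in               *)
(* u = 1/(z - 1) = s/(1 - s), and on U1, given (with x = 1 - z) as series in  *)
(* u = 1/((1 - z) - 1) = - s. The coefficient of s^m in (s/(1 - s))^k is      *)
(* 'C(m - 1, m - k).                                                          *)
Definition expand_U0 n (T : mxseries n) : mxseries n :=
  fun m => \sum_(k < m.+1) ('C(m.-1, m - k))%:R *: T k.

Definition expand_U1 n (T : mxseries n) : mxseries n :=
  fun m => (-1) ^+ m *: T m.

(* F^*E: the object of Mic_uni whose overconvergent isocrystal is the         *)
(* pullback of the one of E by Frobenius, i.e. is isomorphic to F0^*E and     *)
(* F1^*E over U0 and U1, compatibly with the identification of these two. In  *)
(* the coordinate x = 1 - z used on U1 the two residues are exchanged.        *)
Record frobPullback (E : micUni) := FrobPullback {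
  fres0 : 'M[K]_(rank E);
  fres1 : 'M[K]_(rank E);
  unipotent_fres : unipotent fres0 fres1;
  theta0 : mxseries (rank E);
  theta1 : mxseries (rank E);
  theta0_iso : frob_iso (res0 E) (res1 E) fres0 fres1 theta0;
  theta1_iso : frob_iso (res1 E) (res0 E) fres1 fres0 theta1;
  theta_glue : forall m, expand_U1 theta1 m =
    smul (taylor_transport (res0 E) (res1 E)) (expand_U0 theta0) m
}.

Definition Fstar (E : micUni) (P : frobPullback E) : micUni :=
  MicUni (unipotent_fres P).

(* The fibres of the canonical extension V (x) O at 0 and 1 are both V, and   *)
(* the canonical de Rham path between them is the identity, in both           *)
(* directions.                                                                *)
Definition dR_path (E : micUni) : 'M[K]_(rank E) := 1%:M.

(* iota_v : omega(v)(F^*E) -> omega(v)(E). For v = d/dz at 0, s = z and       *)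
(* F0^*s = s^p; for v = - d/dz at 1, s = 1 - z and F1^*s = s^p. In both cases *)
(* ds(v) = 1 and a = 1, so the factor exp(N log(v / (a v^p))) is 1.           *)
Definition iota01 (E : micUni) (P : frobPullback E) : 'M[K]_(rank E) :=
  value_at_cusp (theta0 P).

Definition iota10 (E : micUni) (P : frobPullback E) : 'M[K]_(rank E) :=
  value_at_cusp (theta1 P).

(* F_*(gamma) for gamma = the de Rham path from t01 to t10. *)
Definition Fpush_dR_path (E : micUni) (P : frobPullback E) : 'M[K]_(rank E) :=
  iota10 P *m dR_path (Fstar P) *m invmx (iota01 P).

(* The action of a series in e_0 (letter false) and e_1 (letter true) on      *)
(* omega(t01)(E), where e_i acts by N_i. Products of at least n of the        *)
(* matrices N_0, N_1 vanish by unipotence, n being the rank of E.             *)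
Definition series_act (g : ncseries K bool) (E : micUni) : 'M[K]_(rank E) :=
  \sum_(k < rank E) \sum_(v : k.-tuple bool)
     g v *: (\prod_(i <- v) if i then res1 E else res0 E).

(* g = (de Rham path from t10 to t01) . F_*(de Rham path from t01 to t10) as  *)
(* automorphisms of the fibre functor omega(t01).                             *)
Definition is_frobenius_dR_path (Fs : forall E : micUni, frobPullback E)
    (g : ncseries K bool) : Prop :=
  forall E : micUni, series_act g E = dR_path E *m Fpush_dR_path (Fs E).

End Frobenius.

(* Main.v *)
From HB Require Import structures.
Require Import Defs.
From mathcomp Require Import all_boot all_order all_algebra.
From mathcomp Require Import mpoly.
From mathcomp Require Import boolp.
From mathcomp Require Import zify ring lra.

Set Implicit Arguments.
Unset Strict Implicit.
Unset Printing Implicit Defensive.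

Import Order.TTheory GRing.Theory Num.Theory.
Local Open Scope ring_scope.

(* A strictly triangular pair (A, B) gives the connection with residues A at  *)
(* x = 0 and B at x = 1. If T trivializes its Frobenius over the complement   *)
(* of the disc of x = 1, put chi(A, B) = T(oo) T(0)^-1. An overconvergent     *)
(* horizontal map is constant, so chi does not depend on T and commutes with  *)
(* all that commutes with A and B; adding matrices that commute with A and B  *)
(* to A or B does not change it; x |-> 1/x gives chi(C, B) = chi(A, B)^-1     *)
(* when A + B + C = 0. The two liftings of Frobenius are glued at oo, whence  *)
(*   g(A, B) = chi(B, A)^-1 chi(A, B),                                        *)
(* and (i). It follows that g(C, A) g(B, C) g(A, B) = M^2, where              *)
(* M = chi(B, C) chi(C, A) chi(A, B) is unipotent, and the residues of F^*E   *)
(* show that M commutes with A and g^-1 B g. A series with this property is   *)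
(* constant; this is (ii), and then M = 1, that is chi(A, C) = g(A, B).       *)
(*                                                                            *)
(* For (iii), Frobenius is trivialized on a chart of M_{0,5} with coordinates *)
(* x and y, for the KZ connection with poles x, y = 0 and x, y, x y = 1. The  *)
(* functions on the chart are the overconvergent series in 1/(1 - x),         *)
(* 1/(1 - y) and 1/(1 - x y), modulo one relation; a closed 1-form is exact   *)
(* up to constant logarithmic forms, and the curvature vanishes since it does *)
(* so at six torus-fixed points. The edges joining these points are copies of *)
(* the one-dimensional situation, so going around them yields a relation      *)
(* between six values of chi. For the pentagon product Pi it says that        *)
(* Pi(i, j, k, l, m) = Pi(i, j, k, m, l). As a rotation of the indices        *)
(* conjugates Pi and their reversal inverts it, Pi is conjugate to Pi^-1 by a *)
(* unipotent matrix, and Pi = 1.                                              *)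
(*                                                                            *)
(* Identities of series are obtained from those of matrices by letting the    *)
(* series act on words of bounded length, modulo the ideal for (iii).         *)

(** * p-adic limits *)

(** A unipotent connection on the line is a pair of strictly triangular matrices, and over the
    complement of one residue disc its Frobenius pullback is isomorphic to another such connection.
    The value of an isomorphism at infinity, divided by its value at 0, is an invariant [chi] of the
    two residues. It does not depend on the isomorphism: two of them differ by an overconvergent
    horizontal map ([frob_iso_rigid]), and such a map is constant because a logarithm is not
    overconvergent.

    The two liftings of Frobenius glue by the identity at infinity ([taylor_transport_oo]), so the
    definition of g becomes g(A, B) = chi(B, A)^-1 chi(A, B), together with a relation saying that
    the residues of the pullback at 0, 1 and infinity add up to zero ([frob_act]). The formula for g
    gives (i). If A + B + C = 0, the inversion x |-> 1/x ([chi_flip]) turns the hexagon product into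
    the square of a matrix M ([hexagon_sq]), and the residue relations for the three cyclic orders
    show that M commutes with A and with g^-1 B g ([hex_comm0], [hex_comm1]). A series commuting
    with A and with a series of linear part B is constant ([comm_trivial]), whence (ii). Then M is a
    unipotent square root of 1, so M = 1, which says that chi(A, C) = g(A, B) ([chi_act]): each
    value of g is a single value of [chi].

    For (iii), [chart_solution] solves the same problem for an integrable connection in two
    variables, one subdiagonal at a time. Up to the next subdiagonal the defect of an approximate
    solution is a closed form: the only obstruction is a constant curvature, which vanishes by
    evaluation at six points ([six_vertices]). The closed form is then integrated by [poincare]. The
    six points are the vertices of a hexagon of lines on which the solution restricts to solutions
    in one variable, and going from a vertex to the opposite one in two ways gives [six_term]. With
    the hexagon relation this says that the pentagon product does not change when its last two
    indices are exchanged ([penta_swap]). As rotations only conjugate the product, it is conjugate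
    to the product for the reversed order, which is its inverse; a unipotent matrix conjugate to its
    inverse by a unipotent matrix is 1 ([uconj_inv_eq1]).

    Series are treated as matrices through left multiplication on words of bounded length
    ([lmul_inj]). For the pentagon this is done modulo the ideal, by a projector that respects
    degrees ([exists_graded_projector]) and so keeps the matrices strictly triangular. *)

Lemma bernoulli (R : realFieldType) (x : R) n : -1 <= x -> 1 + n%:R * x <= (1 + x) ^+ n.
Proof.
move=> hx; elim: n => [|n IH]; first by rewrite mul0r addr0 expr0.
rewrite exprS -natr1; have h1 : 0 <= 1 + x by lra.
have := ler_wpM2l h1 IH; have : 0 <= n%:R * x ^+ 2 by rewrite mulr_ge0 ?ler0n ?sqr_ge0.
by move: (n%:R) ((1+x)^+n) => m t; rewrite expr2; nra.
Qed.

Lemma geometric_lt (r C e : rat) : 0 <= r -> r < 1 -> 0 < e ->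
  exists N, forall n, (N <= n)%N -> C * r ^+ n < e.
Proof.
move=> r0 r1 e0.
have [C0|C0] := lerP C 0.
  by exists 0%N => n _; apply: le_lt_trans e0; rewrite mulr_le0_ge0 ?exprn_ge0.
have [->|rn0] := eqVneq r 0.
  by exists 1%N => -[//|n] _; rewrite expr0n mulr0.
have rp : 0 < r by rewrite lt_neqAle eq_sym rn0.
pose x := r^-1 - 1.
have xp : 0 < x by rewrite subr_gt0 invf_gt1.
have [N hN] : exists N : nat, C / e / x < N%:R.
  by exists (Num.bound (C / e / x)); apply: le_lt_trans (archi_boundP _); rewrite ?ler_norm // divr_ge0 ?divr_ge0 ?ltW.
exists N => n Nn.
have hb : n%:R * x <= r^-1 ^+ n.
  have := @bernoulli _ x n; rewrite /x addrCA subrr addr0 => h.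
  by apply: le_trans (h _); [rewrite lerDr | move: xp; rewrite /x; lra].
have rnp : 0 < r ^+ n by rewrite exprn_gt0.
have : C / e < n%:R * x.
  rewrite -ltr_pdivrMr //; apply: lt_le_trans hN _; by rewrite ler_nat.
move=> /lt_le_trans /(_ hb); rewrite exprVn ltr_pdivrMr // => h.
by rewrite -ltr_pdivlMr // mulrC.
Qed.

Lemma linear_geometric (r s : rat) : 0 < r -> r < s ->
  exists2 C : rat, 0 <= C & forall n : nat, n%:R * r ^+ n <= C * s ^+ n.
Proof.
move=> r0 rs; have s0 : 0 < s by lra.
pose x := s / r - 1.
have xp : 0 < x by rewrite subr_gt0 ltr_pdivlMr // mul1r.
exists x^-1; first by rewrite invr_ge0 ltW.
move=> n; rewrite -ler_pdivrMr ?exprn_gt0 // -mulrA mulrC.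
have -> : r ^+ n / s ^+ n = ((s / r) ^+ n)^-1 by rewrite expr_div_n invf_div.
have hb : n%:R * x <= (s / r) ^+ n.
  have := @bernoulli _ x n; rewrite /x addrCA subrr addr0 => h.
  by apply: le_trans (h _); [rewrite lerDr | move: xp; rewrite /x; lra].
rewrite mulrC ler_pdivrMr ?exprn_gt0 ?divr_gt0 //.
by rewrite mulrC ler_pdivlMr.
Qed.

Section PadicNorm.
Variables (p : nat) (hp : prime p) (K : padicField p).
Local Notation nm := (@pnorm p K).
Implicit Types (x y z l : K) (u v : nat -> K) (d e : rat).

Lemma pnorm0 : nm 0 = 0.
Proof. by apply/eqP; rewrite pnorm_eq0. Qed.

Lemma pnorm_gt0 x : x != 0 -> 0 < nm x.
Proof. by move=> h; rewrite lt_neqAle pnorm_ge0 eq_sym pnorm_eq0 h. Qed.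

Lemma pnorm1 : nm 1 = 1.
Proof. by have := pnorm_nat K (isT : (0 < 1)%N); rewrite logn1 expr0 invr1. Qed.

Lemma pnormN x : nm (- x) = nm x.
Proof.
have h : nm (-1) = 1.
  have : nm (-1) ^+ 2 = 1 by rewrite expr2 -pnormM mulrNN mulr1 pnorm1.
  move/eqP; rewrite sqrf_eq1 => /orP[/eqP //|/eqP h].
  by have := pnorm_ge0 (-1 : K); rewrite h ler0N1.
by rewrite -mulN1r pnormM h mul1r.
Qed.

Lemma pnormD_le x y d : nm x <= d -> nm y <= d -> nm (x + y) <= d.
Proof. by move=> hx hy; apply: le_trans (pnormD _ _) _; rewrite ge_max hx hy. Qed.

Lemma pnormD_lt x y d : nm x < d -> nm y < d -> nm (x + y) < d.
Proof. by move=> hx hy; apply: le_lt_trans (pnormD _ _) _; rewrite gt_max hx hy. Qed.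

Lemma pnormB_lt x y d : nm x < d -> nm y < d -> nm (x - y) < d.
Proof. by move=> hx hy; apply: pnormD_lt => //; rewrite pnormN. Qed.

Lemma pnorm_sum (I : Type) (s : seq I) (P : pred I) (F : I -> K) d : 0 <= d ->
  (forall i, P i -> nm (F i) <= d) -> nm (\sum_(i <- s | P i) F i) <= d.
Proof.
move=> d0 h; elim/big_rec: _ => [|i x Pi hx]; first by rewrite pnorm0.
by apply: pnormD_le => //; apply: h.
Qed.

Lemma pnormX x n : nm (x ^+ n) = nm x ^+ n.
Proof. by elim: n => [|n IH]; rewrite ?expr0 ?pnorm1 // !exprS pnormM IH. Qed.

Lemma pnormV x : nm x^-1 = (nm x)^-1.
Proof.
have [->|x0] := eqVneq x 0; first by rewrite invr0 pnorm0 invr0.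
apply: (mulfI (lt0r_neq0 (pnorm_gt0 x0))).
by rewrite -pnormM mulfV // pnorm1 mulfV // (lt0r_neq0 (pnorm_gt0 x0)).
Qed.

Lemma pnorm_sign x n : nm ((-1) ^+ n * x) = nm x.
Proof. by rewrite pnormM pnormX pnormN pnorm1 expr1n mul1r. Qed.

Lemma pnorm_nat_gt0 n : (0 < n)%N -> 0 < nm n%:R.
Proof. by move=> h; rewrite pnorm_nat // invr_gt0 exprn_gt0 // ltr0n prime_gt0. Qed.

Lemma natr_neq0 n : (0 < n)%N -> n%:R != 0 :> K.
Proof. by move=> /pnorm_nat_gt0; rewrite lt_neqAle eq_sym pnorm_eq0 => /andP[]. Qed.

Lemma pnorm_nat_le1 n : nm n%:R <= 1.
Proof.
case: n => [|n]; first by rewrite pnorm0.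
rewrite pnorm_nat // invf_le1 ?exprn_gt0 ?ltr0n ?prime_gt0 //.
by rewrite exprn_ege1 // ler1n prime_gt0.
Qed.

(** The power of p that divides n is at most n. Dividing coefficients by their degree thus costs
    only a linear factor, which a smaller radius absorbs: this keeps primitives overconvergent. *)
Lemma pnorm_natV n : nm n%:R^-1 <= n%:R.
Proof.
case: n => [|n]; first by rewrite invr0 pnorm0.
rewrite pnormV pnorm_nat // invrK -natrX ler_nat.
by apply: dvdn_leq => //; apply: pfactor_dvdnn.
Qed.

Lemma pnorm_p : nm p%:R = p%:R^-1.
Proof. by rewrite pnorm_nat ?prime_gt0 // logn_prime // eqxx expr1. Qed.

Lemma eq0_of_small x : (forall e, 0 < e -> nm x <= e) -> x = 0.
Proof.
move=> h; apply/eqP/negPn/negP => /pnorm_gt0 hx.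
have := h (nm x / 2); lra.
Qed.

Local Notation cvg := (knorm_cvg nm).

Lemma cvg_uniq u l l' : cvg u l -> cvg u l' -> l = l'.
Proof.
move=> h h'; apply/eqP; rewrite -subr_eq0; apply/eqP/eq0_of_small => e e0.
have [N hN] := h _ e0; have [N' hN'] := h' _ e0.
have -> : l - l' = (u (maxn N N') - l') - (u (maxn N N') - l) by ring.
apply: ltW; apply: pnormB_lt; [exact/hN'/leq_maxr | exact/hN/leq_maxl].
Qed.

Lemma plim_eq u l : cvg u l -> plim u = l.
Proof.
by move=> h; apply: (@cvg_uniq u) => //; rewrite /plim; apply: classical_sets.xgetPex; exists l.
Qed.

Lemma plimP u : knorm_cauchy nm u -> cvg u (plim u).
Proof. by move=> /pnorm_complete [l hl]; rewrite (plim_eq hl). Qed.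

Lemma cvg_cst l : cvg (fun=> l) l.
Proof. by move=> e e0; exists 0%N => n _; rewrite subrr pnorm0. Qed.

Lemma cvgD u v l l' : cvg u l -> cvg v l' -> cvg (fun n => u n + v n) (l + l').
Proof.
move=> h h' e e0; have [N hN] := h _ e0; have [N' hN'] := h' _ e0.
exists (maxn N N') => n; rewrite geq_max => /andP[hn hn'].
have -> : u n + v n - (l + l') = (u n - l) + (v n - l') by ring.
by apply: pnormD_lt; [apply: hN | apply: hN'].
Qed.

Lemma cvgZ c u l : cvg u l -> cvg (fun n => c * u n) (c * l).
Proof.
move=> h e e0; have [->|c0] := eqVneq c 0.
  by exists 0%N => n _; rewrite !mul0r subrr pnorm0.
have cp := pnorm_gt0 c0.
have [N hN] := h (e / nm c) (divr_gt0 e0 cp); exists N => n hn.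
by rewrite -mulrBr pnormM mulrC -ltr_pdivlMr //; apply: hN.
Qed.

Lemma cvg_sum (I : Type) (s : seq I) (P : pred I) (F : I -> nat -> K) (L : I -> K) :
  (forall i, P i -> cvg (F i) (L i)) ->
  cvg (fun n => \sum_(i <- s | P i) F i n) (\sum_(i <- s | P i) L i).
Proof.
move=> h; elim: s => [|i s IH].
  rewrite big_nil; have -> : (fun n => \sum_(i <- [::] | P i) F i n) = fun=> 0 :> K.
    by apply/funext => n; rewrite big_nil.
  exact: cvg_cst.
have -> : (fun n => \sum_(j <- i :: s | P j) F j n) =
   (fun n => (if P i then F i n else 0) + \sum_(j <- s | P j) F j n).
  by apply/funext => n; rewrite big_cons; case: (P i); rewrite ?add0r.
rewrite big_cons; case hi: (P i); first by apply: cvgD => //; apply: h.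
by rewrite -[X in cvg _ X]add0r; apply: cvgD => //; apply: cvg_cst.
Qed.

Lemma cvg_ext u v l : (exists N, forall n, (N <= n)%N -> u n = v n) -> cvg u l -> cvg v l.
Proof.
move=> [N hN] h e e0; have [N' hN'] := h e e0; exists (maxn N N') => n.
by rewrite geq_max => /andP[hn hn']; rewrite -hN //; apply: hN'.
Qed.

Lemma cvg0D u v l : cvg u l -> cvg (fun n => v n - u n) 0 -> cvg v l.
Proof.
move=> h h'; have := cvgD h h'; rewrite addr0; apply: cvg_ext.
by exists 0%N => n _; rewrite addrC subrK.
Qed.

Lemma cvg_norm_le u l x d : cvg u l ->
  (exists N, forall n, (N <= n)%N -> nm (u n - x) <= d) -> nm (l - x) <= d.
Proof.
move=> h [N hN]; rewrite leNgt; apply/negP => hd.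
have [N' hN'] := h (nm (l - x)) (le_lt_trans (le_trans (pnorm_ge0 _) (hN N (leqnn _))) hd).
have := hN (maxn N N') (leq_maxl _ _); rewrite leNgt => /negP; apply.
have := hN' (maxn N N') (leq_maxr _ _); set n := maxn _ _ => hn.
apply: lt_le_trans hd _; rewrite leNgt; apply/negP => hn'.
have : nm (l - x) < nm (l - x).
  have {1}-> : l - x = (u n - x) - (u n - l) by ring.
  by apply: pnormB_lt.
by rewrite ltxx.
Qed.

Lemma cvgM0 u v B : (exists N, forall n, (N <= n)%N -> nm (u n) <= B) -> cvg v 0 ->
  cvg (fun n => u n * v n) 0.
Proof.
move=> [N hN] h e e0.
have B0 : 0 <= B by apply: le_trans (hN N (leqnn _)); apply: pnorm_ge0.
have B1 : 0 < B + 1 by lra.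
have [N' hN'] := h (e / (B + 1)) (divr_gt0 e0 B1).
exists (maxn N N') => n; rewrite geq_max => /andP[hn hn'].
rewrite subr0 pnormM; have := hN' n hn'; rewrite subr0 ltr_pdivlMr // mulrC.
apply: le_lt_trans; apply: ler_wpM2r; first exact: pnorm_ge0.
by apply: le_trans (hN n hn) _; lra.
Qed.

Lemma cvg_bounded u l : cvg u l ->
  exists N, forall n, (N <= n)%N -> nm (u n) <= Num.max 1 (nm l).
Proof.
move=> h; have [N hN] := h 1 ltr01; exists N => n hn.
have -> : u n = (u n - l) + l by rewrite subrK.
by apply: pnormD_le; rewrite le_max ?lexx ?orbT // ltW // hN.
Qed.

Lemma cvgM u v l l' : cvg u l -> cvg v l' -> cvg (fun n => u n * v n) (l * l').
Proof.
move=> h h'.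
have h1 : cvg (fun n => u n * (v n - l')) 0.
  apply: cvgM0 (cvg_bounded h) _.
  by have := cvgD h' (cvg_cst (- l')); rewrite subrr.
have := cvgD h1 (cvgZ l' h); rewrite add0r mulrC; apply: cvg_ext.
by exists 0%N => n _; ring.
Qed.

End PadicNorm.

(** * Functions on the two-dimensional chart *)

Section ChartRing.
Variables (p : nat) (hp : prime p) (K : padicField p).
Local Notation nm := (@pnorm p K).
Local Notation R3 := {mpoly K[3]}.
(* a = 1/(1 - x), b = 1/(1 - y) and c = 1/(1 - x y); they satisfy rho = 0,   *)
(* for the polynomial rho below.                                              *)
Definition va : R3 := 'X_(inord 0).
Definition vb : R3 := 'X_(inord 1).
Definition vc : R3 := 'X_(inord 2).
Local Notation a := va.
Local Notation b := vb.
Local Notation c := vc.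
Definition mono i j k : R3 := a ^+ i * b ^+ j * c ^+ k.
Implicit Types (F G H : R3) (d e R : rat).

Lemma mpolyX_mono (m : 'X_{1..3}) : 'X_[m] = mono (m (inord 0)) (m (inord 1)) (m (inord 2)).
Proof.
rewrite mpolyXE_id !big_ord_recl big_ord0 mulr1 mulrA /mono /a /b /c.
have -> : ord0 = inord 0 :> 'I_3 by apply/val_inj; rewrite /= inordK.
have -> : lift (inord 0) ord0 = inord 1 :> 'I_3 by apply/val_inj; rewrite /= !inordK.
by have -> : lift (inord 0) (lift ord0 ord0) = inord 2 :> 'I_3 by apply/val_inj; rewrite /= !inordK.
Qed.

Lemma mdeg3 (m : 'X_{1..3}) : mdeg m = (m (inord 0) + m (inord 1) + m (inord 2))%N.
Proof.
rewrite mdegE !big_ord_recl big_ord0 addn0 addnA.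
have -> : ord0 = inord 0 :> 'I_3 by apply/val_inj; rewrite /= inordK.
have -> : lift (inord 0) ord0 = inord 1 :> 'I_3 by apply/val_inj; rewrite /= !inordK.
by have -> : lift (inord 0) (lift ord0 ord0) = inord 2 :> 'I_3 by apply/val_inj; rewrite /= !inordK.
Qed.

Section Lin.
Variable (V : lmodType K).

Lemma R3_linear_eq (f g : R3 -> V) : linear f -> linear g ->
  (forall i j k, f (mono i j k) = g (mono i j k)) -> forall F, f F = g F.
Proof.
move=> lf lg h; apply: mpolyind => [|x m F _ _ IH].
  have z (u : R3 -> V) : linear u -> u 0 = 0.
    by move=> lu; have := lu (-1) 0 0; rewrite scaler0 addr0 scaleN1r addNr.
  by rewrite !z.
by rewrite lf lg IH mpolyX_mono h.
Qed.

Variable f : nat -> nat -> nat -> V.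

Definition lin F : V :=
  \sum_(m <- msupp F) F@_m *: f (m (inord 0)) (m (inord 1)) (m (inord 2)).

Lemma lin_sub (s : seq 'X_{1..3}) F : uniq s -> {subset msupp F <= s} ->
  lin F = \sum_(m <- s) F@_m *: f (m (inord 0)) (m (inord 1)) (m (inord 2)).
Proof.
move=> us hs; rewrite (bigID (mem (msupp F))) /= [X in _ + X]big1 ?addr0; last first.
  by move=> m; rewrite mcoeff_msupp negbK => /eqP ->; rewrite scale0r.
rewrite -big_filter /lin; apply: perm_big; apply: uniq_perm => //.
- exact: filter_uniq.
- by move=> m; rewrite mem_filter andb_idr //; apply: hs.
Qed.

Lemma lin_is_linear : linear lin.
Proof.
move=> x F G; pose s := undup (msupp F ++ msupp G ++ msupp (x *: F + G)).
have us : uniq s by apply: undup_uniq.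
rewrite !(@lin_sub s) //; last 3 first.
- by move=> m; rewrite mem_undup !mem_cat => ->; rewrite ?orbT.
- by move=> m; rewrite mem_undup !mem_cat => ->; rewrite ?orbT.
- by move=> m; rewrite mem_undup !mem_cat => ->; rewrite ?orbT.
rewrite scaler_sumr -big_split /=; apply: eq_bigr => m _.
by rewrite mcoeffD mcoeffZ scalerDl scalerA.
Qed.
HB.instance Definition _ := GRing.isLinear.Build K R3 V _ lin lin_is_linear.

Lemma lin_mono i j k : lin (mono i j k) = f i j k.
Proof.
pose m : 'X_{1..3} := [multinom nth 0%N [:: i; j; k] q | q < 3].
have -> : mono i j k = 'X_[m] by rewrite mpolyX_mono !mnmE !inordK.
by rewrite /lin msuppX big_seq1 mcoeffX eqxx scale1r !mnmE !inordK.
Qed.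
End Lin.

Lemma monoM i j k i' j' k' : mono i j k * mono i' j' k' = mono (i + i') (j + j') (k + k').
Proof. by rewrite /mono !exprD; ring. Qed.

(* The weighted Gauss norm of radius R is at most d. *)
Definition bd R d F := forall m, nm F@_m * R ^+ mdeg m <= d.

Lemma bd_ge0 R d F : bd R d F -> 0 <= R -> 0 <= d.
Proof. by move=> h R0; apply: le_trans (h 0%MM); rewrite mulr_ge0 ?pnorm_ge0 ?exprn_ge0. Qed.

Lemma bd0 R d : 0 <= d -> bd R d 0.
Proof. by move=> h m; rewrite mcoeff0 pnorm0 // mul0r. Qed.

Lemma bdW R d e F : d <= e -> bd R d F -> bd R e F.
Proof. by move=> h hF m; apply: le_trans h. Qed.

Lemma bd_R R R' d F : 0 <= R' -> R' <= R -> bd R d F -> bd R' d F.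
Proof.
move=> h0 h hF m; apply: le_trans (hF m); apply: ler_wpM2l; first exact: pnorm_ge0.
by apply: lerXn2r => //; rewrite nnegrE ?(le_trans h0 h).
Qed.

Lemma bdD R d F G : 0 <= R -> bd R d F -> bd R d G -> bd R d (F + G).
Proof.
move=> R0 hF hG m; rewrite mcoeffD.
apply: le_trans (ler_wpM2r (exprn_ge0 _ R0) (pnormD _ _)) _.
by rewrite maxr_pMl ?exprn_ge0 // ge_max hF hG.
Qed.

Lemma bdN R d F : bd R d F -> bd R d (- F).
Proof. by move=> hF m; rewrite mcoeffN pnormN. Qed.

Lemma bdB R d F G : 0 <= R -> bd R d F -> bd R d G -> bd R d (F - G).
Proof. by move=> h hF hG; apply: bdD => //; apply: bdN. Qed.

Lemma bdZ R d x F : bd R d F -> bd R (nm x * d) (x *: F).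
Proof. by move=> hF m; rewrite mcoeffZ pnormM -mulrA ler_wpM2l ?pnorm_ge0. Qed.

Lemma bd_sum R d (I : Type) (s : seq I) (P : pred I) (f : I -> R3) : 0 <= R -> 0 <= d ->
  (forall i, P i -> bd R d (f i)) -> bd R d (\sum_(i <- s | P i) f i).
Proof.
move=> R0 d0 h; elim/big_rec: _ => [|i x Pi hx]; first exact: bd0.
by apply: bdD => //; apply: h.
Qed.

Lemma bdM R d e F G : 0 <= R -> bd R d F -> bd R e G -> bd R (d * e) (F * G).
Proof.
move=> R0 hF hG m; rewrite mcoeffM.
have de0 : 0 <= d * e by rewrite mulr_ge0 ?(bd_ge0 hF) ?(bd_ge0 hG).
have [Rm|Rm] := eqVneq (R ^+ mdeg m) 0; first by rewrite Rm mulr0.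
have Rp : 0 < R ^+ mdeg m by rewrite lt_neqAle eq_sym Rm exprn_ge0.
rewrite -ler_pdivlMr //; apply: pnorm_sum => //; first by rewrite divr_ge0 // ltW.
move=> k /eqP /(congr1 (@mdeg 3)); rewrite mdegD => em; rewrite pnormM ler_pdivlMr //.
have -> : nm F@_k.1 * nm G@_k.2 * R ^+ mdeg m = nm F@_k.1 * nm G@_k.2 * (R ^+ mdeg k.1 * R ^+ mdeg k.2).
  by congr (_ * _); rewrite -exprD -em.
by rewrite mulrACA ler_pM ?mulr_ge0 ?pnorm_ge0 ?exprn_ge0.
Qed.

Lemma bdX R d F n : 0 <= R -> bd R d F -> bd R (d ^+ n) (F ^+ n).
Proof.
move=> R0 hF; elim: n => [|n IH]; last by rewrite !exprS; apply: bdM.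
move=> m; rewrite expr0 -mpolyC1 mcoeffC expr0.
by case: eqP => [->|_]; rewrite ?mdeg0 ?expr0 ?mulr1 ?pnorm1 // mulr0 pnorm0 // mul0r.
Qed.

Lemma bdC R x : 0 <= R -> bd R (nm x) x%:MP.
Proof.
move=> R0 m; rewrite mcoeffC; case: eqP => [->|_].
  by rewrite mdeg0 expr0 !mulr1.
by rewrite mulr0 pnorm0 // mul0r pnorm_ge0.
Qed.

Lemma bd_var R (i : 'I_3) : 0 <= R -> bd R R 'X_i.
Proof.
move=> R0 m; rewrite mcoeffX; case: eqP => [<-|_]; first by rewrite mdeg1 pnorm1 mul1r.
by rewrite pnorm0 mul0r.
Qed.

Lemma bd_mono R i j k : 0 <= R -> bd R (R ^+ (i + j + k)) (mono i j k).
Proof. by move=> R0; rewrite !exprD; do ![apply: bdM => //]; apply: bdX => //; apply: bd_var. Qed.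

Lemma bd_lin R R' z d (f : nat -> nat -> nat -> R3) F : 0 <= R -> 0 <= R' -> 0 <= z ->
  (forall i j k, bd R' (z * R ^+ (i + j + k)) (f i j k)) -> bd R d F -> bd R' (z * d) (lin f F).
Proof.
move=> R0 R0' z0 h hF; apply: bd_sum => // [|m _]; first by rewrite mulr_ge0 ?(bd_ge0 hF).
apply: bdW (bdZ _ (h _ _ _)); rewrite -mdeg3 mulrCA; apply: ler_wpM2l => //; exact: hF.
Qed.

Lemma bd_exists R F : 0 <= R -> exists2 d, 0 <= d & bd R d F.
Proof.
move=> R0; elim/mpolyind: F => [|x m F _ _ [d d0 hd]]; first by exists 0 => //; apply: bd0.
exists (nm x * R ^+ (m (inord 0) + m (inord 1) + m (inord 2)) + d).
  by rewrite addr_ge0 ?mulr_ge0 ?pnorm_ge0 ?exprn_ge0.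
apply: bdD => //.
  by rewrite mpolyX_mono; apply: bdW (bdZ _ (bd_mono _ _ _ R0)); rewrite lerDl.
by apply: bdW hd; rewrite lerDr mulr_ge0 ?pnorm_ge0 ?exprn_ge0.
Qed.
End ChartRing.

(** * Normal forms and overconvergent functions on the chart *)

Section NormalForm.
Variables (p : nat) (hp : prime p) (K : padicField p).
Local Notation nm := (@pnorm p K).
Local Notation R3 := {mpoly K[3]}.
Local Notation a := (va K).
Local Notation b := (vb K).
Local Notation c := (vc K).
Local Notation mono := (@mono p K).
Implicit Types (F G H : R3) (d e R : rat).

Definition rho : R3 := a * b - a * c - b * c + c.

Fixpoint nf (i k : nat) : R3 :=
  match i with
  | 0 => c ^+ k
  | i'.+1 => (fix g k := match k with
                         | 0 => a ^+ i
                         | k'.+1 => b * g k' + (1 - b) * nf i' k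
                         end) k
  end.

Lemma nfSS i k : nf i.+1 k.+1 = b * nf i.+1 k + (1 - b) * nf i k.+1.
Proof. by []. Qed.
Lemma nfS0 i : nf i.+1 0 = a ^+ i.+1. Proof. by []. Qed.
Lemma nf0 k : nf 0 k = c ^+ k. Proof. by []. Qed.

(* The normal form modulo [rho]: monomials divisible by [a c] are eliminated. *)
Definition NF : R3 -> R3 := lin (fun i j k => b ^+ j * nf i k).
HB.instance Definition _ := GRing.Linear.copy NF (lin (fun i j k => b ^+ j * nf i k)).

Lemma NF_mono i j k : NF (mono i j k) = b ^+ j * nf i k.
Proof. exact: lin_mono. Qed.

Lemma mulr_linear (V : lmodType K) (L : {linear R3 -> V}) G : linear (fun F => L (G * F)).
Proof. by move=> x F F'; rewrite mulrDr -scalerAr linearP. Qed.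

Lemma NF_rho F : NF (rho * F) = 0.
Proof.
apply: (R3_linear_eq (g := fun=> 0) (mulr_linear NF rho)) => [x u v|i j k].
  by rewrite scaler0 addr0.
have -> : rho * mono i j k =
  mono i.+1 j.+1 k - mono i.+1 j k.+1 - mono i j.+1 k.+1 + mono i j k.+1.
  by rewrite /mono /rho !exprS; ring.
by rewrite !(linearB, linearD) /= !NF_mono nfSS !exprS; ring.
Qed.

Lemma NF_eq F : exists H, F = NF F + rho * H.
Proof.
have nfh i k : exists H, a ^+ i * c ^+ k = nf i k + rho * H.
  elim: i k => [k|i IHi]; first by exists 0; rewrite mul1r mulr0 addr0.
  elim=> [|k [H hH]]; first by exists 0; rewrite mulr1 mulr0 addr0.
  have [H' hH'] := IHi k.+1.
  (* The last summand comes from one rewriting step, a c = b a + (1 - b) c - [rho], multiplied by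
     a^i c^k. *)
  exists (b * H + (1 - b) * H' - a ^+ i * c ^+ k); rewrite nfSS.
  rewrite [RHS](_ : _ = b * (nf i.+1 k + rho * H) + (1 - b) * (nf i k.+1 + rho * H')
     - rho * (a ^+ i * c ^+ k)); last by ring.
  by rewrite -hH -hH' /rho !exprS; ring.
elim/mpolyind: F => [|x m F _ _ [H hH]]; first by exists 0; rewrite linear0 mulr0 addr0.
rewrite mpolyX_mono; set i := m _; set j := m _; set k := m _.
have [H' hH'] := nfh i k.
exists (x *: (b ^+ j * H') + H); rewrite linearP /= NF_mono {1}hH.
have -> : mono i j k = b ^+ j * (a ^+ i * c ^+ k) by rewrite /mono; ring.
by rewrite hH' -!mul_mpolyC; ring.
Qed.

Lemma NF_id F : NF (NF F) = NF F.
Proof. by have [H hH] := NF_eq F; rewrite {2}hH linearD /= NF_rho addr0. Qed.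

Lemma NF_M F G : NF (F * G) = NF (NF F * NF G).
Proof.
have [H hH] := NF_eq F; have [H' hH'] := NF_eq G.
rewrite {1}hH {1}hH' (_ : _ * _ = NF F * NF G + rho * (H * NF G + NF F * H' + H * rho * H')).
  by rewrite linearD /= NF_rho addr0.
by ring.
Qed.

(** No monomial of a normal form is divisible by a c, so normal forms are spanned by the a^i b^j and
    the b^j c^k. Identities between operators on the chart are checked on these two families. *)
Lemma NF_ext (V : lmodType K) (f g : R3 -> V) : linear f -> linear g ->
  (forall i j, f (mono i j 0) = g (mono i j 0)) ->
  (forall j k, f (mono 0 j k) = g (mono 0 j k)) -> forall F, f (NF F) = g (NF F).
Proof.
move=> lf lg ha hc.
have D (u : R3 -> V) : linear u -> forall F G, u (F + G) = u F + u G.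
  by move=> lu F G; rewrite -[F]scale1r lu !scale1r.
have N (u : R3 -> V) : linear u -> forall F, u (- F) = - u F.
  move=> lu F; have z : u 0 = 0 by apply: (addIr (u 0)); rewrite -D // !add0r.
  by have := lu (-1) F 0; rewrite !addr0 z addr0 !scaleN1r.
pose P F := forall j, f (b ^+ j * F) = g (b ^+ j * F).
have PD F G : P F -> P G -> P (F + G) by move=> hF hG j; rewrite mulrDr !D // hF hG.
have PN F : P F -> P (- F) by move=> hF j; rewrite mulrN !N // hF.
have Pb F : P F -> P (b * F) by move=> hF j; rewrite mulrA -exprSr; apply: hF.
have Pnf i k : P (nf i k).
  elim: i k => [k|i IHi].
    by move=> j; rewrite nf0; have := hc j k; rewrite /mono expr0 mul1r.
  elim=> [|k IHk].
    by move=> j; rewrite nfS0 mulrC; have := ha i.+1 j; rewrite /mono expr0 mulr1.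
  rewrite nfSS mulrDl mul1r mulNr.
  by apply: (PD _ _ (Pb _ IHk)); apply: (PD _ _ (IHi _)); apply: PN; apply: Pb; apply: IHi.
have lNF (u : R3 -> V) : linear u -> linear (fun F => u (NF F)).
  by move=> lu x F G; rewrite linearP lu.
apply: (R3_linear_eq (lNF _ lf) (lNF _ lg)) => i j k.
by rewrite NF_mono; apply: Pnf.
Qed.

Lemma bd1 R : 0 <= R -> bd R 1 (1 : R3).
Proof. by move=> R0; have := bdC (1 : K) R0; rewrite pnorm1 mpolyC1. Qed.

Lemma bd_1b R : 1 <= R -> bd R R (1 - b).
Proof.
move=> R1; have R0 : 0 <= R by lra.
by apply: bdB => //; [apply: bdW (bd1 R0) | apply: bd_var].
Qed.

(** A rewriting step replaces a c by a b, c and b c with coefficients 1 and -1. The degree does not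
    increase, hence neither does the norm when R >= 1. *)
Lemma bd_nf R i k : 1 <= R -> bd R (R ^+ (i + k)) (nf i k).
Proof.
move=> R1; have R0 : 0 <= R by lra.
elim: i k => [k|i IHi]; first by rewrite nf0; apply: bdX => //; apply: bd_var.
elim=> [|k IHk]; first by rewrite nfS0 addn0; apply: bdX => //; apply: bd_var.
rewrite nfSS; apply: bdD => //.
  by rewrite addnS exprS; apply: bdM => //; apply: bd_var.
by rewrite addSn exprS; apply: bdM => //; apply: bd_1b.
Qed.

Lemma bd_NF R d F : 1 <= R -> bd R d F -> bd R d (NF F).
Proof.
move=> R1 hF; have R0 : 0 <= R by lra.
rewrite -[d]mul1r; apply: bd_lin hF => // i j k.
rewrite mul1r addnAC addnC exprD; apply: bdM => //; last exact: bd_nf.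
by apply: bdX => //; apply: bd_var.
Qed.

(* The quotient norm on [K[a,b,c]/(rho)]. *)
Definition nb R d F := bd R d (NF F).

Lemma nbW R d e F : d <= e -> nb R d F -> nb R e F. Proof. exact: bdW. Qed.
Lemma nb_R R R' d F : 0 <= R' -> R' <= R -> nb R d F -> nb R' d F. Proof. exact: bd_R. Qed.
Lemma nbD R d F G : 0 <= R -> nb R d F -> nb R d G -> nb R d (F + G).
Proof. by move=> R0 hF hG; rewrite /nb linearD; apply: bdD. Qed.
Lemma nbN R d F : nb R d F -> nb R d (- F).
Proof. by move=> h; rewrite /nb linearN; apply: bdN. Qed.
Lemma nbM R d e F G : 1 <= R -> nb R d F -> nb R e G -> nb R (d * e) (F * G).
Proof.
move=> R1 hF hG; rewrite /nb NF_M; apply: bd_NF => //; apply: bdM => //; lra.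
Qed.
Lemma bd_nb R d F : 1 <= R -> bd R d F -> nb R d F. Proof. exact: bd_NF. Qed.
Lemma nb_eq R d F G : NF F = NF G -> nb R d F -> nb R d G.
Proof. by rewrite /nb => ->. Qed.

(** An overconvergent function is represented by a sequence of polynomials that is Cauchy for the
    quotient norm of some radius R > 1, instead of an element of a completion. Two sequences
    represent the same function when their difference is [Null]. *)
Definition Null (f : nat -> R3) := exists2 R, 1 < R &
  forall e, 0 < e -> exists N, forall n, (N <= n)%N -> nb R e (f n).
Definition Cau (f : nat -> R3) := exists2 R, 1 < R &
  forall e, 0 < e -> exists N, forall m n, (N <= m)%N -> (N <= n)%N -> nb R e (f m - f n).

Lemma Null_ext f g : (forall n, NF (f n) = NF (g n)) -> Null f -> Null g.
Proof.
by move=> h [R R1 hR]; exists R => // e /hR [N hN]; exists N => n hn; apply: nb_eq (hN n hn).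
Qed.

Lemma Null_eq f : (forall n, NF (f n) = 0) -> Null f.
Proof.
move=> h; exists 2 => // e e0; exists 0%N => n _; rewrite /nb h; apply: bd0 => //; exact: ltW.
Qed.

Lemma Null_rho f : (forall n, exists H, f n = rho * H) -> Null f.
Proof. by move=> h; apply: Null_eq => n; have [H ->] := h n; rewrite NF_rho. Qed.

Lemma NullD f g : Null f -> Null g -> Null (fun n => f n + g n).
Proof.
move=> [R R1 hR] [R' R1' hR']; exists (Num.min R R'); first by rewrite lt_min R1.
have m0 : 0 <= Num.min R R' by rewrite le_min !ltW ?(lt_trans ltr01).
move=> e e0; have [N hN] := hR e e0; have [N' hN'] := hR' e e0.
exists (maxn N N') => n; rewrite geq_max => /andP[hn hn'].
apply: nbD => //; first by apply: nb_R (hN n hn); rewrite // ge_min lexx.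
by apply: nb_R (hN' n hn'); rewrite // ge_min lexx orbT.
Qed.

Lemma NullN f : Null f -> Null (fun n => - f n).
Proof.
by move=> [R R1 hR]; exists R => // e e0; have [N hN] := hR e e0; exists N => n /hN /nbN.
Qed.

Lemma NullB f g : Null f -> Null g -> Null (fun n => f n - g n).
Proof. by move=> hf hg; apply: NullD => //; apply: NullN. Qed.

Lemma Null_sum (I : Type) (s : seq I) (P : pred I) (f : I -> nat -> R3) :
  (forall i, P i -> Null (f i)) -> Null (fun n => \sum_(i <- s | P i) f i n).
Proof.
move=> h; elim: s => [|i s IH].
  by apply: Null_eq => n; rewrite big_nil linear0.
have [Pi|Pi] := boolP (P i).
  have -> : (fun n => \sum_(j <- i :: s | P j) f j n) = fun n => f i n + \sum_(j <- s | P j) f j n.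
    by apply/funext => n; rewrite big_cons Pi.
  by apply: NullD => //; apply: h.
have -> // : (fun n => \sum_(j <- i :: s | P j) f j n) = fun n => \sum_(j <- s | P j) f j n.
by apply/funext => n; rewrite big_cons (negbTE Pi).
Qed.

Lemma Null_Cau f : Null f -> Cau f.
Proof.
move=> [R R1 hR]; exists R => // e e0; have [N hN] := hR e e0; exists N => m n hm hn.
by apply: nbD; [lra | apply: hN | apply: nbN; apply: hN].
Qed.

Lemma Cau_cst F : Cau (fun=> F).
Proof.
exists 2 => // e e0; exists 0%N => m n _ _; rewrite subrr /nb linear0; apply: bd0 => //; exact: ltW.
Qed.

Lemma CauD f g : Cau f -> Cau g -> Cau (fun n => f n + g n).
Proof.
move=> [R R1 hR] [R' R1' hR']; exists (Num.min R R'); first by rewrite lt_min R1.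
have m0 : 0 <= Num.min R R' by rewrite le_min !ltW ?(lt_trans ltr01).
move=> e e0; have [N hN] := hR e e0; have [N' hN'] := hR' e e0.
exists (maxn N N') => m n; rewrite !geq_max => /andP[hm hm'] /andP[hn hn'].
rewrite opprD addrACA; apply: nbD => //.
  by apply: nb_R (hN m n hm hn); rewrite // ge_min lexx.
by apply: nb_R (hN' m n hm' hn'); rewrite // ge_min lexx orbT.
Qed.

Lemma CauN f : Cau f -> Cau (fun n => - f n).
Proof.
move=> [R R1 hR]; exists R => // e e0; have [N hN] := hR e e0; exists N => m n hm hn.
by rewrite -opprD; apply: nbN; apply: hN.
Qed.

Lemma CauB f g : Cau f -> Cau g -> Cau (fun n => f n - g n).
Proof. by move=> hf hg; apply: CauD => //; apply: CauN. Qed.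

Lemma Cau_sum (I : Type) (s : seq I) (P : pred I) (f : I -> nat -> R3) :
  (forall i, P i -> Cau (f i)) -> Cau (fun n => \sum_(i <- s | P i) f i n).
Proof.
move=> h; elim: s => [|i s IH].
  have -> : (fun n => \sum_(j <- [::] | P j) f j n) = fun=> 0 by apply/funext => n; rewrite big_nil.
  exact: Cau_cst.
have [Pi|Pi] := boolP (P i).
  have -> : (fun n => \sum_(j <- i :: s | P j) f j n) = fun n => f i n + \sum_(j <- s | P j) f j n.
    by apply/funext => n; rewrite big_cons Pi.
  by apply: CauD => //; apply: h.
have -> // : (fun n => \sum_(j <- i :: s | P j) f j n) = fun n => \sum_(j <- s | P j) f j n.
by apply/funext => n; rewrite big_cons (negbTE Pi).
Qed.

Lemma Cau_bounded R f : 0 <= R -> (forall e, 0 < e -> exists N, forall m n,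
    (N <= m)%N -> (N <= n)%N -> nb R e (f m - f n)) ->
  exists2 B, 0 < B & exists N, forall n, (N <= n)%N -> nb R B (f n).
Proof.
move=> R0 /(_ 1 ltr01) [N hN].
have [B B0 hB] := bd_exists (NF (f N)) R0.
exists (B + 1); first by lra.
exists N => n hn; rewrite -(subrK (f N) (f n)); apply: nbD => //.
  by apply: nbW (hN n N hn (leqnn _)); lra.
by apply: nbW hB; lra.
Qed.

Lemma NullM f g : Cau f -> Null g -> Null (fun n => f n * g n).
Proof.
move=> [R R1 hR] [R' R1' hR']; exists (Num.min R R'); first by rewrite lt_min R1.
have m1 : 1 <= Num.min R R' by rewrite le_min !ltW.
have R0 : 0 <= R by lra.
have [B B0 [N hN]] := Cau_bounded R0 hR.
move=> e e0; have [N' hN'] := hR' (e / B) (divr_gt0 e0 B0).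
exists (maxn N N') => n; rewrite geq_max => /andP[hn hn'].
have -> : e = B * (e / B) by rewrite mulrC divfK // lt0r_neq0.
have m0 : 0 <= Num.min R R' by lra.
apply: nbM => //; first by apply: nb_R (hN n hn); rewrite // ge_min lexx.
by apply: nb_R (hN' n hn'); rewrite // ge_min lexx orbT.
Qed.

Lemma NullMr f g : Cau f -> Null g -> Null (fun n => g n * f n).
Proof.
move=> hf hg; have := NullM hf hg; congr Null; apply/funext => n; exact: mulrC.
Qed.

Lemma CauM f g : Cau f -> Cau g -> Cau (fun n => f n * g n).
Proof.
move=> [R R1 hR] [R' R1' hR']; pose S := Num.min R R'.
have m1 : 1 < S by rewrite lt_min R1.
have m0 : 0 <= S by lra.
have hf e : 0 < e -> exists N, forall m n, (N <= m)%N -> (N <= n)%N -> nb S e (f m - f n).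
  move=> /hR [N hN]; exists N => m n hm hn; apply: nb_R (hN m n hm hn) => //.
  by rewrite ge_min lexx.
have hg e : 0 < e -> exists N, forall m n, (N <= m)%N -> (N <= n)%N -> nb S e (g m - g n).
  move=> /hR' [N hN]; exists N => m n hm hn; apply: nb_R (hN m n hm hn) => //.
  by rewrite ge_min lexx orbT.
have [B B0 [N hN]] := Cau_bounded m0 hf.
have [B' B0' [N' hN']] := Cau_bounded m0 hg.
exists S => // e e0.
have [M hM] := hf (e / B') (divr_gt0 e0 B0'); have [M' hM'] := hg (e / B) (divr_gt0 e0 B0).
exists (maxn (maxn N N') (maxn M M')) => m n; rewrite !geq_max.
move=> /andP[/andP[m1' m2'] /andP[m3' m4']] /andP[/andP[n1' n2'] /andP[n3' n4']].
have -> : f m * g m - f n * g n = f m * (g m - g n) + (f m - f n) * g n by ring.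
apply: nbD => //.
  have -> : e = B * (e / B) by rewrite mulrC divfK // lt0r_neq0.
  by apply: nbM; [exact: ltW | apply: hN | apply: hM'].
have -> : e = (e / B') * B' by rewrite divfK // lt0r_neq0.
by apply: nbM; [exact: ltW | apply: hM | apply: hN'].
Qed.

Lemma Cau_trans f g : Cau g -> Null (fun n => f n - g n) -> Cau f.
Proof.
move=> h /Null_Cau h'; have := CauD h' h; congr Cau; apply/funext => n; by rewrite subrK.
Qed.

(* Operators that are bounded up to shrinking the radius. *)
Definition bop (L : R3 -> R3) := forall R, 1 < R -> exists R' z : rat,
  [/\ 1 < R', R' <= R, 0 < z & forall d F, bd R d F -> bd R' (z * d) (L F)].

Lemma Null_op (L : {linear R3 -> R3}) f : bop L -> Null f -> Null (fun n => L (NF (f n))).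
Proof.
move=> hL [R R1 hR]; have [R' [z [R1' _ z0 h]]] := hL R R1; exists R' => // e e0.
have [N hN] := hR (e / z) (divr_gt0 e0 z0); exists N => n hn.
have -> : e = z * (e / z) by rewrite mulrC divfK // lt0r_neq0.
by apply: bd_nb; [exact: ltW | apply: h; apply: hN].
Qed.

Lemma Cau_op (L : {linear R3 -> R3}) f : bop L -> Cau f -> Cau (fun n => L (NF (f n))).
Proof.
move=> hL [R R1 hR]; have [R' [z [R1' _ z0 h]]] := hL R R1; exists R' => // e e0.
have [N hN] := hR (e / z) (divr_gt0 e0 z0); exists N => m n hm hn.
have -> : e = z * (e / z) by rewrite mulrC divfK // lt0r_neq0.
rewrite -linearB -linearB; apply: bd_nb; first exact: ltW.
by apply: h; rewrite -/(nb _ _ _); apply: hN.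
Qed.

Lemma bop_lin (f : nat -> nat -> nat -> R3) :
  (forall R, 1 < R -> exists R' z : rat, [/\ 1 < R', R' <= R, 0 < z &
     forall i j k, bd R' (z * R ^+ (i + j + k)) (f i j k)]) -> bop (lin f).
Proof.
move=> h R R1; have [R' [z [R1' RR z0 hz]]] := h R R1; exists R', z; split=> // d F.
by apply: bd_lin => //; lra.
Qed.
End NormalForm.

(** * Logarithmic derivations and their primitives *)

Section Poincare.
Variables (p : nat) (hp : prime p) (K : padicField p).
Local Notation nm := (@pnorm p K).
Local Notation R3 := {mpoly K[3]}.
Local Notation a := (va K).
Local Notation b := (vb K).
Local Notation c := (vc K).
Local Notation mono := (@mono p K).
Local Notation rho := (rho K).
Implicit Types (F G H : R3) (d e R : rat).

(** [dx] and [dy] are x d/dx and y d/dy: for a = 1/(1 - x) one has x da/dx = a (a - 1), and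
    similarly for b and c. [db] differentiates the powers of b alone. *)
Definition dxf i j k : R3 := mono i j k * (i%:R * (a - 1) + k%:R * (c - 1)).
Definition dyf i j k : R3 := mono i j k * (j%:R * (b - 1) + k%:R * (c - 1)).
Definition dbf i j k : R3 := mono i j k * (j%:R * (b - 1)).
Definition dx : R3 -> R3 := lin dxf.
HB.instance Definition _ := GRing.Linear.copy dx (lin dxf).
Definition dy : R3 -> R3 := lin dyf.
HB.instance Definition _ := GRing.Linear.copy dy (lin dyf).
Definition db : R3 -> R3 := lin dbf.
HB.instance Definition _ := GRing.Linear.copy db (lin dbf).

Lemma dx_mono i j k : dx (mono i j k) = dxf i j k. Proof. exact: lin_mono. Qed.
Lemma dy_mono i j k : dy (mono i j k) = dyf i j k. Proof. exact: lin_mono. Qed.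
Lemma db_mono i j k : db (mono i j k) = dbf i j k. Proof. exact: lin_mono. Qed.

Lemma mulf_linear (V : lmodType K) (A : comAlgType K) (f : V -> A) (x : A) :
  linear f -> linear (fun v => x * f v).
Proof. by move=> lf z v v'; rewrite lf mulrDr scalerAr. Qed.

Lemma addf_linear (V W : lmodType K) (f g : V -> W) :
  linear f -> linear g -> linear (fun v => f v + g v).
Proof. by move=> lf lg z v v'; rewrite lf lg scalerDr addrACA. Qed.

Lemma oppf_linear (V W : lmodType K) (f : V -> W) : linear f -> linear (fun v => - f v).
Proof. by move=> lf z v v'; rewrite lf opprD scalerN. Qed.

Lemma compf_linear (U V W : lmodType K) (f : V -> W) (g : U -> V) :
  linear f -> linear g -> linear (fun v => f (g v)).
Proof. by move=> lf lg z v v'; rewrite lg lf. Qed.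

Lemma id_linear (V : lmodType K) : linear (fun v : V => v).
Proof. by []. Qed.

Lemma derivation_ext (V : comAlgType K) (E : {lrmorphism R3 -> V}) (D : {linear R3 -> V}) :
  (forall i j k i' j' k', D (mono i j k * mono i' j' k') =
     D (mono i j k) * E (mono i' j' k') + E (mono i j k) * D (mono i' j' k')) ->
  forall F G, D (F * G) = D F * E G + E F * D G.
Proof.
move=> h F G.
apply: (R3_linear_eq (f := fun G => D (F * G))
          (g := fun G => D F * E G + E F * D G)).
- by apply: compf_linear (linearP D) _; apply: mulf_linear; apply: id_linear.
- by apply: addf_linear; apply: mulf_linear; apply: linearP.
move=> i j k; move: F; apply: (R3_linear_eq (f := fun F => D (F * mono i j k))
  (g := fun F => D F * E (mono i j k) + E F * D (mono i j k))) => //.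
- move=> z F F'; rewrite mulrDl linearD -scalerAl linearZ //.
- move=> z F F'; rewrite !linearP /= !mulrDl scalerDr !scalerAl; ring.
Qed.

Lemma dxM F G : dx (F * G) = dx F * G + F * dx G.
Proof.
apply: (derivation_ext (E := idfun) (D := dx)) => i j k i' j' k' /=.
by rewrite monoM !dx_mono /dxf -monoM !natrD; ring.
Qed.

Lemma dyM F G : dy (F * G) = dy F * G + F * dy G.
Proof.
apply: (derivation_ext (E := idfun) (D := dy)) => i j k i' j' k' /=.
by rewrite monoM !dy_mono /dyf -monoM !natrD; ring.
Qed.

Lemma mono_a : a = mono 1 0 0. Proof. by rewrite /mono; ring. Qed.
Lemma mono_b : b = mono 0 1 0. Proof. by rewrite /mono; ring. Qed.
Lemma mono_c : c = mono 0 0 1. Proof. by rewrite /mono; ring. Qed.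

Lemma dxa : dx a = a * (a - 1). Proof. by rewrite {1}mono_a dx_mono /dxf /mono; ring. Qed.
Lemma dxb : dx b = 0. Proof. by rewrite {1}mono_b dx_mono /dxf /mono; ring. Qed.
Lemma dxc : dx c = c * (c - 1). Proof. by rewrite {1}mono_c dx_mono /dxf /mono; ring. Qed.
Lemma dya : dy a = 0. Proof. by rewrite {1}mono_a dy_mono /dyf /mono; ring. Qed.
Lemma dyb : dy b = b * (b - 1). Proof. by rewrite {1}mono_b dy_mono /dyf /mono; ring. Qed.
Lemma dyc : dy c = c * (c - 1). Proof. by rewrite {1}mono_c dy_mono /dyf /mono; ring. Qed.
Lemma dx1 : dx 1 = 0.
Proof. by have : mono 0 0 0 = 1 by [rewrite /mono !expr0 !mulr1]; move=> <-; rewrite dx_mono /dxf !mul0r addr0 mulr0. Qed.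
Lemma dy1 : dy 1 = 0.
Proof. by have : mono 0 0 0 = 1 by [rewrite /mono !expr0 !mulr1]; move=> <-; rewrite dy_mono /dyf !mul0r addr0 mulr0. Qed.

(** As [dx rho] is a multiple of [rho], the derivation descends to functions on the chart. *)
Lemma dx_rho F : exists H, dx (rho * F) = rho * H.
Proof.
exists ((a + c - 1) * F + dx F); rewrite dxM.
have -> : dx rho = rho * (a + c - 1).
  by rewrite /rho !(linearB, linearD) /= !dxM dxa dxb dxc; ring.
by ring.
Qed.

Lemma dy_rho F : exists H, dy (rho * F) = rho * H.
Proof.
exists ((b + c - 1) * F + dy F); rewrite dyM.
have -> : dy rho = rho * (b + c - 1).
  by rewrite /rho !(linearB, linearD) /= !dyM dya dyb dyc; ring.
by ring.
Qed.

Lemma NF_dx F : NF (dx F) = NF (dx (NF F)).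
Proof.
have [H hH] := NF_eq F; have [H' hH'] := dx_rho H.
by rewrite {1}hH linearD /= hH' linearD /= NF_rho addr0.
Qed.

Lemma NF_dy F : NF (dy F) = NF (dy (NF F)).
Proof.
have [H hH] := NF_eq F; have [H' hH'] := dy_rho H.
by rewrite {1}hH linearD /= hH' linearD /= NF_rho addr0.
Qed.

Lemma dxdy F : dx (dy F) = dy (dx F).
Proof.
apply: (R3_linear_eq (f := fun F => dx (dy F)) (g := fun F => dy (dx F))).
- by apply: compf_linear; apply: linearP.
- by apply: compf_linear; apply: linearP.
move=> i j k; rewrite dx_mono dy_mono /dxf /dyf dxM dyM dx_mono dy_mono /dxf /dyf.
have nx n F' : dx (n%:R * F') = n%:R * dx F' by rewrite !mulr_natl linearMn.
have ny n F' : dy (n%:R * F') = n%:R * dy F' by rewrite !mulr_natl linearMn.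
rewrite !linearD /= !nx !ny !linearB /= dx1 dy1 dxb dxc dya dyc; ring.
Qed.

Lemma nb_natr R d n F : 0 <= R -> bd R d F -> bd R d (n%:R * F).
Proof.
move=> R0 hF; have d0 := bd_ge0 hF R0.
rewrite mulr_natl -scaler_nat; apply: bdW (bdZ _ hF).
by rewrite ler_piMl // (pnorm_nat_le1 hp).
Qed.

Lemma bd_sub1 R (i : 'I_3) : 1 <= R -> bd R R ('X_i - 1 : R3).
Proof.
move=> R1; have R0 : 0 <= R by lra.
by apply: bdB => //; [apply: bd_var | apply: bdW (bd1 _ R0)].
Qed.

Lemma bop_der (f : nat -> nat -> nat -> nat) (g : nat -> nat -> nat -> nat)
    (h : nat -> nat -> nat -> nat) :
  bop (lin (fun i j k => mono i j k * ((f i j k)%:R * (a - 1) + (g i j k)%:R * (b - 1)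
     + (h i j k)%:R * (c - 1)))).
Proof.
apply: bop_lin => R R1; exists R, R; have R0 : 0 <= R by lra.
split=> //; first lra.
move=> i j k; rewrite mulrC; apply: bdM => //; first exact: bd_mono.
by apply: bdD => //; [apply: bdD => //|]; apply: nb_natr => //; apply: bd_sub1; lra.
Qed.

Lemma bop_dx : bop dx.
Proof.
have := @bop_der (fun i _ _ => i) (fun _ _ _ => 0%N) (fun _ _ k => k); congr bop.
by apply/funext => F; rewrite /dx /lin; apply: eq_bigr => m _; rewrite /dxf mul0r addr0.
Qed.

Lemma bop_dy : bop dy.
Proof.
have := @bop_der (fun _ _ _ => 0%N) (fun _ j _ => j) (fun _ _ k => k); congr bop.
by apply/funext => F; rewrite /dy /lin; apply: eq_bigr => m _; rewrite /dyf mul0r add0r.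
Qed.

Lemma Null_dy f : Null f -> Null (fun n => dy (f n)).
Proof. by move=> /(Null_op bop_dy); apply: Null_ext => n; rewrite -NF_dy. Qed.
Lemma Cau_dx f : Cau f -> Cau (fun n => dx (f n)).
Proof.
move=> /(Cau_op bop_dx) h; apply: Cau_trans h _; apply: Null_eq => n.
by rewrite linearB /= -NF_dx subrr.
Qed.
Lemma Cau_dy f : Cau f -> Cau (fun n => dy (f n)).
Proof.
move=> /(Cau_op bop_dy) h; apply: Cau_trans h _; apply: Null_eq => n.
by rewrite linearB /= -NF_dy subrr.
Qed.

(* [prim x n] is the derivation-primitive of [x ^ n - x]:                     *)
(* [D x = x (x - 1)] gives [D (x ^ l / l) = x ^ l.+1 - x ^ l].                *)
Definition prim1 (x : R3) n : R3 := \sum_(1 <= l < n) l%:R^-1 *: x ^+ l.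

(** On normal forms, [prim] integrates powers of a and of c along x, with b as a parameter, and
    [remn] keeps what cannot be integrated, namely multiples of 1, a and c by polynomials in b.
    [prb] integrates in b; [zb], [kb] and [kc] project to the monomials without b, in b only, and
    containing c. *)
Definition primf i j k : R3 := b ^+ j * ((k == 0%N)%:R * prim1 a i + (i == 0%N)%:R * prim1 c k).
Definition remf i j k : R3 := b ^+ j * (if (0 < i)%N then a else if (0 < k)%N then c else 1).
Definition prbf i j k : R3 := a ^+ i * prim1 b j * c ^+ k.
Definition zbf i j k : R3 := if j == 0%N then mono i j k else 0.
Definition kbf i j k : R3 := if (i == 0%N) && (k == 0%N) then mono i j k else 0.
Definition kcf i j k : R3 := if (k == 0%N) then 0 else mono i j k.
Definition prim : R3 -> R3 := lin primf.
HB.instance Definition _ := GRing.Linear.copy prim (lin primf).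
Definition remn : R3 -> R3 := lin remf.
HB.instance Definition _ := GRing.Linear.copy remn (lin remf).
Definition prb : R3 -> R3 := lin prbf.
HB.instance Definition _ := GRing.Linear.copy prb (lin prbf).
Definition zb : R3 -> R3 := lin zbf.
HB.instance Definition _ := GRing.Linear.copy zb (lin zbf).
Definition kb : R3 -> R3 := lin kbf.
HB.instance Definition _ := GRing.Linear.copy kb (lin kbf).
Definition kc : R3 -> R3 := lin kcf.
HB.instance Definition _ := GRing.Linear.copy kc (lin kcf).

Definition linE := (lin_mono primf, lin_mono remf, lin_mono prbf, lin_mono zbf, lin_mono kbf,
  lin_mono kcf, lin_mono dxf, lin_mono dyf, lin_mono dbf).

Lemma bd_prim1 R R' z (i : 'I_3) n : 0 <= R' -> R' <= R -> 0 <= z ->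
  (forall l : nat, l%:R * R' ^+ l <= z * R ^+ l) -> 1 <= R ->
  bd R' (z * R ^+ n) (prim1 'X_i n).
Proof.
move=> R0 RR z0 h R1; rewrite /prim1 big_nat.
apply: bd_sum => [//||l /andP[_ ln]]; first by rewrite mulr_ge0 ?exprn_ge0 //; lra.
apply: bdW (bdZ _ (bdX _ R0 (bd_var _ _ R0))).
apply: le_trans (ler_wpM2r (exprn_ge0 _ R0) (pnorm_natV K _)) _.
apply: le_trans (h l) _; apply: ler_wpM2l => //.
by apply: ler_weXn2l => //; apply: ltnW.
Qed.

Lemma radius R : 1 < R -> exists R' z : rat, [/\ 1 < R', R' <= R, 1 <= z &
  forall l : nat, l%:R * R' ^+ l <= z * R ^+ l].
Proof.
move=> R1; pose R' := (1 + R) / 2; have h1 : 1 < R' by rewrite /R'; lra.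
have h2 : R' < R by rewrite /R'; lra.
have [|z z0 hz] := linear_geometric (r := R') (s := R) _ h2; first lra.
exists R', (z + 1); split=> //; [lra | lra |] => l.
apply: le_trans (hz l) _; apply: ler_wpM2r; last lra.
by rewrite exprn_ge0 //; lra.
Qed.

Lemma bd_bool R d F (t : bool) : 0 <= R -> bd R d F -> bd R d (t%:R * F).
Proof. by move=> R0 hF; apply: nb_natr. Qed.

Lemma bop_prim : bop prim.
Proof.
apply: bop_lin => R R1; have [R' [z [h1 h2 z1 hz]]] := radius R1.
have [R0 R0'] : 0 <= R' /\ 0 <= R by split; lra.
exists R', z; split=> //; first lra.
move=> i j k; rewrite addnAC addnC exprD mulrCA; apply: bdM => //.
  apply: (@bdW _ _ R' (R' ^+ j)); first by rewrite lerXn2r // nnegrE.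
  by apply: bdX => //; apply: bd_var.
apply: bdD => //.
  case: k => [|k]; last by rewrite mul0r; apply: bd0; rewrite mulr_ge0 ?exprn_ge0 //; lra.
  by rewrite addn0; apply: bd_bool => //; apply: bd_prim1 => //; lra.
case: i => [|i]; last by rewrite mul0r; apply: bd0; rewrite mulr_ge0 ?exprn_ge0 //; lra.
by rewrite add0n; apply: bd_bool => //; apply: bd_prim1 => //; lra.
Qed.

Lemma bop_prb : bop prb.
Proof.
apply: bop_lin => R R1; have [R' [z [h1 h2 z1 hz]]] := radius R1.
have [R0 R0'] : 0 <= R' /\ 0 <= R by split; lra.
exists R', z; split=> //; first lra.
have X (v : 'I_3) n : bd R' (R ^+ n) ('X_v ^+ n : R3).
  apply: (@bdW _ _ R' (R' ^+ n)); first by rewrite lerXn2r // nnegrE.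
  by apply: bdX => //; apply: bd_var.
move=> i j k; rewrite !exprD mulrA (mulrCA z).
apply: bdM (X _ _) => //; apply: bdM => //; first exact: X.
by apply: bd_prim1 => //; lra.
Qed.

Lemma bop_simple (f : nat -> nat -> nat -> R3) :
  (forall R, 1 < R -> forall i j k, bd R (R ^+ (i + j + k)) (f i j k)) -> bop (lin f).
Proof.
move=> h; apply: bop_lin => R R1; exists R, 1; split=> // i j k.
by rewrite mul1r; apply: h.
Qed.

Lemma bop_remn : bop remn.
Proof.
apply: bop_simple => R R1 i j k; have R0 : 0 <= R by lra.
rewrite addnAC addnC exprD; apply: bdM => //; first by apply: bdX => //; apply: bd_var.
case: i => [|i] /=; last first.
  by rewrite addSn exprS; apply: bdW (bd_var _ _ R0); rewrite ler_peMr // exprn_ege1 // ltW.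
case: k => [|k] /=; first by rewrite expr0; apply: bd1.
by rewrite add0n exprS; apply: bdW (bd_var _ _ R0); rewrite ler_peMr // exprn_ege1 // ltW.
Qed.

Lemma bd_if_mono R (t : bool) i j k : 1 < R -> bd R (R ^+ (i + j + k)) (if t then mono i j k else 0).
Proof.
move=> R1; have R0 : 0 <= R by lra.
by case: t; [apply: bd_mono | apply: bd0; rewrite exprn_ge0].
Qed.

Lemma bop_kb : bop kb.
Proof. by apply: bop_simple => R R1 i j k; apply: bd_if_mono. Qed.
Lemma bop_kc : bop kc.
Proof.
apply: bop_simple => R R1 i j k; have := @bd_if_mono R (k != 0%N) i j k R1.
by rewrite /kcf; case: (k == 0%N).
Qed.

Lemma prim1_0 x : prim1 x 0 = 0. Proof. by rewrite /prim1 big_geq. Qed.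
Lemma prim1_1 x : prim1 x 1 = 0. Proof. by rewrite /prim1 big_geq. Qed.
Lemma prim1_S x n : n.+1%:R * (prim1 x n.+2 - prim1 x n.+1) = x ^+ n.+1.
Proof.
rewrite /prim1 big_nat_recr //= addrAC subrr add0r mulr_natl -scaler_nat scalerA.
by rewrite mulfV ?scale1r // (natr_neq0 hp).
Qed.

Lemma der_prim1 (D : {linear R3 -> R3}) x : (forall F G, D (F * G) = D F * G + F * D G) ->
  D x = x * (x - 1) -> forall n, D (prim1 x n.+1) = x ^+ n.+1 - x.
Proof.
move=> DM Dx.
have DX n : D (x ^+ n.+1) = n.+1%:R * (x ^+ n.+2 - x ^+ n.+1).
  elim: n => [|n IH]; first by rewrite expr1 Dx; ring.
  by rewrite exprS DM IH Dx -(natr1 n.+1) !exprS; ring.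
elim=> [|n IH]; first by rewrite prim1_1 linear0 expr1 subrr.
rewrite /prim1 big_nat_recr //= linearD linearZ /= IH DX mulr_natl -scaler_nat scalerA.
by rewrite mulVf ?scale1r ?(natr_neq0 hp) // addrC subrKA.
Qed.

Lemma der_prim1' (D : {linear R3 -> R3}) x : (forall F G, D (F * G) = D F * G + F * D G) ->
  D x = 0 -> forall n, D (prim1 x n) = 0.
Proof.
move=> DM Dx n; rewrite linear_sum big1 // => l _; rewrite linearZ /=.
suff -> : D (x ^+ l) = 0 by rewrite scaler0.
elim: l => [|l IH]; last by rewrite exprS DM Dx IH mul0r mulr0 addr0.
by have := DM 1 1; rewrite expr0 !mulr1 mul1r => /eqP; rewrite -subr_eq subrr eq_sym => /eqP.
Qed.

Lemma derX0 (D : {linear R3 -> R3}) x : (forall F G, D (F * G) = D F * G + F * D G) ->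
  D x = 0 -> forall n, D (x ^+ n) = 0.
Proof.
move=> DM Dx; elim => [|l IH]; last by rewrite exprS DM Dx IH mul0r mulr0 addr0.
by have := DM 1 1; rewrite expr0 !mulr1 mul1r => /eqP; rewrite -subr_eq subrr eq_sym => /eqP.
Qed.

Lemma mono_i i j : mono i j 0 = a ^+ i * b ^+ j. Proof. by rewrite /mono mulr1. Qed.
Lemma mono_k j k : mono 0 j k = b ^+ j * c ^+ k. Proof. by rewrite /mono mul1r. Qed.

(** Since x d/dx sends a^l / l to a^(l+1) - a^l, all positive powers of a are cohomologous along x;
    so are those of c. *)
Lemma decomp_x F : NF F = remn (NF F) + dx (prim (NF F)).
Proof.
apply: (NF_ext (f := fun G => G) (g := fun G => remn G + dx (prim G))) => //.
- by apply: addf_linear; [|apply: compf_linear]; apply: linearP.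
- move=> i j; rewrite /remn /prim !linE /remf /primf /= mul1r prim1_0 mulr0 addr0.
  rewrite dxM (derX0 dxM dxb) mul0r add0r.
  case: i => [|i] /=; first by rewrite prim1_0 linear0 mono_i; ring.
  by rewrite (der_prim1 dxM dxa) mono_i; ring.
- move=> j k; rewrite /remn /prim !linE /remf /primf /= mul1r prim1_0 mulr0 add0r.
  rewrite dxM (derX0 dxM dxb) mul0r add0r.
  case: k => [|k] /=; first by rewrite prim1_0 linear0 mono_k; ring.
  by rewrite (der_prim1 dxM dxc) mono_k; ring.
Qed.
End Poincare.

(** * The first cohomology of the chart *)

Section PoincareLemma.
Variables (p : nat) (hp : prime p) (K : padicField p).
Local Notation nm := (@pnorm p K).
Local Notation R3 := {mpoly K[3]}.
Local Notation a := (va K).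
Local Notation b := (vb K).
Local Notation c := (vc K).
Local Notation mono := (@mono p K).
Local Notation rho := (rho K).
Local Notation dx := (@dx p K).
Local Notation dy := (@dy p K).
Local Notation db := (@db p K).
Local Notation NF := (@NF p K).
Implicit Types (F G H : R3) (d e R : rat).

Lemma linn (L : {linear R3 -> R3}) n F : L (n%:R * F) = n%:R * L F.
Proof. by rewrite !mulr_natl linearMn. Qed.

Lemma dxE i j k : dx (mono i j k) =
  i%:R * (mono i.+1 j k - mono i j k) + k%:R * (mono i j k.+1 - mono i j k).
Proof. by rewrite dx_mono /dxf /mono !exprS; ring. Qed.
Lemma dyE i j k : dy (mono i j k) =
  j%:R * (mono i j.+1 k - mono i j k) + k%:R * (mono i j k.+1 - mono i j k).
Proof. by rewrite dy_mono /dyf /mono !exprS; ring. Qed.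
Lemma dbE i j k : db (mono i j k) = j%:R * (mono i j.+1 k - mono i j k).
Proof. by rewrite db_mono /dbf /mono !exprS; ring. Qed.

Lemma NFi i j : NF (mono i j 0) = mono i j 0.
Proof. by rewrite NF_mono mono_i; case: i => [|i]; rewrite ?nfS0 ?nf0; ring. Qed.
Lemma NFk j k : NF (mono 0 j k) = mono 0 j k.
Proof. by rewrite NF_mono mono_k. Qed.

Lemma remni i j : remn (mono i j 0) = mono (i != 0%N) j 0.
Proof. by rewrite /remn linE /remf mono_i lt0n; case: i => [|i] /=; ring. Qed.
Lemma remnk j k : remn (mono 0 j k) = mono 0 j (k != 0%N).
Proof. by rewrite /remn linE /remf mono_k lt0n; case: k => [|k] /=; ring. Qed.
Lemma primi i j : prim (mono i j 0) = b ^+ j * prim1 a i.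
Proof. by rewrite /prim linE /primf eqxx /= prim1_0; ring. Qed.
Lemma primk j k : prim (mono 0 j k) = b ^+ j * prim1 c k.
Proof. by rewrite /prim linE /primf eqxx /= prim1_0; ring. Qed.
Lemma kbi i j : kb (mono i j 0) = (i == 0%N)%:R * mono i j 0.
Proof. by rewrite /kb linE /kbf andbT; case: (i == _) => /=; ring. Qed.
Lemma kbk j k : kb (mono 0 j k) = (k == 0%N)%:R * mono 0 j k.
Proof. by rewrite /kb linE /kbf; case: (k == _) => /=; ring. Qed.
Lemma kci i j : kc (mono i j 0) = 0.
Proof. by rewrite /kc linE. Qed.
Lemma kck j k : kc (mono 0 j k) = (k != 0%N)%:R * mono 0 j k.
Proof. by rewrite /kc linE /kcf; case: (k == _) => /=; ring. Qed.
Lemma zbE i j k : zb (mono i j k) = (j == 0%N)%:R * mono i j k.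
Proof. by rewrite /zb linE /zbf; case: (j == _) => /=; ring. Qed.

Ltac lin3 := repeat first [apply: addf_linear | apply: oppf_linear
  | exact: linearP | apply: (@id_linear) | apply: compf_linear ].

Lemma prim_dx F : prim (dx (NF F)) = NF F - kb (NF F).
Proof.
apply: (NF_ext (f := fun G => prim (dx G)) (g := fun G => G - kb G)); [lin3|lin3| |].
- move=> i j; rewrite dxE mul0r addr0 linn linearB /= !primi kbi.
  case: i => [|i]; first by rewrite mul0r mul1r subrr.
  by rewrite -mulrBr mulrCA (prim1_S hp) mono_i /=; ring.
- move=> j k; rewrite dxE mul0r add0r linn linearB /= !primk kbk.
  case: k => [|i]; first by rewrite mul0r mul1r subrr.
  by rewrite -mulrBr mulrCA (prim1_S hp) mono_k /=; ring.
Qed.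

Lemma remn_dx F : remn (dx (NF F)) = 0.
Proof.
apply: (NF_ext (f := fun G => remn (dx G)) (g := fun=> 0)); [lin3| | |].
- by move=> x u v; rewrite scaler0 addr0.
- by move=> i j; rewrite dxE mul0r addr0 linn linearB /= !remni; case: i => [|i] /=; ring.
- by move=> j k; rewrite dxE mul0r add0r linn linearB /= !remnk; case: k => [|k] /=; ring.
Qed.

Lemma prim_dy_remn F : prim (dy (remn (NF F))) = kc (remn (NF F)).
Proof.
apply: (NF_ext (f := fun G => prim (dy (remn G))) (g := fun G => kc (remn G))); [lin3|lin3| |].
- move=> i j; rewrite remni dyE mul0r addr0 linn linearB /= !primi kci.
  by case: i => [|i]; rewrite /= ?prim1_0 ?prim1_1; ring.
- move=> j k; rewrite remnk dyE linearD /= !linn !linearB /= !primk kck.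
  case: k => [|i]; rewrite /= ?prim1_0 ?prim1_1; first by ring.
  by have := prim1_S hp c 0; rewrite prim1_1 expr1 mono_k; move: (prim1 c 2) => x; rewrite subr0 mul1r => ->; ring.
Qed.

Lemma remn_dy_remn F : remn (dy (remn (NF F))) = db (remn (NF F)).
Proof.
apply: (NF_ext (f := fun G => remn (dy (remn G))) (g := fun G => db (remn G))); [lin3|lin3| |].
- move=> i j; rewrite remni dyE dbE mul0r addr0 linn linearB /= !remni.
  by case: i => [|i] /=; ring.
- move=> j k; rewrite remnk dyE dbE linearD /= !linn !linearB /= !remnk.
  by case: k => [|i] /=; ring.
Qed.

Lemma prb_db F : prb (db F) = F - zb F.
Proof.
apply: (R3_linear_eq (f := fun G => prb (db G)) (g := fun G => G - zb G)); [lin3|lin3|].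
move=> i j k; rewrite dbE linn linearB /= zbE /prb !linE /prbf.
case: j => [|j] /=; first by ring.
have -> (u v w z : R3) : j.+1%:R * (u * v * w - u * z * w) = u * (j.+1%:R * (v - z)) * w by ring.
by rewrite (prim1_S hp) /mono; ring.
Qed.

Lemma NF_dx_id F : NF (dx (NF F)) = dx (NF F).
Proof.
apply: (NF_ext (f := fun G => NF (dx G)) (g := fun G => dx G)); [lin3|lin3| |].
- by move=> i j; rewrite dxE mul0r addr0 linn linearB /= !NFi.
- by move=> j k; rewrite dxE mul0r add0r linn linearB /= !NFk.
Qed.

Lemma NF_remn F : NF (remn (NF F)) = remn (NF F).
Proof.
apply: (NF_ext (f := fun G => NF (remn G)) (g := fun G => remn G)); [lin3|lin3| |].
- by move=> i j; rewrite remni NFi.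
- by move=> j k; rewrite remnk NFk.
Qed.

Lemma NF_dy_id F : NF (dy (NF F)) = dy (NF F).
Proof.
apply: (NF_ext (f := fun G => NF (dy G)) (g := fun G => dy G)); [lin3|lin3| |].
- by move=> i j; rewrite dyE mul0r addr0 linn linearB /= !NFi.
- by move=> j k; rewrite dyE linearD /= !linn !linearB /= !NFk.
Qed.

Lemma NF_db_id F : NF (db (NF F)) = db (NF F).
Proof.
apply: (NF_ext (f := fun G => NF (db G)) (g := fun G => db G)); [lin3|lin3| |].
- by move=> i j; rewrite dbE linn linearB /= !NFi.
- by move=> j k; rewrite dbE linn !linearB /= !NFk.
Qed.

Lemma NF_zb F : NF (zb (NF F)) = zb (NF F).
Proof.
apply: (NF_ext (f := fun G => NF (zb G)) (g := fun G => zb G)); [lin3|lin3| |].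
- by move=> i j; rewrite zbE; case: (j == _); rewrite ?mul1r ?mul0r ?NFi ?linear0.
- by move=> j k; rewrite zbE; case: (j == _); rewrite ?mul1r ?mul0r ?NFk ?linear0.
Qed.

Definition charf (t : nat -> nat -> nat -> bool) i j k : K^o := (t i j k)%:R.
(** A sum of selected coefficients is continuous for every radius at least 1. Such sums extract the
    constants in the Poincare lemma, and they are also the values of polynomials at points with
    coordinates 0 and 1. *)
Definition coefn t : R3 -> K := lin (charf t) : R3 -> K^o.

Lemma coefn_linear t (V : lmodType K) (v : V) : linear (fun F => coefn t F *: v).
Proof. by move=> x F G; rewrite /coefn linearP /= scalerDl scalerA. Qed.

Lemma coefn_mono t i j k : coefn t (mono i j k) = (t i j k)%:R.
Proof. by rewrite /coefn lin_mono. Qed.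

Lemma coefn_bound t R d F : 1 <= R -> bd R d F -> nm (coefn t F) <= d.
Proof.
move=> R1 hF; have d0 : 0 <= d by apply: bd_ge0 hF _; lra.
apply: pnorm_sum => // m _; apply: le_trans (hF m).
rewrite /= [X in nm X](_ : _ = F@_m * (t (m (inord 0)) (m (inord 1)) (m (inord 2)))%:R) // pnormM.
apply: ler_wpM2l; first exact: pnorm_ge0.
by apply: le_trans (pnorm_nat_le1 hp _ _) _; apply: exprn_ege1.
Qed.

Lemma coefn_limit t (f : nat -> R3) : Cau f -> exists l : K, forall v : R3,
  Null (fun n => coefn t (NF (f n)) *: v - l *: v).
Proof.
move=> [R R1 hR]; pose u n := coefn t (NF (f n)).
have cu : knorm_cauchy nm u.
  move=> e e0; have e2 : 0 < e / 2 by lra.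
  have [N hN] := hR _ e2; exists N => m n hm hn.
  apply: (@le_lt_trans _ _ (e / 2)); last by lra.
  have -> : u m - u n = coefn t (NF (f m - f n)) by rewrite /u /coefn !linearB.
  by apply: (@coefn_bound _ R); [exact: ltW | apply: hN].
exists (plim u) => v; exists 2 => // e e0.
have [B B0 hB] := bd_exists (NF v) (ler0n _ 2).
have [N hN] := plimP cu (divr_gt0 e0 (ltr_wpDl B0 ltr01)).
exists N => n hn; rewrite -scalerBl /nb linearZ /=.
apply: bdW (bdZ _ hB); apply: le_trans (ler_wpM2r B0 (ltW (hN n hn))) _.
by rewrite mulrAC ler_pdivrMr ?ltr_wpDl // ler_wpM2l ?ltW //; lra.
Qed.

Definition k0 i j k := [&& i == 0, j == 0 & k == 0]%N.
Definition k1 i j k := [&& i != 0, j == 0 & k == 0]%N.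
Definition k2 i j k := [&& i == 0, j == 0 & k != 0]%N.
Definition l1 i j k := [&& i == 0, j != 0 & k == 0]%N.

Lemma zb_remn F : zb (remn (NF F)) =
  coefn k0 (NF F) *: 1 + coefn k1 (NF F) *: a + coefn k2 (NF F) *: c.
Proof.
apply: (NF_ext (f := fun G => zb (remn G))
  (g := fun G => coefn k0 G *: 1 + coefn k1 G *: a + coefn k2 G *: c)).
- by lin3.
- by do ![apply: addf_linear]; apply: coefn_linear.
- move=> i j; rewrite remni zbE !coefn_mono /k0 /k1 /k2 eqxx andbT /= !andbF /mono.
  by case: i => [|i]; case: j => [|j]; rewrite /= ?scale1r ?scale0r; ring.
- move=> j k; rewrite remnk zbE !coefn_mono /k0 /k1 /k2 eqxx /mono /=.
  by case: k => [|i]; case: j => [|j]; rewrite /= ?scale1r ?scale0r; ring.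
Qed.

Lemma kb_decomp F : kb (NF F) =
  coefn k0 (NF F) *: 1 + coefn l1 (NF F) *: b + dy (prb (kb (NF F))).
Proof.
apply: (NF_ext (f := fun G => kb G)
  (g := fun G => coefn k0 G *: 1 + coefn l1 G *: b + dy (prb (kb G)))).
- by lin3.
- by apply: addf_linear; [apply: addf_linear; apply: coefn_linear|lin3].
- move=> i j; rewrite kbi !coefn_mono /k0 /l1 eqxx andbT /= linn linn /= /prb linE /prbf.
  case: i => [|i]; last by rewrite /= ?scale0r /mono; ring.
  rewrite expr0 mulr1 mul1r /= mul1r; case: j => [|j].
    by rewrite prim1_0 linear0 scale1r scale0r /mono; ring.
  by rewrite (der_prim1 hp (@dyM _ _) (dyb K)) scale0r scale1r /mono; ring.
- move=> j i; rewrite kbk !coefn_mono /k0 /l1 eqxx /= linn linn /= /prb linE /prbf.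
  case: i => [|i]; last by rewrite /= ?andbF ?scale0r /mono; ring.
  rewrite expr0 mulr1 mul1r /= mul1r !andbT; case: j => [|j].
    by rewrite prim1_0 linear0 scale1r scale0r /mono; ring.
  by rewrite (der_prim1 hp (@dyM _ _) (dyb K)) scale0r scale1r /mono; ring.
Qed.

Lemma dx_prb_kb F : dx (prb (kb (NF F))) = 0.
Proof.
apply: (NF_ext (f := fun G => dx (prb (kb G))) (g := fun=> 0)); first lin3.
- by move=> x u v; rewrite scaler0 addr0.
- move=> i j; rewrite kbi !linn /= /prb linE /prbf; case: i => [|i]; last by rewrite mul0r.
  by rewrite !expr0 !mulr1 mul1r (der_prim1' (@dxM _ _) (dxb K)) mulr0.
- move=> j i; rewrite kbk !linn /= /prb linE /prbf; case: i => [|i]; last by rewrite mul0r.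
  by rewrite !expr0 !mulr1 mul1r (der_prim1' (@dxM _ _) (dxb K)) mulr0.
Qed.

Lemma kc_zb_remn F : kc (zb (remn (NF F))) = coefn k2 (NF F) *: c.
Proof.
have k1' : kc 1 = 0 :> R3.
  by have := kci 0 0; rewrite /mono !mulr1 !expr0.
have ka' : kc a = 0 by rewrite mono_a kci.
have kc' : kc c = c by rewrite {1}mono_c kck /mono /=; ring.
by rewrite zb_remn !linearD !linearZ /= k1' ka' kc' !scaler0 !add0r.
Qed.

Lemma Null_sub0 (f g : nat -> R3) : (forall n, f n = g n) -> Null g -> Null f.
Proof. by move=> h; congr Null; apply/funext => n. Qed.

(** Subtracting a primitive along x reduces the first component to r = r0(b) + r1(b) a + r2(b) c.
    Closedness then says that r does not involve b and that the second component is a function of b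
    plus the term of r in c; this is why both components share the coefficient of c. What is left is
    integrated in b, which does not affect the first component. *)
Lemma poincare (ex ey : nat -> R3) : Cau ex -> Cau ey ->
  Null (fun n => dy (ex n) - dx (ey n)) ->
  exists (T : nat -> R3) (x0 xa xc y0 yb : K),
  [/\ Cau T, Null (fun n => ex n - (x0 *: 1 + xa *: a + xc *: c) - dx (T n)) &
     Null (fun n => ey n - (y0 *: 1 + yb *: b + xc *: c) - dy (T n))].
Proof.
move=> cx cy closed.
pose g n := prim (NF (ex n)); pose r n := remn (NF (ex n)).
have cg : Cau g by apply: Cau_op (bop_prim hp _) cx.
have NFsub F : NF (F - NF F) = 0 by rewrite linearB /= NF_id subrr.
have ex_dec : Null (fun n => ex n - r n - dx (g n)).
  by apply: Null_eq => n; rewrite -addrA -opprD -(decomp_x hp) NFsub.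
pose ey' n := ey n - dy (g n).
have cy' : Cau ey' by apply: CauB => //; apply: Cau_dy.
have cl' : Null (fun n => dy (r n) - dx (ey' n)).
  apply: (Null_sub0 (g := fun n => (dy (ex n) - dx (ey n)) - dy (ex n - r n - dx (g n)))).
    by move=> n; rewrite /ey' !linearB /= dxdy; ring.
  by apply: NullB => //; apply: Null_dy.
pose G n := NF (ey' n).
have clG : Null (fun n => dy (r n) - dx (G n)).
  by apply: Null_ext cl' => n; rewrite [LHS]linearB [RHS]linearB /= [NF (dx (ey' n))]NF_dx.
have NFE n : NF (dy (r n) - dx (G n)) = dy (r n) - dx (G n).
  by rewrite linearB /= /r -(NF_remn (ex n)) NF_dy_id NF_dx_id.
(* The part of the closedness relation that is exact along x determines the second component up to
   functions of b. *)
have h1 : Null (fun n => kc (r n) - (G n - kb (G n))).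
  have := Null_op (bop_prim hp K) clG; apply: Null_ext => n.
  by rewrite NFE linearB /= prim_dy_remn prim_dx.
(* The part that lives in cohomology along x: the classes making up r do not depend on b. *)
have h2 : Null (fun n => db (r n)).
  have := Null_op (bop_remn (p:=p) K) clG; apply: Null_ext => n.
  by rewrite NFE linearB /= remn_dy_remn remn_dx subr0.
have h3 : Null (fun n => r n - zb (r n)).
  have := Null_op (bop_prb K) h2; apply: Null_ext => n.
  by rewrite /r -(NF_remn (ex n)) NF_db_id /= prb_db.
have [x0 hx0] := coefn_limit k0 cx; have [xa hxa] := coefn_limit k1 cx.
have [xc hxc] := coefn_limit k2 cx.
have cey : Cau ey' := cy'.
have [y0 hy0] := coefn_limit k0 cey; have [yb hyb] := coefn_limit l1 cey.
have h4 : Null (fun n => kc (r n) - xc *: c).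
  have k := Null_op (bop_kc (p:=p) K) h3.
  apply: (Null_sub0 (g := fun n => kc (NF (r n - zb (r n))) + (coefn k2 (NF (ex n)) *: c - xc *: c))).
    move=> n; rewrite /r -(NF_remn (ex n)) [NF (_ - _)]linearB /= NF_zb NF_id linearB /=.
    by rewrite (NF_remn (ex n)) kc_zb_remn; ring.
  exact: NullD.
pose g2 n := prb (kb (G n)).
have cg2 : Cau g2.
  have ck : Cau (fun n => kb (NF (ey' n))) by apply: Cau_op (bop_kb (p:=p) K) cy'.
  have := Cau_op (bop_prb K) ck; congr Cau; apply/funext => n; congr (prb _).
  apply: (NF_ext (f := fun G => NF (kb G)) (g := fun G => kb G)); [lin3|lin3| |].
  - by move=> i j; rewrite kbi; case: (i == _); rewrite ?mul1r ?mul0r ?NFi ?linear0.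
  - by move=> j i; rewrite kbk; case: (i == _); rewrite ?mul1r ?mul0r ?NFk ?linear0.
exists (fun n => g n + g2 n), x0, xa, xc, y0, yb; split; first exact: CauD.
- apply: (Null_sub0 (g := fun n => (ex n - r n - dx (g n)) + (r n - zb (r n)) +
      ((coefn k0 (NF (ex n)) *: 1 - x0 *: 1) + (coefn k1 (NF (ex n)) *: a - xa *: a) +
       (coefn k2 (NF (ex n)) *: c - xc *: c)))).
    move=> n; have -> : dx (g n + g2 n) = dx (g n) by rewrite [LHS]linearD /= [X in _ + X](dx_prb_kb (ey' n)) addr0.
    rewrite zb_remn.
    by move: (coefn k0 _ *: 1) (coefn k1 _ *: a) (coefn k2 _ *: c) (x0 *: 1) (xa *: a) (xc *: c) => *; ring.
  by apply: NullD; [exact: NullD | apply: NullD => //; apply: NullD].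
- have heq n : ey' n - (ey' n) = 0 by rewrite subrr.
  apply: (Null_sub0 (g := fun n => (ey' n - G n) - (kc (r n) - (G n - kb (G n))) + (kc (r n) - xc *: c) +
      ((coefn k0 (NF (ey' n)) *: 1 - y0 *: 1) + (coefn l1 (NF (ey' n)) *: b - yb *: b)))).
    move=> n; rewrite linearD /= /g2 /G.
    move: (kb_decomp (ey' n)); move: (coefn k0 _ *: 1) (coefn l1 _ *: b) (y0 *: 1) (yb *: b) (xc *: c).
    move: (prb _) => u1 u2 u3 u4 u5 u6 ->; rewrite /ey'; ring.
  apply: NullD; last by apply: NullD.
  apply: NullD => //; apply: NullB => //.
  by apply: Null_eq => n; apply: NFsub.
Qed.
End PoincareLemma.

(** * Pullback by Frobenius *)

Section FrobPoly.
Variables (p : nat) (A : comNzRingType).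
Implicit Types (z : A).

(* The Frobenius pullback of [z = 1/(1 - x)] is [z ^ p / Q] with              *)
(* [Q = z ^ p - (z - 1) ^ p]; [1 - (-1) ^ p.+1 * Q] is divisible by [p], so   *)
(* that [qn z n] converges to this pullback.                                  *)
Definition frobQ z : A := z ^+ p - (z - 1) ^+ p.
Definition frobV z : A := 1 - (-1) ^+ p.+1 * frobQ z.
Definition frobU z n : A := (-1) ^+ p.+1 * \sum_(k < n) frobV z ^+ k.
Definition qn z n : A := z ^+ p * frobU z n.

Lemma frobQU z n : frobQ z * frobU z n = 1 - frobV z ^+ n.
Proof.
rewrite /frobU mulrA [_ * (-1) ^+ _]mulrC.
have -> : (-1) ^+ p.+1 * frobQ z = 1 - frobV z by rewrite /frobV; ring.
by rewrite -opprB mulNr -subrX1 opprB.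
Qed.

Lemma frobVE z : (0 < p)%N -> frobV z =
  (-1) ^+ p.+1 * \sum_(1 <= k < p) ((-1) ^+ k * z ^+ (p - k)) *+ 'C(p, k).
Proof.
move=> p0; rewrite /frobV /frobQ exprBn big_ord_recr /= binn subnn.
rewrite -(prednK p0) big_ord_recl /= subn0 bin0 prednK // big_add1 big_mkord.
rewrite !expr0 !expr1n !mulr1 !mulr1n mul1r.
under eq_bigr do rewrite expr1n mulr1.
have e : (-1) ^+ p.+1 * (-1) ^+ p = -1 :> A by rewrite -exprD addSn addnn -signr_odd /= odd_double.
move: (\sum_(_ < _) _) => S.
move: e; move: ((-1) ^+ p.+1) ((-1) ^+ p) => s t e.
have -> : 1 - s * (z ^+ p - (z ^+ p + S + t)) = 1 + s * S + s * t by ring.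
by rewrite e; ring.
Qed.

(** Here [ua], [ub], [uc] are approximate inverses of [qa], [qb], [qc], with errors [wa], [wb],
    [wc]. Up to the errors, the left side is its own form with denominators cleared. *)
Lemma frob_relation (x y z ua ub uc qa qb qc wa wb wc : A) :
  qa * ua = 1 - wa -> qb * ub = 1 - wb -> qc * uc = 1 - wc ->
  x * ua * (y * ub) - x * ua * (z * uc) - y * ub * (z * uc) + z * uc =
  (x * y * qc - x * z * qb - y * z * qa + z * qa * qb) * (ua * ub * uc) +
  (x * ua * (y * ub) * wc - x * ua * (z * uc) * wb - y * ub * (z * uc) * wa
   + z * uc * (qb * ub * wa + qa * ua * wb + wa * wb)).
Proof.
move=> ha hb hc.
have -> : wa = 1 - qa * ua by rewrite ha; ring.
have -> : wb = 1 - qb * ub by rewrite hb; ring.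
have -> : wc = 1 - qc * uc by rewrite hc; ring.
ring.
Qed.
End FrobPoly.

(** * The lifting (x, y) |-> (x^p, y^p) of Frobenius on the chart *)

Section FrobChart.
Variables (p : nat) (hp : prime p) (K : padicField p).
Local Notation nm := (@pnorm p K).
Local Notation R3 := {mpoly K[3]}.
Local Notation a := (va K).
Local Notation b := (vb K).
Local Notation c := (vc K).
Local Notation rho := (rho K).
Local Notation dx := (@dx p K).
Local Notation dy := (@dy p K).
Implicit Types (F G H : R3) (d e R : rat) (i : 'I_3).

Lemma bd_sign R d n F : bd R d F -> bd R d ((-1) ^+ n * F).
Proof. by move=> h; rewrite -signr_odd; case: odd; rewrite ?mul1r // mulN1r; apply: bdN. Qed.

(** The binomial coefficients left in [frobVE] are divisible by p, whence the factor 1/p. *)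
Lemma bd_frobV R i : 1 <= R -> bd R (R ^+ p / p%:R) (frobV p ('X_i : R3)).
Proof.
move=> R1; have R0 : 0 <= R by lra.
have p0 := prime_gt0 hp.
rewrite frobVE //; apply: bd_sign; rewrite big_nat.
have R2 : 0 <= R ^+ p / p%:R by rewrite divr_ge0 ?exprn_ge0.
apply: bd_sum => // k /andP[k0 kp].
have [q hq] := dvdnP (prime_dvd_bin (k := k) hp (introT andP (conj k0 kp))).
rewrite -scaler_nat hq; apply: bdW (bdZ _ (bd_sign (R := R) (d := R ^+ (p - k)) _ _)); last first.
  by apply: bdX => //; apply: bd_var.
rewrite natrM pnormM (pnorm_p hp) mulrAC ler_pM2r ?invr_gt0 ?ltr0n //.
have := pnorm_nat_le1 hp K q; have := ler_weXn2l R1 (leq_subr k p).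
have := pnorm_ge0 (q%:R : K); have := exprn_ge0 (p - k) R0.
by move: (nm _) (R ^+ _) (R ^+ _) => x y z; nra.
Qed.

Lemma frob_radius : exists2 R : rat, 1 < R & R ^+ p / p%:R < 1.
Proof.
have p2 : 2 <= p%:R :> rat by rewrite ler_nat prime_gt1.
(* The radius will be 1/s: by the Bernoulli inequality s^p >= 3/4, so that (1/s)^p <= 4/3 < 2 <=
   p. *)
pose s : rat := 1 - (4 * p%:R)^-1.
have i0 : 0 < (4 * p%:R)^-1 :> rat by rewrite invr_gt0; lra.
have i1 : (4 * p%:R)^-1 < 1 :> rat by rewrite invf_lt1; lra.
have s0 : 0 < s by rewrite /s; lra.
have h : 3%:R / 4%:R <= s ^+ p.
  apply: le_trans (@bernoulli _ (- (4 * p%:R)^-1) p _); last lra.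
  by rewrite invfM mulrN mulrCA mulfV; lra.
exists s^-1; first by rewrite invf_gt1 // /s; lra.
rewrite exprVn -invfM invf_lt1; first by nra.
by rewrite mulr_gt0 ?exprn_gt0 //; lra.
Qed.

Lemma Null_frobV i : Null (fun n => frobV p ('X_i : R3) ^+ n).
Proof.
have [R R1 hR] := frob_radius; exists R => // e e0.
have R0 : 0 <= R by lra.
have [|N hN] := geometric_lt 1 _ hR e0; first by rewrite divr_ge0 ?exprn_ge0.
exists N => n hn; apply: bd_nb; first exact: ltW.
by apply: bdW (bdX _ R0 (bd_frobV _ (ltW R1))); rewrite ltW // -[X in X < _]mul1r hN.
Qed.

Lemma Cau_frobU i : Cau (frobU p ('X_i : R3)).
Proof.
have [R R1 hR] := frob_radius; exists R => // e e0.
have R0 : 0 <= R by lra.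
have t0 : 0 <= R ^+ p / p%:R by rewrite divr_ge0 ?exprn_ge0.
have [N hN] := geometric_lt 1 t0 hR e0.
exists N => m n.
wlog nm : m n / (n <= m)%N.
  move=> h hm hn; have [nm|/ltnW mn] := leqP n m; first exact: h.
  by rewrite -opprB; apply: nbN; apply: h.
move=> hm hn; apply: bd_nb; first exact: ltW.
rewrite /frobU -mulrBr; apply: bd_sign.
rewrite -!(big_mkord xpredT (fun k => _ ^+ k)) (big_cat_nat (n := n) (p := m)) //= addrAC subrr add0r big_nat.
apply: bd_sum => //; first exact: ltW.
move=> k /andP[nk _]; apply: bdW (bdX _ R0 (bd_frobV _ (ltW R1))).
by rewrite ltW // -[X in X < _]mul1r hN // (leq_trans hn).
Qed.

Lemma Cau_qn i : Cau (qn p ('X_i : R3)).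
Proof. by apply: CauM; [apply: Cau_cst | apply: Cau_frobU]. Qed.

(** With x = (a - 1)/a, y = (b - 1)/b and x y = (c - 1)/c, the relation reads c (a - 1) (b - 1) = a
    b (c - 1). The p-th powers of its two sides differ by a multiple of [rho], so Frobenius
    preserves it. *)
Lemma Null_qn_rho : Null (fun n => qn p a n * qn p b n - qn p a n * qn p c n
   - qn p b n * qn p c n + qn p c n).
Proof.
have [H hH] : exists H, a ^+ p * b ^+ p * frobQ p c - a ^+ p * c ^+ p * frobQ p b
   - b ^+ p * c ^+ p * frobQ p a + c ^+ p * frobQ p a * frobQ p b = rho * H.
  have -> : a ^+ p * b ^+ p * frobQ p c - a ^+ p * c ^+ p * frobQ p b
     - b ^+ p * c ^+ p * frobQ p a + c ^+ p * frobQ p a * frobQ p b =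
     (c * (a - 1) * (b - 1)) ^+ p - (a * b * (c - 1)) ^+ p.
    by rewrite !exprMn /frobQ; ring.
  rewrite subrXX; eexists; congr (_ * _); rewrite /rho; ring.
pose U z n : R3 := frobU p z n; pose V z n : R3 := frobV p z ^+ n.
apply: (Null_sub0 (g := fun n => rho * H * (U a n * U b n * U c n) +
  (qn p a n * qn p b n * V c n - qn p a n * qn p c n * V b n - qn p b n * qn p c n * V a n
   + c ^+ p * U c n * ((frobQ p b * U b n) * V a n + (frobQ p a * U a n) * V b n + V a n * V b n)))).
  move=> n; rewrite -hH.
  exact: (frob_relation _ _ _ (frobQU p a n) (frobQU p b n) (frobQU p c n)).
apply: NullD; first by apply: Null_rho => n; eexists; rewrite -mulrA.
have na : Null (V a) by apply: Null_frobV.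
have nb' : Null (V b) by apply: Null_frobV.
have nc : Null (V c) by apply: Null_frobV.
have ca : Cau (U a) by apply: Cau_frobU.
have cb : Cau (U b) by apply: Cau_frobU.
have cc : Cau (U c) by apply: Cau_frobU.
have qa : Cau (qn p a) by apply: Cau_qn.
have qb : Cau (qn p b) by apply: Cau_qn.
have qc : Cau (qn p c) by apply: Cau_qn.
apply: NullD.
  exact: (NullB (NullB (NullM (CauM qa qb) nc) (NullM (CauM qa qc) nb')) (NullM (CauM qb qc) na)).
apply: (NullM (CauM (Cau_cst _) cc)).
apply: NullD; last exact: (NullM (Null_Cau na) nb').
exact: (NullD (NullM (CauM (Cau_cst _) cb) na) (NullM (CauM (Cau_cst _) ca) nb')).
Qed.

Lemma dx_qn_c n : dx (qn p c n) = dy (qn p c n).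
Proof.
pose P F := dx F = dy F.
have Pc : P c by rewrite /P dxc dyc.
have P1 : P 1 by rewrite /P dx1 dy1.
have PM F G : P F -> P G -> P (F * G) by move=> hF hG; rewrite /P dxM dyM hF hG.
have PB F G : P F -> P G -> P (F - G) by move=> hF hG; rewrite /P !linearB /= hF hG.
have PN F : P F -> P (- F) by move=> hF; rewrite /P !linearN /= hF.
have PX F k : P F -> P (F ^+ k) by move=> hF; elim: k => [|k IH] //; rewrite exprS; apply: PM.
have Ps : P ((-1) ^+ p.+1) by apply: PX; apply: PN.
apply: (PM _ _ (PX _ _ Pc)); apply: (PM _ _ Ps).
elim/big_rec: _ => [|k F _ hF]; first by rewrite /P !linear0.
have h : P (frobV p c ^+ k).
  exact: (PX _ _ (PB _ _ P1 (PM _ _ Ps (PB _ _ (PX _ _ Pc) (PX _ _ (PB _ _ Pc P1)))))).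
by rewrite /P !linearD /= h hF.
Qed.
End FrobChart.

(** * Triangular matrices and flat connections *)

Section Low.
Variables (R : pzRingType) (N : nat).
Implicit Types A B : 'M[R]_N.

(** The filtration by subdiagonals: indices add up under products, [low 1] is strict triangularity,
    and [low N] forces the zero matrix. Induction along it replaces induction over extensions. *)
Definition low d A := forall i j : 'I_N, (i < j + d)%N -> A i j = 0.

Lemma lowW d e A : (e <= d)%N -> low d A -> low e A.
Proof. by move=> h hA i j ij; apply: hA; apply: leq_trans ij _; rewrite leq_add2l. Qed.
Lemma low_0 d : low d (0 : 'M[R]_N).
Proof. by move=> i j _; rewrite mxE. Qed.
Lemma lowD d A B : low d A -> low d B -> low d (A + B).
Proof. by move=> hA hB i j ij; rewrite mxE hA ?hB ?addr0. Qed.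
Lemma lowN d A : low d A -> low d (- A).
Proof. by move=> hA i j ij; rewrite mxE hA ?oppr0. Qed.
Lemma lowB d A B : low d A -> low d B -> low d (A - B).
Proof. by move=> hA hB; apply: lowD => //; apply: lowN. Qed.
Lemma lowZ d x A : low d A -> low d (x *: A).
Proof. by move=> hA i j ij; rewrite mxE hA ?mulr0. Qed.
Lemma lowM d e A B : low d A -> low e B -> low (d + e) (A *m B).
Proof.
move=> hA hB i j ij; rewrite mxE big1 // => k _.
have [ik|ki] := ltnP i (k + d); first by rewrite hA ?mul0r.
by rewrite hB ?mulr0 //; lia.
Qed.
Lemma lowMS d A B : low d A -> low 1 B -> low d.+1 (A *m B).
Proof. by move=> hA hB; have := lowM hA hB; rewrite addn1. Qed.
Lemma lowSM d A B : low 1 A -> low d B -> low d.+1 (A *m B).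
Proof. by move=> hA hB; have := lowM hA hB; rewrite add1n. Qed.
Lemma low_full A : low N A -> A = 0.
Proof. by move=> h; apply/matrixP => i j; rewrite h ?mxE //; have := ltn_ord i; lia. Qed.
End Low.

Lemma low_map (R S : pzRingType) N d (f : R -> S) (A : 'M[R]_N) : f 0 = 0 -> low d A -> low d (map_mx f A).
Proof. by move=> f0 h i j ij; rewrite mxE h. Qed.

Section Curvature.
Variables (R : comPzRingType) (N : nat).
Implicit Types X Y T E : 'M[R]_N.

(** [Ex] and [Ey] are the defects of horizontality of T from the connection (X', Y') to (X, Y), and
    the left side is the differential of the defect. The second derivatives of T cancel; what
    remains is a defect times a connection matrix, or one of the two curvatures times T. *)
Lemma curvature_identity X Y X' Y' T Tx Ty Txy Xy X'y Ex Ey :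
  Ex = Tx - X *m T + T *m X' -> Ey = Ty - Y *m T + T *m Y' ->
  (Txy - (Xy *m T + X *m Ty) + (Ty *m X' + T *m X'y)) -
  (Txy - (Xy *m T + Y *m Tx) + (Tx *m Y' + T *m X'y)) =
  (Ey *m X' - Ex *m Y') - X *m Ey + Y *m Ex - (X *m Y - Y *m X) *m T
   + T *m (X' *m Y' - Y' *m X').
Proof.
move=> -> ->; rewrite !(mulmxDl, mulmxDr, mulNmx, mulmxN) !mulmxA.
apply/matrixP => i j.
do ![move: (_ *m _ *m _) => ?]; do ![move: (_ *m _) => ?]; rewrite !mxE; ring.
Qed.

(** The last coefficient becomes [rho] at 1 - a, 1 - b, 1 - c, and [rho] is invariant under this
    substitution. The other coefficients are the expressions that [flat] sets to zero. *)
Lemma bracket_identity (ex f1 f12 ey f2 : 'M[R]_N) (x y z : R) :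
  (ex + x *: f1 + z *: f12) *m (ey + y *: f2 + z *: f12) -
  (ey + y *: f2 + z *: f12) *m (ex + x *: f1 + z *: f12) =
  (ex *m ey - ey *m ex) + x *: (f1 *m ey - ey *m f1) + y *: (ex *m f2 - f2 *m ex) +
  z *: ((ex *m f12 - f12 *m ex) + (f12 *m ey - ey *m f12) - (f1 *m f2 - f2 *m f1)) +
  (x * z) *: ((f1 *m f12 - f12 *m f1) + (f1 *m f2 - f2 *m f1)) +
  (y * z) *: ((f12 *m f2 - f2 *m f12) + (f1 *m f2 - f2 *m f1)) +
  (x * y - x * z - y * z + z) *: (f1 *m f2 - f2 *m f1).
Proof.
rewrite !mulmxDl !mulmxDr -!scalemxAl -!scalemxAr.
apply/matrixP => i j; do ![move: (_ *m _) => ?]; rewrite !mxE; ring.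
Qed.
Lemma scale_bracket (A B : 'M[R]_N) x :
  (x *: A) *m (x *: B) - (x *: B) *m (x *: A) = (x ^+ 2) *: (A *m B - B *m A).
Proof. by rewrite -!scalemxAl -!scalemxAr !scalerA scalerBr expr2. Qed.

Lemma sum_scale0 (x1 x2 x3 x4 x5 x6 : R) (w : 'M[R]_N) :
  0 + x1 *: 0 + x2 *: 0 + x3 *: 0 + x4 *: 0 + x5 *: 0 + x6 *: w = x6 *: w.
Proof. by rewrite !scaler0 !addr0 add0r. Qed.

Lemma step_identity (X X' T T1 Tx T1x Z : 'M[R]_N) :
  (Tx + T1x) - X *m (T + T1) + (T + T1) *m (X' + Z) =
  ((Tx - X *m T + T *m X') + (T1x + Z)) + ((T1 *m X' - X *m T1) + ((T - 1%:M) *m Z + T1 *m Z)).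
Proof.
rewrite !mulmxDl !mulmxDr mulNmx mul1mx.
apply/matrixP => i j; do ![move: (_ *m _) => ?]; rewrite !mxE; ring.
Qed.

Lemma sum7_generic (A0 A1 A2 A3 A4 A5 A6 : 'M[R]_N) (x1 x2 x3 x4 x5 x6 : R) i j :
  (A0 + x1 *: A1 + x2 *: A2 + x3 *: A3 + x4 *: A4 + x5 *: A5 + x6 *: A6) i j =
  A0 i j + x1 * A1 i j + x2 * A2 i j + x3 * A3 i j + x4 * A4 i j + x5 * A5 i j + x6 * A6 i j.
Proof. by rewrite !mxE. Qed.

Lemma bracket_perturb (A B A' B' : 'M[R]_N) i j :
  ((A + B) *m (A' + B') - (A' + B') *m (A + B)) i j - (A *m A' - A' *m A) i j =
  (A *m B' + B *m A' + B *m B' - (A' *m B + B' *m A + B' *m B)) i j.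
Proof. by rewrite !mulmxDl !mulmxDr; do ![move: (_ *m _) => ?]; rewrite !mxE; ring. Qed.

Lemma addmx3_entry (A B C : 'M[R]_N) i j : (A + (B + C)) i j = A i j + (B i j + C i j).
Proof. by rewrite !mxE. Qed.
End Curvature.

Section Flat.
Variables (p : nat) (K : padicField p) (N : nat).
Local Notation R3 := {mpoly K[3]}.
Implicit Types A B C : 'M[K]_N.

Definition cm A : 'M[R3]_N := map_mx (@mpolyC 3 K) A.
Definition conn A B C (x z : R3) : 'M[R3]_N := cm A + (1 - x) *: cm B + (1 - z) *: cm C.

Definition br A B := A *m B - B *m A.

(* The KZ connection with residues ex, ey, f1, f2, f12 along x = 0, y = 0,    *)
(* x = 1, y = 1, x y = 1 is integrable.                                       *)
Definition flat (ex ey f1 f2 f12 : 'M[K]_N) : Prop :=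
  [/\ br ex ey = 0, br f1 ey = 0 & br ex f2 = 0] /\
  [/\ br ex f12 + br f12 ey - br f1 f2 = 0, br f1 f12 + br f1 f2 = 0
     & br f12 f2 + br f1 f2 = 0].

Lemma cmM A B : cm (A *m B) = cm A *m cm B.
Proof. exact: map_mxM. Qed.
Lemma cmB A B : cm (A - B) = cm A - cm B.
Proof. exact: map_mxB. Qed.
Lemma cmD A B : cm (A + B) = cm A + cm B.
Proof. exact: map_mxD. Qed.

Lemma connD A B C A' B' C' x z : conn (A + A') (B + B') (C + C') x z = conn A B C x z + conn A' B' C' x z.
Proof. by rewrite /conn !cmD !scalerDr; apply/matrixP => i j; do ![move: (_ *: _) => ?]; rewrite !mxE; ring. Qed.

Lemma sum7_entry (A0 A1 A2 A3 A4 A5 A6 : 'M[K]_N) (x1 x2 x3 x4 x5 x6 : R3) i j :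
  (cm A0 + x1 *: cm A1 + x2 *: cm A2 + x3 *: cm A3 + x4 *: cm A4 + x5 *: cm A5 + x6 *: cm A6) i j =
  (A0 i j)%:MP + x1 * (A1 i j)%:MP + x2 * (A2 i j)%:MP + x3 * (A3 i j)%:MP + x4 * (A4 i j)%:MP
   + x5 * (A5 i j)%:MP + x6 * (A6 i j)%:MP.
Proof. by rewrite sum7_generic /cm ![map_mx _ _ _ _]mxE. Qed.

Lemma bracket_conn ex ey f1 f2 f12 (x y z : R3) :
  conn ex f1 f12 x z *m conn ey f2 f12 y z - conn ey f2 f12 y z *m conn ex f1 f12 x z =
  cm (br ex ey) + (1 - x) *: cm (br f1 ey) + (1 - y) *: cm (br ex f2) +
  (1 - z) *: cm (br ex f12 + br f12 ey - br f1 f2) +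
  ((1 - x) * (1 - z)) *: cm (br f1 f12 + br f1 f2) +
  ((1 - y) * (1 - z)) *: cm (br f12 f2 + br f1 f2) +
  (x * y - x * z - y * z + z) *: cm (br f1 f2).
Proof.
rewrite /conn bracket_identity /br !(cmB, cmD, cmM).
congr (_ + _ *: _); ring.
Qed.
End Flat.

(** * Torus-fixed points and constant curvature *)

Section Vertex.
Variables (p : nat) (hp : prime p) (K : padicField p).
Local Notation R3 := {mpoly K[3]}.
Local Notation a := (va K).
Local Notation b := (vb K).
Local Notation c := (vc K).
Local Notation rho := (rho K).

(* [coefn (vtx x y z) F] is the value of F at the point (x, y, z) of {0, 1}^3. *)
Definition vtx (x y z : bool) i j k := [&& (i == 0%N) || x, (j == 0%N) || y & (k == 0%N) || z].
(** Of the eight points of {0, 1}^3, these six satisfy [rho] = 0. The value 1 of a, b or c stands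
    for x, y or x y equal to 0, and the value 0 for infinity. *)
Definition on_chart (x y z : bool) := (x, y, z) \in [:: (true, true, true);
  (false, true, true); (false, true, false); (false, false, false); (true, false, false);
  (true, false, true)].

Lemma vtx_rho x y z (F : R3) : on_chart x y z -> coefn (vtx x y z) (rho * F) = 0.
Proof.
move=> h; apply: (R3_linear_eq (V := K^o) (f := fun F => coefn (vtx x y z) (rho * F)) (g := fun=> 0)).
- by move=> u v w; rewrite /coefn mulrDr -scalerAr linearP.
- by move=> u v w; rewrite scaler0 addr0.
move=> i j k; have -> : rho * mono K i j k =
  mono K i.+1 j.+1 k - mono K i.+1 j k.+1 - mono K i j.+1 k.+1 + mono K i j k.+1.
  by rewrite /mono /rho !exprS; ring.
rewrite /coefn linearD !linearB /= -!/(coefn _ _) !coefn_mono /vtx /=.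
move: h; case: x; case: y; case: z => //= _; case: i => [|i]; case: j => [|j]; case: k => [|k] /=;
  rewrite ?subrr ?subr0 ?addr0 ?sub0r ?addNr ?oppr0 //.
Qed.

Lemma vtx_NF x y z (F : R3) : on_chart x y z -> coefn (vtx x y z) (NF F) = coefn (vtx x y z) F.
Proof.
move=> h; have [H hH] := NF_eq F.
by rewrite [in RHS]hH /coefn linearD /= -!/(coefn _ _) vtx_rho // addr0.
Qed.

Lemma vtx_dx x y z (F : R3) : coefn (vtx x y z) (dx F) = 0.
Proof.
apply: (R3_linear_eq (V := K^o) (f := fun F => coefn (vtx x y z) (dx F)) (g := fun=> 0)).
- by move=> u v w; rewrite /coefn !linearP.
- by move=> u v w; rewrite scaler0 addr0.
move=> i j k; rewrite dxE /coefn linearD !mulr_natl !linearMn !linearB /= -!/(coefn _ _) !coefn_mono.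
by case: i => [|i]; case: k => [|k]; rewrite /vtx /= ?subrr ?mul0rn ?mulr0n ?addr0.
Qed.

Lemma vtx_dy x y z (F : R3) : coefn (vtx x y z) (dy F) = 0.
Proof.
apply: (R3_linear_eq (V := K^o) (f := fun F => coefn (vtx x y z) (dy F)) (g := fun=> 0)).
- by move=> u v w; rewrite /coefn !linearP.
- by move=> u v w; rewrite scaler0 addr0.
move=> i j k; rewrite dyE /coefn linearD !mulr_natl !linearMn !linearB /= -!/(coefn _ _) !coefn_mono.
by case: j => [|j]; case: k => [|k]; rewrite /vtx /= ?subrr ?mul0rn ?mulr0n ?addr0.
Qed.

(* A constant 2-form that is a coboundary vanishes at the toric fixed points, *)
(* where all logarithmic derivatives vanish.                                  *)
Lemma vtx_coboundary x y z (f g : nat -> R3) C : on_chart x y z ->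
  Null (fun n => dy (f n) - dx (g n) - C) -> coefn (vtx x y z) C = 0.
Proof.
move=> h [R R1 hR]; apply: eq0_of_small => e e0.
have [N hN] := hR e e0; have := coefn_bound hp (vtx x y z) (ltW R1) (hN N (leqnn _)).
rewrite vtx_NF // /coefn !linearB /= -!/(coefn _ _) vtx_dx vtx_dy subrr sub0r.
by rewrite pnormN.
Qed.

(** The six points impose six linear conditions on the six constants other than w, which only zero
    satisfies; the remaining multiple of [rho] is zero on the chart. *)
Lemma six_vertices (w0 wa wb wc wac wbc w : K) (f g : nat -> R3) :
  let C := w0%:MP + (1 - a) * wa%:MP + (1 - b) * wb%:MP + (1 - c) * wc%:MP +
    ((1 - a) * (1 - c)) * wac%:MP + ((1 - b) * (1 - c)) * wbc%:MP + rho * w%:MP in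
  Null (fun n => dy (f n) - dx (g n) - C) -> NF C = 0.
Proof.
move=> C h.
have CE : C = (w0 + wa + wb + wc + wac + wbc) *: mono K 0 0 0
  - (wa + wac) *: mono K 1 0 0 - (wb + wbc) *: mono K 0 1 0
  - (wc + wac + wbc) *: mono K 0 0 1 + wac *: mono K 1 0 1 + wbc *: mono K 0 1 1 + rho * w%:MP.
  by rewrite /C -!mul_mpolyC /mono !(mpolyCD); ring.
have V x y z : on_chart x y z -> w0 + (~~ x)%:R * wa + (~~ y)%:R * wb + (~~ z)%:R * wc
    + (~~ x && ~~ z)%:R * wac + (~~ y && ~~ z)%:R * wbc = 0.
  move=> hx; have := vtx_coboundary hx h.
  rewrite CE /coefn !(linearD, linearN, linearZ) /= -!/(coefn _ _) vtx_rho // addr0.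
  rewrite !coefn_mono /vtx /=.
  have sE (u v : K) : (u *: (v : K^o)) = u * v by [].
  rewrite !sE => <-.
  by case: x {hx}; case: y; case: z => /=; ring.
have := V true true true isT; have := V false true true isT; have := V true false true isT.
have := V false true false isT; have := V true false false isT; have := V false false false isT.
rewrite /= !mul0r !mul1r !addr0 => h1 h2 h3 h4 h5 h6.
have e0 : w0 = 0 by [].
have ea : wa = 0 by rewrite -h5 e0; ring.
have eb : wb = 0 by rewrite -h4 e0; ring.
have eac : wac = - wc by apply/eqP; rewrite -subr_eq0 -h3 e0 ea; apply/eqP; ring.
have ebc : wbc = - wc by apply/eqP; rewrite -subr_eq0 -h2 e0 eb; apply/eqP; ring.
have ec : wc = 0.
  move: h1; rewrite e0 ea eb eac ebc => h1.
  have h' : - wc = 0 by rewrite -h1; ring.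
  by rewrite -[wc]opprK h' oppr0.
by rewrite /C eac ebc e0 ea eb ec oppr0 !mpolyC0 !mulr0 !addr0 add0r NF_rho.
Qed.
End Vertex.

(** * Frobenius trivializations on the chart *)

Section Existence.
Variables (p : nat) (hp : prime p) (K : padicField p) (N : nat).
Local Notation R3 := {mpoly K[3]}.
Local Notation a := (va K).
Local Notation b := (vb K).
Local Notation c := (vc K).
Local Notation rho := (rho K).
Local Notation MS := (nat -> 'M[R3]_N).

Definition CauM_ (E : MS) := forall i j, Cau (fun n => E n i j).
(** The condition [low d] in the limit. *)
Definition NullM_ d (E : MS) := forall i j : 'I_N, (i < j + d)%N -> Null (fun n => E n i j).

Lemma CauM_cst A : CauM_ (fun=> A). Proof. by move=> i j; apply: Cau_cst. Qed.
Lemma CauM_D E F : CauM_ E -> CauM_ F -> CauM_ (fun n => E n + F n).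
Proof.
move=> hE hF i j; have := CauD (hE i j) (hF i j); congr Cau; apply/funext => n; by rewrite mxE.
Qed.
Lemma CauM_B E F : CauM_ E -> CauM_ F -> CauM_ (fun n => E n - F n).
Proof.
move=> hE hF i j; have := CauB (hE i j) (hF i j); congr Cau; apply/funext => n; by rewrite !mxE.
Qed.
Lemma CauM_M E F : CauM_ E -> CauM_ F -> CauM_ (fun n => E n *m F n).
Proof.
move=> hE hF i j.
have := Cau_sum (index_enum 'I_N) (P := xpredT) (fun k _ => CauM (hE i k) (hF k j)).
by congr Cau; apply/funext => n; rewrite mxE.
Qed.
Lemma CauM_Z (x : nat -> R3) E : Cau x -> CauM_ E -> CauM_ (fun n => x n *: E n).
Proof.
by move=> hx hE i j; have := CauM hx (hE i j); congr Cau; apply/funext => n; rewrite mxE.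
Qed.
Lemma CauM_dx E : CauM_ E -> CauM_ (fun n => map_mx (@dx p K) (E n)).
Proof.
by move=> hE i j; have := Cau_dx hp (hE i j); congr Cau; apply/funext => n; rewrite mxE.
Qed.
Lemma CauM_dy E : CauM_ E -> CauM_ (fun n => map_mx (@dy p K) (E n)).
Proof.
by move=> hE i j; have := Cau_dy hp (hE i j); congr Cau; apply/funext => n; rewrite mxE.
Qed.

Lemma NullM_D d E F : NullM_ d E -> NullM_ d F -> NullM_ d (fun n => E n + F n).
Proof.
by move=> hE hF i j h; have := NullD (hE i j h) (hF i j h); congr Null; apply/funext => n; rewrite mxE.
Qed.
Lemma NullM_B d E F : NullM_ d E -> NullM_ d F -> NullM_ d (fun n => E n - F n).
Proof.
by move=> hE hF i j h; have := NullB (hE i j h) (hF i j h); congr Null; apply/funext => n; rewrite !mxE.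
Qed.

Lemma Null0 : Null (fun=> 0 : R3).
Proof. by apply: Null_eq => n; rewrite linear0. Qed.

Lemma NullM_low d E : (forall n, low d (E n)) -> NullM_ d E.
Proof.
move=> h i j ij; have := Null0; congr Null; apply/funext => n; by rewrite h.
Qed.

Lemma NullM_Ml d e (A E : MS) : (forall n, low e (A n)) -> CauM_ A -> NullM_ d E ->
  NullM_ (d + e) (fun n => A n *m E n).
Proof.
move=> lA cA nE i j ij.
apply: (Null_sub0 (g := fun n => \sum_k A n i k * E n k j)) => [n|]; first by rewrite mxE.
apply: Null_sum => k _; have [ik|ki] := ltnP i (k + e).
  by have := Null0; congr Null; apply/funext => n; rewrite lA ?mul0r.
by apply: NullM (cA i k) (nE k j _); lia.
Qed.

Lemma NullM_Mr d e (A E : MS) : (forall n, low e (A n)) -> CauM_ A -> NullM_ d E ->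
  NullM_ (d + e) (fun n => E n *m A n).
Proof.
move=> lA cA nE i j ij.
apply: (Null_sub0 (g := fun n => \sum_k E n i k * A n k j)) => [n|]; first by rewrite mxE.
apply: Null_sum => k _; have [ik|ki] := ltnP k (j + e).
  by have := Null0; congr Null; apply/funext => n; rewrite lA ?mulr0.
by apply: NullMr (cA k j) (nE i k _); lia.
Qed.

Lemma map_dxM (A B : 'M[R3]_N) : map_mx (@dx p K) (A *m B) =
  map_mx (@dx p K) A *m B + A *m map_mx (@dx p K) B.
Proof.
apply/matrixP => i j; rewrite !mxE linear_sum -big_split /=; apply: eq_bigr => k _.
by rewrite dxM !mxE.
Qed.
Lemma map_dyM (A B : 'M[R3]_N) : map_mx (@dy p K) (A *m B) =
  map_mx (@dy p K) A *m B + A *m map_mx (@dy p K) B.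
Proof.
apply/matrixP => i j; rewrite !mxE linear_sum -big_split /=; apply: eq_bigr => k _.
by rewrite dyM !mxE.
Qed.

Lemma dxC (x : K) : dx x%:MP = 0.
Proof. by rewrite -[x%:MP]mulr1 mul_mpolyC linearZ /= dx1 scaler0. Qed.
Lemma dyC (x : K) : dy x%:MP = 0.
Proof. by rewrite -[x%:MP]mulr1 mul_mpolyC linearZ /= dy1 scaler0. Qed.

Variables (ex ey f1 f2 f12 : 'M[K]_N).
Hypotheses (lex : low 1 ex) (ley : low 1 ey) (lf1 : low 1 f1) (lf2 : low 1 f2) (lf12 : low 1 f12).
Hypothesis hflat : flat ex ey f1 f2 f12.

Lemma low_conn (A B C : 'M[K]_N) x z : low 1 A -> low 1 B -> low 1 C -> low 1 (conn A B C x z).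
Proof.
have h0 : (0 : K)%:MP_[3] = 0 by exact: mpolyC0.
move=> hA hB hC; apply: lowD; first apply: lowD; last apply: lowZ; try apply: lowZ; exact: low_map.
Qed.

Definition frobX n : 'M[R3]_N := p%:R *: conn ex f1 f12 (qn p a n) (qn p c n).
Definition frobY n : 'M[R3]_N := p%:R *: conn ey f2 f12 (qn p b n) (qn p c n).

Lemma Cau_conn (A B C : 'M[K]_N) (x z : nat -> R3) : Cau x -> Cau z -> CauM_ (fun n => conn A B C (x n) (z n)).
Proof.
move=> hx hz; apply: CauM_D; first apply: CauM_D; first exact: CauM_cst.
  by apply: CauM_Z (CauM_cst _); apply: CauB (Cau_cst _) hx.
by apply: CauM_Z (CauM_cst _); apply: CauB (Cau_cst _) hz.
Qed.

Lemma Cau_frobX : CauM_ frobX.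
Proof. by apply: CauM_Z (Cau_cst _) _; apply: Cau_conn; apply: Cau_qn. Qed.
Lemma Cau_frobY : CauM_ frobY.
Proof. by apply: CauM_Z (Cau_cst _) _; apply: Cau_conn; apply: Cau_qn. Qed.

Lemma low_frobX n : low 1 (frobX n). Proof. by apply: lowZ; apply: low_conn. Qed.
Lemma low_frobY n : low 1 (frobY n). Proof. by apply: lowZ; apply: low_conn. Qed.

Lemma connE (A B C : 'M[K]_N) (x z : R3) i j : conn A B C x z i j =
  (A i j)%:MP + (1 - x) * (B i j)%:MP + (1 - z) * (C i j)%:MP.
Proof. by rewrite /conn /cm !mxE. Qed.

Lemma scale2E (B C : 'M[K]_N) (x z : R3) i j : (x *: cm B + z *: cm C) i j =
  x * (B i j)%:MP + z * (C i j)%:MP.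
Proof. by rewrite /cm !mxE. Qed.

Lemma map_dy_connX (A B C : 'M[K]_N) (x z : R3) : map_mx (@dy p K) (conn A B C x z) =
  (- dy x) *: cm B + (- dy z) *: cm C.
Proof.
have h (w : R3) (u : K) : dy ((1 - w) * u%:MP) = (- dy w) * u%:MP.
  by rewrite dyM dyC mulr0 addr0 [dy (1 - w)]linearB /= dy1 sub0r.
apply/matrixP => i j; rewrite scale2E [LHS]mxE connE.
by rewrite [LHS]linearD [X in X + _]linearD /= dyC !h add0r.
Qed.
Lemma map_dx_connX (A B C : 'M[K]_N) (x z : R3) : map_mx (@dx p K) (conn A B C x z) =
  (- dx x) *: cm B + (- dx z) *: cm C.
Proof.
have h (w : R3) (u : K) : dx ((1 - w) * u%:MP) = (- dx w) * u%:MP.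
  by rewrite dxM dxC mulr0 addr0 [dx (1 - w)]linearB /= dx1 sub0r.
apply/matrixP => i j; rewrite scale2E [LHS]mxE connE.
by rewrite [LHS]linearD [X in X + _]linearD /= dxC !h add0r.
Qed.

Lemma der_qn0 (D : {linear R3 -> R3}) z n : (forall F G, D (F * G) = D F * G + F * D G) ->
  D z = 0 -> D (qn p z n) = 0.
Proof.
move=> DM Dz; pose P F := D F = 0.
have D1 : P 1.
  by have := DM 1 1; rewrite !mulr1 mul1r => /eqP; rewrite -subr_eq subrr eq_sym => /eqP.
have PM F G : P F -> P G -> P (F * G) by move=> hF hG; rewrite /P DM hF hG mul0r mulr0 addr0.
have PB F G : P F -> P G -> P (F - G) by move=> hF hG; rewrite /P linearB /= hF hG subrr.
have PN F : P F -> P (- F) by move=> hF; rewrite /P linearN /= hF oppr0.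
have PX F k : P F -> P (F ^+ k) by move=> hF; elim: k => [|k IH] //; rewrite exprS; apply: PM.
have Ps : P ((-1) ^+ p.+1) by apply: PX; apply: PN.
apply: (PM _ _ (PX _ _ Dz)); apply: (PM _ _ Ps).
elim/big_rec: _ => [|k F _ hF]; first by rewrite /P linear0.
have h : P (frobV p z ^+ k).
  exact: (PX _ _ (PB _ _ D1 (PM _ _ Ps (PB _ _ (PX _ _ Dz) (PX _ _ (PB _ _ Dz D1)))))).
by rewrite /P linearD /= h hF addr0.
Qed.

Lemma dy_qn_a n : dy (qn p a n) = 0.
Proof. exact: (@der_qn0 (@dy p K) a n (@dyM p K) (dya K)). Qed.
Lemma dx_qn_b n : dx (qn p b n) = 0.
Proof. exact: (@der_qn0 (@dx p K) b n (@dxM p K) (dxb K)). Qed.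

Lemma closed_conn (A B C A' B' : 'M[K]_N) (x y z : R3) :
  dy x = 0 -> dx y = 0 -> dx z = dy z ->
  map_mx (@dy p K) (conn A B C x z) = map_mx (@dx p K) (conn A' B' C y z).
Proof. by move=> hx hy hz; rewrite map_dy_connX map_dx_connX hx hy hz oppr0 !scale0r. Qed.

Lemma closed_frob n : map_mx (@dy p K) (frobX n) = map_mx (@dx p K) (frobY n).
Proof.
have ny (A : 'M[R3]_N) : map_mx (@dy p K) (p%:R *: A) = p%:R *: map_mx (@dy p K) A.
  by apply/matrixP => i j; rewrite [LHS]mxE [in LHS]mxE [RHS]mxE [in RHS]mxE; apply: linn.
have nx (A : 'M[R3]_N) : map_mx (@dx p K) (p%:R *: A) = p%:R *: map_mx (@dx p K) A.
  by apply/matrixP => i j; rewrite [LHS]mxE [in LHS]mxE [RHS]mxE [in RHS]mxE; apply: linn.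
rewrite /frobX.
rewrite /frobY.
rewrite ny.
rewrite nx.
by rewrite (closed_conn ex f1 f12 ey f2 (dy_qn_a n) (dx_qn_b n) (dx_qn_c K n)).
Qed.

(** Integrability of the pulled-back connection: after [flat] only one term is left, with
    coefficient [rho] at the pulled-back functions. *)
Lemma Null_frob_bracket i j :
  Null (fun n => (frobX n *m frobY n - frobY n *m frobX n) i j).
Proof.
case: hflat => [[h1 h2 h3] [h4 h5 h6]].
apply: (Null_sub0 (g := fun n => (p%:R ^+ 2 * (cm (br f1 f2)) i j) *
  (qn p a n * qn p b n - qn p a n * qn p c n - qn p b n * qn p c n + qn p c n))).
  move=> n; rewrite /frobX /frobY scale_bracket bracket_conn h1 h2 h3 h4 h5 h6.
  have z : cm (0 : 'M[K]_N) = 0 by apply/matrixP => u v; rewrite !mxE mpolyC0.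
  by rewrite z sum_scale0 scalerA [LHS]mxE mulrAC.
by apply: NullM (Cau_cst _) (Null_qn_rho hp K).
Qed.
End Existence.

(** * Successive approximation along the subdiagonals *)

Section Induction.
Variables (p : nat) (hp : prime p) (K : padicField p) (N : nat).
Local Notation R3 := {mpoly K[3]}.
Local Notation a := (va K).
Local Notation b := (vb K).
Local Notation c := (vc K).
Local Notation rho := (rho K).
Local Notation MS := (nat -> 'M[R3]_N).
Variables (ex ey f1 f2 f12 : 'M[K]_N).
Hypotheses (lex : low 1 ex) (ley : low 1 ey) (lf1 : low 1 f1) (lf2 : low 1 f2) (lf12 : low 1 f12).
Hypothesis hflat : flat ex ey f1 f2 f12.
Local Notation FX := (frobX ex f1 f12).
Local Notation FY := (frobY ey f2 f12).

Definition errx (T : MS) (A B C : 'M[K]_N) n : 'M[R3]_N :=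
  map_mx (@dx p K) (T n) - FX n *m T n + T n *m conn A B C a c.
Definition erry (T : MS) (A B C : 'M[K]_N) n : 'M[R3]_N :=
  map_mx (@dy p K) (T n) - FY n *m T n + T n *m conn A B C b c.
Definition curv (sx sy s1 s2 s12 : 'M[K]_N) : 'M[R3]_N :=
  conn sx s1 s12 a c *m conn sy s2 s12 b c - conn sy s2 s12 b c *m conn sx s1 s12 a c.

(** The residues of the source connection are unknowns just as T is. Their integrability cannot be
    imposed at the outset, so it is carried along to the same order as the equations. *)
Record stage d (T : MS) (sx sy s1 s2 s12 : 'M[K]_N) : Prop := Stage {
  st_cau : CauM_ T;
  st_uni : forall n, low 1 (T n - 1%:M);
  st_low : [/\ low 1 sx, low 1 sy, low 1 s1, low 1 s2 & low 1 s12];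
  st_x : NullM_ d (errx T sx s1 s12);
  st_y : NullM_ d (erry T sy s2 s12);
  st_br : forall i j : 'I_N, (i < j + d)%N -> NF (curv sx sy s1 s2 s12 i j) = 0
}.

Lemma cm0 : cm (0 : 'M[K]_N) = 0.
Proof. by apply/matrixP => i j; rewrite !mxE mpolyC0. Qed.

Lemma conn0 x z : conn (0 : 'M[K]_N) 0 0 x z = 0.
Proof. by rewrite /conn cm0 scaler0 scaler0 !addr0. Qed.

Lemma stage1 : stage 1 (fun=> 1%:M) 0 0 0 0 0.
Proof.
split.
- exact: CauM_cst.
- by move=> n; rewrite subrr; apply: low_0.
- by split; apply: low_0.
- apply: NullM_low => n; rewrite /errx conn0 mulmx0 addr0 mulmx1; apply: lowB; last exact: low_frobX.
  move=> i j _; rewrite !mxE; case: (_ == _); [exact: dx1 | exact: (linear0 (@dx p K))].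
- apply: NullM_low => n; rewrite /erry conn0 mulmx0 addr0 mulmx1; apply: lowB; last exact: low_frobY.
  move=> i j _; rewrite !mxE; case: (_ == _); [exact: dy1 | exact: (linear0 (@dy p K))].
- by move=> i j _; rewrite /curv !conn0 mulmx0 subrr mxE linear0.
Qed.

Lemma map_dy_err (Tx X T X' : 'M[R3]_N) :
  map_mx (@dy p K) (Tx - X *m T + T *m X') = map_mx (@dy p K) Tx
   - (map_mx (@dy p K) X *m T + X *m map_mx (@dy p K) T)
   + (map_mx (@dy p K) T *m X' + T *m map_mx (@dy p K) X').
Proof. by rewrite map_mxD map_mxB map_dyM map_dyM. Qed.
Lemma map_dx_err (Tx X T X' : 'M[R3]_N) :
  map_mx (@dx p K) (Tx - X *m T + T *m X') = map_mx (@dx p K) Tx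
   - (map_mx (@dx p K) X *m T + X *m map_mx (@dx p K) T)
   + (map_mx (@dx p K) T *m X' + T *m map_mx (@dx p K) X').
Proof. by rewrite map_mxD map_mxB map_dxM map_dxM. Qed.

Lemma NullM_all d (E T : MS) : (forall i j, Null (fun n => E n i j)) -> CauM_ T ->
  NullM_ d (fun n => E n *m T n).
Proof.
move=> hE hT i j _.
apply: (Null_sub0 (g := fun n => \sum_k E n i k * T n k j)) => [n|]; first by rewrite mxE.
by apply: Null_sum => k _; apply: NullMr.
Qed.

Section Step.
Variables (d : nat) (T : MS) (sx sy s1 s2 s12 : 'M[K]_N).
Hypothesis st : stage d T sx sy s1 s2 s12.
Local Notation X' := (conn sx s1 s12 a c).
Local Notation Y' := (conn sy s2 s12 b c).
Local Notation EX := (errx T sx s1 s12).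
Local Notation EY := (erry T sy s2 s12).
Local Notation CV := (curv sx sy s1 s2 s12).

Lemma Cau_errx : CauM_ EX.
Proof.
have hT := st_cau st.
apply: CauM_D; first apply: CauM_B.
- exact: CauM_dx.
- exact: CauM_M (Cau_frobX hp ex f1 f12) hT.
- exact: CauM_M hT (CauM_cst _).
Qed.
Lemma Cau_erry : CauM_ EY.
Proof.
have hT := st_cau st.
apply: CauM_D; first apply: CauM_B.
- exact: CauM_dy.
- exact: CauM_M (Cau_frobY hp ey f2 f12) hT.
- exact: CauM_M hT (CauM_cst _).
Qed.

Lemma map_dxdy (A : 'M[R3]_N) : map_mx (@dx p K) (map_mx (@dy p K) A) =
  map_mx (@dy p K) (map_mx (@dx p K) A).
Proof. by apply/matrixP => i j; rewrite [LHS]mxE [in LHS]mxE [RHS]mxE [in RHS]mxE dxdy. Qed.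

(** On the right stand defects times strictly triangular matrices, the curvature of the pullback,
    which is null, and the curvature of the source times T - 1. Up to the next subdiagonal, the
    constant curvature of the source is therefore a coboundary. *)
Lemma closed_err n : map_mx (@dy p K) (EX n) - map_mx (@dx p K) (EY n) - CV =
  ((EY n *m X' - EX n *m Y') - FX n *m EY n + FY n *m EX n -
     (FX n *m FY n - FY n *m FX n) *m T n) + (T n - 1%:M) *m CV.
Proof.
have hc : map_mx (@dy p K) X' = map_mx (@dx p K) Y'.
  by apply: closed_conn; [exact: dya | exact: dxb | rewrite dxc dyc].
rewrite [(T n - 1%:M) *m _]mulmxBl mul1mx addrA; congr (_ - _).
rewrite {1}/errx {1}/erry map_dy_err map_dx_err map_dxdy -(closed_frob ex ey f1 f2 f12) -hc.
exact: curvature_identity.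
Qed.

Lemma Null_closed_err : NullM_ d.+1 (fun n => map_mx (@dy p K) (EX n) - map_mx (@dx p K) (EY n) - CV).
Proof.
have [lx ly l1 l2 l12] := st_low st; have hT := st_cau st.
have hX := st_x st; have hY := st_y st; rewrite -addn1.
have -> : (fun n => map_mx (@dy p K) (EX n) - map_mx (@dx p K) (EY n) - CV) = fun n =>
  ((EY n *m X' - EX n *m Y') - FX n *m EY n + FY n *m EX n -
     (FX n *m FY n - FY n *m FX n) *m T n) + (T n - 1%:M) *m CV.
  by apply/funext => n; apply: closed_err.
have cX' : CauM_ (fun=> X') by apply: CauM_cst.
have cY' : CauM_ (fun=> Y') by apply: CauM_cst.
have lX' (n : nat) : low 1 X' by apply: low_conn.
have lY' (n : nat) : low 1 Y' by apply: low_conn.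
have cFX := Cau_frobX hp ex f1 f12 : CauM_ FX.
have cFY := Cau_frobY hp ey f2 f12 : CauM_ FY.
apply: NullM_D; first apply: NullM_B; first apply: NullM_D; first apply: NullM_B; first apply: NullM_B.
- exact: (NullM_Mr hp lX' cX' hY).
- exact: (NullM_Mr hp lY' cY' hX).
- exact: (NullM_Ml hp (low_frobX lex lf1 lf12) cFX hY).
- exact: (NullM_Ml hp (low_frobY ley lf2 lf12) cFY hX).
- by apply: NullM_all hT => i j; apply: Null_frob_bracket.
apply: (NullM_Ml hp (st_uni st) (CauM_B hT (CauM_cst _))) => i j ij.
by apply: Null_eq => n; apply: (st_br st).
Qed.

Lemma Null_closed_entry (i j : 'I_N) : (i < j + d.+1)%N ->
  Null (fun n => dy (EX n i j) - dx (EY n i j) - CV i j).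
Proof.
move=> ij; have := Null_closed_err ij; congr Null; apply/funext => n.
by rewrite [LHS]mxE [X in X + _]mxE [X in X + _ + _]mxE [X in _ + X + _]mxE [X in _ - X + _]mxE [X in _ + X]mxE.
Qed.

Lemma curv_step (i j : 'I_N) : (i < j + d.+1)%N -> NF (CV i j) = 0.
Proof.
move=> /Null_closed_entry; rewrite /curv bracket_conn sum7_entry => h.
exact: (six_vertices hp h).
Qed.

Lemma Null_closed_step (i j : 'I_N) : (i < j + d.+1)%N ->
  Null (fun n => dy (EX n i j) - dx (EY n i j)).
Proof.
move=> ij; have h1 := Null_closed_entry ij.
have h2 : Null (fun=> CV i j) by apply: Null_eq => n; apply: curv_step.
by have := NullD h1 h2; congr Null; apply/funext => n; rewrite subrK.
Qed.

Definition ok_entry (ij : 'I_N * 'I_N) (t : (nat -> R3) * (K * K * K * K * K)) :=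
  let: (T1, (kx, ky, k1, k2, k12)) := t in
  let: (i, j) := ij in
  if (i == j + d :> nat)%N then
    [/\ Cau T1, Null (fun n => EX n i j + (dx (T1 n) + (kx%:MP + (1 - a) * k1%:MP + (1 - c) * k12%:MP))) &
      Null (fun n => EY n i j + (dy (T1 n) + (ky%:MP + (1 - b) * k2%:MP + (1 - c) * k12%:MP)))]
  else t = (fun=> 0, (0, 0, 0, 0, 0)).

Lemma ok_entry_ex ij : exists t, ok_entry ij t.
Proof.
case: ij => i j; rewrite /ok_entry.
have [/eqP ij|ij] := boolP (i == j + d :> nat)%N; last first.
  by exists (fun=> 0, (0, 0, 0, 0, 0)).
have h : Null (fun n => dy (- EX n i j) - dx (- EY n i j)).
  have ij' : (i < j + d.+1)%N by rewrite ij addnS.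
  have := NullN (Null_closed_step ij'); congr Null; apply/funext => n.
  by rewrite (linearN (@dy p K)) (linearN (@dx p K)) opprB addrC opprK.
have [T1 [x0 [xa [xc [y0 [yb [cT hx hy]]]]]]] :=
  poincare hp (CauN (Cau_errx i j)) (CauN (Cau_erry i j)) h.
(* This rewrites x0 + xa a + xc c in 1, 1 - a and 1 - c, the functions that multiply the residues in
   [conn]. *)
exists (T1, (x0 + xa + xc, y0 + yb + xc, - xa, - yb, - xc)); split=> //.
- have := NullN hx; congr Null; apply/funext => n.
  rewrite -!mul_mpolyC !mpolyCD !mpolyCN.
  by move: (x0%:MP) (xa%:MP) (xc%:MP) (EX n i j) (dx (T1 n)) => *; ring.
- have := NullN hy; congr Null; apply/funext => n.
  rewrite -!mul_mpolyC !mpolyCD !mpolyCN.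
  by move: (y0%:MP) (yb%:MP) (xc%:MP) (EY n i j) (dy (T1 n)) => *; ring.
Qed.

(** The correction is concentrated on the d-th subdiagonal. There it changes the defect by an exact
    form plus constant logarithmic forms, which is what [poincare] needs; its products with strictly
    triangular matrices lie further down. *)
Lemma stage_step : (0 < d)%N -> exists T' sx' sy' s1' s2' s12', stage d.+1 T' sx' sy' s1' s2' s12'.
Proof.
move=> d0.
have [t ht] := choice ok_entry_ex.
pose T1 n : 'M[R3]_N := \matrix_(i, j) (t (i, j)).1 n.
pose kx : 'M[K]_N := \matrix_(i, j) (t (i, j)).2.1.1.1.1.
pose ky : 'M[K]_N := \matrix_(i, j) (t (i, j)).2.1.1.1.2.
pose k1 : 'M[K]_N := \matrix_(i, j) (t (i, j)).2.1.1.2.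
pose k2 : 'M[K]_N := \matrix_(i, j) (t (i, j)).2.1.2.
pose k12 : 'M[K]_N := \matrix_(i, j) (t (i, j)).2.2.
have [lx ly l1 l2 l12] := st_low st.
have off (i j : 'I_N) : (i != j + d :> nat)%N -> t (i, j) = (fun=> 0, (0, 0, 0, 0, 0)).
  move=> /negbTE ij; have := ht (i, j); rewrite /ok_entry; case: (t (i, j)) => u [[[[? ?] ?] ?] ?].
  by rewrite ij.
have lowt (f : (nat -> R3) * (K * K * K * K * K) -> K) :
   f (fun=> 0, (0, 0, 0, 0, 0)) = 0 -> low d (\matrix_(i, j) f (t (i, j)) : 'M[K]_N).
  by move=> f0 i j ij; rewrite mxE off //; apply/eqP; lia.
have lowt1 (f : (nat -> R3) * (K * K * K * K * K) -> K) :
   f (fun=> 0, (0, 0, 0, 0, 0)) = 0 -> low 1 (\matrix_(i, j) f (t (i, j)) : 'M[K]_N).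
  by move=> f0; apply: lowW d0 (lowt _ f0).
have lT1 n : low d (T1 n) by move=> i j ij; rewrite mxE off //; apply/eqP; lia.
have cT1 : CauM_ T1.
  move=> i j; have [ij|ij] := boolP (i == j + d :> nat)%N; last first.
    apply: Cau_trans (Cau_cst 0) _; apply: Null_eq => n; rewrite mxE off //= subr0.
    exact: linear0.
  have := ht (i, j); rewrite /ok_entry; case et : (t (i, j)) => [u [[[[? ?] ?] ?] ?]]; rewrite ij => -[hu _ _].
  by move: hu; congr Cau; apply/funext => n; rewrite mxE et.
have hT := st_cau st.
have lkX : low d (conn kx k1 k12 a c).
  have h0 : (0 : K)%:MP_[3] = 0 by exact: mpolyC0.
  apply: lowD; first apply: lowD; last apply: lowZ; try apply: lowZ.
  - by apply: low_map => //; apply: (lowt (fun t => t.2.1.1.1.1)).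
  - by apply: low_map => //; apply: (lowt (fun t => t.2.1.1.2)).
  - by apply: low_map => //; apply: (lowt (fun t => t.2.2)).
have lkY : low d (conn ky k2 k12 b c).
  have h0 : (0 : K)%:MP_[3] = 0 by exact: mpolyC0.
  apply: lowD; first apply: lowD; last apply: lowZ; try apply: lowZ.
  - by apply: low_map => //; apply: (lowt (fun t => t.2.1.1.1.2)).
  - by apply: low_map => //; apply: (lowt (fun t => t.2.1.2)).
  - by apply: low_map => //; apply: (lowt (fun t => t.2.2)).
have lTn := st_uni st.
have rest (F X'' Z : MS) : (forall n, low 1 (F n)) -> (forall n, low 1 (X'' n)) -> (forall n, low d (Z n)) ->
    NullM_ d.+1 (fun n => (T1 n *m X'' n - F n *m T1 n) + ((T n - 1%:M) *m Z n + T1 n *m Z n)).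
  move=> lF lX lZ; apply: NullM_low => n; apply: lowD; first apply: lowB.
  - exact: lowMS.
  - exact: lowSM.
  - apply: lowD; first exact: lowSM.
    by apply: (@lowW _ _ (d + d)); [lia | apply: lowM].
exists (fun n => T n + T1 n), (sx + kx), (sy + ky), (s1 + k1), (s2 + k2), (s12 + k12); split.
- exact: CauM_D.
- by move=> n; rewrite addrAC; apply: lowD => //; apply: lowW d0 (lT1 n).
- split; apply: lowD => //.
  + exact: (lowt1 (fun t => t.2.1.1.1.1)).
  + exact: (lowt1 (fun t => t.2.1.1.1.2)).
  + exact: (lowt1 (fun t => t.2.1.1.2)).
  + exact: (lowt1 (fun t => t.2.1.2)).
  + exact: (lowt1 (fun t => t.2.2)).
- have -> : errx (fun n => T n + T1 n) (sx + kx) (s1 + k1) (s12 + k12) = fun n =>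
     (EX n + (map_mx (@dx p K) (T1 n) + conn kx k1 k12 a c)) +
     ((T1 n *m X' - FX n *m T1 n) + ((T n - 1%:M) *m conn kx k1 k12 a c + T1 n *m conn kx k1 k12 a c)).
    apply/funext => n; rewrite {1}/errx connD map_mxD.
    exact: (step_identity (FX n) X' (T n) (T1 n) (map_mx (@dx p K) (T n)) (map_mx (@dx p K) (T1 n))).
  apply: NullM_D; last first.
    exact: (rest FX (fun=> X') (fun=> conn kx k1 k12 a c) (low_frobX lex lf1 lf12) (fun=> low_conn a c lx l1 l12) (fun=> lkX)).
  move=> i j ij; have [/eqP e|e] := boolP (i == j + d :> nat)%N; last first.
    have ij' : (i < j + d)%N by move/eqP: e; lia.
    have := st_x st ij'; congr Null; apply/funext => n.
    by rewrite addmx3_entry [map_mx _ _ i j]mxE (lT1 n i j ij') (lkX i j ij') (linear0 (@dx p K)) !addr0.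
  have := ht (i, j); rewrite /ok_entry; case et : (t (i, j)) => [u [[[[? ?] ?] ?] ?]]; rewrite e eqxx => -[_ hu _].
  move: hu; congr Null; apply/funext => n.
  by rewrite addmx3_entry [map_mx _ _ i j]mxE connE [T1 n i j]mxE [kx i j]mxE [k1 i j]mxE [k12 i j]mxE et.
- have -> : erry (fun n => T n + T1 n) (sy + ky) (s2 + k2) (s12 + k12) = fun n =>
     (EY n + (map_mx (@dy p K) (T1 n) + conn ky k2 k12 b c)) +
     ((T1 n *m Y' - FY n *m T1 n) + ((T n - 1%:M) *m conn ky k2 k12 b c + T1 n *m conn ky k2 k12 b c)).
    apply/funext => n; rewrite {1}/erry connD map_mxD.
    exact: (step_identity (FY n) Y' (T n) (T1 n) (map_mx (@dy p K) (T n)) (map_mx (@dy p K) (T1 n))).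
  apply: NullM_D; last first.
    exact: (rest FY (fun=> Y') (fun=> conn ky k2 k12 b c) (low_frobY ley lf2 lf12) (fun=> low_conn b c ly l2 l12) (fun=> lkY)).
  move=> i j ij; have [/eqP e|e] := boolP (i == j + d :> nat)%N; last first.
    have ij' : (i < j + d)%N by move/eqP: e; lia.
    have := st_y st ij'; congr Null; apply/funext => n.
    by rewrite addmx3_entry [map_mx _ _ i j]mxE (lT1 n i j ij') (lkY i j ij') (linear0 (@dy p K)) !addr0.
  have := ht (i, j); rewrite /ok_entry; case et : (t (i, j)) => [u [[[[? ?] ?] ?] ?]]; rewrite e eqxx => -[_ _ hu].
  move: hu; congr Null; apply/funext => n.
  by rewrite addmx3_entry [map_mx _ _ i j]mxE connE [T1 n i j]mxE [ky i j]mxE [k2 i j]mxE [k12 i j]mxE et.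
- move=> i j ij; rewrite -(curv_step ij).
  have lX : low 1 X' by apply: low_conn.
  have lY : low 1 Y' by apply: low_conn.
  have D (A B A' B' : 'M[R3]_N) : low 1 A -> low 1 A' -> low d B -> low d B' ->
    ((A + B) *m (A' + B') - (A' + B') *m (A + B)) i j = (A *m A' - A' *m A) i j.
    move=> hA hA' hB hB'; apply/eqP; rewrite -subr_eq0; apply/eqP.
    pose Z := A *m B' + B *m A' + B *m B' - (A' *m B + B' *m A + B' *m B).
    have lZ : low d.+1 Z.
      have lBB (U V : 'M[R3]_N) : low d U -> low d V -> low d.+1 (U *m V).
        by move=> hU hV; apply: (@lowW _ _ (d + d)); [lia | apply: lowM].
      apply: lowB; (apply: lowD; first apply: lowD).
      - exact: lowSM. - exact: lowMS. - exact: lBB.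
      - exact: lowSM. - exact: lowMS. - exact: lBB.
    by rewrite -[RHS](lZ i j ij); exact: bracket_perturb.
  apply: (congr1 (@NF p K)); rewrite {1}/curv connD connD.
  exact: (D X' (conn kx k1 k12 a c) Y' (conn ky k2 k12 b c)).
Qed.
End Step.

Theorem chart_solution : exists (T : MS) (sx sy s1 s2 s12 : 'M[K]_N),
  [/\ CauM_ T, forall n, low 1 (T n - 1%:M), [/\ low 1 sx, low 1 sy, low 1 s1, low 1 s2 & low 1 s12],
    forall i j, Null (fun n => errx T sx s1 s12 n i j) &
    forall i j, Null (fun n => erry T sy s2 s12 n i j)].
Proof.
have h d : (0 < d)%N -> exists T sx sy s1 s2 s12, stage d T sx sy s1 s2 s12.
  elim: d => [//|[|d] IH] _; first by do 6 eexists; exact: stage1.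
  have [T [sx [sy [s1 [s2 [s12 st]]]]]] := IH isT; exact: (stage_step st).
(* At order N + 1 the condition i < j + d holds for all entries. *)
have [T [sx [sy [s1 [s2 [s12 [h1 h2 h3 h4 h5 _]]]]]]] := h N.+1 isT.
have lt (i j : 'I_N) : (i < j + N.+1)%N by have := ltn_ord i; lia.
exists T, sx, sy, s1, s2, s12; split=> // i j; [exact: h4 | exact: h5].
Qed.
End Induction.

(** * Restriction to the edges *)

Section PolySeq.
Variables (p : nat) (hp : prime p) (K : padicField p).
Local Notation nm := (@pnorm p K).
Implicit Types (f g : {poly K}) (d e R : rat).

Definition bdp R d f := forall m, nm f`_m * R ^+ m <= d.

Lemma bdpW R d e f : d <= e -> bdp R d f -> bdp R e f.
Proof. by move=> h hF m; apply: le_trans h. Qed.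
Lemma bdp_ge0 R d f : bdp R d f -> 0 <= d.
Proof. by move=> h; apply: le_trans (h 0%N); rewrite mulr1 pnorm_ge0. Qed.
Lemma bdpD R d f g : 0 <= R -> bdp R d f -> bdp R d g -> bdp R d (f + g).
Proof.
move=> R0 hF hG m; rewrite coefD.
apply: le_trans (ler_wpM2r (exprn_ge0 _ R0) (pnormD _ _)) _.
by rewrite maxr_pMl ?exprn_ge0 // ge_max hF hG.
Qed.
Lemma bdpN R d f : bdp R d f -> bdp R d (- f).
Proof. by move=> h m; rewrite coefN pnormN. Qed.
Lemma bdp0 R d : 0 <= d -> bdp R d 0.
Proof. by move=> h m; rewrite coef0 pnorm0 // mul0r. Qed.
Lemma bdpZ R d x f : bdp R d f -> bdp R (nm x * d) (x *: f).
Proof. by move=> h m; rewrite coefZ pnormM -mulrA ler_wpM2l ?pnorm_ge0. Qed.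
Lemma bdp_sum R d (I : Type) (s : seq I) (P : pred I) (F : I -> {poly K}) : 0 <= R -> 0 <= d ->
  (forall i, P i -> bdp R d (F i)) -> bdp R d (\sum_(i <- s | P i) F i).
Proof.
move=> R0 d0 h; elim/big_rec: _ => [|i x Pi hx]; first exact: bdp0.
by apply: bdpD => //; apply: h.
Qed.
Lemma bdpM R d e f g : 0 < R -> bdp R d f -> bdp R e g -> bdp R (d * e) (f * g).
Proof.
move=> R0 hF hG m; rewrite coefM.
have de0 : 0 <= d * e by rewrite mulr_ge0 ?(bdp_ge0 hF) ?(bdp_ge0 hG).
have Rp : 0 < R ^+ m by apply: exprn_gt0.
rewrite -ler_pdivlMr //; apply: pnorm_sum => //; first by rewrite divr_ge0 // ltW.
move=> k _; rewrite pnormM ler_pdivlMr //.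
have -> : R ^+ m = R ^+ k * R ^+ (m - k) by rewrite -exprD subnKC // -ltnS.
by rewrite mulrACA ler_pM ?mulr_ge0 ?pnorm_ge0 ?exprn_ge0 // ltW.
Qed.
Lemma bdp1 R : bdp R 1 1.
Proof. by case=> [|m]; rewrite coef1 /= ?pnorm1 ?mulr1 // pnorm0 // mul0r. Qed.
Lemma bdpX R d f n : 0 < R -> bdp R d f -> bdp R (d ^+ n) (f ^+ n).
Proof.
move=> R0 h; elim: n => [|n IH]; first exact: bdp1.
by rewrite !exprS; apply: bdpM.
Qed.

Definition NullP (f : nat -> {poly K}) := exists2 R, 1 < R &
  forall e, 0 < e -> exists N, forall n, (N <= n)%N -> bdp R e (f n).
Definition CauP (f : nat -> {poly K}) := exists2 R, 1 < R &
  forall e, 0 < e -> exists N, forall m n, (N <= m)%N -> (N <= n)%N -> bdp R e (f m - f n).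

Lemma NullP_coef (f : nat -> {poly K}) : NullP f -> forall m, knorm_cvg nm (fun n => (f n)`_m) 0.
Proof.
move=> [R R1 hR] m e e0; have e2 : 0 < e / 2 by lra.
have [N hN] := hR _ e2; exists N => n hn; rewrite subr0.
apply: (@le_lt_trans _ _ (e / 2)); last by lra.
apply: le_trans (hN n hn m); rewrite ler_peMr ?pnorm_ge0 // exprn_ege1 // ltW //.
Qed.

Lemma CauP_coef (f : nat -> {poly K}) : CauP f -> forall m, knorm_cauchy nm (fun n => (f n)`_m).
Proof.
move=> [R R1 hR] m e e0; have e2 : 0 < e / 2 by lra.
have [N hN] := hR _ e2; exists N => k n hk hn; rewrite -coefB.
apply: (@le_lt_trans _ _ (e / 2)); last by lra.
apply: le_trans (hN k n hk hn m); rewrite ler_peMr ?pnorm_ge0 // exprn_ege1 // ltW //.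
Qed.

Definition limc (f : nat -> {poly K}) m : K := plim (fun n => (f n)`_m).

Lemma limcP (f : nat -> {poly K}) m : CauP f -> knorm_cvg nm (fun n => (f n)`_m) (limc f m).
Proof. by move=> h; apply: plimP; apply: CauP_coef. Qed.

Lemma limc_approx (f : nat -> {poly K}) R : 1 < R -> (forall e, 0 < e -> exists N, forall m n, (N <= m)%N -> (N <= n)%N -> bdp R e (f m - f n)) ->
  forall e, 0 < e -> exists N, forall n, (N <= n)%N -> forall m, nm (limc f m - (f n)`_m) * R ^+ m <= e.
Proof.
move=> R1 hR e e0; have [N hN] := hR e e0; exists N => n hn m.
have cf : CauP f by exists R.
have Rp : 0 < R ^+ m by apply: exprn_gt0; lra.
rewrite -ler_pdivlMr //; apply: cvg_norm_le (limcP m cf) _.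
by exists N => k hk; rewrite -coefB ler_pdivlMr //; apply: hN.
Qed.

Lemma limc_over (f : nat -> {poly K}) : CauP f -> exists C r : rat, [/\ 0 <= C, 0 < r, r < 1 & forall m, nm (limc f m) <= C * r ^+ m].
Proof.
move=> [R R1 hR]; have R0 : 0 < R by lra.
have [N hN] := limc_approx R1 hR ltr01.
have [B B0 hB] : exists2 B, 0 <= B & bdp R B (f N).
  elim/poly_ind: (f N) => [|q x [B B0 hB]]; first by exists 0 => //; apply: bdp0.
  have xp : bdp R (nm x) x%:P.
    by case=> [|m]; rewrite coefC /= ?mulr1 // pnorm0 // mul0r pnorm_ge0.
  have hX : bdp R R 'X.
    by move=> m; rewrite coefX; case: eqP => [->|_]; rewrite ?pnorm1 ?mul1r // pnorm0 // mul0r ltW.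
  exists (B * R + nm x); first by rewrite addr_ge0 ?mulr_ge0 ?pnorm_ge0 // ltW.
  apply: bdpD; [exact: ltW | |].
    by apply: bdpW (bdpM R0 hB hX); rewrite lerDl pnorm_ge0.
  by apply: bdpW xp; rewrite lerDr mulr_ge0 // ltW.
exists (1 + B), R^-1; split; [lra | by rewrite invr_gt0 | by rewrite invf_lt1 |] => m.
have Rp : 0 < R ^+ m by apply: exprn_gt0.
rewrite exprVn -ler_pdivrMr ?invr_gt0 // invrK.
rewrite -(subrK (f N)`_m (limc f m)).
apply: le_trans (ler_wpM2r (ltW Rp) (pnormD _ _)) _.
rewrite maxr_pMl ?(ltW Rp) // ge_max (le_trans (hN N (leqnn _) m)) ?lerDl //.
by apply: le_trans (hB m) _; rewrite lerDr.
Qed.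

(** A radius R > 1 makes the approximation of the coefficients uniform, so evaluation at u = -1,
    which is x = 0, commutes with the limit. *)
Lemma limc_value (f : nat -> {poly K}) l : CauP f -> knorm_cvg nm (fun n => (f n).[-1]) l ->
  knorm_cvg nm (fun M => \sum_(k < M) (-1) ^+ k * limc f k) l.
Proof.
move=> [R R1 hR] hl e e0; have e2 : 0 < e / 2 by lra.
have [N hN] := limc_approx R1 hR e2; have [N' hN'] := hl _ e2.
pose n := maxn N N'; exists (size (f n)) => M hM.
have -> : \sum_(k < M) (-1) ^+ k * limc f k - l =
  (\sum_(k < M) (-1) ^+ k * (limc f k - (f n)`_k)) + ((f n).[-1] - l).
  rewrite (horner_coef_wide _ hM) addrA -big_split /=; congr (_ - _).
  by apply: eq_bigr => k _; ring.
apply: (@le_lt_trans _ _ (e / 2)); last by lra.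
apply: pnormD_le; last by rewrite ltW // hN' // leq_maxr.
apply: pnorm_sum => [|k _]; first exact: ltW.
rewrite pnorm_sign; apply: le_trans (hN n (leq_maxl _ _) k).
by rewrite ler_peMr ?pnorm_ge0 // exprn_ege1 // ltW.
Qed.

Lemma bdp_horner R d f : 1 <= R -> bdp R d f -> nm f.[-1] <= d.
Proof.
move=> R1 h; rewrite horner_coef; apply: pnorm_sum => [|k _]; first exact: bdp_ge0 h.
rewrite mulrC pnorm_sign; apply: le_trans (h k).
by rewrite ler_peMr ?pnorm_ge0 // exprn_ege1.
Qed.

Lemma CauP_horner (f : nat -> {poly K}) : CauP f -> knorm_cauchy nm (fun n => (f n).[-1]).
Proof.
move=> [R R1 hR] e e0; have e2 : 0 < e / 2 by lra.
have [N hN] := hR _ e2; exists N => m n hm hn.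
apply: (@le_lt_trans _ _ (e / 2)); last by lra.
by rewrite -hornerN -hornerD; apply: (bdp_horner (ltW R1)); apply: hN.
Qed.
End PolySeq.

(** * Evaluation of functions along the edges of the chart *)

Section EdgeEval.
Variables (p : nat) (hp : prime p) (K : padicField p).
Local Notation nm := (@pnorm p K).
Local Notation R3 := {mpoly K[3]}.
Local Notation a := (va K).
Local Notation b := (vb K).
Local Notation c := (vc K).
Local Notation rho := (rho K).
Implicit Types (F G : R3) (d e R : rat).

Section Ev.
Variables (x y z : {poly K}).
(** Restriction to a curve on which a, b, c are polynomials in u. The hypothesis [xyz] below says
    that this curve lies on the chart. *)
Definition ev : R3 -> {poly K} := lin (fun i j k => x ^+ i * y ^+ j * z ^+ k).
HB.instance Definition _ := GRing.Linear.copy ev (lin (fun i j k => x ^+ i * y ^+ j * z ^+ k)).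

Lemma ev_mono i j k : ev (mono K i j k) = x ^+ i * y ^+ j * z ^+ k.
Proof. exact: lin_mono. Qed.

Lemma ev_is_monoid : monoid_morphism ev.
Proof.
have e1 : ev 1 = 1.
  have -> : 1 = mono K 0 0 0 by rewrite /mono !expr0 !mulr1.
  by rewrite ev_mono !expr0 !mulr1.
split=> // F G.
apply: (R3_linear_eq (f := fun G => ev (F * G)) (g := fun G => ev F * ev G)).
- by move=> t u v; rewrite mulrDr -scalerAr linearP.
- by move=> t u v; rewrite linearP /= mulrDr -scalerAr.
move=> i j k; move: F; apply: (R3_linear_eq (f := fun F => ev (F * mono K i j k))
  (g := fun F => ev F * ev (mono K i j k))).
- by move=> t u v; rewrite mulrDl -scalerAl linearP.
- by move=> t u v; rewrite linearP /= mulrDl -scalerAl.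
by move=> i' j' k'; rewrite monoM !ev_mono !exprD; ring.
Qed.
HB.instance Definition _ := GRing.isMonoidMorphism.Build R3 {poly K} ev ev_is_monoid.

Lemma ev_a : ev a = x. Proof. by rewrite mono_a ev_mono; ring. Qed.
Lemma ev_b : ev b = y. Proof. by rewrite mono_b ev_mono; ring. Qed.
Lemma ev_c : ev c = z. Proof. by rewrite mono_c ev_mono; ring. Qed.
Lemma ev_C (t : K) : ev t%:MP = t%:P.
Proof. by rewrite -[t%:MP]mulr1 mul_mpolyC linearZ /= rmorph1 -mul_polyC mulr1. Qed.

Hypothesis xyz : x * y - x * z - y * z + z = 0.

Lemma ev_NF F : ev (NF F) = ev F.
Proof.
have [H hH] := NF_eq F; rewrite [in RHS]hH rmorphD rmorphM /=.
suff -> : ev rho = 0 by rewrite mul0r addr0.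
by rewrite /rho !(rmorphD, rmorphN, rmorphM) /= ev_a ev_b ev_c.
Qed.

Hypothesis bxyz : forall R, 1 <= R -> [/\ bdp R R x, bdp R R y & bdp R R z].

Lemma bdp_ev R d F : 1 <= R -> bd R d F -> bdp R d (ev F).
Proof.
move=> R1 hF; have [hx hy hz] := bxyz R1; have R0 : 0 < R by lra.
apply: bdp_sum => [||m _]; [exact: ltW | exact: (bd_ge0 hF (ltW R0))|].
apply: bdpW (bdpZ _ (bdpM R0 (bdpM R0 (bdpX _ R0 hx) (bdpX _ R0 hy)) (bdpX _ R0 hz))).
by rewrite -!exprD -mdeg3.
Qed.

Lemma Null_ev (f : nat -> R3) : Null f -> NullP (fun n => ev (f n)).
Proof.
move=> [R R1 hR]; exists R => // e /hR [N hN]; exists N => n hn.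
by rewrite -ev_NF; apply: bdp_ev (ltW R1) (hN n hn).
Qed.

Lemma Cau_ev (f : nat -> R3) : Cau f -> CauP (fun n => ev (f n)).
Proof.
move=> [R R1 hR]; exists R => // e /hR [N hN]; exists N => m n hm hn.
by rewrite -linearB /= -ev_NF; apply: bdp_ev (ltW R1) (hN m n hm hn).
Qed.
End Ev.

(* The derivation [x d/dx] in the coordinate [u = 1 / (x - 1)]. *)
Definition d1 (f : {poly K}) : {poly K} := - ((1 + 'X) * ('X * f^`())).
Lemma d1_linear : linear d1.
Proof. by move=> t f g; rewrite /d1 derivD derivZ -!mul_polyC; ring. Qed.
HB.instance Definition _ := GRing.isLinear.Build K {poly K} {poly K} _ d1 d1_linear.

Lemma d1M f g : d1 (f * g) = d1 f * g + f * d1 g.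
Proof. by rewrite /d1 derivM; ring. Qed.

Lemma d1X f q n : d1 f = f * q -> d1 (f ^+ n) = f ^+ n * (n%:R * q).
Proof.
move=> h; elim: n => [|n IH]; last by rewrite exprS d1M IH h -natr1; ring.
by rewrite expr0 /d1 derivC; ring.
Qed.

Lemma ev_dx x y z F : d1 x = x * (x - 1) -> d1 y = 0 -> d1 z = z * (z - 1) ->
  ev x y z (dx F) = d1 (ev x y z F).
Proof.
move=> hx hy hz.
apply: (R3_linear_eq (f := fun F => ev x y z (dx F)) (g := fun F => d1 (ev x y z F))).
- by move=> t u v; rewrite !linearP.
- by move=> t u v; rewrite !linearP.
have hy' : d1 y = y * 0 by rewrite mulr0.
move=> i j k; rewrite dx_mono /dxf ev_mono !d1M (d1X _ hx) (d1X _ hy') (d1X _ hz).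
rewrite rmorphM /= ev_mono rmorphD !rmorphM !rmorphB !rmorph_nat !rmorph1 /= ev_a ev_c.
by move: (x ^+ i) (y ^+ j) (z ^+ k) => *; ring.
Qed.

Lemma ev_dy x y z F : d1 x = 0 -> d1 y = y * (y - 1) -> d1 z = z * (z - 1) ->
  ev x y z (dy F) = d1 (ev x y z F).
Proof.
move=> hx hy hz.
apply: (R3_linear_eq (f := fun F => ev x y z (dy F)) (g := fun F => d1 (ev x y z F))).
- by move=> t u v; rewrite !linearP.
- by move=> t u v; rewrite !linearP.
have hx' : d1 x = x * 0 by rewrite mulr0.
move=> i j k; rewrite dy_mono /dyf ev_mono !d1M (d1X _ hx') (d1X _ hy) (d1X _ hz).
rewrite rmorphM /= ev_mono rmorphD !rmorphM !rmorphB !rmorph_nat !rmorph1 /= ev_b ev_c.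
by move: (x ^+ i) (y ^+ j) (z ^+ k) => *; ring.
Qed.
End EdgeEval.

Section CoefLimits.
Variables (p : nat) (K : padicField p).
Local Notation nm := (@pnorm p K).
Implicit Types (f g : nat -> {poly K}) (L : nat -> K).

Definition cvp f L := forall m, knorm_cvg nm (fun n => (f n)`_m) (L m).
Definition convs (L L' : nat -> K) m : K := \sum_(l < m.+1) L l * L' (m - l)%N.

Lemma cvp_uniq f L L' : cvp f L -> cvp f L' -> L =1 L'.
Proof. by move=> h h' m; apply: cvg_uniq (h m) (h' m). Qed.
Lemma cvpD f g L L' : cvp f L -> cvp g L' -> cvp (fun n => f n + g n) (fun m => L m + L' m).
Proof.
move=> h h' m; have := cvgD (h m) (h' m); congr knorm_cvg; apply/funext => n; by rewrite coefD.
Qed.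
Lemma cvpN f L : cvp f L -> cvp (fun n => - f n) (fun m => - L m).
Proof.
move=> h m; have := cvgZ (-1) (h m); rewrite mulN1r; congr knorm_cvg; apply/funext => n.
by rewrite coefN mulN1r.
Qed.
Lemma cvpB f g L L' : cvp f L -> cvp g L' -> cvp (fun n => f n - g n) (fun m => L m - L' m).
Proof. by move=> h h'; apply: cvpD => //; apply: cvpN. Qed.
Lemma cvp_cst (q : {poly K}) : cvp (fun=> q) (fun m => q`_m).
Proof. by move=> m; apply: cvg_cst. Qed.
Lemma cvpM f g L L' : cvp f L -> cvp g L' -> cvp (fun n => f n * g n) (convs L L').
Proof.
move=> h h' m; have := cvg_sum (index_enum 'I_m.+1) (P := xpredT) (fun l _ => cvgM (h l) (h' (m - l)%N)).
by congr knorm_cvg; apply/funext => n; rewrite coefM.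
Qed.
Lemma cvpZ x f L : cvp f L -> cvp (fun n => x%:P * f n) (fun m => x * L m).
Proof.
move=> h m; have := cvgZ x (h m); congr knorm_cvg; apply/funext => n; by rewrite coefCM.
Qed.
Lemma cvp_sum (I : Type) (s : seq I) (F : I -> nat -> {poly K}) (L : I -> nat -> K) :
  (forall i, cvp (F i) (L i)) -> cvp (fun n => \sum_(i <- s) F i n) (fun m => \sum_(i <- s) L i m).
Proof.
move=> h m; have := cvg_sum s (P := xpredT) (fun i _ => h i m); congr knorm_cvg.
by apply/funext => n; rewrite coef_sum.
Qed.
Lemma cvp_euler f L : cvp f L -> cvp (fun n => 'X * (f n)^`()) (fun m => m%:R * L m).
Proof.
move=> h m; have := cvgZ m%:R (h m); congr knorm_cvg; apply/funext => n.
rewrite coefXM; case: m => [|m] /=; first by rewrite mul0r.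
by rewrite coef_deriv mulr_natl.
Qed.
Lemma cvp_null f : NullP f -> cvp f (fun=> 0).
Proof. by move=> h m; apply: NullP_coef. Qed.
Lemma cvp_limc f : CauP f -> cvp f (limc f).
Proof. by move=> h m; apply: limcP. Qed.
End CoefLimits.

Section Frobpoly.
Variables (p : nat) (K : padicField p).

(** As [qn p (- 'X)] approximates 1/(1 - x^p), this is x^p/(x^p - 1) = (1 + u)^p / Q with an
    explicit error. *)
Lemma frobQ_u n : let Q : {poly K} := (1 + 'X) ^+ p - 'X ^+ p in
  Q * (1 - qn p (- 'X) n) = (1 + 'X) ^+ p - 'X ^+ p * frobV p (- 'X) ^+ n.
Proof.
move=> Q.
have h : Q = (-1) ^+ p.+1 * frobQ p (- 'X).
  have e : - 'X - 1 = - (1 + 'X) :> {poly K} by rewrite opprD addrC.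
  rewrite /frobQ e (exprNn 'X) (exprNn (1 + 'X)) -mulrBr mulrA -exprD addSn addnn.
  by rewrite -signr_odd /= odd_double /= expr1 mulN1r opprB.
rewrite mulrBr mulr1 /qn (exprNn 'X).
have -> : Q * ((-1) ^+ p * 'X ^+ p * frobU p (- 'X) n) =
   ((-1) ^+ p.+1 * (-1) ^+ p) * 'X ^+ p * (frobQ p (- 'X) * frobU p (- 'X) n) by rewrite h; ring.
rewrite frobQU -exprD addSn addnn -signr_odd /= odd_double /= expr1 /Q; ring.
Qed.
End Frobpoly.

(** * From polynomial approximations to horizontal series *)

Section SeriesSolution.
Variables (p : nat) (hp : prime p) (K : padicField p) (N : nat).
Local Notation nm := (@pnorm p K).
Local Notation MP := (nat -> 'M[{poly K}]_N).
Implicit Types (A B : 'M[K]_N).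

Definition cp A : 'M[{poly K}]_N := map_mx polyC A.
Definition pconn A B (x : {poly K}) : 'M[{poly K}]_N := cp A + (1 - x) *: cp B.
Definition err1 (R0 R1 S0 S1 : 'M[K]_N) (P : MP) n : 'M[{poly K}]_N :=
  map_mx (@d1 p K) (P n) - (p%:R *: pconn R0 R1 (qn p (- 'X) n)) *m P n + P n *m pconn S0 S1 (- 'X).

(** In this form a solution on the chart restricts to an edge by mere evaluation. An inverse is
    included because [frob_iso] asks for an overconvergent one. *)
Record sol1 (R0 R1 S0 S1 : 'M[K]_N) (P : MP) : Prop := Sol1 {
  sol_cau : forall i j, CauP (fun n => P n i j);
  sol_inv : exists2 Q : MP, forall i j, CauP (fun n => Q n i j) & forall n, P n *m Q n = 1%:M;
  sol_low : forall n, low 1 (P n - 1%:M);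
  sol_err : forall i j, NullP (fun n => err1 R0 R1 S0 S1 P n i j)
}.

Definition ser (P : MP) : mxseries K N := fun m => \matrix_(i, j) limc (fun n => P n i j) m.
Definition limval (x : K) (P : MP) : 'M[K]_N := \matrix_(i, j) plim (fun n => (P n i j).[x]).

Lemma cp_entry A B x i j : (pconn A B x) i j = (A i j)%:P + (1 - x) * (B i j)%:P.
Proof. by rewrite !mxE. Qed.

Lemma err1_entry (R0 R1 S0 S1 : 'M[K]_N) P n i j : err1 R0 R1 S0 S1 P n i j =
  d1 (P n i j) - p%:R * \sum_k ((R0 i k)%:P + (1 - qn p (- 'X) n) * (R1 i k)%:P) * P n k j +
  \sum_k P n i k * ((S0 k j)%:P + (1 + 'X) * (S1 k j)%:P).
Proof.
rewrite /err1 -scalemxAl [LHS]mxE [X in X + _]mxE [X in X + _ + _]mxE; congr (_ + _ + _).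
  rewrite [LHS]mxE [X in - X]mxE mxE; congr (- (_ * _)); apply: eq_bigr => k _.
  by rewrite cp_entry.
by rewrite mxE; apply: eq_bigr => k _; rewrite cp_entry opprK.
Qed.

Lemma lincomb_entry x (A B C D : 'M[K]_N) i j :
  (x *: (A + B) - (C + D)) i j = x * (A i j + B i j) - (C i j + D i j).
Proof. by rewrite !mxE. Qed.

Lemma smul_constl A (T : mxseries K N) m : smul (sconst A) T m = A *m T m.
Proof.
rewrite /smul big_ord_recl /= /sconst /= subn0 big1 ?addr0 // => i _.
by rewrite mul0mx.
Qed.
Lemma smul_constr A (T : mxseries K N) m : smul T (sconst A) m = T m *m A.
Proof.
rewrite /smul big_ord_recr /= /sconst /= subnn /= big1 ?add0r // => i _.
by case: eqP => [e|_]; [have := ltn_ord i; rewrite -subn_gt0 e | rewrite mulmx0].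
Qed.

Lemma spoly_entry (q : {poly K}) (T : mxseries K N) m i j :
  spoly q T m i j = convs (fun l => q`_l) (fun l => T l i j) m.
Proof. by rewrite /spoly summxE; apply: eq_bigr => l _; rewrite mxE. Qed.

Lemma ext_convs (L L1 L2 : nat -> K) : L1 =1 L2 -> convs L L1 =1 convs L L2.
Proof. by move=> h m; apply: eq_bigr => l _; rewrite h. Qed.

Lemma over_mx (T : mxseries K N) :
  (forall i j, exists C r : rat, [/\ 0 <= C, 0 < r, r < 1 & forall m, nm (T m i j) <= C * r ^+ m]) ->
  overconvergent T.
Proof.
move=> h.
have h' (ij : 'I_N * 'I_N) : exists Cr : rat * rat, [/\ 0 <= Cr.1, 0 < Cr.2, Cr.2 < 1 &
    forall m, nm (T m ij.1 ij.2) <= Cr.1 * Cr.2 ^+ m].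
  by have [C [r hr]] := h ij.1 ij.2; exists (C, r).
have [f hf] := choice h'.
pose C := \sum_ij (f ij).1.
pose r := \big[Num.max/2^-1]_ij (f ij).2.
exists C, r; split.
- by rewrite /r; apply: lt_le_trans (bigmax_ge_id _ _ _ _); rewrite invr_gt0.
- by rewrite /r; apply: bigmax_lt => [|ij _]; [rewrite invf_lt1 | case: (hf ij)].
move=> m i j; have [C0 r0 r1 hT] := hf (i, j); apply: le_trans (hT m) _.
apply: ler_pM; rewrite ?exprn_ge0 //; first exact: ltW.
  rewrite /C (bigD1 (i, j)) //= lerDl sumr_ge0 // => ij _; by case: (hf ij).
apply: lerXn2r; rewrite ?nnegrE; first exact: ltW.
  by apply: le_trans (ltW r0) _; apply: le_bigmax.
by apply: le_bigmax.
Qed.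

Section Conv.
Variables (R0 R1 S0 S1 : 'M[K]_N) (P : MP).
Hypothesis hs : sol1 R0 R1 S0 S1 P.
Local Notation T := (ser P).

Lemma ser_cvp i j : cvp (fun n => P n i j) (fun m => T m i j).
Proof.
move=> m; rewrite mxE; exact: cvp_limc (sol_cau hs i j) m.
Qed.

Lemma ser_over (Q : MP) : (forall i j, CauP (fun n => Q n i j)) -> overconvergent (ser Q).
Proof.
move=> h; apply: over_mx => i j; have [C [r hr]] := limc_over (h i j).
exists C, r; case: hr => ? ? ? hr; split=> // m; by rewrite mxE.
Qed.

Lemma smul_entry (U V : mxseries K N) m i j :
  smul U V m i j = \sum_k convs (fun l => U l i k) (fun l => V l k j) m.
Proof.
rewrite /smul summxE exchange_big /=; apply: eq_bigr => l _.
by rewrite mxE.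
Qed.

Lemma ser_inv (P1 P2 : MP) : (forall i j, CauP (fun n => P1 n i j)) ->
  (forall i j, CauP (fun n => P2 n i j)) -> (forall n, P1 n *m P2 n = 1%:M) ->
  forall m, smul (ser P1) (ser P2) m = sconst 1%:M m.
Proof.
move=> c1 c2 h m; apply/matrixP => i j; rewrite smul_entry.
have h1 (Q : MP) (c : forall i j, CauP (fun n => Q n i j)) i' j' : cvp (fun n => Q n i' j') (fun m => ser Q m i' j').
  by move=> m'; rewrite mxE; apply: cvp_limc (c i' j') m'.
have h2 : cvp (fun n => \sum_k P1 n i k * P2 n k j)
   (fun m => \sum_k convs (fun l => ser P1 l i k) (fun l => ser P2 l k j) m).
  by apply: cvp_sum => k; apply: cvpM; apply: h1.
have h3 : cvp (fun n => \sum_k P1 n i k * P2 n k j) (fun m => ((1%:M : 'M[{poly K}]_N) i j)`_m).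
  have := cvp_cst ((1%:M : 'M[{poly K}]_N) i j); congr cvp; apply/funext => n.
  by rewrite -(h n) mxE.
rewrite (cvp_uniq h2 h3) /sconst [in LHS]mxE.
by case: m => [|m] /=; rewrite mxE; case: (i == j); rewrite ?mulr1n ?mulr0n ?coef1 ?coef0.
Qed.

Hypothesis nullV : NullP (fun n => frobV p (- 'X : {poly K}) ^+ n).

Lemma sol1_horizontal : frob_horizontal R0 R1 S0 S1 T.
Proof.
move=> m; apply/matrixP => i j.
set Q : {poly K} := (1 + 'X) ^+ p - 'X ^+ p.
pose A k : nat -> K := fun m => T m k j; pose B k : nat -> K := fun m => T m i k.
pose E n := - (Q * (1 + 'X)) * ('X * (P n i j)^`()) -
  p%:R%:P * (Q * \sum_k (R0 i k)%:P * P n k j + (1 + 'X) ^+ p * \sum_k (R1 i k)%:P * P n k j) +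
  (Q * \sum_k (S0 k j)%:P * P n i k + (Q * (1 + 'X)) * \sum_k (S1 k j)%:P * P n i k).
have c1 : cvp E (fun m => convs (fun l => (- (Q * (1 + 'X)))`_l) (fun l => l%:R * T l i j) m -
   p%:R * (convs (fun l => Q`_l) (fun l => \sum_k R0 i k * A k l) m +
           convs (fun l => ((1 + 'X) ^+ p)`_l) (fun l => \sum_k R1 i k * A k l) m) +
   (convs (fun l => Q`_l) (fun l => \sum_k S0 k j * B k l) m +
    convs (fun l => (Q * (1 + 'X))`_l) (fun l => \sum_k S1 k j * B k l) m)).
  apply: cvpD; first apply: cvpB.
  - by apply: cvpM (cvp_cst _) _; apply: cvp_euler; apply: ser_cvp.
  - by apply: cvpZ; apply: cvpD; apply: cvpM (cvp_cst _) _; apply: cvp_sum => k; apply: cvpZ; apply: ser_cvp.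
  - by apply: cvpD; apply: cvpM (cvp_cst _) _; apply: cvp_sum => k; apply: cvpZ; apply: ser_cvp.
pose Vn n : {poly K} := frobV p (- 'X) ^+ n.
(* Multiplication by Q turns the truncated pullback into (1 + u)^p, at the price of an error with
   factor [Vn n]. *)
have EE n : E n = Q * err1 R0 R1 S0 S1 P n i j -
    p%:R%:P * ('X ^+ p * (Vn n * \sum_k (R1 i k)%:P * P n k j)).
  rewrite err1_entry.
  have -> : \sum_k ((R0 i k)%:P + (1 - qn p (- 'X) n) * (R1 i k)%:P) * P n k j =
    \sum_k (R0 i k)%:P * P n k j + (1 - qn p (- 'X) n) * \sum_k (R1 i k)%:P * P n k j.
    by rewrite mulr_sumr -big_split /=; apply: eq_bigr => k _; rewrite mulrDl mulrA.
  have -> : \sum_k P n i k * ((S0 k j)%:P + (1 + 'X) * (S1 k j)%:P) =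
    \sum_k (S0 k j)%:P * P n i k + (1 + 'X) * \sum_k (S1 k j)%:P * P n i k.
    by rewrite mulr_sumr -big_split /=; apply: eq_bigr => k _; ring.
  have := frobQ_u K n; rewrite /= -/Q -/(Vn n) => hQ.
  rewrite /E polyC_natr /d1.
  set x1 := \sum_k (R0 i k)%:P * _; set x2 := \sum_k (R1 i k)%:P * _.
  set x3 := \sum_k (S0 k j)%:P * _; set x4 := \sum_k (S1 k j)%:P * _.
  have -> : Q * (- ((1 + 'X) * ('X * (P n i j)^`())) - p%:R * (x1 + (1 - qn p (- 'X) n) * x2) + (x3 + (1 + 'X) * x4))
    = - (Q * (1 + 'X)) * ('X * (P n i j)^`()) - p%:R * (Q * x1 + (Q * (1 - qn p (- 'X) n)) * x2) + (Q * x3 + Q * (1 + 'X) * x4) by ring.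
  by rewrite hQ; move: (Vn n) => v; ring.
have c2 : cvp E (fun m => convs (fun l => Q`_l) (fun=> 0) m - p%:R * (
    convs (fun l => ('X ^+ p)`_l) (convs (fun=> 0) (fun l => \sum_k R1 i k * A k l)) m)).
  have -> : E = fun n => Q * err1 R0 R1 S0 S1 P n i j -
    p%:R%:P * ('X ^+ p * (Vn n * \sum_k (R1 i k)%:P * P n k j)) by apply/funext.
  apply: cvpB; first by apply: cvpM (cvp_cst _) _; apply: cvp_null; apply: (sol_err hs).
  apply: cvpZ; apply: cvpM (cvp_cst _) _; apply: cvpM; first exact: cvp_null.
  by apply: cvp_sum => k; apply: cvpZ; apply: ser_cvp.
have z0 (L : nat -> K) : convs L (fun=> 0) =1 fun=> 0 by move=> l; apply: big1 => ? _; rewrite mulr0.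
have z1 (L : nat -> K) : convs (fun=> 0) L =1 fun=> 0 by move=> l; apply: big1 => ? _; rewrite mul0r.
have := cvp_uniq c1 c2 m; rewrite z0 (ext_convs _ (z1 _)) z0 mulr0 subrr => h.
rewrite [LHS]mxE lincomb_entry !spoly_entry.
have e0 : convs (fun l => (- (Q * (1 + 'X)))`_l) (fun l => l%:R * T l i j) m =
   - convs (fun l => (Q * (1 + 'X))`_l) (fun l => (sEuler T l) i j) m.
  by rewrite /convs -sumrN; apply: eq_bigr => l _; rewrite coefN mulNr; congr (- (_ * _)); rewrite /sEuler [RHS]mxE.
have e1 (D : 'M[K]_N) q : convs q (fun l => \sum_k D i k * A k l) m = convs q (fun l => (smul (sconst D) T l) i j) m.
  by apply: ext_convs => l; rewrite smul_constl [RHS]mxE.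
have e2 (D : 'M[K]_N) q : convs q (fun l => \sum_k D k j * B k l) m = convs q (fun l => (smul T (sconst D) l) i j) m.
  by apply: ext_convs => l; rewrite smul_constr [RHS]mxE; apply: eq_bigr => k _; rewrite mulrC.
move: h; rewrite e0 !e1 !e2 => h.
apply/eqP; rewrite -subr_eq0; apply/eqP; rewrite -[RHS]h.
by do ![move: (convs _ _ m) => ?]; ring.
Qed.

Lemma sol1_frob_iso : frob_iso R0 R1 S0 S1 T.
Proof.
have [Q cQ hQ] := sol_inv hs; split.
- exact: ser_over (sol_cau hs).
- exists (ser Q); split; first exact: ser_over.
  + by apply: ser_inv => //; apply: (sol_cau hs).
  + by apply: ser_inv => // [|n]; [apply: (sol_cau hs) | apply: mulmx1C].
- exact: sol1_horizontal.
Qed.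

Lemma sol1_value : value_at_cusp T = limval (-1) P.
Proof.
apply/matrixP => i j; rewrite !mxE.
have c := sol_cau hs i j; have := limc_value c (plimP (CauP_horner c)) => h.
rewrite -(plim_eq h); congr plim; apply/funext => M.
by rewrite summxE; apply: eq_bigr => k _; rewrite !mxE.
Qed.

Lemma sol1_zero : T 0%N = limval 0 P.
Proof.
apply/matrixP => i j; rewrite !mxE /limc; congr plim; apply/funext => n.
by rewrite horner_coef0.
Qed.
End Conv.
End SeriesSolution.

(** * Limits of polynomials and the inversion x |-> 1/x *)

Section PolyClosure.
Variables (p : nat) (hp : prime p) (K : padicField p).
Local Notation nm := (@pnorm p K).
Implicit Types (f g : nat -> {poly K}) (d e R : rat).

Lemma bdp_R (R R' d : rat) (f : {poly K}) : 0 <= R' -> R' <= R -> bdp R d f -> bdp R' d f.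
Proof.
move=> h0 h hF m; apply: le_trans (hF m); apply: ler_wpM2l; first exact: pnorm_ge0.
by apply: lerXn2r => //; rewrite nnegrE ?(le_trans h0 h).
Qed.

Lemma bdp_exists R (f : {poly K}) : 0 < R -> exists2 B, 0 <= B & bdp R B f.
Proof.
move=> R0; elim/poly_ind: f => [|q x [B B0 hB]]; first by exists 0 => //; apply: bdp0.
have xp : bdp R (nm x) x%:P.
  by case=> [|m]; rewrite coefC /= ?mulr1 // pnorm0 // mul0r pnorm_ge0.
have hX : bdp R R ('X : {poly K}).
  by move=> m; rewrite coefX; case: eqP => [->|_]; rewrite ?pnorm1 ?mul1r // pnorm0 // mul0r ltW.
exists (B * R + nm x); first by rewrite addr_ge0 ?mulr_ge0 ?pnorm_ge0 // ltW.
apply: bdpD; [exact: ltW | |].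
  by apply: bdpW (bdpM R0 hB hX); rewrite lerDl pnorm_ge0.
by apply: bdpW xp; rewrite lerDr mulr_ge0 // ltW.
Qed.

Lemma NullP_D f g : NullP f -> NullP g -> NullP (fun n => f n + g n).
Proof.
move=> [R R1 hR] [R' R1' hR']; exists (Num.min R R'); first by rewrite lt_min R1.
have m0 : 0 <= Num.min R R' by rewrite le_min !ltW ?(lt_trans ltr01).
move=> e e0; have [N hN] := hR e e0; have [N' hN'] := hR' e e0.
exists (maxn N N') => n; rewrite geq_max => /andP[hn hn'].
apply: bdpD => //; first by apply: bdp_R (hN n hn); rewrite // ge_min lexx.
by apply: bdp_R (hN' n hn'); rewrite // ge_min lexx orbT.
Qed.

Lemma NullP_N f : NullP f -> NullP (fun n => - f n).
Proof.
by move=> [R R1 hR]; exists R => // e e0; have [N hN] := hR e e0; exists N => n /hN /bdpN.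
Qed.

Lemma NullP_B f g : NullP f -> NullP g -> NullP (fun n => f n - g n).
Proof. by move=> hf hg; apply: NullP_D => //; apply: NullP_N. Qed.

Lemma NullP_0 : NullP (fun=> 0 : {poly K}).
Proof. by exists 2 => // e e0; exists 0%N => n _; apply: bdp0; apply: ltW. Qed.

Lemma NullP_ext f g : (forall n, f n = g n) -> NullP g -> NullP f.
Proof. by move=> h; congr NullP; apply/funext => n. Qed.

Lemma NullP_sum (I : Type) (s : seq I) (F : I -> nat -> {poly K}) :
  (forall i, NullP (F i)) -> NullP (fun n => \sum_(i <- s) F i n).
Proof.
move=> h; elim: s => [|i s IH]; first by apply: NullP_ext NullP_0 => n; rewrite big_nil.
apply: (NullP_ext (g := fun n => F i n + \sum_(j <- s) F j n)) => [n|]; first by rewrite big_cons.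
exact: NullP_D.
Qed.

Lemma CauP_bounded R f : 0 < R -> (forall e, 0 < e -> exists N, forall m n,
    (N <= m)%N -> (N <= n)%N -> bdp R e (f m - f n)) ->
  exists2 B, 0 < B & exists N, forall n, (N <= n)%N -> bdp R B (f n).
Proof.
move=> R0 /(_ 1 ltr01) [N hN].
have [B B0 hB] := bdp_exists (f N) R0.
exists (B + 1); first by lra.
exists N => n hn; rewrite -(subrK (f N) (f n)); apply: bdpD; first exact: ltW.
  by apply: bdpW (hN n N hn (leqnn _)); lra.
by apply: bdpW hB; lra.
Qed.

Lemma NullP_M f g : CauP f -> NullP g -> NullP (fun n => f n * g n).
Proof.
move=> [R R1 hR] [R' R1' hR']; exists (Num.min R R'); first by rewrite lt_min R1.
have m1 : 0 < Num.min R R' by rewrite lt_min !(lt_trans ltr01).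
have R0 : 0 < R by lra.
have [B B0 [N hN]] := CauP_bounded R0 hR.
move=> e e0; have [N' hN'] := hR' (e / B) (divr_gt0 e0 B0).
exists (maxn N N') => n; rewrite geq_max => /andP[hn hn'].
have -> : e = B * (e / B) by rewrite mulrC divfK // lt0r_neq0.
apply: bdpM => //; first by apply: bdp_R (hN n hn); [exact: ltW | rewrite ge_min lexx].
by apply: bdp_R (hN' n hn'); [exact: ltW | rewrite ge_min lexx orbT].
Qed.

Lemma CauP_D f g : CauP f -> CauP g -> CauP (fun n => f n + g n).
Proof.
move=> [R R1 hR] [R' R1' hR']; exists (Num.min R R'); first by rewrite lt_min R1.
have m0 : 0 <= Num.min R R' by rewrite le_min !ltW ?(lt_trans ltr01).
move=> e e0; have [N hN] := hR e e0; have [N' hN'] := hR' e e0.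
exists (maxn N N') => m n; rewrite !geq_max => /andP[hm hm'] /andP[hn hn'].
rewrite opprD addrACA; apply: bdpD => //.
  by apply: bdp_R (hN m n hm hn); rewrite // ge_min lexx.
by apply: bdp_R (hN' m n hm' hn'); rewrite // ge_min lexx orbT.
Qed.

Lemma CauP_Z x f : CauP f -> CauP (fun n => x%:P * f n).
Proof.
move=> [R R1 hR]; exists R => // e e0.
have [N hN] := hR (e / (nm x + 1)) (divr_gt0 e0 (ltr_wpDl (pnorm_ge0 _) ltr01)).
exists N => m n hm hn; rewrite -mulrBr mul_polyC.
apply: bdpW (bdpZ _ (hN m n hm hn)).
by rewrite mulrCA ler_piMr ?(ltW e0) // ler_pdivrMr ?mul1r ?lerDl // ltr_wpDl ?pnorm_ge0.
Qed.

(** The inversion x |-> 1/x in the coordinate u = 1/(x - 1). *)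
Definition flip : {poly K} := - 1 - 'X.

Lemma bdp_flip R d (f : {poly K}) : 1 <= R -> bdp R d f -> bdp R d (f \Po flip).
Proof.
move=> R1 h; have R0 : 0 < R by lra.
have hX : bdp R R ('X : {poly K}).
  by move=> m; rewrite coefX; case: eqP => [->|_]; rewrite ?pnorm1 ?mul1r // pnorm0 // mul0r ltW.
have hf : bdp R R flip.
  by apply: bdpD; [exact: ltW | apply: bdpN; apply: bdpW (bdp1 K R) | apply: bdpN].
rewrite comp_polyE; apply: bdp_sum => [||i _]; [exact: ltW | exact: bdp_ge0 h|].
by apply: bdpW (bdpZ _ (bdpX _ R0 hf)).
Qed.

Lemma NullP_flip f : NullP f -> NullP (fun n => f n \Po flip).
Proof.
by move=> [R R1 hR]; exists R => // e /hR [N hN]; exists N => n /hN; apply: bdp_flip; apply: ltW.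
Qed.
Lemma CauP_flip f : CauP f -> CauP (fun n => f n \Po flip).
Proof.
move=> [R R1 hR]; exists R => // e /hR [N hN]; exists N => m n hm hn.
by rewrite -rmorphB; apply: bdp_flip; [exact: ltW | apply: hN].
Qed.

Lemma bd_edge R : 1 <= R -> [/\ bdp R R (- 'X : {poly K}), bdp R R (1 : {poly K}) & bdp R R (0 : {poly K})].
Proof.
move=> R1; have R0 : 0 <= R by lra.
split; last exact: bdp0.
  apply: bdpN => m; rewrite coefX; case: eqP => [->|_]; rewrite ?pnorm1 ?mul1r // pnorm0 // mul0r //.
by apply: bdpW (bdp1 K R).
Qed.

Section RMorph.
Variables (A B : comNzRingType) (f : {rmorphism A -> B}).
Lemma rmorph_frobV z : f (frobV p z) = frobV p (f z).
Proof. by rewrite /frobV /frobQ !(rmorphB, rmorphM, rmorphXn, rmorphN, rmorph1). Qed.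
Lemma rmorph_frobU z n : f (frobU p z n) = frobU p (f z) n.
Proof.
rewrite /frobU rmorphM rmorphXn rmorphN rmorph1 rmorph_sum; congr (_ * _).
by apply: eq_bigr => k _; rewrite rmorphXn rmorph_frobV.
Qed.
Lemma rmorph_qn z n : f (qn p z n) = qn p (f z) n.
Proof. by rewrite /qn rmorphM rmorphXn rmorph_frobU. Qed.
End RMorph.

Lemma edge_a : (- 'X) * 1 - (- 'X) * 1 - 1 * 1 + 1 = 0 :> {poly K}. Proof. ring. Qed.
Lemma edge_a_bd R : 1 <= R -> [/\ bdp R R (- 'X : {poly K}), bdp R R (1 : {poly K}) & bdp R R (1 : {poly K})].
Proof. by move=> /bd_edge []. Qed.
Lemma ev_one : 1 * 1 - 1 * 1 - 1 * 1 + 1 = 0 :> {poly K}. Proof. ring. Qed.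
Lemma ev_one_bd R : 1 <= R -> [/\ bdp R R (1 : {poly K}), bdp R R (1 : {poly K}) & bdp R R (1 : {poly K})].
Proof. by move=> /bd_edge []. Qed.

Lemma NullP_frobV : NullP (fun n => frobV p (- 'X : {poly K}) ^+ n).
Proof.
have := Null_ev edge_a edge_a_bd (Null_frobV hp K (inord 0)); apply: NullP_ext => n.
by rewrite rmorphXn rmorph_frobV /= [ev _ _ _ _]ev_a.
Qed.
Lemma NullP_frobV1 : NullP (fun n => frobV p (1 : {poly K}) ^+ n).
Proof.
have := Null_ev ev_one ev_one_bd (Null_frobV hp K (inord 0)); apply: NullP_ext => n.
by rewrite rmorphXn rmorph_frobV /= [ev _ _ _ _]ev_a.
Qed.
Lemma CauP_frobU : CauP (frobU p (- 'X : {poly K})).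
Proof.
have := Cau_ev edge_a edge_a_bd (Cau_frobU hp K (inord 0)); congr CauP; apply/funext => n.
by rewrite rmorph_frobU /= [ev _ _ _ _]ev_a.
Qed.

Lemma flipX : - 'X \Po flip = 1 + 'X.
Proof. by rewrite rmorphN /= comp_polyX /flip; ring. Qed.

(** The limit is the identity 1/(1 - x^p) + 1/(1 - x^-p) = 1, which expresses that Frobenius
    commutes with the inversion. *)
Lemma qn_flip : NullP (fun n => qn p (- 'X : {poly K}) n + qn p (1 + 'X) n - 1).
Proof.
set z : {poly K} := - 'X.
have fz : z \Po flip = 1 - z by rewrite flipX opprK.
pose U := frobU p z; pose U' := frobU p (1 - z).
pose V n := frobV p z ^+ n; pose V' n := frobV p (1 - z) ^+ n.
have nV : NullP V by apply: NullP_frobV.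
have nV' : NullP V'.
  by have := NullP_flip NullP_frobV; apply: NullP_ext => n; rewrite rmorphXn rmorph_frobV /= fz.
have cU : CauP U by apply: CauP_frobU.
have cU' : CauP U'.
  by have := CauP_flip CauP_frobU; congr CauP; apply/funext => n; rewrite rmorph_frobU /= fz.
pose s : {poly K} := (-1) ^+ p.+1.
have s2 : s * s = 1 by rewrite -expr2 sqrr_sign.
pose D n := U n - s * U' n.
have cD : CauP D.
  have := CauP_D cU (CauP_Z (- (-1) ^+ p.+1) cU'); congr CauP; apply/funext => n.
  by rewrite /D /s polyCN mulNr rmorphXn /= polyCN.
have hQ' : frobQ p (1 - z) = s * frobQ p z.
  rewrite /frobQ /s.
  have -> : (1 - z) - 1 = - z by ring.
  have -> : 1 - z = - (z - 1) by ring.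
  by rewrite (exprNn (z - 1)) (exprNn z) exprS; ring.
have h1 n : frobQ p z * U n = 1 - V n by apply: frobQU.
have h2 n : frobQ p z * U' n = s * (1 - V' n).
  by rewrite -frobQU hQ' !mulrA s2 mul1r.
(* The two approximate inverses of Q satisfy Q D = V' - V and Q U = 1 - V; so D is made of null
   sequences. *)
have hD n : D n = U n * (V' n - V n) + V n * D n.
  have -> : V' n - V n = frobQ p z * D n.
    rewrite /D mulrBr h1 mulrCA h2 mulrA s2; ring.
  by have e : V n = 1 - frobQ p z * U n; [rewrite h1; ring | rewrite e; ring].
apply: (NullP_ext (g := fun n => z ^+ p * (U n * (V' n - V n) + V n * D n) - V' n)) => [n|].
  rewrite -hD /qn -/(U n) (_ : 1 + 'X = 1 - z); last by rewrite opprK.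
  rewrite -/(U' n).
  have -> : (1 - z) ^+ p = - s * (z ^+ p - frobQ p z).
    rewrite /frobQ (_ : 1 - z = - (z - 1)); last by ring.
    by rewrite (exprNn (z - 1)) /s exprS; ring.
  have -> : - s * (z ^+ p - frobQ p z) * U' n = - s * z ^+ p * U' n + s * (frobQ p z * U' n) by ring.
  by rewrite h2 mulrA s2 /D; ring.
have cc : CauP (fun=> z ^+ p).
  by exists 2 => // e e0; exists 0%N => m n _ _; rewrite subrr; apply: bdp0; apply: ltW.
apply: NullP_B => //; apply: NullP_M => //.
apply: NullP_D; first by apply: NullP_M => //; apply: NullP_B.
have := NullP_M cD nV; apply: NullP_ext => n; exact: mulrC.
Qed.
End PolyClosure.

Section Neumann.
Variables (R : comPzRingType) (N : nat).
Implicit Types A B : 'M[R]_N.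

Definition neumann A : 'M[R]_N := \sum_(k < N) (1%:M - A) ^+ k.

Lemma low_exp A k : low 1 A -> low k (A ^+ k).
Proof.
move=> h; elim: k => [|k IH]; last by rewrite exprS; apply: lowSM.
move=> i j ij; rewrite expr0 mxE; case: eqP => [e|//].
by move: ij; rewrite e addn0 ltnn.
Qed.

Lemma neumannP A : low 1 (A - 1%:M) -> A *m neumann A = 1%:M.
Proof.
move=> h.
have h1 : low 1 (1%:M - A) by rewrite -opprB; apply: lowN.
have := subrX1 (1%:M - A) N; rewrite (low_full (low_exp h1)) sub0r => e.
have e' : A = - ((1%:M - A) - 1) by rewrite addrAC subrr sub0r opprK.
rewrite {1}e' mulNmx -[RHS]opprK; congr (- _); exact: esym e.
Qed.
End Neumann.

(** * Connections on an edge *)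

Section Edges.
Variables (p : nat) (hp : prime p) (K : padicField p) (N : nat).
Local Notation R3 := {mpoly K[3]}.
Local Notation a := (va K).
Local Notation b := (vb K).
Local Notation c := (vc K).
Local Notation MS := (nat -> 'M[R3]_N).
Local Notation MP := (nat -> 'M[{poly K}]_N).

Lemma CauM_exp (E : MS) k : CauM_ E -> CauM_ (fun n => E n ^+ k).
Proof.
move=> h; elim: k => [|k IH]; first exact: CauM_cst.
have := CauM_M h IH; congr CauM_; apply/funext => n; by rewrite exprS.
Qed.

Lemma CauM_sum (I : Type) (s : seq I) (F : I -> MS) : (forall i, CauM_ (F i)) ->
  CauM_ (fun n => \sum_(i <- s) F i n).
Proof.
move=> h; elim: s => [|i s IH].
  have := CauM_cst (0 : 'M[R3]_N); congr CauM_; apply/funext => n; by rewrite big_nil.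
have := CauM_D (h i) IH; congr CauM_; apply/funext => n; by rewrite big_cons.
Qed.

Lemma CauM_neumann (T : MS) : CauM_ T -> CauM_ (fun n => neumann (T n)).
Proof.
by move=> h; apply: CauM_sum => k; apply: CauM_exp; apply: CauM_B => //; apply: CauM_cst.
Qed.

Definition pconn3 (A B C : 'M[K]_N) (x z : {poly K}) : 'M[{poly K}]_N :=
  cp A + (1 - x) *: cp B + (1 - z) *: cp C.

Lemma pconn3_swap A B C x z : pconn3 A B C x z = pconn3 A C B z x.
Proof. by rewrite /pconn3 addrAC. Qed.

Lemma pconn3_cst A B C x (v : bool) : pconn3 A B C x v%:R = pconn (A + (~~ v)%:R *: C) B x.
Proof.
apply/matrixP => i j; rewrite !mxE polyCD polyCM.
by case: v; rewrite /= ?polyC1 ?polyC0; ring.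
Qed.

Lemma pconn3_approx A B C x y (v : bool) : pconn3 A B C x y =
  pconn (A + (~~ v)%:R *: C) B x + (v%:R - y) *: cp C.
Proof.
apply/matrixP => i j; rewrite !mxE polyCD polyCM.
by case: v; rewrite /= ?polyC1 ?polyC0; ring.
Qed.

Lemma NullP_qn_cst (v : bool) : NullP (fun n => v%:R - qn p (v%:R : {poly K}) n).
Proof.
have p0 : (p == 0%N) = false by rewrite eqn0Ngt prime_gt0.
case: v => /=; last first.
  by apply: NullP_ext (NullP_0 K) => n; rewrite /qn expr0n p0 mul0r subr0.
apply: NullP_ext (NullP_frobV1 hp K) => n; rewrite /qn expr1n mul1r.
have := frobQU p (1 : {poly K}) n; rewrite {1}/frobQ subrr expr1n expr0n.
by rewrite p0 subr0 mul1r => ->; ring.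
Qed.

Lemma NullP_mulmxr (F G : MP) : (forall i j, NullP (fun n => F n i j)) ->
  (forall i j, CauP (fun n => G n i j)) -> forall i j, NullP (fun n => (F n *m G n) i j).
Proof.
move=> hF hG i j; apply: (NullP_ext (g := fun n => \sum_k F n i k * G n k j)) => [n|]; first by rewrite mxE.
apply: NullP_sum => k; have := NullP_M (hG k j) (hF i k); apply: NullP_ext => n; exact: mulrC.
Qed.

Lemma NullP_scal (x : nat -> {poly K}) (A : 'M[K]_N) : NullP x -> forall i j, NullP (fun n => (x n *: cp A) i j).
Proof.
move=> h i j; apply: (NullP_ext (g := fun n => (A i j)%:P * x n)) => [n|]; first by rewrite !mxE mulrC.
apply: NullP_M h; exists 2 => // e e0; exists 0%N => m n _ _; rewrite subrr; apply: bdp0; exact: ltW.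
Qed.

Lemma NullP_p (x : nat -> {poly K}) : NullP x -> NullP (fun n => p%:R * x n).
Proof.
apply: NullP_M; exists 2 => // e e0; exists 0%N => m n _ _; rewrite subrr; apply: bdp0; exact: ltW.
Qed.

(** If one of the functions is constant on the edge, its residue C is added to A when the constant
    is 0 and disappears when it is 1. Frobenius fixes both constants, so a connection on the line
    with two finite residues is left. *)
Lemma edge_err A B C A' B' C' (v : bool) (P : MP) :
  (forall i j, CauP (fun n => P n i j)) ->
  (forall i j, NullP (fun n => (map_mx (@d1 p K) (P n)
     - (p%:R *: pconn3 A B C (qn p (- 'X) n) (qn p v%:R n)) *m P n + P n *m pconn3 A' B' C' (- 'X) v%:R) i j)) ->
  forall i j, NullP (fun n => err1 (A + (~~ v)%:R *: C) B (A' + (~~ v)%:R *: C') B' P n i j).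
Proof.
move=> cP hE i j.
have h1 : forall i j, NullP (fun n => ((p%:R * (v%:R - qn p (v%:R : {poly K}) n)) *: cp C *m P n) i j).
  by apply: NullP_mulmxr cP; apply: NullP_scal; apply: NullP_p; apply: NullP_qn_cst.
have := NullP_D (hE i j) (h1 i j); apply: NullP_ext => n.
rewrite /err1 pconn3_cst (pconn3_approx A B C _ _ v).
move: (pconn (A + _) B _) => X1; rewrite scalerDr scalerA mulmxDl.
move: (_ *m P n) (_ *m P n) (map_mx _ _) (P n *m _) => U V W Y.
rewrite !mxE; ring.
Qed.

Section EvMatrix.
Variables x y z : {poly K}.
Local Notation E := (ev x y z).

Lemma map_ev_cm (A : 'M[K]_N) : map_mx E (cm A) = cp A.
Proof. by apply/matrixP => i j; rewrite [LHS]mxE [cm A i j]mxE [RHS]mxE; exact: ev_C. Qed.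

Lemma map_ev_conn A B C u w : map_mx E (conn A B C u w) = pconn3 A B C (E u) (E w).
Proof.
have sc (t : R3) (A' : 'M[K]_N) : map_mx E (t *: cm A') = E t *: cp A'.
  by rewrite map_mxZ map_ev_cm.
by rewrite /conn map_mxD map_mxD map_ev_cm sc sc !rmorphB rmorph1.
Qed.

Lemma map_ev_scale (A : 'M[R3]_N) : map_mx E (p%:R *: A) = p%:R *: map_mx E A.
Proof. by rewrite map_mxZ rmorph_nat. Qed.

Lemma map_ev_err (Tx X T X' : 'M[R3]_N) : map_mx E (Tx - X *m T + T *m X') =
  map_mx E Tx - map_mx E X *m map_mx E T + map_mx E T *m map_mx E X'.
Proof. by rewrite map_mxD map_mxB !map_mxM. Qed.
End EvMatrix.

(** The inversion fixes x = 1 and exchanges 0 with infinity, where the residue is minus the sum of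
    the two others; [qn_flip] makes it compatible with Frobenius. *)
Lemma sol1_flip (R0 R1 S0 S1 : 'M[K]_N) (P : MP) : sol1 R0 R1 S0 S1 P ->
  sol1 (- R0 - R1) R1 (- S0 - S1) S1 (fun n => map_mx (comp_poly (flip K)) (P n)).
Proof.
move=> h; have [Q cQ hQ] := sol_inv h; have cP := sol_cau h.
have cP' i j : CauP (fun n => map_mx (comp_poly (flip K)) (P n) i j).
  have := CauP_flip (cP i j); congr CauP; apply/funext => n; by rewrite [RHS]mxE.
split=> //.
- exists (fun n => map_mx (comp_poly (flip K)) (Q n)).
    move=> i j; have := CauP_flip (cQ i j); congr CauP; apply/funext => n; by rewrite [RHS]mxE.
  by move=> n; rewrite -map_mxM hQ map_mx1.
- move=> n i j ij; have := sol_low h n ij; rewrite !mxE => e.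
  have -> : P n i j = (i == j)%:R by apply/eqP; rewrite -subr_eq0 e.
  by rewrite rmorph_nat subrr.
move=> i j.
have h1 : forall i j, NullP (fun n => ((p%:R * (qn p (- 'X : {poly K}) n + qn p (1 + 'X) n - 1)) *: cp R1
    *m map_mx (comp_poly (flip K)) (P n)) i j).
  by apply: NullP_mulmxr cP'; apply: NullP_scal; apply: NullP_p; apply: qn_flip.
have h2 : NullP (fun n => err1 R0 R1 S0 S1 P n i j \Po flip K) by apply: NullP_flip; apply: (sol_err h).
have := NullP_B (h1 i j) h2; apply: NullP_ext => n.
have -> : err1 R0 R1 S0 S1 P n i j \Po flip K = map_mx (comp_poly (flip K)) (err1 R0 R1 S0 S1 P n) i j.
  by rewrite [RHS]mxE.
rewrite /err1 map_mxD map_mxB !map_mxM map_mxZ rmorph_nat.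
set Pg := map_mx _ (P n).
have mc (A : 'M[K]_N) : map_mx (comp_poly (flip K)) (cp A) = cp A.
  by apply/matrixP => u w; rewrite !mxE comp_polyC.
have mp A B x : map_mx (comp_poly (flip K)) (pconn A B x) = pconn A B (x \Po flip K).
  by apply/matrixP => u w; rewrite !mxE rmorphD rmorphM rmorphB rmorph1 /= !comp_polyC.
rewrite !mp rmorph_qn /= flipX.
have -> : map_mx (comp_poly (flip K)) (map_mx (@d1 p K) (P n)) = - map_mx (@d1 p K) Pg.
  apply/matrixP => u w; rewrite !mxE /d1 deriv_comp /flip.
  have -> : (- 1 - 'X : {poly K})^`() = -1.
    by rewrite derivB derivX derivN derivC oppr0 sub0r.
  by rewrite !(rmorphN, rmorphM, rmorphD, rmorph1) /= comp_polyX; ring.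
have e1 (S S' : 'M[K]_N) (q q' : {poly K}) : pconn (- S - S') S' q = - pconn S S' q' + (1 - q - q') *: cp S'.
  by apply/matrixP => u w; rewrite !mxE polyCB polyCN; ring.
rewrite (e1 R0 R1 _ (qn p (1 + 'X) n)) (e1 S0 S1 _ (1 + 'X)).
have -> : 1 - - 'X - (1 + 'X) = 0 :> {poly K} by ring.
move: (pconn R0 R1 _) => X1; rewrite scale0r addr0 mulmxN scalerDr scalerN scalerA mulmxDl mulNmx.
have -> : p%:R * (1 - qn p (- 'X) n - qn p (1 + 'X) n) = - (p%:R * (qn p (- 'X) n + qn p (1 + 'X) n - 1)) :> {poly K} by ring.
rewrite scaleNr mulNmx.
move: (_ *m Pg) (_ *m Pg) (map_mx _ _) (Pg *m _) => U V W Y.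
rewrite !mxE; ring.
Qed.

Lemma limval_flip (P : MP) : limval 0 (fun n => map_mx (comp_poly (flip K)) (P n)) = limval (-1) P /\
  limval (-1) (fun n => map_mx (comp_poly (flip K)) (P n)) = limval 0 P.
Proof.
split; apply/matrixP => i j; rewrite [LHS]mxE [RHS]mxE; congr plim; apply/funext => n;
  by rewrite mxE horner_comp /flip !hornerE; congr (_.[_]); ring.
Qed.
End Edges.

(** * The hexagon of edges of the chart *)

Section ChartEdges.
Variables (p : nat) (hp : prime p) (K : padicField p) (N : nat).
Local Notation R3 := {mpoly K[3]}.
Local Notation a := (va K).
Local Notation b := (vb K).
Local Notation c := (vc K).
Local Notation MS := (nat -> 'M[R3]_N).
Local Notation MP := (nat -> 'M[{poly K}]_N).

(* U and W are the values at x = oo and x = 0.                                *)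
Definition edge (R0 R1 U W : 'M[K]_N) := exists (S0 S1 : 'M[K]_N) (P : MP),
  [/\ low 1 S0, low 1 S1, sol1 R0 R1 S0 S1 P, limval 0 P = U & limval (-1) P = W].

Variables (ex ey f1 f2 f12 : 'M[K]_N).
Hypotheses (lex : low 1 ex) (ley : low 1 ey) (lf1 : low 1 f1) (lf2 : low 1 f2) (lf12 : low 1 f12).
Hypothesis hflat : flat ex ey f1 f2 f12.

Section WithSolution.
Variables (T : MS) (sx sy s1 s2 s12 : 'M[K]_N).
Hypotheses (cT : CauM_ T) (uT : forall n, low 1 (T n - 1%:M)).
Hypotheses (lsx : low 1 sx) (lsy : low 1 sy) (ls1 : low 1 s1) (ls2 : low 1 s2) (ls12 : low 1 s12).
Hypothesis nx : forall i j, Null (fun n => errx ex f1 f12 T sx s1 s12 n i j).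
Hypothesis ny : forall i j, Null (fun n => erry ey f2 f12 T sy s2 s12 n i j).

Definition vval X Y Z : 'M[K]_N := \matrix_(i, j) plim (fun n => coefn (vtx X Y Z) (T n i j)).

Lemma coefn_one X Y Z : coefn (vtx X Y Z) 1 = 1 :> K.
Proof.
have -> : 1 = mono K 0 0 0 by rewrite /mono !expr0 !mulr1.
by rewrite coefn_mono.
Qed.

Lemma vval_low X Y Z : low 1 (vval X Y Z - 1%:M).
Proof.
move=> i j ij; rewrite !mxE.
have e n : coefn (vtx X Y Z) (T n i j) = (i == j)%:R.
  have := uT n ij; rewrite [LHS]mxE [X in _ + X]mxE [X in - X]mxE => /eqP; rewrite subr_eq0 => /eqP ->.
  by case: (i == j); rewrite ?mulr1n ?mulr0n ?coefn_one // /coefn linear0.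
have -> : (fun n => coefn (vtx X Y Z) (T n i j)) = fun=> (i == j)%:R by apply/funext.
by rewrite (plim_eq (cvg_cst _)) subrr.
Qed.

Section Ev.
Variables x y z : {poly K}.
Hypothesis xyz : x * y - x * z - y * z + z = 0.
Hypothesis bxyz : forall R : rat, 1 <= R -> [/\ bdp R R x, bdp R R y & bdp R R z].
Let P : MP := fun n => map_mx (ev x y z) (T n).

Lemma ev_cau i j : CauP (fun n => P n i j).
Proof.
have := Cau_ev xyz bxyz (cT i j); congr CauP; apply/funext => n; by rewrite [RHS]mxE.
Qed.

Lemma ev_inv : exists2 Q : MP, forall i j, CauP (fun n => Q n i j) & forall n, P n *m Q n = 1%:M.
Proof.
exists (fun n => map_mx (ev x y z) (neumann (T n))).
  move=> i j; have := Cau_ev xyz bxyz (CauM_neumann cT i j); congr CauP; apply/funext => n.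
  by rewrite [RHS]mxE.
by move=> n; rewrite /P -map_mxM (neumannP (uT n)) map_mx1.
Qed.

Lemma ev_low n : low 1 (P n - 1%:M).
Proof.
move=> i j ij; have := uT n ij.
rewrite [LHS]mxE [X in _ + X]mxE [X in - X]mxE => /eqP; rewrite subr_eq0 => /eqP e.
by rewrite [LHS]mxE [X in _ + X]mxE [X in - X]mxE [P n i j]mxE e rmorph_nat subrr.
Qed.

Lemma ev_value (t : K) (X Y Z : bool) : x.[t] = X%:R -> y.[t] = Y%:R -> z.[t] = Z%:R -> limval t P = vval X Y Z.
Proof.
move=> hx hy hz; apply/matrixP => i j; rewrite [LHS]mxE [RHS]mxE; congr plim; apply/funext => n.
rewrite [P n i j]mxE; move: (T n i j).
apply: (R3_linear_eq (V := K^o) (f := fun F => (ev x y z F).[t]) (g := fun F => coefn (vtx X Y Z) F)).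
- by move=> s u v; rewrite linearP /= hornerD hornerZ.
- by move=> s u v; rewrite /coefn linearP.
move=> i' j' k'; rewrite ev_mono coefn_mono !hornerM !horner_exp hx hy hz /vtx.
by case: X {hx}; case: Y {hy}; case: Z {hz}; case: i' => [|i']; case: j' => [|j']; case: k' => [|k'];
  rewrite /= ?expr1n ?expr0 ?exprS ?mul0r ?mulr0 ?mulr1 ?mul1r.
Qed.

Lemma ev_qn_a n : ev x y z (qn p a n) = qn p x n.
Proof. by apply: etrans (rmorph_qn _ _ _ _) _; rewrite /= ev_a. Qed.
Lemma ev_qn_b n : ev x y z (qn p b n) = qn p y n.
Proof. by apply: etrans (rmorph_qn _ _ _ _) _; rewrite /= ev_b. Qed.
Lemma ev_qn_c n : ev x y z (qn p c n) = qn p z n.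
Proof. by apply: etrans (rmorph_qn _ _ _ _) _; rewrite /= ev_c. Qed.

Lemma ev_errx : d1 x = x * (x - 1) -> d1 y = 0 -> d1 z = z * (z - 1) ->
  forall i j, NullP (fun n => (map_mx (@d1 p K) (P n)
     - (p%:R *: pconn3 ex f1 f12 (qn p x n) (qn p z n)) *m P n + P n *m pconn3 sx s1 s12 x z) i j).
Proof.
move=> hx hy hz i j; have := Null_ev xyz bxyz (nx i j); apply: NullP_ext => n.
have -> : ev x y z (errx ex f1 f12 T sx s1 s12 n i j) = map_mx (ev x y z) (errx ex f1 f12 T sx s1 s12 n) i j.
  by rewrite [RHS]mxE.
congr (fun_of_matrix _ i j).
rewrite /errx.
rewrite map_ev_err.
congr (_ - _ + _).
- by apply/matrixP => i' j'; rewrite [LHS]mxE [RHS]mxE [X in ev _ _ _ X]mxE [P n i' j']mxE; rewrite ev_dx.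
- rewrite /frobX.
  rewrite map_ev_scale.
  rewrite map_ev_conn.
  apply: esym; exact: (congr2 (fun u w => (p%:R *: pconn3 ex f1 f12 u w) *m P n) (ev_qn_a n) (ev_qn_c n)).
- rewrite map_ev_conn.
  apply: esym; exact: (congr2 (fun u w => P n *m pconn3 sx s1 s12 u w) (ev_a x y z) (ev_c x y z)).
Qed.

Lemma ev_erry : d1 x = 0 -> d1 y = y * (y - 1) -> d1 z = z * (z - 1) ->
  forall i j, NullP (fun n => (map_mx (@d1 p K) (P n)
     - (p%:R *: pconn3 ey f2 f12 (qn p y n) (qn p z n)) *m P n + P n *m pconn3 sy s2 s12 y z) i j).
Proof.
move=> hx hy hz i j; have := Null_ev xyz bxyz (ny i j); apply: NullP_ext => n.
have -> : ev x y z (erry ey f2 f12 T sy s2 s12 n i j) = map_mx (ev x y z) (erry ey f2 f12 T sy s2 s12 n) i j.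
  by rewrite [RHS]mxE.
congr (fun_of_matrix _ i j).
rewrite /erry.
rewrite map_ev_err.
congr (_ - _ + _).
- by apply/matrixP => i' j'; rewrite [LHS]mxE [RHS]mxE [X in ev _ _ _ X]mxE [P n i' j']mxE; rewrite ev_dy.
- rewrite /frobY.
  rewrite map_ev_scale.
  rewrite map_ev_conn.
  apply: esym; exact: (congr2 (fun u w => (p%:R *: pconn3 ey f2 f12 u w) *m P n) (ev_qn_b n) (ev_qn_c n)).
- rewrite map_ev_conn.
  apply: esym; exact: (congr2 (fun u w => P n *m pconn3 sy s2 s12 u w) (ev_b x y z) (ev_c x y z)).
Qed.

Lemma ev_edge (A B C A' B' C' : 'M[K]_N) (v X Y Z X' Y' Z' : bool) :
  (forall i j, NullP (fun n => (map_mx (@d1 p K) (P n)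
     - (p%:R *: pconn3 A B C (qn p (- 'X) n) (qn p v%:R n)) *m P n
     + P n *m pconn3 A' B' C' (- 'X) v%:R) i j)) ->
  low 1 A' -> low 1 B' -> low 1 C' ->
  [/\ x.[0] = X%:R, y.[0] = Y%:R & z.[0] = Z%:R] ->
  [/\ x.[-1] = X'%:R, y.[-1] = Y'%:R & z.[-1] = Z'%:R] ->
  edge (A + (~~ v)%:R *: C) B (vval X Y Z) (vval X' Y' Z').
Proof.
move=> h lA lB lC [h1 h2 h3] [h1' h2' h3'].
exists (A' + (~~ v)%:R *: C'), B', P; split=> //.
- by apply: lowD => //; apply: lowZ.
- split; [exact: ev_cau | exact: ev_inv | exact: ev_low |].
  by apply: edge_err => //; exact: ev_cau.
- exact: ev_value.
- exact: ev_value.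
Qed.
End Ev.

Lemma d1_X : d1 (- 'X : {poly K}) = (- 'X) * (- 'X - 1).
Proof. by rewrite /d1 derivN derivX; ring. Qed.
Lemma d1_0 : d1 (0 : {poly K}) = 0. Proof. exact: linear0. Qed.
Lemma d1_1 : d1 (1 : {poly K}) = 0.
Proof. by rewrite /d1 derivC !mulr0 oppr0. Qed.
Lemma d1_0' : d1 (0 : {poly K}) = 0 * (0 - 1). Proof. by rewrite d1_0 mul0r. Qed.
Lemma d1_1' : d1 (1 : {poly K}) = 1 * (1 - 1). Proof. by rewrite d1_1 subrr mulr0. Qed.

Lemma bd3 (x y z : {poly K}) : x \in [:: - 'X; 1; 0] -> y \in [:: - 'X; 1; 0] -> z \in [:: - 'X; 1; 0] ->
  forall R : rat, 1 <= R -> [/\ bdp R R x, bdp R R y & bdp R R z].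
Proof.
move=> hx hy hz R /(bd_edge K) [h1 h2 h3].
have H (w : {poly K}) : w \in [:: - 'X; 1; 0] -> bdp R R w.
  by rewrite !inE => /or3P[/eqP->|/eqP->|/eqP->].
by split; apply: H.
Qed.

Local Notation V := vval.

(** In this order the edges are y = 0, the exceptional curve over (oo, 0), x = oo, y = oo, the
    exceptional curve over (0, oo), and x = 0. On each of them exactly one of a, b, c varies, and
    consecutive edges of the hexagon share a vertex and hence a value of T. *)
Lemma chart_edges_sol :
  [/\ edge ex f1 (V false true true) (V true true true),
      edge (ex + f1) f12 (V false true false) (V false true true) &
      edge (ey + f12) f2 (V false false false) (V false true false)] /\
  [/\ edge (ex + f12) f1 (V false false false) (V true false false),
      edge ex f12 (V true false false) (V true false true) &
      edge ey f2 (V true false true) (V true true true)].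
Proof.
have i1 : - 'X \in [:: - 'X; 1; 0 : {poly K}] by rewrite inE eqxx.
have i2 : 1 \in [:: - 'X; 1; 0 : {poly K}] by rewrite !inE eqxx orbT.
have i3 : 0 \in [:: - 'X; 1; 0 : {poly K}] by rewrite !inE eqxx !orbT.
have z0 (A B : 'M[K]_N) : A + (~~ true)%:R *: B = A by rewrite scale0r addr0.
have z1 (A B : 'M[K]_N) : A + (~~ false)%:R *: B = A + B by rewrite scale1r.
have x0 : (- 'X : {poly K}).[0] = false%:R by rewrite hornerN hornerX oppr0.
have x1 : (- 'X : {poly K}).[-1] = true%:R by rewrite hornerN hornerX opprK.
have o0 (t : K) : (1 : {poly K}).[t] = true%:R by rewrite hornerC.
have n0 (t : K) : (0 : {poly K}).[t] = false%:R by rewrite hornerC.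
split; split.
- have e : (- 'X) * 1 - (- 'X) * 1 - 1 * 1 + 1 = 0 :> {poly K} by ring.
  have := @ev_edge _ _ _ e (bd3 i1 i2 i2) _ _ _ _ _ _ true false true true true true true
    (ev_errx e (bd3 i1 i2 i2) d1_X d1_1 d1_1') lsx ls1 ls12.
  by rewrite z0; apply; split.
- have e : 0 * 1 - 0 * (- 'X) - 1 * (- 'X) + (- 'X) = 0 :> {poly K} by ring.
  have h := ev_errx e (bd3 i3 i2 i1) d1_0' d1_1 d1_X.
  have := @ev_edge _ _ _ e (bd3 i3 i2 i1) ex f12 f1 sx s12 s1 false false true false false true true.
  rewrite z1; apply => // i j.
  by have := h i j; apply: NullP_ext => n; rewrite pconn3_swap (pconn3_swap sx).
- have e : 0 * (- 'X) - 0 * 0 - (- 'X) * 0 + 0 = 0 :> {poly K} by ring.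
  have := @ev_edge _ _ _ e (bd3 i3 i1 i3) _ _ _ _ _ _ false false false false false true false
    (ev_erry e (bd3 i3 i1 i3) d1_0 d1_X d1_0') lsy ls2 ls12.
  by rewrite z1; apply; split.
- have e : (- 'X) * 0 - (- 'X) * 0 - 0 * 0 + 0 = 0 :> {poly K} by ring.
  have := @ev_edge _ _ _ e (bd3 i1 i3 i3) _ _ _ _ _ _ false false false false true false false
    (ev_errx e (bd3 i1 i3 i3) d1_X d1_0 d1_0') lsx ls1 ls12.
  by rewrite z1; apply; split.
- have e : 1 * 0 - 1 * (- 'X) - 0 * (- 'X) + (- 'X) = 0 :> {poly K} by ring.
  have h := ev_errx e (bd3 i2 i3 i1) d1_1' d1_0 d1_X.
  have := @ev_edge _ _ _ e (bd3 i2 i3 i1) ex f12 f1 sx s12 s1 true true false false true false true.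
  rewrite z0; apply => // i j.
  by have := h i j; apply: NullP_ext => n; rewrite pconn3_swap (pconn3_swap sx).
- have e : 1 * (- 'X) - 1 * 1 - (- 'X) * 1 + 1 = 0 :> {poly K} by ring.
  have := @ev_edge _ _ _ e (bd3 i2 i1 i2) _ _ _ _ _ _ true true false true true true true
    (ev_erry e (bd3 i2 i1 i2) d1_1 d1_X d1_1') lsy ls2 ls12.
  by rewrite z0; apply; split.
Qed.
End WithSolution.

Theorem chart_edges : exists V : bool -> bool -> bool -> 'M[K]_N,
  (forall X Y Z, low 1 (V X Y Z - 1%:M)) /\
  [/\ edge ex f1 (V false true true) (V true true true),
      edge (ex + f1) f12 (V false true false) (V false true true) &
      edge (ey + f12) f2 (V false false false) (V false true false)] /\
  [/\ edge (ex + f12) f1 (V false false false) (V true false false),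
      edge ex f12 (V true false false) (V true false true) &
      edge ey f2 (V true false true) (V true true true)].
Proof.
have [T [sx [sy [s1 [s2 [s12 [cT uT [lsx lsy ls1 ls2 ls12] nx ny]]]]]]] :=
  chart_solution hp lex ley lf1 lf2 lf12 hflat.
exists (vval T); split; first exact: vval_low.
exact: (chart_edges_sol cT uT lsx lsy ls1 ls2 ls12 nx ny).
Qed.
End ChartEdges.

(** * Rigidity of horizontal maps *)

(** A separate type gives series with matrix coefficients a ring structure, so that horizontality
    becomes an identity in a noncommutative ring. *)
Record pser (R : pzRingType) := PSer { pcoef :> nat -> R }.

HB.instance Definition _ (R : pzRingType) := gen_eqMixin (pser R).
HB.instance Definition _ (R : pzRingType) := gen_choiceMixin (pser R).

Section PowerSeriesRing.
Variable R : pzRingType.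
Implicit Types (f g h : pser R).

Lemma pserP f g : f =1 g <-> f = g.
Proof.
split=> [|-> //]; case: f g => [f] [g] /= fg; congr PSer; exact/funext.
Qed.

Definition ps_add f g := PSer (fun m => f m + g m).
Definition ps_opp f := PSer (fun m => - f m).
Definition ps_const (c : R) := PSer (fun m => if m == 0%N then c else 0).
Definition ps_mul f g := PSer (fun m => \sum_(i < m.+1) f i * g (m - i)%N).
Let shift f := PSer (fun m => f m.+1).
Let scale c f := PSer (fun m => c * f m).

Let addA : associative ps_add.
Proof. by move=> f g h; apply/pserP => m /=; rewrite addrA. Qed.
Let addC : commutative ps_add.
Proof. by move=> f g; apply/pserP => m /=; rewrite addrC. Qed.
Let add0 : left_id (ps_const 0) ps_add.
Proof. by move=> f; apply/pserP => m /=; rewrite if_same add0r. Qed.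
Let addN : left_inverse (ps_const 0) ps_opp ps_add.
Proof. by move=> f; apply/pserP => m /=; rewrite addNr if_same. Qed.

HB.instance Definition _ := GRing.isZmodule.Build (pser R) addA addC add0 addN.

Let mulS f g m : ps_mul f g m.+1 = f 0%N * g m.+1 + ps_mul (shift f) g m.
Proof. by rewrite /= big_ord_recl. Qed.
Let mul0 f g : ps_mul f g 0%N = f 0%N * g 0%N.
Proof. by rewrite /= big_ord1. Qed.
Let mulDl : left_distributive ps_mul +%R.
Proof.
by move=> f g h; apply/pserP => m /=; rewrite -big_split; apply: eq_bigr => i _; rewrite mulrDl.
Qed.
Let mulDr : right_distributive ps_mul +%R.
Proof.
by move=> f g h; apply/pserP => m /=; rewrite -big_split; apply: eq_bigr => i _; rewrite mulrDr.
Qed.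
Let mulZl c f g m : ps_mul (scale c f) g m = c * ps_mul f g m.
Proof. by rewrite /= mulr_sumr; apply: eq_bigr => i _; rewrite mulrA. Qed.
Let mulA : associative ps_mul.
Proof.
move=> f g h; apply/pserP => m; elim: m f g => [|m IH] f g.
  by rewrite !mul0 mulrA.
rewrite !mulS IH mul0 mulrDr -!addrA mulrA; congr (_ + _).
have -> : shift (ps_mul f g) = scale (f 0%N) (shift g) + ps_mul (shift f) g.
  by apply/pserP => n; rewrite [LHS]mulS.
by rewrite mulDl -mulZl.
Qed.
Let mul1 : left_id (ps_const 1) ps_mul.
Proof.
move=> f; apply/pserP => -[|m]; first by rewrite mul0 mul1r.
by rewrite mulS mul1r [X in _ + X]big1 ?addr0 // => i _; rewrite mul0r.
Qed.
Let mulr1' : right_id (ps_const 1) ps_mul.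
Proof.
move=> f; apply/pserP => m; elim: m f => [|m IH] f; first by rewrite mul0 mulr1.
by rewrite mulS IH mulr0 add0r.
Qed.

HB.instance Definition _ := GRing.Zmodule_isPzRing.Build (pser R)
  mulA mul1 mulr1' mulDl mulDr.

Lemma pcoefM f g m : (f * g) m = \sum_(i < m.+1) f i * g (m - i)%N.
Proof. by []. Qed.
Lemma pcoefD f g m : (f + g) m = f m + g m.
Proof. by []. Qed.
Lemma pcoefN f m : (- f) m = - f m.
Proof. by []. Qed.
Lemma pcoef_constl c f m : (ps_const c * f) m = c * f m.
Proof.
by rewrite pcoefM big_ord_recl /= subn0 big1 ?addr0 // => i _; rewrite mul0r.
Qed.
Lemma pcoef_constr c f m : (f * ps_const c) m = f m * c.
Proof.
rewrite pcoefM big_ord_recr /= subnn /= big1 ?add0r // => i _.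
by case: eqP => [e|_]; [have := ltn_ord i; rewrite -subn_gt0 e | rewrite mulr0].
Qed.
Lemma ps_const_comm (c d : R) : c * d = d * c -> ps_const c * ps_const d = ps_const d * ps_const c.
Proof.
move=> h; apply/pserP => m; rewrite !pcoef_constl /=; case: (m == 0%N) => //.
by rewrite !mulr0.
Qed.

Definition euler f := PSer (fun m => f m *+ m).
Lemma eulerM f g : euler (f * g) = euler f * g + f * euler g.
Proof.
apply/pserP => m; rewrite pcoefD !pcoefM /= -sumrMnl -big_split /=; apply: eq_bigr => i _.
by rewrite mulrnAl mulrnAr -mulrnDr subnKC // -ltnS.
Qed.
Lemma euler_const c : euler (ps_const c) = 0.
Proof. by apply/pserP => -[|m] //=; rewrite mul0rn. Qed.

Lemma ps_central f : (forall m c, f m * c = c * f m) -> forall g, f * g = g * f.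
Proof.
move=> h g; apply/pserP => m; rewrite !pcoefM (reindex_inj rev_ord_inj) /=.
by apply: eq_bigr => i _; rewrite subSS subKn ?h // -ltnS.
Qed.

Lemma ps_cancel f g : f 0%N = 1 -> f * g = 0 -> g = 0.
Proof.
move=> f0 fg; apply/pserP => m; have : forall k, (k <= m)%N -> g k = 0.
  elim: m => [|m IH] k.
    rewrite leqn0 => /eqP->; have /pserP/(_ 0%N) := fg.
    by rewrite pcoefM big_ord1 f0 mul1r.
  rewrite leq_eqVlt => /orP[/eqP->|]; last exact: IH.
  have /pserP/(_ m.+1) := fg; rewrite pcoefM big_ord_recl f0 mul1r subn0 big1 ?addr0 //.
  by move=> i _; rewrite IH ?mulr0 //= /bump /= subSS leq_subr.
by move=> -> //; case: m.
Qed.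

(** T and T2 are horizontal for the same target G, and F is constant and commutes with G. In Ti F T2
    the contributions of G cancel, which leaves a horizontal map between the two sources. *)
Lemma dlog_euler (q G S S2 T Ti T2 F : pser R) :
  (forall g, q * g = g * q) -> Ti * T = 1 -> T * Ti = 1 -> euler F = 0 -> G * F = F * G ->
  - (q * euler T) = G * T - T * S -> - (q * euler T2) = G * T2 - T2 * S2 ->
  let H := Ti * F * T2 in - (q * euler H) = S * H - H * S2.
Proof.
move=> cq iT iT' eF cF hT hT2 H.
have hTi : euler Ti = - (Ti * euler T * Ti).
  have := eulerM Ti T; rewrite iT -[1]/(ps_const 1) euler_const => /esym/eqP.
  rewrite addr_eq0 => /eqP/(congr1 (fun x => x * Ti)); rewrite -mulrA iT' mulr1 => ->.
  by rewrite mulNr.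
have TH : T * H = F * T2 by rewrite /H !mulrA iT' mul1r.
have eH : euler H = - (Ti * euler T * H) + Ti * F * euler T2.
  by rewrite /H eulerM eulerM eF mulr0 addr0 hTi !mulNr !mulrA.
rewrite eH mulrDr mulrN opprD opprK.
have -> : q * (Ti * euler T * H) = Ti * (q * euler T) * H by rewrite !mulrA cq.
have -> : q * (Ti * F * euler T2) = Ti * F * (q * euler T2) by rewrite !mulrA -cq !mulrA.
rewrite -[q * euler T]opprK hT -[q * euler T2]opprK hT2.
rewrite !(mulrN, mulNr) opprK !(mulrBr, mulrBl).
have -> : Ti * (T * S) * H = S * H by rewrite mulrA iT mul1r.
have -> : Ti * (G * T) * H = Ti * F * (G * T2) by rewrite -!mulrA TH (mulrA F) -cF !mulrA.
have -> : Ti * F * (T2 * S2) = H * S2 by rewrite /H !mulrA.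
by rewrite opprB addrA subrK.
Qed.
End PowerSeriesRing.

Section Uniqueness.
Variables (p : nat) (hp : prime p) (K : padicField p).
Local Notation nm := (@pnorm p K).

(* The equation is - (1 + u) u h'(u) = al + be (1 + u); it forces             *)
(* m h_m = (-1)^m be, and such coefficients do not decay unless be = 0.       *)
Lemma primitive_const (h : nat -> K) (al be : K) (C r : rat) :
  0 < r -> r < 1 -> (forall m, nm (h m) <= C * r ^+ m) ->
  (forall m, - (h m.+1 *+ m.+1 + h m *+ m) = if m == 0%N then be else 0) ->
  be = 0 /\ forall m, h m.+1 = 0.
Proof.
move=> r0 r1 hh he.
have hm m : h m.+1 *+ m.+1 = (-1) ^+ m.+1 * be.
  elim: m => [|m IH].
    by have := he 0%N; rewrite eqxx mulr0n addr0 expr1 mulN1r => <-; rewrite opprK.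
  have /eqP := he m.+1; rewrite IH oppr_eq0 addr_eq0 => /eqP ->.
  by rewrite [in RHS]exprS mulN1r mulNr.
have be0 : be = 0.
  apply: (@eq0_of_small _ K) => e e0.
  have C0 : 0 <= C by have := hh 0%N; rewrite expr0 mulr1; apply: le_trans; apply: pnorm_ge0.
  have [n hn] := geometric_lt C (ltW r0) r1 e0.
  have := hn n (leqnn n) => hn'.
  apply: le_trans (ltW hn').
  have -> : nm be = nm (h n.+1 *+ n.+1) by rewrite hm pnorm_sign.
  rewrite -mulr_natl pnormM.
  apply: le_trans (_ : 1 * nm (h n.+1) <= _).
    by apply: ler_wpM2r; [apply: pnorm_ge0 | apply: pnorm_nat_le1].
  rewrite mul1r; apply: le_trans (hh _) _; apply: ler_wpM2l => //.
  by rewrite exprS ler_piMl ?exprn_ge0 // ltW.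
split=> // m; have := hm m; rewrite be0 mulr0 => /eqP.
by rewrite -mulr_natl mulf_eq0 (negbTE (natr_neq0 hp K _)) //= => /eqP.
Qed.

Variable N : nat.
Implicit Types (T H : mxseries K N) (A B : 'M[K]_N).

Lemma overconvergent_smul T H : overconvergent T -> overconvergent H -> overconvergent (smul T H).
Proof.
move=> [C [r [r0 r1 hT]]] [C' [r' [r0' r1' hH]]].
have C0 : 0 <= `|C| by [].
exists (`|C| * `|C'|), (Num.max r r'); split.
- by rewrite lt_max r0.
- by rewrite gt_max r1.
have rm m : r ^+ m <= Num.max r r' ^+ m.
  by apply: lerXn2r; rewrite ?nnegrE ?le_max ?lexx // ltW.
have rm' m : r' ^+ m <= Num.max r r' ^+ m.
  by apply: lerXn2r; rewrite ?nnegrE ?le_max ?lexx ?orbT // ltW.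
have mr : 0 <= Num.max r r' by rewrite le_max ltW.
move=> m i j; rewrite /smul summxE; apply: pnorm_sum => [|l _].
  by rewrite !mulr_ge0 ?exprn_ge0.
rewrite mxE; apply: pnorm_sum => [|k _]; first by rewrite !mulr_ge0 ?exprn_ge0.
rewrite pnormM.
have -> : Num.max r r' ^+ m = Num.max r r' ^+ l * Num.max r r' ^+ (m - l).
  by rewrite -exprD subnKC // -ltnS.
rewrite mulrACA; apply: ler_pM; rewrite ?pnorm_ge0 //.
  apply: le_trans (hT _ _ _) _; apply: le_trans (_ : `|C| * r ^+ l <= _).
    by apply: ler_wpM2r; rewrite ?exprn_ge0 ?ler_norm // ltW.
  exact: ler_wpM2l.
apply: le_trans (hH _ _ _) _; apply: le_trans (_ : `|C'| * r' ^+ (m - l) <= _).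
  by apply: ler_wpM2r; rewrite ?exprn_ge0 ?ler_norm // ltW.
exact: ler_wpM2l.
Qed.

Lemma overconvergent_const A : overconvergent (sconst A).
Proof.
exists (\sum_i \sum_j nm (A i j)), 2^-1; split=> // m i j.
have s0 : 0 <= \sum_i \sum_j nm (A i j) by do 2 (apply: sumr_ge0 => ? _); apply: pnorm_ge0.
rewrite /sconst; case: m => [|m] /=; last by rewrite mxE pnorm0 mulr_ge0 ?exprn_ge0.
rewrite expr0 mulr1 (bigD1 i) //= (bigD1 j) //= -addrA lerDl addr_ge0 ?sumr_ge0 // => k _.
  exact: pnorm_ge0.
by apply: sumr_ge0 => ? _; apply: pnorm_ge0.
Qed.

Lemma overconvergent_conj A B T : overconvergent T -> overconvergent (fun m => A *m T m *m B).
Proof.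
move=> h; have := overconvergent_smul (overconvergent_smul (overconvergent_const A) h) (overconvergent_const B).
by congr overconvergent; apply/funext => m; rewrite smul_constr smul_constl.
Qed.

(** Induction on i + (N - j): products with strictly triangular matrices only involve entries
    already known to be constant, so each entry satisfies the scalar equation of
    [primitive_const]. *)
Lemma triangular_const (S0 S1 S0' S1' : 'M[K]_N) H :
  low 1 S0 -> low 1 S1 -> low 1 S0' -> low 1 S1' -> overconvergent H ->
  S0 *m H 0%N + S1 *m H 0%N - H 0%N *m S0' - H 0%N *m S1' = 0 ->
  (forall m, - (H m.+1 *+ m.+1 + H m *+ m) =
    S0 *m H m.+1 + S1 *m (H m.+1 + H m) - H m.+1 *m S0' - (H m.+1 + H m) *m S1') ->
  forall m, H m.+1 = 0.
Proof.
move=> l0 l1 l0' l1' [C [r [r0 r1 hC]]] e0 eS.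
suff h k : forall i j : 'I_N, (i + (N - j) < k)%N -> forall m, H m.+1 i j = 0.
  by move=> m; apply/matrixP => i j; rewrite mxE (h (i + (N - j)).+1).
elim: k => // k IH i j; rewrite ltnS leq_eqVlt => /orP[/eqP ek|]; last exact: IH.
have hl (S : 'M[K]_N) m : low 1 S -> (S *m H m.+1) i j = 0.
  move=> lS; rewrite mxE big1 // => l _.
  have [il|li] := leqP i l; first by rewrite lS ?mul0r // addn1 ltnS.
  by rewrite IH ?mulr0 // -ek ltn_add2r.
have hr (S : 'M[K]_N) m : low 1 S -> (H m.+1 *m S) i j = 0.
  move=> lS; rewrite mxE big1 // => l _.
  have [il|li] := leqP l j; first by rewrite lS ?mulr0 // addn1 ltnS.
  rewrite IH ?mul0r // -ek ltn_add2l; have := ltn_ord l; lia.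
have := @primitive_const (fun m => H m i j) 0 ((S1 *m H 0%N) i j - (H 0%N *m S1') i j) C r r0 r1 _ _.
case=> // m.
have /matrixP/(_ i j) := eS m.
rewrite mulmxDr mulmxDl.
have E (A B D E' F G X Y : 'M[K]_N) : (- (X + Y)) i j = (A + (B + D) - E' - (F + G)) i j ->
  A i j = 0 -> B i j = 0 -> E' i j = 0 -> F i j = 0 -> - (X i j + Y i j) = D i j - G i j.
  by rewrite !mxE => -> -> -> -> ->; ring.
move/E; rewrite !hl // !hr // => /(_ erefl erefl erefl erefl).
rewrite !mulmxnE => ->; case: m => [|m] //=.
by rewrite hl // hr // subr0.
Qed.
End Uniqueness.

(** * Overconvergent horizontal maps are constant *)

Section Rigidity.
Variables (p : nat) (hp : prime p) (K : padicField p) (N : nat).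
Local Notation nm := (@pnorm p K).
Implicit Types (T H : mxseries K N) (A B : 'M[K]_N) (q : {poly K}).
Local Notation MR := (GRing.PzRing.clone 'M[K]_N _).
Local Notation ps := (@PSer MR).
Local Notation cst := (@ps_const MR).

Definition ps_poly q : pser MR := ps (fun m => (q`_m)%:M).

Lemma ps_polyM q r : ps_poly (q * r) = ps_poly q * ps_poly r.
Proof.
apply/pserP => m; rewrite pcoefM /= coefM raddf_sum; apply: eq_bigr => i _ /=.
by rewrite scalar_mxM.
Qed.
Lemma ps_poly_central q f : ps_poly q * f = f * ps_poly q.
Proof. by apply: ps_central => m c; exact: esym (scalar_mxC _ _). Qed.
Lemma spolyE q T : ps (spoly q T) = ps_poly q * ps T.
Proof.
apply/pserP => m; rewrite pcoefM; apply: eq_bigr => i _ /=.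
exact: esym (mul_scalar_mx _ _).
Qed.
Lemma smulE T H : ps (smul T H) = ps T * ps H.
Proof. by []. Qed.
Lemma sconstE A : ps (sconst A) = cst A.
Proof. by []. Qed.
Lemma sEulerE T : ps (sEuler T) = euler (ps T).
Proof. by apply/pserP => m; rewrite /= /sEuler scaler_nat. Qed.

Lemma frob_horizontal_ps (R0 R1 S0 S1 : 'M[K]_N) T :
  let Q : {poly K} := (1 + 'X) ^+ p - 'X ^+ p in
  frob_horizontal R0 R1 S0 S1 T <->
  - (ps_poly (Q * (1 + 'X)) * euler (ps T)) =
  (ps_poly (p%:R *: Q) * cst R0 + ps_poly (p%:R *: (1 + 'X) ^+ p) * cst R1) * ps T
  - ps T * (ps_poly Q * (cst S0 + ps_poly (1 + 'X) * cst S1)).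
Proof.
move=> Q.
transitivity (- ps (spoly (Q * (1 + 'X)) (sEuler T)) =
   ps_poly (p%:R%:P) * (ps (spoly Q (smul (sconst R0) T)) + ps (spoly ((1 + 'X) ^+ p) (smul (sconst R1) T)))
   - (ps (spoly Q (smul T (sconst S0))) + ps (spoly (Q * (1 + 'X)) (smul T (sconst S1))))).
  have e m : (ps_poly (p%:R%:P) * (ps (spoly Q (smul (sconst R0) T)) + ps (spoly ((1 + 'X) ^+ p) (smul (sconst R1) T)))) m =
     p%:R *: (spoly Q (smul (sconst R0) T) m + spoly ((1 + 'X) ^+ p) (smul (sconst R1) T) m).
    rewrite pcoefM big_ord_recl big1 => [|i _]; last first.
      rewrite /= coefC /= (raddf0 (@scalar_mx K N)); exact: mul0mx.
    by rewrite addr0 subn0 pcoefD /= coefC /= -mul_scalar_mx.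
  split=> [h|/pserP h Q1 m].
    by apply/pserP => m; rewrite pcoefN [LHS]h -/Q pcoefD e.
  by have := h m; rewrite pcoefN pcoefD e.
rewrite !spolyE !smulE !sconstE sEulerE.
suff -> : ps_poly p%:R%:P * (ps_poly Q * (cst R0 * ps T) + ps_poly ((1 + 'X) ^+ p) * (cst R1 * ps T)) -
   (ps_poly Q * (ps T * cst S0) + ps_poly (Q * (1 + 'X)) * (ps T * cst S1)) =
   (ps_poly (p%:R *: Q) * cst R0 + ps_poly (p%:R *: (1 + 'X) ^+ p) * cst R1) * ps T
  - ps T * (ps_poly Q * (cst S0 + ps_poly (1 + 'X) * cst S1)) by [].
rewrite -!mul_polyC !ps_polyM.
move: (ps_poly Q) (ps_poly (1 + 'X)) (ps_poly p%:R%:P) (ps_poly ((1 + 'X) ^+ p))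
  (@ps_poly_central Q) (@ps_poly_central (1 + 'X)) => q x c y hq hx.
congr (_ - _); first by rewrite mulrDr mulrDl !mulrA.
rewrite !mulrDr; congr (_ + _); first by rewrite !mulrA hq.
by rewrite !mulrA -(mulrA q) hx mulrA hq.
Qed.

Lemma frobQ0 : ((1 + 'X) ^+ p - 'X ^+ p : {poly K})`_0 = 1.
Proof.
by rewrite -horner_coef0 !(hornerD, hornerN, horner_exp, hornerX, hornerC) addr0 expr1n expr0n eqn0Ngt prime_gt0 // subr0.
Qed.

Lemma conj_mx_mul m (P Q : 'M[K]_m) (A H : 'M[K]_m) : P \in unitmx ->
  P *m (A *m H) *m Q = (P *m A *m invmx P) *m (P *m H *m Q).
Proof. by move=> uP; rewrite !mulmxA mulmxKV. Qed.
Lemma conj_mx_mulr m (P Q : 'M[K]_m) (A H : 'M[K]_m) : Q \in unitmx ->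
  P *m (H *m A) *m invmx Q = (P *m H *m invmx Q) *m (Q *m A *m invmx Q).
Proof. by move=> uP; rewrite !mulmxA mulmxKV. Qed.

(** By [dlog_euler] the map T^-1 phi T2 satisfies an equation free of Frobenius. The factor Q is
    cancelled, having constant term 1; after conjugation to triangular form [triangular_const]
    applies. Taking phi = 1 compares two solutions, other phi encode symmetries of (R0, R1). *)
Theorem frob_iso_rigid (R0 R1 S0 S1 S0' S1' phi : 'M[K]_N) T T2 :
  frob_iso R0 R1 S0 S1 T -> frob_iso R0 R1 S0' S1' T2 ->
  unipotent S0 S1 -> unipotent S0' S1' ->
  phi *m R0 = R0 *m phi -> phi *m R1 = R1 *m phi ->
  exists H : 'M[K]_N, (forall m, phi *m T2 m = T m *m H) /\
     (S0 *m H = H *m S0' /\ S1 *m H = H *m S1').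
Proof.
move=> [oT [Ti [oTi iT' iT]] hT] [oT2 _ hT2] uS uS' c0 c1.
pose H := smul (smul Ti (sconst phi)) T2.
have oH : overconvergent H.
  by do !apply: overconvergent_smul => //; apply: overconvergent_const.
pose Q : {poly K} := (1 + 'X) ^+ p - 'X ^+ p.
have iT1 : ps Ti * ps T = 1 by apply/pserP => m; apply: iT.
have iT2 : ps T * ps Ti = 1 by apply/pserP => m; apply: iT'.
pose G := ps_poly (p%:R *: Q) * cst R0 + ps_poly (p%:R *: (1 + 'X) ^+ p) * cst R1.
have cG : G * cst phi = cst phi * G.
  rewrite /G mulrDl mulrDr -!mulrA (ps_const_comm (esym c0)) (ps_const_comm (esym c1)) !mulrA.
  by rewrite !ps_poly_central.
have := dlog_euler (R := MR) (@ps_poly_central (Q * (1 + 'X))) iT1 iT2 (euler_const phi) cG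
  ((frob_horizontal_ps _ _ _ _ _).1 hT) ((frob_horizontal_ps _ _ _ _ _).1 hT2).
have -> : ps Ti * cst phi * ps T2 = ps H by [].
move=> /= hH.
have hH' : - (ps_poly (1 + 'X) * euler (ps H)) =
   (cst S0 + ps_poly (1 + 'X) * cst S1) * ps H - ps H * (cst S0' + ps_poly (1 + 'X) * cst S1').
  apply/eqP; rewrite -subr_eq0; apply/eqP; apply: (@ps_cancel _ (ps_poly Q)).
    by rewrite /= frobQ0.
  move/eqP: hH; rewrite -subr_eq0 => /eqP; rewrite -/Q => <-.
  rewrite ps_polyM !mulrBr mulrN !mulrA; congr (_ - (_ - _)).
  by rewrite -(ps_poly_central Q (ps H)) -!mulrA.
have e1 f m : (ps_poly (1 + 'X) * f) m = f m + (if m is k.+1 then f k else 0).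
  rewrite pcoefM; case: m => [|m].
    by rewrite big_ord1 /= coefD coefX coef1 /= addr0 mul1r addr0.
  rewrite big_ord_recl big_ord_recl big1 => [|i _]; last first.
    by rewrite /= coefD coefX coef1 /= addr0 (raddf0 (@scalar_mx K N)); exact: mul0mx.
  by rewrite !lift0 subn0 subSS subn0 addr0 /= !coefD !coefX !coef1 /= addr0 add0r !mul1r.
pose Hp m := if m is k.+1 then H k else 0.
have eL m : ((cst S0 + ps_poly (1 + 'X) * cst S1) * ps H) m = S0 *m H m + S1 *m (H m + Hp m).
  rewrite mulrDl -mulrA pcoefD e1 pcoef_constl mulmxDr; congr (_ + (_ + _)).
    by rewrite pcoef_constl.
  by rewrite /Hp; case: m => [|m]; rewrite ?pcoef_constl ?mulmx0.
have eR m : (ps H * (cst S0' + ps_poly (1 + 'X) * cst S1')) m = H m *m S0' + (H m + Hp m) *m S1'.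
  rewrite mulrDr mulrA -ps_poly_central -mulrA pcoefD e1 pcoef_constr mulmxDl; congr (_ + (_ + _)).
    by rewrite pcoef_constr.
  by rewrite /Hp; case: m => [|m]; rewrite ?pcoef_constr ?mul0mx.
have hm m : - (H m *+ m + (if m is k.+1 then H k *+ k else 0)) =
   S0 *m H m + S1 *m (H m + Hp m) - H m *m S0' - (H m + Hp m) *m S1'.
  have /pserP/(_ m) := hH'; rewrite pcoefN e1 pcoefD pcoefN eL eR => e.
  have E (A B D : 'M[K]_N) : A - (B + D) = A - B - D by rewrite opprD addrA.
  by rewrite -E; apply: etrans e; case: (m).
have [P uP [t0 t1]] := uS; have [P' uP' [t0' t1']] := uS'.
have tl (A : 'M[K]_N) : strictly_triangular A -> low 1 A.
  by move=> h i j; rewrite addn1 ltnS; apply: h.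
pose Hc m := P *m H m *m invmx P'.
have cj (A B D E : 'M[K]_N) : P *m A *m invmx P' + P *m B *m invmx P' - P *m D *m invmx P' - P *m E *m invmx P'
   = P *m (A + B - D - E) *m invmx P'.
  by rewrite !(mulmxDl, mulmxDr, mulmxN, mulNmx).
have Hc0 m : Hc m.+1 = 0.
  apply: (triangular_const hp (tl _ t0) (tl _ t1) (tl _ t0') (tl _ t1')).
  - exact: overconvergent_conj.
  - rewrite /Hc -!conj_mx_mul // -!conj_mx_mulr //.
    rewrite cj.
    have := hm 0%N; rewrite /Hp mulr0n !addr0 oppr0 => e.
    apply: (etrans (y := P *m 0 *m invmx P')); last by rewrite mulmx0 mul0mx.
    congr (_ *m _ *m _); exact: esym e.
  - move=> k; rewrite /Hc -(mulmxDl _ _ (invmx P')) -mulmxDr.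
    rewrite -!conj_mx_mul // -!conj_mx_mulr //.
    have mn (A : 'M[K]_N) n : (P *m A *m invmx P') *+ n = P *m (A *+ n) *m invmx P'.
      by rewrite -!scaler_nat -scalemxAr -scalemxAl.
    rewrite cj !mn -mulmxDl -mulmxDr -mulNmx -mulmxN.
    congr (_ *m _ *m _); exact: hm k.+1.
have H0 m : H m.+1 = 0.
  have := Hc0 m; rewrite /Hc => /(congr1 (fun X => invmx P *m X *m P')).
  by rewrite !mulmxA mulVmx // mul1mx mulmxKV // mulmx0 mul0mx.
exists (H 0%N).
have eH : ps H = cst (H 0%N) by apply/pserP => -[|m] //=; rewrite H0.
split.
  move=> m; have <- : (ps T * cst (H 0%N)) m = T m *m H 0%N by rewrite pcoef_constr.
  have <- : (cst phi * ps T2) m = phi *m T2 m by rewrite pcoef_constl.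
  by rewrite -eH -[ps H]/(ps Ti * cst phi * ps T2) !mulrA iT2 mul1r.
have h0 := hm 0%N; have h1 := hm 1%N; rewrite /Hp in h0 h1.
move: h1; rewrite H0 mul0rn mulr0n !add0r oppr0 mulmx0 mul0mx subr0 add0r => /eqP.
rewrite eq_sym subr_eq0 => /eqP h1; split=> //.
move: h0; rewrite mulr0n !addr0 oppr0 h1 => /eqP; rewrite eq_sym.
by rewrite addrAC addrK subr_eq0 => /eqP.
Qed.
End Rigidity.

(** * The invariant chi *)

Lemma unimx_unit (F : fieldType) n (A : 'M[F]_n) : low 1 (A - 1%:M) -> A \in unitmx.
Proof. by move=> /neumannP/mulmx1_unit[]. Qed.

Lemma low_mulmx1 (R : comPzRingType) n (A B : 'M[R]_n) :
  low 1 (A - 1%:M) -> low 1 (B - 1%:M) -> low 1 (A *m B - 1%:M).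
Proof.
move=> hA hB; have -> : A *m B - 1%:M = (A - 1%:M) *m (B - 1%:M) + (A - 1%:M) + (B - 1%:M).
  rewrite mulmxBl mulmxBr mulmx1 mul1mx; move: (A *m B) => AB.
  by apply/matrixP => i j; rewrite !mxE; ring.
by apply: lowD => //; apply: lowD => //; apply: lowW (lowM hA hB).
Qed.

Lemma low_invmx1 (F : fieldType) n (A : 'M[F]_n) : low 1 (A - 1%:M) -> low 1 (invmx A - 1%:M).
Proof.
move=> hA; have -> : invmx A = neumann A.
  by rewrite -[neumann A]mul1mx -(mulVmx (unimx_unit hA)) -mulmxA neumannP ?mulmx1.
have l0 : low 0 (neumann A).
  have h : low 1 (1%:M - A) by rewrite -opprB; apply: lowN.
  move=> i j ij; rewrite summxE big1 // => k _.
  exact: (lowW (leq0n k) (low_exp h) ij).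
have -> : neumann A - 1%:M = - (neumann A *m (A - 1%:M)).
  by rewrite mulmxBr (mulmx1C (neumannP hA)) mulmx1 opprB.
by apply: lowN; apply: (lowM l0 hA).
Qed.

Section Chi.
Variables (p : nat) (hp : prime p) (K : padicField p) (N : nat).
Local Notation nm := (@pnorm p K).
Implicit Types (A B X Y Z U W phi : 'M[K]_N) (T : mxseries K N).

Lemma value_at_cusp_cvg T i j : overconvergent T ->
  knorm_cvg nm (fun M => (\sum_(k < M) (-1) ^+ k *: T k) i j) (value_at_cusp T i j).
Proof.
move=> [C [r [r0 r1 hT]]]; rewrite mxE; apply: plimP => e e0.
have [M hM] := geometric_lt C (ltW r0) r1 e0; exists M.
have C0 : 0 <= C by have := hT 0%N i j; rewrite expr0 mulr1; apply: le_trans; apply: pnorm_ge0.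
have main a b : (M <= a)%N -> (a <= b)%N ->
   nm ((\sum_(k < b) (-1) ^+ k *: T k) i j - (\sum_(k < a) (-1) ^+ k *: T k) i j) < e.
  move=> Ma ab; apply: le_lt_trans (hM a Ma).
  rewrite !summxE -!(big_mkord xpredT (fun k => ((-1) ^+ k *: T k) i j)) (big_cat_nat (n := a)) //=.
  rewrite addrAC subrr add0r big_nat_cond; apply: pnorm_sum => [|k /andP[/andP[ak _] _]].
    by rewrite mulr_ge0 ?exprn_ge0 // ltW.
  rewrite mxE pnorm_sign; apply: le_trans (hT k i j) _; apply: ler_wpM2l => //.
  rewrite -(subnKC ak) exprD ler_piMr ?exprn_ge0 ?exprn_ile1 // ltW //.
move=> a b Ma Mb; have [ab|/ltnW ba] := leqP a b; last exact: main.
by rewrite -opprB pnormN; apply: main.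
Qed.

Lemma value_at_cuspM (A B A' B' : 'M[K]_N) T T' : overconvergent T -> overconvergent T' ->
  (forall m, A *m T m *m B = A' *m T' m *m B') ->
  A *m value_at_cusp T *m B = A' *m value_at_cusp T' *m B'.
Proof.
move=> oT oT' h; apply/matrixP => i j.
have cv (A0 B0 : 'M[K]_N) T0 : overconvergent T0 ->
   knorm_cvg nm (fun M => (\sum_(k < M) (-1) ^+ k *: (A0 *m T0 k *m B0)) i j) ((A0 *m value_at_cusp T0 *m B0) i j).
  move=> o0.
  have : knorm_cvg nm (fun M => \sum_l B0 l j * \sum_k A0 i k * (\sum_(m < M) (-1) ^+ m *: T0 m) k l)
    (\sum_l B0 l j * \sum_k A0 i k * value_at_cusp T0 k l).
    by apply: cvg_sum => l _; apply: cvgZ; apply: cvg_sum => k _; apply: cvgZ; apply: value_at_cusp_cvg.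
  have -> : \sum_l B0 l j * \sum_k A0 i k * value_at_cusp T0 k l = (A0 *m value_at_cusp T0 *m B0) i j.
    by rewrite mxE; apply: eq_bigr => l _; rewrite mulrC; congr (_ * _); rewrite mxE.
  congr knorm_cvg; apply/funext => M.
  have -> : \sum_(k < M) (-1) ^+ k *: (A0 *m T0 k *m B0) = A0 *m (\sum_(k < M) (-1) ^+ k *: T0 k) *m B0.
    by rewrite mulmx_sumr mulmx_suml; apply: eq_bigr => k _; rewrite -scalemxAr -scalemxAl.
  by rewrite mxE; apply: eq_bigr => l _; rewrite mulrC; congr (_ * _); rewrite mxE.
apply: cvg_uniq (cv A B T oT) _; have := cv A' B' T' oT'; congr knorm_cvg.
by apply/funext => M; congr (fun_of_matrix _ i j); apply: eq_bigr => k _; rewrite h.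
Qed.

Definition frob_at (R0 R1 S0 S1 U W : 'M[K]_N) := exists T,
  [/\ unipotent S0 S1, frob_iso R0 R1 S0 S1 T, T 0%N = U & value_at_cusp T = W].

Lemma low_unipotent A B : low 1 A -> low 1 B -> unipotent A B.
Proof.
move=> lA lB; exists 1%:M; first exact: unitmx1.
by rewrite invmx1 !mul1mx !mulmx1; split=> i j ij; [apply: lA | apply: lB]; rewrite addn1.
Qed.

Lemma edge_frob_at R0 R1 U W : edge R0 R1 U W -> exists S0 S1, frob_at R0 R1 S0 S1 U W.
Proof.
move=> [S0 [S1 [P [l0 l1 hP hU hW]]]]; exists S0, S1, (ser P); split.
- exact: low_unipotent.
- exact: (sol1_frob_iso hP (NullP_frobV hp K)).
- by rewrite (sol1_zero).
- by rewrite (sol1_value hP).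
Qed.

Lemma frob_at_rigid R0 R1 S0 S1 S0' S1' U W U' W' phi :
  frob_at R0 R1 S0 S1 U W -> frob_at R0 R1 S0' S1' U' W' ->
  phi *m R0 = R0 *m phi -> phi *m R1 = R1 *m phi ->
  exists H : 'M[K]_N, [/\ phi *m U' = U *m H, phi *m W' = W *m H, S0 *m H = H *m S0' & S1 *m H = H *m S1'].
Proof.
move=> [T [uS iT <- <-]] [T' [uS' iT' <- <-]] c0 c1.
have [H [hH [hS0 hS1]]] := frob_iso_rigid hp iT iT' uS uS' c0 c1; exists H; split=> //.
case: iT iT' => oT _ _ [oT' _ _].
have := @value_at_cuspM phi 1%:M 1%:M H T' T oT' oT; rewrite mulmx1 mul1mx; apply.
by move=> m; rewrite mulmx1 mul1mx.
Qed.

(** The constant term of the horizontality equation, that is, its residue at infinity: Frobenius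
    multiplies residues by p. *)
Lemma frob_at_residue R0 R1 S0 S1 U W : frob_at R0 R1 S0 S1 U W ->
  p%:R *: ((R0 + R1) *m U) = U *m (S0 + S1).
Proof.
move=> [T [_ [_ _ h] <- _]]; have := h 0%N; rewrite /spoly !big_ord1 !smul_constl !smul_constr !subn0.
have Q0 := frobQ0 hp K; rewrite coefM !big_ord1 /= !Q0 coefD coefX addr0.
have -> : ((1 + 'X : {poly K}) ^+ p)`_0 = 1.
  by rewrite -horner_coef0 horner_exp !(hornerD, hornerX, hornerC) addr0 expr1n.
rewrite coef1 /= mulr1 !scale1r /sEuler scale0r oppr0 mulmxDl mulmxDr => /eqP.
by rewrite eq_sym subr_eq0 => /eqP.
Qed.

Lemma edge_flip R0 R1 U W : edge R0 R1 U W -> edge (- R0 - R1) R1 W U.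
Proof.
move=> [S0 [S1 [P [l0 l1 hP hU hW]]]].
exists (- S0 - S1), S1, (fun n => map_mx (comp_poly (flip K)) (P n)); split=> //.
- by apply: lowB => //; apply: lowN.
- exact: sol1_flip.
- by rewrite (limval_flip P).1.
- by rewrite (limval_flip P).2.
Qed.

Definition is_chi R0 R1 X := exists U W,
  [/\ edge R0 R1 U W, low 1 (U - 1%:M), low 1 (W - 1%:M) & X *m W = U].

(** A connection in x alone is an integrable connection on the chart, with zero residues along the
    other divisors; the edge y = 0 of a solution is what is sought. *)
Lemma exists_chi R0 R1 : low 1 R0 -> low 1 R1 -> exists X, is_chi R0 R1 X.
Proof.
move=> l0 l1; have lz := @low_0 K N 1.
have fl : flat R0 0 R1 0 0.
  by split; split; rewrite /br !(mulmx0, mul0mx, subrr, addr0).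
have [V [uV [[h _ _] _]]] := chart_edges hp l0 lz l1 lz lz fl.
exists (V false true true *m invmx (V true true true)), (V false true true), (V true true true).
by split=> //; rewrite mulmxKV // unimx_unit.
Qed.

Definition chi R0 R1 : 'M[K]_N := classical_sets.xget 1%:M (is_chi R0 R1).

Section Props.
Variables R0 R1 : 'M[K]_N.
Hypotheses (l0 : low 1 R0) (l1 : low 1 R1).

Lemma chiP : is_chi R0 R1 (chi R0 R1).
Proof. by apply: classical_sets.xgetPex; apply: exists_chi. Qed.

Lemma chi_low : low 1 (chi R0 R1 - 1%:M).
Proof.
have [U [W [_ lU lW e]]] := chiP.
have -> : chi R0 R1 = U *m invmx W by rewrite -e mulmxK // unimx_unit.
by apply: low_mulmx1 => //; apply: low_invmx1.
Qed.

(** Rigidity with phi = 1: another solution differs by a constant factor on the right, which cancels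
    in U W^-1. So [chi] does not depend on the choice made by [xget]. *)
Lemma chi_frob_at S0 S1 U W : frob_at R0 R1 S0 S1 U W -> W \in unitmx /\ U = chi R0 R1 *m W.
Proof.
move=> h; have [U' [W' [e lU lW eX]]] := chiP; have [S0' [S1' h']] := edge_frob_at e.
have [H [e1 e2 _ _]] := frob_at_rigid h h' (esym (scalar_mxC 1 R0)) (esym (scalar_mxC 1 R1)).
rewrite !mul1mx in e1 e2.
have uW : W \in unitmx.
  have : W *m (H *m invmx W') = 1%:M by rewrite mulmxA -e2 mulmxV // unimx_unit.
  by case/mulmx1_unit.
have uH : H \in unitmx.
  by have := unimx_unit lW; rewrite e2 unitmx_mul uW.
split=> //; apply: (can_inj (mulmxK uH)).
by rewrite -e1 -mulmxA -e2.
Qed.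

Lemma chi_edge U W : edge R0 R1 U W -> U = chi R0 R1 *m W.
Proof. by move=> /edge_frob_at [S0 [S1 /chi_frob_at[]]]. Qed.

End Props.

Lemma chi_flip R0 R1 : low 1 R0 -> low 1 R1 -> chi (- R0 - R1) R1 *m chi R0 R1 = 1%:M.
Proof.
move=> l0 l1; have [U [W [e lU lW eX]]] := chiP l0 l1.
have := edge_flip e => /(chi_edge (lowB (lowN l0) l1) l1) e'.
apply: (can_inj (mulmxK (unimx_unit lW))).
by rewrite -mulmxA eX mul1mx.
Qed.

Lemma p_inj A B : p%:R *: A = p%:R *: B -> A = B.
Proof. by apply: scalerI; apply: natr_neq0 => //; apply: prime_gt0. Qed.

(** The relation at 0 is the relation at infinity for the flipped solution. *)
Lemma edge_residues R0 R1 U W : edge R0 R1 U W -> exists S0 S1,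
  [/\ frob_at R0 R1 S0 S1 U W, p%:R *: ((R0 + R1) *m U) = U *m (S0 + S1) & p%:R *: (R0 *m W) = W *m S0].
Proof.
move=> e; have [S0 [S1 [P [l0 l1 hP hU hW]]]] := e.
have h : frob_at R0 R1 S0 S1 U W.
  exists (ser P); split; [exact: low_unipotent | | by rewrite (sol1_zero) | by rewrite (sol1_value hP)].
  exact: (sol1_frob_iso hP (NullP_frobV hp K)).
have h' : frob_at (- R0 - R1) R1 (- S0 - S1) S1 W U.
  have hP' := sol1_flip hp hP.
  exists (ser (fun n => map_mx (comp_poly (flip K)) (P n))); split.
  - by apply: low_unipotent => //; apply: lowB => //; apply: lowN.
  - exact: (sol1_frob_iso hP' (NullP_frobV hp K)).
  - by rewrite (sol1_zero) (limval_flip P).1.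
  - by rewrite (sol1_value hP') (limval_flip P).2.
exists S0, S1; split=> //; first exact: frob_at_residue h.
have := frob_at_residue h'; rewrite !subrK mulNmx mulmxN scalerN => /eqP.
by rewrite eqr_opp => /eqP.
Qed.
End Chi.

(** * Taylor transport at infinity *)

Lemma logn2_fact n : (logn 2 n`! <= n)%N.
Proof.
have h m : (\sum_(1 <= k < m.+1) n %/ 2 ^ k + n %/ 2 ^ m <= n)%N.
  elim: m => [|m IH]; first by rewrite big_nil expn0 divn1.
  rewrite big_nat_recr //=; apply: leq_trans IH; rewrite -addnA leq_add2l.
  by rewrite expnSr divnMA addnn -muln2 leq_divM.
by rewrite logn_fact // (leq_trans (leq_addr _ _) (h n)).
Qed.

Section FallingFactorial.
Variables (p : nat) (hp : prime p) (K : padicField p).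
Local Notation nm := (@pnorm p K).

Lemma natr_inj : injective (fun n => n%:R : K).
Proof.
have main m n : (m <= n)%N -> m%:R = n%:R :> K -> m = n.
  move=> mn /eqP; rewrite eq_sym -subr_eq0 -natrB // => /eqP h.
  apply/eqP; rewrite eqn_leq mn -subn_eq0 /=; apply: contraT; rewrite -lt0n => /(natr_neq0 hp K).
  by rewrite h eqxx.
by move=> m n; case: (leqP m n) => [|/ltnW] h e; [apply: main | apply: esym; apply: main].
Qed.

Lemma poly_eq_nat (f g : {poly K}) : (forall n : nat, f.[n%:R] = g.[n%:R]) -> f = g.
Proof.
move=> h; apply/eqP; rewrite -subr_eq0; apply/eqP.
apply: (@roots_geq_poly_eq0 _ _ [seq n%:R | n <- iota 0 (size (f - g))]).
- by apply/allP => x /mapP [n _ ->]; rewrite /root hornerD hornerN h subrr.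
- by rewrite map_inj_uniq ?iota_uniq //; apply: natr_inj.
- by rewrite size_map size_iota.
Qed.

Definition ffp k : {poly K} := \prod_(i < k) ('X - i%:R%:P).
Lemma ffpS k : ffp k.+1 = ffp k * ('X - k%:R%:P).
Proof. by rewrite /ffp big_ord_recr. Qed.
Lemma ffp_nat k m : (ffp k).[m%:R] = (m ^_ k)%:R.
Proof.
elim: k => [|k IH]; first by rewrite /ffp big_ord0 hornerC ffactn0.
rewrite ffpS hornerM IH !hornerE ffactnSr natrM.
have [km|mk] := leqP k m; first by rewrite natrB.
by rewrite ffact_small // !mul0r.
Qed.
Lemma ffp_bd k : bdp 1 1 (ffp k).
Proof.
elim: k => [|k IH]; first by rewrite /ffp big_ord0; apply: bdp1.
rewrite ffpS; suff h : bdp 1 1 ('X - k%:R%:P : {poly K}) by have := bdpM ltr01 IH h; rewrite mulr1.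
apply: bdpD => //.
  by move=> m; rewrite expr1n mulr1 coefX; case: eqP; rewrite ?pnorm1 ?pnorm0.
move=> m; rewrite expr1n mulr1 coefN coefC pnormN; case: eqP; rewrite ?pnorm0 // => _.
exact: pnorm_nat_le1.
Qed.

(** The truncated binomial series of (1 + y)^X. *)
Definition binser (y : K) M : {poly K} := \sum_(k < M) (y ^+ k / k`!%:R) *: ffp k.

Lemma fact_neq0 k : k`!%:R != 0 :> K.
Proof. by apply: natr_neq0 => //; apply: fact_gt0. Qed.

Lemma binser_nat y M m : (binser y M).[m%:R] = \sum_(k < M) y ^+ k * 'C(m, k)%:R.
Proof.
rewrite /binser horner_sum; apply: eq_bigr => k _; rewrite hornerZ ffp_nat -bin_ffact natrM.
by rewrite -mulrA [_ * k`!%:R]mulrC mulKf ?fact_neq0.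
Qed.

Lemma coef_1DcXn (c : K) m k : ((1 + c *: 'X) ^+ m)`_k = c ^+ k * 'C(m, k)%:R.
Proof.
rewrite exprDn coef_sum.
have E (i : 'I_m.+1) : (1 ^+ (m - i) * (c *: 'X) ^+ i *+ 'C(m, i))`_k = if i == k :> nat then c ^+ k * 'C(m, k)%:R else 0.
  rewrite expr1n mul1r coefMn exprZn coefZ coefXn (eq_sym k).
  by case: eqP => [->|_]; rewrite ?mulr1 ?mulr0 ?mul0rn ?mulr_natr.
rewrite (eq_bigr _ (fun i _ => E i)) -big_mkcond /=.
have [km|mk] := leqP k m; last first.
  by rewrite bin_small // mulr0 big1.
by rewrite (big_pred1 (Ordinal (km : (k < m.+1)%N))).
Qed.

Definition xx1 j : {poly K} := ('X * (1 + 'X)) ^+ j.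
Definition xx1_alt M j : K := \sum_(k < M) (-1) ^+ k * (xx1 j)`_k.

Lemma xx1_small j k : (k < j)%N -> (xx1 j)`_k = 0.
Proof. by move=> kj; rewrite /xx1 exprMn coefXnM kj. Qed.
Lemma xx1_size j : (size (xx1 j) <= j.*2.+1)%N.
Proof.
apply: leq_trans (size_poly_exp_leq _ _) _; rewrite ltnS.
have : (size ('X * (1 + 'X) : {poly K})%R <= 3)%N.
  apply: leq_trans (size_polyMleq _ _) _; rewrite size_polyX /=.
  by rewrite [1 + 'X]addrC -polyC1 size_XaddC.
by rewrite -mul2n; case: (size _) => [|n] h; rewrite leq_mul2r /= ?orbT // -ltnS h orbT.
Qed.
Lemma xx1_bd j : bdp 1 1 (xx1 j).
Proof.
have hX : bdp 1 1 ('X : {poly K}).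
  by move=> m; rewrite expr1n mulr1 coefX; case: eqP; rewrite ?pnorm1 ?pnorm0.
have hX1 : bdp 1 1 (1 + 'X : {poly K}) by apply: bdpD => //; apply: bdp1.
by have := bdpX j ltr01 (bdpM ltr01 hX hX1); rewrite mulr1 expr1n.
Qed.
Lemma xx1_alt_le1 M j : nm (xx1_alt M j) <= 1.
Proof.
apply: pnorm_sum => // k _; rewrite pnorm_sign.
by have := xx1_bd j k; rewrite expr1n mulr1.
Qed.
Lemma xx1_alt_full M j : (j.*2 < M)%N -> xx1_alt M j = (j == 0%N)%:R.
Proof.
move=> h; transitivity ((xx1 j).[-1]).
  by rewrite (horner_coef_wide _ (leq_trans (xx1_size j) h)); apply: eq_bigr => k _; rewrite mulrC.
by rewrite /xx1 horner_exp !hornerE subrr mulr0 expr0n.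
Qed.
Lemma xx1_alt_small M j : (M <= j)%N -> xx1_alt M j = 0.
Proof.
by move=> h; rewrite /xx1_alt big1 // => k _; rewrite xx1_small ?mulr0 // (leq_trans (ltn_ord k)).
Qed.

(** From (1 + 2 x)^2 = 1 + 4 x (1 + x): truncating (1 + 2 x)^(2 n) in powers of x, at x = -1, leaves
    the alternating sums [xx1_alt]. The point is that 4^j / j! tends to 0 for p = 2, which (-2)^k /
    k! does not. *)
Lemma binser_m2 M : binser (-2) M \Po (2 *: 'X) = \sum_(j < M) (4 ^+ j / j`!%:R * xx1_alt M j) *: ffp j.
Proof.
apply: poly_eq_nat => n; rewrite horner_comp hornerZ hornerX -natrM binser_nat.
rewrite horner_sum.
have -> : \sum_(k < M) (-2) ^+ k * 'C(2 * n, k)%:R =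
   \sum_(k < M) (-1) ^+ k * ((1 + 2 *: 'X : {poly K}) ^+ (2 * n))`_k.
  by apply: eq_bigr => k _; rewrite coef_1DcXn mulrA -exprMn mulN1r.
have -> : (1 + 2 *: 'X : {poly K}) ^+ (2 * n) = \sum_(j < n.+1) (4 ^+ j * 'C(n, j)%:R) *: xx1 j.
  rewrite exprM.
  have -> : (1 + 2 *: 'X : {poly K}) ^+ 2 = 1 + 4 *: ('X * (1 + 'X)).
    by rewrite -!mul_polyC !polyC_natr; ring.
  rewrite exprDn; apply: eq_bigr => j _.
  by rewrite expr1n mul1r exprZn -scaler_nat scalerA mulrC.
have E j : (4 ^+ j * 'C(n, j)%:R) * xx1_alt M j = ((4 ^+ j / j`!%:R * xx1_alt M j) *: ffp j).[n%:R].
  rewrite hornerZ ffp_nat -bin_ffact natrM.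
  have E' (x y z t : K) : x != 0 -> t * z * y = t / x * y * (z * x).
    by move=> x0; field.
  exact: E' (fact_neq0 j).
transitivity (\sum_(j < n.+1) (4 ^+ j * 'C(n, j)%:R) * xx1_alt M j).
  rewrite /xx1_alt; under [RHS]eq_bigr => j _ do rewrite mulr_sumr.
  rewrite exchange_big; apply: eq_bigr => k _ /=.
  rewrite coef_sum mulr_sumr; apply: eq_bigr => j _; rewrite coefZ; ring.
(* The ranges j <= n and j < M both contain all nonzero terms: the binomial coefficient vanishes for
   j > n and [xx1_alt] for j >= M. *)
pose S m := \sum_(j < m) (4 ^+ j * 'C(n, j)%:R) * xx1_alt M j.
have w m : (forall j, (m <= j)%N -> (4 ^+ j * 'C(n, j)%:R) * xx1_alt M j = 0) -> S m = S (maxn n.+1 M) \/ (maxn n.+1 M < m)%N.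
  move=> h; have [lt|le] := ltnP (maxn n.+1 M) m; [by right | left].
  rewrite /S (big_ord_widen _ (fun j => (4 ^+ j * 'C(n, j)%:R) * xx1_alt M j) le) big_mkcond.
  by apply: eq_bigr => j _; case: ltnP => // /h.
have [e1|] := w n.+1 (fun j hj => etrans (congr1 (fun t => 4 ^+ j * t%:R * xx1_alt M j) (bin_small hj)) (etrans (congr1 (fun t => t * xx1_alt M j) (mulr0 _)) (mul0r _))); last first.
  by rewrite gtn_max ltnn.
have [e2|] := w M (fun j hj => etrans (congr1 (fun t => 4 ^+ j * _ * t) (xx1_alt_small hj)) (mulr0 _)); last first.
  by rewrite gtn_max ltnn andbF.
by rewrite -/(S n.+1) e1 -e2; apply: eq_bigr => j _; rewrite E.
Qed.
End FallingFactorial.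

Lemma sum_delta_exp (R : comPzRingType) n (A : 'M[R]_n) : \sum_(l < n) (l == 0%N :> nat)%:R *: A ^+ l = 1%:M.
Proof.
case: n A => [|n] A; first by apply/matrixP => -[].
by rewrite big_ord_recl expr0 scale1r big1 ?addr0 // => i _; rewrite scale0r.
Qed.

Section Transport.
Variables (p : nat) (hp : prime p) (K : padicField p).
Local Notation nm := (@pnorm p K).

Lemma coef_comp_scale (f : {poly K}) c l : (f \Po (c *: 'X))`_l = c ^+ l * f`_l.
Proof.
have -> : f \Po (c *: 'X) = \poly_(i < size f) (c ^+ i * f`_i).
  by rewrite comp_polyE poly_def; apply: eq_bigr => i _; rewrite exprZn scalerA mulrC.
by rewrite coef_poly; case: ltnP => // h; rewrite nth_default // mulr0.
Qed.

Lemma coef_ffp0 l : (ffp K 0)`_l = (l == 0%N)%:R.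
Proof. by rewrite /ffp big_ord0 coef1. Qed.

(** The value of h = F1/F0 at infinity is 1 for odd p and -1 for p = 2. In the second case the
    binomial series of (-1)^X is still 1, in accordance with the vanishing of the p-adic logarithm
    of -1. *)
Lemma binser_oo (l : nat) : let y := (('X ^+ p - ('X - 1) ^+ p : {poly K}) - 1)`_0 in
  knorm_cvg nm (fun M => (binser y M)`_l) (l == 0%N)%:R.
Proof.
have y0 : (('X ^+ p - ('X - 1) ^+ p : {poly K}) - 1)`_0 = - (-1) ^+ p - 1.
  rewrite -horner_coef0 !(hornerD, hornerN, horner_exp, hornerX, hornerC).
  by rewrite expr0n eqn0Ngt prime_gt0 // !add0r.
rewrite y0 /=; case/boolP: (odd p) => hodd.
  rewrite -signr_odd hodd expr1 opprK subrr => e e0; exists 1%N => -[//|M] _.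
  rewrite /binser big_ord_recl expr0 fact0 divr1 scale1r big1 => [|k _].
    by rewrite addr0 coef_ffp0 subrr pnorm0.
  by rewrite exprS mul0r mul0r scale0r.
have p2 : p = 2%N by case: (even_prime hp) => //; rewrite (negbTE hodd).
have e2 : p%:R = 2 :> K := congr1 (fun n : nat => n%:R) p2.
have e2' : p%:R = 2 :> rat := congr1 (fun n : nat => n%:R) p2.
have eln n : logn p n = logn 2 n by rewrite p2.
have -> : - (-1) ^+ p - 1 = -2 :> K by rewrite -signr_odd (negbTE hodd) expr0; ring.
have nm2 : nm 2 = 2^-1 by have := pnorm_p hp K; rewrite e2 e2'.
have n4 j : nm (4 ^+ j / j`!%:R) <= 2^-1 ^+ j.
  have -> : (4 : K) = 2 * 2 by ring.
  rewrite pnormM pnormX pnormM nm2 exprMn -mulrA ler_piMr ?exprn_ge0 //.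
  rewrite pnormV pnorm_nat ?fact_gt0 // e2' eln invrK exprVn mulrC ler_pdivrMr ?exprn_gt0 // mul1r.
  by rewrite ler_weXn2l // logn2_fact.
move=> e e0; have r0 : (0 : rat) <= 2^-1 by [].
have r1 : (2^-1 : rat) < 1 by [].
(* The factor 2^l undoes the substitution of 2 X for X. For M > 2 J the terms with 0 < 2 j < M
   vanish, and the later ones have j >= J. *)
have [J hJ] := geometric_lt (2 ^+ l) r0 r1 e0.
exists (J.*2.+1) => M hM.
have main : nm (2 ^+ l * (binser (-2) M)`_l - (l == 0%N)%:R) <= 2^-1 ^+ J.
  rewrite -coef_comp_scale (binser_m2 hp) coef_sum.
  case: M hM => // M hM.
  rewrite big_ord_recl expr0 fact0 divr1 mul1r (xx1_alt_full K) // scale1r coef_ffp0.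
  rewrite addrAC subrr add0r; apply: pnorm_sum => [|j _]; first by rewrite exprn_ge0.
  set i := lift ord0 j; have [h|h] := ltnP i.*2 M.+1.
    by rewrite (xx1_alt_full K) // mulr0 scale0r coef0 pnorm0 exprn_ge0.
  rewrite coefZ pnormM pnormM.
  apply: le_trans (_ : 2^-1 ^+ i * 1 * 1 <= _).
    have := ffp_bd hp K i l; rewrite expr1n mulr1 => hf.
    have ha := xx1_alt_le1 K M.+1 i.
    apply: ler_pM => //; [exact: mulr_ge0 (pnorm_ge0 _) (pnorm_ge0 _) | exact: pnorm_ge0 |].
    by apply: ler_pM => //; apply: pnorm_ge0.
  rewrite !mulr1 ler_wiXn2l //; lia.
have [l0|l0] := eqVneq l 0%N.
  move: main; rewrite l0 eqxx expr0 mul1r => h; apply: le_lt_trans h _.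
  by have := hJ J (leqnn _); rewrite l0 expr0 mul1r.
move: main; rewrite (negbTE l0) !subr0 pnormM pnormX nm2 => h.
apply: le_lt_trans (hJ J (leqnn _)).
by rewrite mulrC -ler_pdivrMr ?exprn_gt0 // mulrC -exprVn.
Qed.

Variables (N : nat) (N0 N1 : 'M[K]_N).
Hypotheses (l0 : low 1 N0) (l1 : low 1 N1).

Let ph (q : {poly K}) : 'M[K]_N := \sum_(l < N) q`_l *: (N0 + N1) ^+ l.

Lemma phMX q : ph (q * 'X) = ph q *m (N0 + N1).
Proof.
have e : ph q *m (N0 + N1) = \sum_(l < N) q`_l *: (N0 + N1) ^+ l.+1.
  by rewrite /ph mulmx_suml; apply: eq_bigr => l _; rewrite exprSr -scalemxAl.
have z : (N0 + N1) ^+ N = 0 by apply: low_full; apply: low_exp; apply: lowD.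
rewrite e /ph.
have -> : \sum_(l < N) (q * 'X)`_l *: (N0 + N1) ^+ l = \sum_(0 <= l < N) (q * 'X)`_l *: (N0 + N1) ^+ l by rewrite big_mkord.
have -> : \sum_(l < N) q`_l *: (N0 + N1) ^+ l.+1 = \sum_(0 <= l < N) q`_l *: (N0 + N1) ^+ l.+1 by rewrite big_mkord.
have -> : \sum_(0 <= l < N) q`_l *: (N0 + N1) ^+ l.+1 = \sum_(0 <= l < N.+1) (q * 'X)`_l *: (N0 + N1) ^+ l.
  rewrite big_nat_recl // coefMX eqxx scale0r add0r.
  by apply: eq_bigr => l _; rewrite coefMX.
by rewrite big_nat_recr //= z scaler0 addr0.
Qed.

Lemma ph_linear : linear ph.
Proof.
move=> c f g; rewrite /ph scaler_sumr -big_split /=; apply: eq_bigr => l _.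
by rewrite coefD coefZ scalerDl scalerA.
Qed.

(** z^k (d/dz)^k is the falling factorial of z d/dz, and at infinity z d/dz acts by N0 + N1. *)
Lemma taylor_coef_oo k : taylor_coef N0 N1 k 0%N = ph (ffp K k).
Proof.
elim: k => [|k IH].
  rewrite /= /sconst /= /ph -[LHS](sum_delta_exp (N0 + N1)).
  by apply: eq_bigr => l _; rewrite coef_ffp0.
rewrite ffpS mulrBr mulrC -[_ * _ - _]/(_ + _).
have -> : 'X * ffp K k - ffp K k * k%:R%:P = (- k%:R) *: ffp K k + ffp K k * 'X.
  by rewrite -mul_polyC polyCN; ring.
rewrite ph_linear phMX -IH /= /sEuler scale0r oppr0 add0r /smul big_ord1 subnn /conn_at_oo eqxx.
by rewrite scaleNr.
Qed.

(** At s = 0 the Taylor series is the binomial series of h(0) to the power N0 + N1, of which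
    [binser_oo] computes the coefficients. *)
Theorem taylor_transport_oo : taylor_transport N0 N1 0%N = 1%:M.
Proof.
apply/matrixP => i j; rewrite [LHS]mxE; apply: plim_eq.
set h : {poly K} := 'X ^+ p - ('X - 1) ^+ p.
have e M : (\sum_(k < M) (k`!)%:R^-1 *: spoly ((h - 1) ^+ k) (frob_subst (taylor_coef N0 N1 k)) 0%N) i j =
   \sum_(l < N) ((N0 + N1) ^+ l) i j * (binser (h - 1)`_0 M)`_l.
  transitivity (ph (binser (h - 1)`_0 M) i j); last first.
    by rewrite /ph summxE; apply: eq_bigr => l _; rewrite mxE mulrC.
  congr (fun_of_matrix _ i j).
  have ph0 : ph 0 = 0 by rewrite /ph big1 // => l _; rewrite coef0 scale0r.
  have phD : {morph ph : f g / f + g >-> f + g}.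
    by move=> f g; have := ph_linear 1 f g; rewrite !scale1r.
  rewrite /binser (big_morph ph phD ph0); apply: eq_bigr => k _.
  have := ph_linear ((h - 1)`_0 ^+ k / k`!%:R) (ffp K k) 0; rewrite !addr0 ph0 addr0 => ->.
  rewrite /spoly big_ord1 /frob_subst dvdn0 div0n taylor_coef_oo scalerA mulrC.
  by rewrite -!horner_coef0 horner_exp.
have -> : (fun M => (\sum_(k < M) (k`!)%:R^-1 *: spoly ((h - 1) ^+ k) (frob_subst (taylor_coef N0 N1 k)) 0%N) i j) =
   fun M => \sum_(l < N) ((N0 + N1) ^+ l) i j * (binser (h - 1)`_0 M)`_l by apply/funext.
have -> : 1%:M i j = \sum_(l < N) ((N0 + N1) ^+ l) i j * (l == 0%N :> nat)%:R.
  by rewrite -[in LHS](sum_delta_exp (N0 + N1)) summxE; apply: eq_bigr => l _; rewrite mxE mulrC.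
by apply: cvg_sum => l _; apply: cvgZ; apply: binser_oo.
Qed.
End Transport.

(** * Central shifts *)

Lemma zmod_cancel (V : zmodType) (X Y Z W E : V) : X + Y - (Z + W) = X + E + Y - (Z + E + W).
Proof.
rewrite [X + E + Y]addrAC [Z + E + W]addrAC; move: (X + Y) (Z + W) => a b.
by rewrite opprD addrACA subrr addr0.
Qed.

Lemma central_swap (R : pzRingType) (x q t h : R) : (forall f, x * f = f * x) -> (forall f, q * f = f * q) ->
  x * (q * (t * h)) = t * (q * (x * h)).
Proof. by move=> cx cq; rewrite (mulrA t q) -(cq t) -(mulrA q t) (mulrA t x) -(cx t) -(mulrA x t) (mulrA q x) -(cx q) -mulrA. Qed.

(** Leibniz rule: t solves the equation whose only residue is z and commutes with r0 and r1, so
    multiplying T by t adds z to r1. *)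
Lemma product_horizontal (R : pzRingType) (x q y u r0 r1 z T H t S0 S1 eT et : R) :
  (forall f, x * f = f * x) -> (forall f, q * f = f * q) -> (forall f, y * f = f * y) ->
  (forall f, u * f = f * u) -> r0 * t = t * r0 -> r1 * t = t * r1 -> z * T = T * H ->
  - (q * u * et) = x * (y * z) * t - t * (q * (u * (x * z))) ->
  - (q * u * eT) = x * (q * r0 + y * r1) * T - T * (q * (S0 + u * S1)) ->
  - (q * u * (et * T + t * eT)) =
    x * (q * r0 + y * (r1 + z)) * (t * T) - t * T * (q * (S0 + u * (S1 + x * H))).
Proof.
move=> cx cq cy cu h0 h1 hz he hE.
have -> : q * u * (et * T + t * eT) = q * u * et * T + t * (q * u * eT).
  by rewrite mulrDr !mulrA; congr (_ + _ * _); rewrite -cq -!mulrA cu.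
rewrite opprD -(mulNr _ T) -(mulrN t) he hE mulrBl mulrBr.
have -> : t * (x * (q * r0 + y * r1) * T) = x * (q * r0 + y * r1) * (t * T).
  have tG : t * (q * r0 + y * r1) = (q * r0 + y * r1) * t.
    by rewrite mulrDr mulrDl !mulrA -(cq t) -(cy t) -!mulrA h0 h1.
  by rewrite !mulrA -(cx t) -(mulrA x t) tG !mulrA.
have -> : t * (q * (u * (x * z))) * T = t * T * (q * (u * (x * H))).
  rewrite -!mulrA hz; congr (_ * _).
  rewrite (mulrA x T) (cx T) -(mulrA T x) (mulrA u T) (cu T) -(mulrA T u) (mulrA q T) (cq T).
  by rewrite -(mulrA T q).
have -> : x * (q * r0 + y * (r1 + z)) * (t * T) = x * (q * r0 + y * r1) * (t * T) + x * (y * z) * t * T.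
  by rewrite -(mulrA (x * (y * z))) -mulrDl -mulrDr [y * (r1 + z)]mulrDr addrA.
have -> : t * T * (q * (S0 + u * (S1 + x * H))) = t * (T * (q * (S0 + u * S1))) + t * T * (q * (u * (x * H))).
  by rewrite (mulrA t T) -mulrDr -mulrDr [u * (S1 + _)]mulrDr addrA.
move: (x * (y * z) * t * T) (t * T * (q * (u * (x * H)))) (t * (T * _)) (x * _ * (t * T)) => a b c d.
by rewrite addrACA (addrC a) -opprD (addrC b).
Qed.

Lemma central_push (R : pzRingType) (q u x w g : R) : (forall f, q * f = f * q) ->
  (forall f, u * f = f * u) -> (forall f, x * f = f * x) ->
  q * (u * (w * (x * g))) = w * (q * (u * (x * g))).
Proof. by move=> cq cu cx; rewrite (mulrA u w) (cu w) -(mulrA w u) (mulrA q w) (cq w) -(mulrA w q). Qed.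

Section Shift.
Variables (p : nat) (hp : prime p) (K : padicField p) (N : nat).
Local Notation nm := (@pnorm p K).
Local Notation MR := (GRing.PzRing.clone 'M[K]_N _).
Local Notation ps := (@PSer MR).
Local Notation cst := (@ps_const MR).
Implicit Types (A B X Y z U W H phi : 'M[K]_N) (T : mxseries K N).

(** The product of truncations exceeds the truncated product only by terms of total degree at least
    M, which are geometrically small. *)
Lemma value_at_cusp_smul T T' : overconvergent T -> overconvergent T' ->
  value_at_cusp (smul T T') = value_at_cusp T *m value_at_cusp T'.
Proof.
move=> oT oT'; have oTT := overconvergent_smul oT oT'.
apply/matrixP => i j.
pose s (F : mxseries K N) M := \sum_(k < M) (-1) ^+ k *: F k.
have h1 : knorm_cvg nm (fun M => (s T M *m s T' M) i j) ((value_at_cusp T *m value_at_cusp T') i j).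
  have -> : (fun M => (s T M *m s T' M) i j) = fun M => \sum_k s T M i k * s T' M k j.
    by apply/funext => M; rewrite mxE.
  by rewrite mxE; apply: cvg_sum => k _; apply: cvgM; apply: value_at_cusp_cvg.
apply: cvg_uniq (value_at_cusp_cvg i j oTT) _; apply: cvg0D h1 _ => e e0.
have [C [r [r0 r1 hT]]] := oT; have [C' [r' [r0' r1' hT']]] := oT'.
pose D := `|C| * `|C'|; pose t := Num.max r r'.
have t0 : 0 < t by rewrite lt_max r0.
have t1 : t < 1 by rewrite gt_max r1.
have [M0 hM] := geometric_lt D (ltW t0) t1 e0; exists M0 => M hM0.
apply: le_lt_trans (hM M hM0).
have hp1 (F : mxseries K N) c r2 : 0 < r2 -> r2 <= t -> (forall m i j, nm (F m i j) <= c * r2 ^+ m) ->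
    forall m i j, nm (F m i j) <= `|c| * t ^+ m.
  move=> r20 r2t hF m i' j'; apply: le_trans (hF m i' j') _.
  apply: le_trans (_ : `|c| * r2 ^+ m <= _).
    by apply: ler_wpM2r; rewrite ?exprn_ge0 ?ler_norm // ltW.
  by apply: ler_wpM2l => //; apply: lerXn2r; rewrite ?nnegrE // ltW.
have kT := hp1 T C r r0 (_ : r <= t) hT; have kT' := hp1 T' C' r' r0' (_ : r' <= t) hT'.
have bd (a b : nat) : (M <= a + b)%N -> nm ((T a *m T' b) i j) <= D * t ^+ M.
  move=> ab; rewrite mxE; apply: pnorm_sum => [|k _].
    by rewrite !mulr_ge0 ?exprn_ge0 // ltW.
  rewrite pnormM; apply: le_trans (_ : D * t ^+ (a + b) <= _).
    rewrite exprD mulrACA; apply: ler_pM; rewrite ?pnorm_ge0 //; [apply: kT | apply: kT'];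
      by rewrite /t le_max lexx ?orbT.
  by apply: ler_wpM2l; [rewrite mulr_ge0 | rewrite ler_wiXn2l // ltW].
have -> : (\sum_(k < M) (-1) ^+ k *: smul T T' k) i j - (s T M *m s T' M) i j =
   - \sum_(a < M) \sum_(b < M | (M <= a + b)%N) (-1) ^+ (a + b) * (T a *m T' b) i j.
  have -> : (\sum_(k < M) (-1) ^+ k *: smul T T' k) i j =
     \sum_(a < M) \sum_(b < M | (a + b < M)%N) (-1) ^+ (a + b) * (T a *m T' b) i j.
    rewrite summxE.
    have e1 (k : 'I_M) : ((-1) ^+ k *: smul T T' k) i j =
      \sum_(a < M | (a <= k)%N) (-1) ^+ k * (T a *m T' (k - a)%N) i j.
      rewrite mxE /smul summxE mulr_sumr (big_ord_widen M (fun a => (-1) ^+ k * (T a *m T' (k - a)%N) i j) (ltn_ord k)).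
      by [].
    rewrite (eq_bigr _ (fun k _ => e1 k)) (exchange_big_dep xpredT) //=; apply: eq_bigr => a _.
    rewrite -(big_mkord (fun k => (a <= k)%N) (fun k => (-1) ^+ k * (T a *m T' (k - a)%N) i j)).
    rewrite -(big_mkord (fun b => (a + b < M)%N) (fun b => (-1) ^+ (a + b) * (T a *m T' b) i j)).
    have aM := ltnW (ltn_ord a).
    rewrite (big_cat_nat (n := a)) //= [X in X + _]big_nat_cond big1 ?add0r => [|k /andP[/andP[_ h1'] h2']]; last by lia.
    rewrite -{1}[nat_of_ord a]add0n big_addn.
    rewrite [RHS](big_cat_nat (n := M - a)) ?leq_subr //= [X in _ + X]big_nat_cond [X in _ + X]big1 ?addr0 => [|k /andP[/andP[h1' _] h2']]; last by lia.
    rewrite big_nat_cond [RHS]big_nat_cond; apply: eq_big => [k|k _]; first by lia.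
    by rewrite addnK addnC.
  have -> : (s T M *m s T' M) i j = \sum_(a < M) \sum_(b < M) (-1) ^+ (a + b) * (T a *m T' b) i j.
    rewrite /s mulmx_suml summxE; apply: eq_bigr => a _; rewrite mulmx_sumr summxE; apply: eq_bigr => b _.
    by rewrite -scalemxAl -scalemxAr scalerA -exprD mxE.
  rewrite -sumrB -sumrN; apply: eq_bigr => a _.
  rewrite [X in _ - X](bigID (fun b : 'I_M => (a + b < M)%N)) /= opprD addrA subrr add0r; congr (- _).
  by apply: eq_bigl => b; rewrite -leqNgt.
rewrite subr0 pnormN; apply: pnorm_sum => [|a _]; first by rewrite !mulr_ge0 ?exprn_ge0 // ltW.
apply: pnorm_sum => [|b ab]; first by rewrite !mulr_ge0 ?exprn_ge0 // ltW.
by rewrite pnorm_sign; apply: bd.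
Qed.

Lemma low_conj A W : low 1 A -> low 1 (W - 1%:M) -> low 1 (invmx W *m A *m W).
Proof.
move=> lA lW.
have l0 (V : 'M[K]_N) : low 1 (V - 1%:M) -> low 0 V.
  move=> lV; rewrite -[V](subrK 1%:M); apply: lowD; first exact: lowW (lV).
  by move=> i j ij; rewrite mxE; case: eqP ij => // ->; rewrite addn0 ltnn.
have := lowM (lowM (l0 _ (low_invmx1 lW)) lA) (l0 _ lW); by rewrite add0n addn0.
Qed.

Lemma smul_constl_ps A T m : (cst A * ps T) m = A *m T m.
Proof. exact: pcoef_constl. Qed.
Lemma smul_constr_ps A T m : (ps T * cst A) m = T m *m A.
Proof. exact: pcoef_constr. Qed.
Lemma cstD A B : cst (A + B) = cst A + cst B.
Proof. by apply/pserP => m; rewrite pcoefD /=; case: (m == 0%N); rewrite ?addr0. Qed.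
Lemma cstZ (c : K) A : cst (c *: A) = ps_poly N c%:P * cst A.
Proof.
apply/pserP => m; rewrite pcoef_constr /= coefC; case: (m == 0%N).
  by rewrite -mul_scalar_mx.
by rewrite (raddf0 (@scalar_mx K N)) mul0r.
Qed.

Lemma cst_mul A B : cst A * cst B = cst (A *m B).
Proof. by apply/pserP => m; rewrite pcoef_constl /=; case: (m == 0%N); rewrite ?mulr0. Qed.
Lemma cst_one : cst 1%:M = 1.
Proof. by []. Qed.

Lemma frob_horizontalE (R0 R1 S0 S1 : 'M[K]_N) T :
  let Q : {poly K} := (1 + 'X) ^+ p - 'X ^+ p in
  let q := ps_poly N Q in let u := ps_poly N (1 + 'X) in
  frob_horizontal R0 R1 S0 S1 T <->
  - (q * u * euler (ps T)) =
  ps_poly N p%:R%:P * (q * cst R0 + ps_poly N ((1 + 'X) ^+ p) * cst R1) * ps T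
  - ps T * (q * (cst S0 + u * cst S1)).
Proof.
move=> Q q u; rewrite /q /u -ps_polyM.
have -> A B : ps_poly N p%:R%:P * (ps_poly N Q * cst A + ps_poly N ((1 + 'X) ^+ p) * cst B) =
   ps_poly N (p%:R *: Q) * cst A + ps_poly N (p%:R *: (1 + 'X) ^+ p) * cst B.
  by rewrite mulrDr !mulrA -!ps_polyM !mul_polyC.
exact: frob_horizontal_ps.
Qed.

(** (X - 1) (X + 1) = 0, and (X + 1)/2 is unipotent, hence invertible. *)
Lemma unitri_involution X : X *m X = 1%:M -> low 1 (X - 1%:M) -> X = 1%:M.
Proof.
move=> e lX.
have h : (X - 1%:M) *m (X + 1%:M) = 0.
  by rewrite mulmxBl mulmxDr mulmx1 mul1mx e; apply/matrixP => i j; rewrite !mxE; ring.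
have n2 : 2 != 0 :> K by apply: natr_neq0.
have u : 2^-1 *: (X + 1%:M) \in unitmx.
  apply: unimx_unit.
  have -> : 2^-1 *: (X + 1%:M) - 1%:M = 2^-1 *: (X - 1%:M).
    by apply/matrixP => i j; rewrite !mxE; field.
  exact: lowZ.
apply/eqP; rewrite -subr_eq0; apply/eqP; apply: (can_inj (mulmxK u)).
by rewrite -scalemxAr h mul0mx scaler0.
Qed.

Section Central.
Variables R0 R1 z : 'M[K]_N.
Hypotheses (l0 : low 1 R0) (l1 : low 1 R1) (lz : low 1 z).
Hypotheses (z0 : z *m R0 = R0 *m z) (z1 : z *m R1 = R1 *m z).

Lemma edge_series U W : edge R0 R1 U W -> exists S0 S1 T,
  [/\ low 1 S0 /\ low 1 S1, frob_iso R0 R1 S0 S1 T, T 0%N = U & value_at_cusp T = W].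
Proof.
move=> [S0 [S1 [P [lS0 lS1 hP hU hW]]]]; exists S0, S1, (ser P); split=> //.
- exact: (sol1_frob_iso hP (NullP_frobV hp K)).
- by rewrite sol1_zero.
- by rewrite (sol1_value hP).
Qed.

Lemma central_conj S0 S1 T U W : low 1 S0 -> low 1 S1 -> frob_iso R0 R1 S0 S1 T ->
  T 0%N = U -> value_at_cusp T = W -> low 1 (W - 1%:M) ->
  exists2 H, low 1 H & forall m, z *m T m = T m *m H.
Proof.
move=> lS0 lS1 iT hU hW lW; have uS := low_unipotent lS0 lS1.
have [H [hH _]] := frob_iso_rigid hp iT iT uS uS z0 z1; exists H => //.
have oT : overconvergent T by case: iT.
have e : z *m W = W *m H.
  have := @value_at_cuspM p K N z 1%:M 1%:M H T T oT oT; rewrite mulmx1 mul1mx hW; apply.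
  by move=> m; rewrite mulmx1 mul1mx.
have -> : H = invmx W *m z *m W by rewrite -mulmxA e mulKmx ?unimx_unit.
exact: low_conj.
Qed.

(** The same T remains a solution: by rigidity z T = T H with H constant, and the residue of the
    source moves by p H. *)
Lemma chi_shift0 : chi (R0 + z) R1 = chi R0 R1.
Proof.
have [U [W [e lU lW eX]]] := chiP hp l0 l1.
have [S0 [S1 [T [[lS0 lS1] iT hU hW]]]] := edge_series e.
have [H lH hH] := central_conj lS0 lS1 iT hU hW lW.
have h : frob_at (R0 + z) R1 (S0 + p%:R *: H) S1 U W.
  exists T; split=> //; first by apply: low_unipotent => //; apply: lowD => //; apply: lowZ.
  case: iT => oT iT hT; split=> //.
  move/frob_horizontalE: hT => hT; apply/frob_horizontalE; rewrite hT.
  have hH' : cst z * ps T = ps T * cst H.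
    by apply/pserP => m; rewrite smul_constl_ps smul_constr_ps.
  rewrite !cstD cstZ; move: (@ps_poly_central p K N) => cen.
  rewrite !(mulrDr, mulrDl) -!mulrA hH'.
  have -> : ps_poly N p%:R%:P * (ps_poly N ((1 + 'X) ^+ p - 'X^p) * (ps T * cst H)) =
     ps T * (ps_poly N ((1 + 'X) ^+ p - 'X^p) * (ps_poly N p%:R%:P * cst H)).
    exact: central_swap.
  exact: zmod_cancel.
have [_ hchi] := chi_frob_at hp (lowD l0 lz) l1 h.
by apply: (can_inj (mulmxK (unimx_unit lW))); rewrite -hchi eX.
Qed.
End Central.

(** The inversion gives chi(-z, z) chi(0, z) = 1, and a central shift by -z identifies the two
    factors. *)
Lemma chi_0c z : low 1 z -> chi 0 z = 1%:M.
Proof.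
move=> lz; have l0 := @low_0 K N 1.
have hs : chi (- 0 - z) z = chi 0 z.
  rewrite oppr0; apply: (chi_shift0 l0 lz (lowN lz)); by rewrite ?mulmx0 ?mul0mx // mulNmx mulmxN.
have := chi_flip hp l0 lz; rewrite hs => e.
have := chi_low hp l0 lz; move: e; set X := chi 0 z => e lX.
exact: unitri_involution.
Qed.

(* A solution for (0, z) whose value at the cusp is 1 commutes with           *)
(* everything that commutes with z; its product with a solution for (R0, R1)  *)
(* is one for (R0, R1 + z).                                                   *)
Lemma chi_shift1 (R0 R1 z : 'M[K]_N) : low 1 R0 -> low 1 R1 -> low 1 z ->
  z *m R0 = R0 *m z -> z *m R1 = R1 *m z -> chi R0 (R1 + z) = chi R0 R1.
Proof.
move=> l0 l1 lz z0 z1; have lO := @low_0 K N 1.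
have [U3 [W3 [e3 lU3 lW3 eX3]]] := chiP hp lO lz.
have UW3 : U3 = W3 by rewrite -eX3 (chi_0c lz) mul1mx.
have uW3 := unimx_unit lW3.
have [S0' [S1' [T3 [[lS0' lS1'] iT3 hU3 hW3]]]] := edge_series e3.
have f3 : frob_at 0 z S0' S1' U3 W3 by exists T3; split=> //; apply: low_unipotent.
have [U [W [e lU lW eX]]] := chiP hp l0 l1.
have [S0 [S1 [T [[lS0 lS1] iT hU hW]]]] := edge_series e.
have [H lH hH] := central_conj lz z0 z1 lS0 lS1 iT hU hW lW.
have [S0s [S1s [f3' r3 r3']]] := edge_residues hp e3.
(* By [edge_residues] some solution has a zero residue at 0 in the source, and rigidity transfers
   this to the present one. *)
have S0'0 : S0' = 0.
  have [|| G [_ eW eS0 _]] := frob_at_rigid hp (phi := 1%:M) f3' f3; rewrite ?mulmx1 ?mul1mx ?mulmx0 ?mul0mx //.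
  have S0s0 : S0s = 0.
    by apply: (can_inj (mulKmx uW3)); rewrite -r3' mul0mx scaler0 mulmx0.
  have uG : G \in unitmx.
    by move: uW3; rewrite -[W3 in W3 \in _]mul1mx eW unitmx_mul => /andP[].
  by apply: (can_inj (mulKmx uG)); rewrite -eS0 S0s0 mul0mx mulmx0.
have S1'z : S1' *m invmx W3 = invmx W3 *m (p%:R *: z).
  apply: (can_inj (mulKmx uW3)); rewrite mulmxA mulmxA mulmxV // mul1mx.
  have := frob_at_residue hp f3; rewrite S0'0 !add0r UW3 => <-.
  by rewrite -scalemxAl mulmxK.
pose t := ps T3 * cst (invmx W3).
have ct phi : phi *m z = z *m phi -> cst phi * t = t * cst phi.
  move=> cz; have u3 : unipotent S0' S1' by apply: low_unipotent.
  have [|| G [hG _]] := frob_iso_rigid hp iT3 iT3 u3 u3 (phi := phi); rewrite ?mulmx0 ?mul0mx //.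
  have [|| G' [_ eW _ _]] := frob_at_rigid hp (phi := phi) f3 f3; rewrite ?mulmx0 ?mul0mx //.
  have GG : G = G'.
    apply: (can_inj (mulKmx uW3)); rewrite -eW.
    by have := hG 0%N; rewrite hU3 UW3 => <-.
  apply/pserP => m; have tm : t m = T3 m *m invmx W3 by exact: smul_constr_ps.
  have ea : (cst phi * t) m = phi *m t m by exact: pcoef_constl.
  have eb : (t * cst phi) m = t m *m phi by exact: pcoef_constr.
  rewrite ea eb tm mulmxA hG -!mulmxA; congr (_ *m _).
  apply: (can_inj (mulKmx uW3)); rewrite !mulmxA mulmxV // mul1mx.
  by rewrite GG -eW mulmxK.
have hTH : cst z * ps T = ps T * cst H.
  by apply/pserP => m; rewrite smul_constl_ps smul_constr_ps.
pose T4 := smul (smul T3 (sconst (invmx W3))) T.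
have T4E : ps T4 = t * ps T by [].
have u4 : unipotent S0 (S1 + p%:R *: H).
  by apply: low_unipotent => //; apply: lowD => //; apply: lowZ.
case: iT3 => oT3 [T3i [oT3i i1 i2]] hor3; case: iT => oT [Ti [oTi j1 j2]] hor.
have oc A := overconvergent_const A.
have h4 : frob_at R0 (R1 + z) S0 (S1 + p%:R *: H) U W.
  exists T4; split=> //.
  - split; first by do !apply: overconvergent_smul.
    + exists (smul Ti (smul (sconst W3) T3i)); split.
      * by do !apply: overconvergent_smul.
      * move=> m; have -> : smul T4 (smul Ti (smul (sconst W3) T3i)) m =
          (ps T3 * cst (invmx W3) * ps T * (ps Ti * (cst W3 * ps T3i))) m by [].
        have jj : ps T * ps Ti = 1 by apply/pserP => k; apply: j1.
        have ii : ps T3 * ps T3i = 1 by apply/pserP => k; apply: i1.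
        rewrite -!mulrA (mulrA (ps T)) jj mul1r (mulrA (cst _)) cst_mul mulVmx //.
        by rewrite cst_one mul1r ii.
      * move=> m; have -> : smul (smul Ti (smul (sconst W3) T3i)) T4 m =
          (ps Ti * (cst W3 * ps T3i) * (ps T3 * cst (invmx W3) * ps T)) m by [].
        have jj : ps Ti * ps T = 1 by apply/pserP => k; apply: j2.
        have ii : ps T3i * ps T3 = 1 by apply/pserP => k; apply: i2.
        rewrite -!mulrA (mulrA (ps T3i)) ii mul1r (mulrA (cst _)) cst_mul mulmxV //.
        by rewrite cst_one mul1r jj.
    + apply/frob_horizontalE; rewrite T4E eulerM.
      move/frob_horizontalE: hor => hor; move/frob_horizontalE: hor3 => hor3.
      move: (@ps_poly_central p K N) => cen.
      have et : euler t = euler (ps T3) * cst (invmx W3) by rewrite eulerM euler_const mulr0 addr0.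
      have c0 : cst 0 = 0 by apply/pserP => m /=; case: (m == 0%N).
      pose Q : {poly K} := (1 + 'X) ^+ p - 'X ^+ p.
      have het : - (ps_poly N Q * ps_poly N (1 + 'X) * euler t) =
        ps_poly N p%:R%:P * (ps_poly N ((1 + 'X) ^+ p) * cst z) * t -
        t * (ps_poly N Q * (ps_poly N (1 + 'X) * (ps_poly N p%:R%:P * cst z))).
        have := hor3; rewrite S0'0 c0 mulr0 !add0r -/Q => /(congr1 (fun f => f * cst (invmx W3))).
        rewrite mulNr mulrBl et (mulrA _ (euler (ps T3))) => ->; congr (_ - _); first exact: esym (mulrA _ _ _).
        rewrite -(mulrA (ps T3)) -(mulrA (ps_poly N Q)) -(mulrA (ps_poly N (1 + 'X))) cst_mul S1'z -cst_mul cstZ /t.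
        rewrite -(mulrA (ps T3)); congr (_ * _).
        exact: central_push (cen _) (cen _) (cen _).
      rewrite !cstD cstZ.
      exact: (@product_horizontal (pser MR) (ps_poly N p%:R%:P) (ps_poly N Q) (ps_poly N ((1 + 'X) ^+ p))
        (ps_poly N (1 + 'X)) (cst R0) (cst R1) (cst z) (ps T) (cst H) t (cst S0) (cst S1) (euler (ps T))
        (euler t) (cen _) (cen _) (cen _) (cen _) (ct R0 (esym z0)) (ct R1 (esym z1)) hTH het hor).
  - rewrite /T4 /smul !big_ord1 subnn /sconst eqxx hU hU3 UW3.
    by rewrite mulmxV // mul1mx.
  - rewrite /T4 value_at_cusp_smul //; last by apply: overconvergent_smul.
    have -> : value_at_cusp (smul T3 (sconst (invmx W3))) = value_at_cusp T3 *m invmx W3.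
      have := @value_at_cuspM p K N 1%:M 1%:M 1%:M (invmx W3) (smul T3 (sconst (invmx W3))) T3.
      by rewrite !mulmx1 !mul1mx; apply => //; [apply: overconvergent_smul | move=> m; rewrite smul_constr mulmx1 !mul1mx].
    by rewrite hW hW3 mulmxV // mul1mx.
have [_ hchi] := chi_frob_at hp l0 (lowD l1 lz) h4.
by apply: (can_inj (mulmxK (unimx_unit lW))); rewrite -hchi eX.
Qed.
End Shift.

(** * The hexagon for matrices *)

Definition act (K : fieldType) (N : nat) (g : ncseries K bool) (A B : 'M[K]_N) : 'M[K]_N :=
  \sum_(k < N) \sum_(v : k.-tuple bool) g v *: (\prod_(i <- v) if i then B else A).

Section Relations.
Variables (p : nat) (hp : prime p) (K : padicField p) (N : nat).
Implicit Types (A B C U W S : 'M[K]_N).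

Lemma frob_at_residue0 A B S0 S1 U W : low 1 A -> low 1 B ->
  frob_at A B S0 S1 U W -> p%:R *: (A *m W) = W *m S0.
Proof.
move=> lA lB f; have [U' [W' [e lU lW eX]]] := chiP hp lA lB.
have [S0' [S1' [f' _ r]]] := edge_residues hp e.
have [|| H [_ eW eS _]] := frob_at_rigid hp (phi := 1%:M) f' f; rewrite ?mulmx1 ?mul1mx //.
by move: eW; rewrite mul1mx => ->; rewrite mulmxA scalemxAl r -!mulmxA eS.
Qed.

Lemma chi_unit A B : low 1 A -> low 1 B -> chi A B \in unitmx.
Proof. by move=> lA lB; apply: unimx_unit; apply: chi_low. Qed.

(** The solutions in the coordinates z and 1 - z have the same value U at infinity. The first
    relation equates two expressions of U; the second computes S0 + S1 both from the cusps 0 and 1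
    and from infinity. *)
Lemma frob_at_relation A B S0 S1 U W W1 : low 1 A -> low 1 B ->
  frob_at A B S0 S1 U W -> frob_at B A S1 S0 U W1 ->
  let G := W1 *m invmx W in
  [/\ W \in unitmx, chi B A *m G = chi A B & A + invmx G *m B *m G = invmx (chi A B) *m (A + B) *m chi A B].
Proof.
move=> lA lB f f1 G.
have [uW eU] := chi_frob_at hp lA lB f; have [uW1 eU1] := chi_frob_at hp lB lA f1.
have r := frob_at_residue hp f; have r0 := frob_at_residue0 lA lB f.
have r1 := frob_at_residue0 lB lA f1.
have uG : G \in unitmx by rewrite unitmx_mul uW1 unitmx_inv.
have eW1 : W1 = G *m W by rewrite mulmxKV.
split=> //; first by rewrite /G mulmxA -eU1 eU mulmxK.
have ux := chi_unit lA lB; set x := chi A B in ux eU *.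
apply: (can_inj (mulmxK uW)); apply: (p_inj hp).
transitivity (W *m (S0 + S1)); last first.
  rewrite -[invmx x *m _ *m x *m W]mulmxA -eU -mulmxA scalemxAr r eU mulmxA mulKmx //.
rewrite mulmxDl scalerDr r0 mulmxDr; congr (_ + _).
by rewrite -(mulmxA _ G) -eW1 -mulmxA scalemxAr r1 mulmxA {1}eW1 mulKmx.
Qed.

Variables (Fs : forall E : micUni K, frobPullback E) (g : ncseries K bool).
Hypothesis hg : is_frobenius_dR_path Fs g.

(** The definition of g, read on the object with residues A and B, presents g as a ratio of values
    at the two cusps of solutions that agree at infinity. *)
Lemma frob_act A B : low 1 A -> low 1 B ->
  [/\ act g A B \in unitmx, chi B A *m act g A B = chi A B
    & A + invmx (act g A B) *m B *m act g A B = invmx (chi A B) *m (A + B) *m chi A B].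
Proof.
move=> lA lB; pose E := MicUni (low_unipotent lA lB).
have := hg E; rewrite /Fpush_dR_path /dR_path mul1mx mulmx1.
move: (Fs E) => [S0 S1 uS t0 t1 i0 i1 gl] /=.
rewrite /iota10 /iota01 /= => e.
have f0 : frob_at A B S0 S1 (t0 0%N) (value_at_cusp t0) by exists t0.
have uS' : unipotent S1 S0 by case: uS => P uP [h1 h2]; exists P.
have f1 : frob_at B A S1 S0 (t1 0%N) (value_at_cusp t1) by exists t1.
(* The gluing condition at s = 0, where the Taylor transport is 1. *)
have et : t1 0%N = t0 0%N.
  have := gl 0%N; rewrite /expand_U1 /smul big_ord1 /expand_U0 big_ord1 /= bin0 expr0 !scale1r.
  by rewrite taylor_transport_oo // mul1mx.
rewrite et in f1.
have := frob_at_relation lA lB f0 f1.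
have -> : act g A B = value_at_cusp t1 *m invmx (value_at_cusp t0) by rewrite -e.
move=> [uW h1 h2]; split=> //.
by have [uW1 _] := chi_frob_at hp lB lA f1; rewrite unitmx_mul uW1 unitmx_inv.
Qed.

Lemma act_inv A B : low 1 A -> low 1 B -> act g B A *m act g A B = 1%:M.
Proof.
move=> lA lB; have [_ h1 _] := frob_act lA lB; have [_ h2 _] := frob_act lB lA.
apply: (can_inj (mulKmx (chi_unit lA lB))); rewrite mulmxA h2 h1 mulmx1 //.
Qed.

Lemma act_low A B : low 1 A -> low 1 B -> low 1 (act g A B - 1%:M).
Proof.
move=> lA lB; have [_ h1 _] := frob_act lA lB.
have -> : act g A B = invmx (chi B A) *m chi A B.
  by rewrite -h1 mulKmx ?chi_unit.
by apply: low_mulmx1; [apply: low_invmx1 |]; apply: chi_low.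
Qed.

Section Hexagon.
Variables A B C : 'M[K]_N.
Hypotheses (lA : low 1 A) (lB : low 1 B) (lC : low 1 C) (s : A + B + C = 0).

(** C is the residue at infinity for the pair (B, A), so [chi_flip] replaces chi(B, A)^-1 by chi(C,
    A). *)
Lemma act_chi : act g A B = chi C A *m chi A B.
Proof.
have [_ h1 _] := frob_act lA lB.
apply: (can_inj (mulKmx (chi_unit lB lA))); rewrite h1 mulmxA.
have -> : C = - B - A by rewrite -opprD (addrC B); apply/eqP; rewrite -addr_eq0 -s; apply/eqP; exact: addrC.
by rewrite (mulmx1C (chi_flip hp lB lA)) mul1mx.
Qed.

Lemma act_residue : A + invmx (act g A B) *m B *m act g A B + invmx (chi A B) *m C *m chi A B = 0.
Proof.
have [_ _ ->] := frob_act lA lB.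
by rewrite -mulmxDl -mulmxDr s mulmx0 mul0mx.
Qed.
End Hexagon.

Section Hexagon3.
Variables A B C : 'M[K]_N.
Hypotheses (lA : low 1 A) (lB : low 1 B) (lC : low 1 C) (s : A + B + C = 0).

Let s1 : B + C + A = 0. Proof. by rewrite addrC addrA s. Qed.
Let s2 : C + A + B = 0. Proof. by rewrite -addrA addrC s. Qed.
Let x := chi A B.
Let y := chi B C.
Let w := chi C A.
Definition hex_monodromy := chi B C *m chi C A *m chi A B.
Let M := hex_monodromy.

(** By [act_chi] the product is (y w) (x y) (w x), and M = y w x. *)
Lemma hexagon_sq : act g C A *m act g B C *m act g A B = M *m M.
Proof.
rewrite (act_chi lA lB s) (act_chi lB lC s1) (act_chi lC lA s2) /M /hex_monodromy.
by rewrite !mulmxA.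
Qed.

Lemma hex_monodromy_low : low 1 (M - 1%:M).
Proof. by do 2 (apply: low_mulmx1; last exact: chi_low); apply: chi_low. Qed.

Let ux : x \in unitmx. Proof. exact: chi_unit. Qed.
Let uy : y \in unitmx. Proof. exact: chi_unit. Qed.
Let uw : w \in unitmx. Proof. exact: chi_unit. Qed.

Let r1 : A + invmx (w *m x) *m B *m (w *m x) + invmx x *m C *m x = 0.
Proof. by rewrite -(act_chi lA lB s); apply: act_residue. Qed.
Let r2 : B + invmx (x *m y) *m C *m (x *m y) + invmx y *m A *m y = 0.
Proof. by rewrite -(act_chi lB lC s1); apply: act_residue. Qed.
Let r3 : C + invmx (y *m w) *m A *m (y *m w) + invmx w *m B *m w = 0.
Proof. by rewrite -(act_chi lC lA s2); apply: act_residue. Qed.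

Lemma invmxM (P Q : 'M[K]_N) : P \in unitmx -> Q \in unitmx -> invmx (P *m Q) = invmx Q *m invmx P.
Proof.
move=> uP uQ; have uPQ : P *m Q \in unitmx by rewrite unitmx_mul uP.
by apply: (can_inj (mulKmx uPQ)); rewrite mulmxV // mulmxA mulmxK // mulmxV.
Qed.

Lemma hex_comm0 : M *m A = A *m M.
Proof.
have uM : M \in unitmx by rewrite !unitmx_mul ux uy uw.
have h : invmx M *m A *m M = A.
  have := congr1 (fun T => invmx x *m T *m x) r3; rewrite mulmx0 mul0mx.
  rewrite !mulmxDr !mulmxDl => e.
  have : invmx M *m A *m M + (invmx (w *m x) *m B *m (w *m x) + invmx x *m C *m x) = 0.
    rewrite -[RHS]e /M /hex_monodromy -/x -/y -/w !invmxM ?unitmx_mul ?uy ?ux ?uw // !mulmxA.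
    by rewrite addrA addrC addrA.
  move=> /eqP; rewrite addr_eq0 => /eqP ->.
  by apply/eqP; rewrite eq_sym -addr_eq0 addrA r1.
by rewrite -[X in M *m X]h !mulmxA mulmxV // mul1mx.
Qed.

(** Comparing [r1] with [r2] conjugated by y^-1 gives y B y^-1 = (w x)^-1 B (w x). Hence w x y
    commutes with B, and M is the conjugate of w x y by y. *)
Lemma hex_comm1 (G := act g A B) : M *m (invmx G *m B *m G) = (invmx G *m B *m G) *m M.
Proof.
rewrite /G (act_chi lA lB s) -/x -/w.
have h : y *m B *m invmx y = invmx (w *m x) *m B *m (w *m x).
  have e : y *m B *m invmx y + invmx x *m C *m x + A = 0.
    have := congr1 (fun T => y *m T *m invmx y) r2; rewrite mulmx0 mul0mx => <-.
    by rewrite !mulmxDr !mulmxDl invmxM // !mulmxA mulmxV // !mul1mx !mulmxK.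
  have H (a b c : 'M[K]_N) : a + c + A = 0 -> A + b + c = 0 -> a = b.
    move=> h1 h2; apply/eqP; rewrite -subr_eq0; apply/eqP.
    have -> : a - b = (a + c + A) - (A + b + c) by apply/matrixP => i j; rewrite !mxE; ring.
    by rewrite h1 h2 subrr.
  exact: H e r1.
have uM : M \in unitmx by rewrite !unitmx_mul ux uy uw.
have e : M *m y = y *m (w *m x *m y) by rewrite /M /hex_monodromy !mulmxA.
have hB : w *m x *m y *m B = B *m (w *m x *m y).
  have uwx : w *m x \in unitmx by rewrite unitmx_mul uw.
  have : w *m x *m (y *m B *m invmx y) *m y = w *m x *m (invmx (w *m x) *m B *m (w *m x)) *m y by rewrite h.
  by rewrite !mulmxA mulmxKV // mulmxV // mul1mx.
have fin (m : 'M[K]_N) : m *m y = y *m (w *m x *m y) -> m *m (y *m B *m invmx y) = y *m B *m invmx y *m m.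
  move=> em; apply: (can_inj (mulmxK uy)).
  rewrite -[RHS]mulmxA em !mulmxA mulmxKV // mulmxKV // em -!mulmxA; congr (_ *m _).
  by rewrite !mulmxA hB !mulmxA.
by rewrite -h; apply: fin.
Qed.
End Hexagon3.
End Relations.

(** * Series as matrices *)

Section Words.
Variables (K : fieldType) (X : finType) (x0 : X) (d : nat).
Implicit Types (f g h a b : ncseries K X) (w v u : seq X).

(* Sorted by length, so that left multiplication is lower triangular. *)
Definition wordlist : seq (seq X) :=
  sort (relpre size leq) (undup (flatten [seq [seq val t | t <- enum {: k.-tuple X}] | k <- iota 0 d.+1])).

Lemma mem_wordlist w : (w \in wordlist) = (size w <= d)%N.
Proof.
rewrite mem_sort mem_undup; apply/flattenP/idP.
  move=> [s /mapP [k hk ->] /mapP [t _ ->]]; rewrite size_tuple.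
  by move: hk; rewrite mem_iota add0n ltnS.
move=> hw; exists [seq val t | t <- enum {: (size w).-tuple X}].
  by apply/mapP; exists (size w) => //; rewrite mem_iota add0n ltnS.
by apply/mapP; exists (in_tuple w) => //; rewrite mem_enum.
Qed.

Lemma uniq_wordlist : uniq wordlist.
Proof. by rewrite sort_uniq undup_uniq. Qed.

Local Notation n := (size wordlist).
Definition wd (i : 'I_n) := nth [::] wordlist i.

Lemma size_wd i : (size (wd i) <= d)%N.
Proof. by rewrite -mem_wordlist mem_nth. Qed.

Lemma wd_inj : injective wd.
Proof. by move=> i j /eqP; rewrite nth_uniq ?uniq_wordlist // => /eqP/val_inj. Qed.

Lemma wdP w : (size w <= d)%N -> exists i, wd i = w.
Proof.
by rewrite -mem_wordlist => h; have h' := h; rewrite -index_mem in h'; exists (Ordinal h'); rewrite /wd nth_index.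
Qed.

Lemma wd_sorted (i j : 'I_n) : (i <= j)%N -> (size (wd i) <= size (wd j))%N.
Proof.
move=> ij.
have tr : transitive (relpre (@size X) leq) by move=> u v w /=; apply: leq_trans.
have so : sorted (relpre (@size X) leq) wordlist by apply: sort_sorted => u v; apply: leq_total.
by apply: (sorted_leq_nth tr _ [::] so) => //; [move=> u /= | rewrite inE | rewrite inE].
Qed.

(** The sum in [act] stops at the size of the matrices, so this size has to exceed d for all words
    of length at most d to count. *)
Lemma wordlist_size : (d < n)%N.
Proof.
have : (size [seq nseq k x0 | k <- iota 0 d.+1] <= n)%N.
  apply: uniq_leq_size.
    rewrite map_inj_uniq ?iota_uniq // => k l /(congr1 size); by rewrite !size_nseq.
  by move=> w /mapP [k hk ->]; rewrite mem_wordlist size_nseq; move: hk; rewrite mem_iota add0n ltnS.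
by rewrite size_map size_iota.
Qed.

Lemma sum_wd (F : seq X -> K) v : (size v <= d)%N -> \sum_j (v == wd j)%:R * F (wd j) = F v.
Proof.
move=> /wdP [i <-]; rewrite (bigD1 i) //= eqxx mul1r big1 ?addr0 // => j ji.
by rewrite (inj_eq wd_inj) eq_sym (negbTE ji) mul0r.
Qed.

Definition word v : ncseries K X := NcSeries (fun w => (w == v)%:R).

Lemma ncsM f g w : (f * g) w = \sum_(i < (size w).+1) f (take i w) * g (drop i w).
Proof. by []. Qed.
Lemma ncsD f g w : (f + g) w = f w + g w. Proof. by []. Qed.
Lemma ncsN f w : (- f) w = - f w. Proof. by []. Qed.
Lemma ncs1 w : (1 : ncseries K X) w = (w == [::])%:R. Proof. by []. Qed.
Lemma ncs_nilM f g : (f * g) [::] = f [::] * g [::].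
Proof. by rewrite ncsM big_ord1. Qed.

(** Left multiplication on series modulo words longer than d, in the basis of words. *)
Definition lmul f : 'M[K]_n := \matrix_(i, j) (f * word (wd j)) (wd i).
Definition tcol h : 'cV[K]_n := \col_i h (wd i).

Lemma lmul_col f h : lmul f *m tcol h = tcol (f * h).
Proof.
apply/matrixP => i k; rewrite !mxE ncsM.
transitivity (\sum_j \sum_(t < (size (wd i)).+1) f (take t (wd i)) * ((drop t (wd i) == wd j)%:R * h (wd j))).
  apply: eq_bigr => j _; rewrite !mxE ncsM mulr_suml; apply: eq_bigr => t _; by rewrite mulrA.
rewrite exchange_big; apply: eq_bigr => t _ /=; rewrite -mulr_sumr sum_wd //.
by rewrite size_drop (leq_trans (leq_subr _ _) (size_wd i)).
Qed.

Lemma lmulM f g : lmul (f * g) = lmul f *m lmul g.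
Proof.
apply/matrixP => i j; rewrite [LHS]mxE -mulrA.
have := congr1 (fun T : 'cV[K]_n => T i 0) (lmul_col f (g * word (wd j))).
rewrite [tcol _ i 0]mxE => <-; rewrite !mxE; apply: eq_bigr => k _.
by rewrite [tcol _ _ _]mxE [lmul g _ _]mxE.
Qed.
Lemma lmulD f g : lmul (f + g) = lmul f + lmul g.
Proof. by apply/matrixP => i j; rewrite !mxE mulrDl. Qed.
Lemma lmulN f : lmul (- f) = - lmul f.
Proof. by apply/matrixP => i j; rewrite !mxE mulNr. Qed.
Lemma lmul1 : lmul 1 = 1%:M.
Proof. by apply/matrixP => i j; rewrite !mxE mul1r /= (inj_eq wd_inj). Qed.
Lemma lmul0 : lmul 0 = 0.
Proof. by apply/matrixP => i j; rewrite !mxE mul0r. Qed.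

Lemma tcol_eq f g : tcol f = tcol g -> forall w, (size w <= d)%N -> f w = g w.
Proof.
by move=> h w /wdP [i <-]; have := congr1 (fun T : 'cV[K]_n => T i 0) h; rewrite !mxE.
Qed.

Lemma lmul_inj f g : lmul f = lmul g -> forall w, (size w <= d)%N -> f w = g w.
Proof.
by move=> h; apply: tcol_eq; rewrite -[f]mulr1 -[g]mulr1 -!lmul_col h.
Qed.

Lemma lmul_size f i j : f [::] = 0 -> (size (wd i) <= size (wd j))%N -> lmul f i j = 0.
Proof.
move=> f0 ij; rewrite mxE ncsM.
rewrite big_ord_recl take0 f0 mul0r add0r big1 // => t _ /=.
case: eqP => [e|]; rewrite ?mulr0 //.
have := congr1 size e; rewrite size_drop /bump /= => h; have := ltn_ord t; lia.
Qed.

Lemma lmul_low f : f [::] = 0 -> low 1 (lmul f).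
Proof. by move=> f0 i j; rewrite addn1 ltnS => /wd_sorted ij; apply: lmul_size. Qed.

Lemma prod_small (I : Type) (s : seq I) (F : I -> ncseries K X) w : (forall i, F i [::] = 0) ->
  (size w < size s)%N -> (\prod_(i <- s) F i) w = 0.
Proof.
move=> h; elim: s w => // i s IH w hw; rewrite big_cons ncsM.
rewrite big_ord_recl take0 h mul0r add0r big1 // => t _.
rewrite IH ?mulr0 // size_drop lift0; have tw := ltn_ord t; rewrite /= in hw. lia.
Qed.

Lemma lmul_prod (I : Type) (s : seq I) (F : I -> ncseries K X) :
  lmul (\prod_(i <- s) F i) = \prod_(i <- s) lmul (F i).
Proof.
elim: s => [|i s IH]; first by rewrite !big_nil lmul1.
by rewrite !big_cons lmulM IH.
Qed.

Lemma subst_trunc (phi : ncseries K bool) a b m w : a [::] = 0 -> b [::] = 0 -> (size w < m)%N ->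
  subst phi a b w = \sum_(k < m) \sum_(v : k.-tuple bool) phi v * (\prod_(i <- v) if i then b else a) w.
Proof.
move=> a0 b0 hm; rewrite /subst /=.
rewrite (big_ord_widen m (fun k => \sum_(v : k.-tuple bool) phi v * (\prod_(i <- v) if i then b else a) w) hm).
rewrite big_mkcond; apply: eq_bigr => k _; case: ltnP => // h.
rewrite big1 // => v _; rewrite prod_small ?mulr0 //; first by case.
by rewrite size_tuple.
Qed.

Lemma lmul_subst (phi : ncseries K bool) a b : a [::] = 0 -> b [::] = 0 ->
  lmul (subst phi a b) = act phi (lmul a) (lmul b).
Proof.
move=> a0 b0; apply/matrixP => i j; rewrite mxE ncsM /act summxE.
have hn := wordlist_size.
transitivity (\sum_(t < (size (wd i)).+1) \sum_(k < n) \sum_(v : k.-tuple bool)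
   phi v * ((\prod_(l <- v) if l then b else a) (take t (wd i)) * word (wd j) (drop t (wd i)))).
  apply: eq_bigr => t _; rewrite (@subst_trunc phi a b n) //; last first.
    by rewrite size_take_min (leq_ltn_trans (geq_minr _ _)) // (leq_ltn_trans (size_wd i)).
  rewrite mulr_suml; apply: eq_bigr => k _; rewrite mulr_suml; apply: eq_bigr => v _.
  by rewrite mulrA.
rewrite exchange_big; apply: eq_bigr => k _; rewrite summxE exchange_big; apply: eq_bigr => v _ /=.
rewrite mxE -mulr_sumr; congr (_ * _).
have -> : \prod_(l <- v) (if l then lmul b else lmul a) = lmul (\prod_(l <- v) if l then b else a).
  by rewrite lmul_prod; apply: eq_bigr => l _; case: l.
by rewrite [RHS]mxE ncsM.
Qed.

Lemma subst_nil (phi : ncseries K bool) a b : subst phi a b [::] = phi [::].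
Proof.
rewrite /subst /= big_ord1 (big_pred1 [tuple]) => [|v]; last by apply: esym; apply/eqP; apply: tuple0.
by rewrite big_nil /= mulr1.
Qed.
End Words.

(** * Centralizers among series *)

Section CommTrivial.
Variable K : fieldType.
Implicit Types (m b : ncseries K bool) (u : seq bool).

Lemma low_mull b m u y : b [::] = 0 -> (forall w, (size w < size u)%N -> m w = 0) ->
  (b * m) (y :: u) = b [:: y] * m u.
Proof.
move=> b0 hm; rewrite ncsM big_ord_recl take0 b0 mul0r add0r big_ord_recl /= take0 drop0.
rewrite big1 ?addr0 // => t _; rewrite hm ?mulr0 // size_drop; have tu : (t < size u)%N := ltn_ord t.
by rewrite ltn_subrL /bump leq0n (leq_ltn_trans (leq0n _) tu).
Qed.

Lemma low_mulr b m u y : b [::] = 0 -> (forall w, (size w < size u)%N -> m w = 0) ->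
  (m * b) (rcons u y) = m u * b [:: y].
Proof.
have dz : drop (size u).+1 (rcons u y) = [::] by rewrite drop_oversize ?size_rcons.
move=> b0 hm; rewrite ncsM size_rcons big_ord_recr /= dz b0 mulr0 addr0.
rewrite big_ord_recr /= -cats1 take_size_cat // drop_size_cat // big1 ?add0r // => t _.
by rewrite hm ?mul0r // size_take_min size_cat (leq_ltn_trans (geq_minl _ _)).
Qed.

Lemma comm_trivial b m : m [::] = 0 -> b [::] = 0 -> b [:: false] = 0 -> b [:: true] = 1 ->
  m * letter K false = letter K false * m -> m * b = b * m -> m = 0.
Proof.
move=> m0 b0 b1 b2 cA cb; apply/ncseriesP => w.
have [k] := ubnP (size w); elim: k w => // k IH w; rewrite ltnS => wk.
case/lastP: w wk => [|w y] wk; first exact: m0.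
have IH' v : (size v < size (rcons w y))%N -> m v = 0.
  by move=> hv; apply: IH; apply: leq_trans hv wk.
have IH2 x v : (size v < size (x :: w))%N -> m v = 0.
  by move=> hv; apply: IH'; rewrite size_rcons.
case: y wk IH' => wk IH'.
  have e : (m * letter K false) (false :: rcons w true) = (letter K false * m) (false :: rcons w true) by rewrite cA.
  have eR := low_mull false (b := letter K false) erefl IH'.
  have eL := low_mulr (u := false :: w) true (b := letter K false) erefl (IH2 false).
  have := etrans (esym eL) (etrans e eR).
  by rewrite /= mulr0 mul1r => <-.
have e : (m * b) (true :: rcons w false) = (b * m) (true :: rcons w false) by rewrite cb.
have eR := low_mull true b0 IH'.
have eL := low_mulr (u := true :: w) false b0 (IH2 true).
have := etrans (esym eL) (etrans e eR).
by rewrite b1 b2 mulr0 mul1r => <-.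
Qed.
End CommTrivial.

(** * The inversion and hexagon relations for series *)

Section SeriesIdentities.
Variables (p : nat) (hp : prime p) (K : padicField p).
Variables (Fs : forall E : micUni K, frobPullback E) (g : ncseries K bool).
Hypothesis hg : is_frobenius_dR_path Fs g.
Local Notation A := (letter K false).
Local Notation B := (letter K true).
Local Notation C := (- A - B).
Implicit Types (f h : ncseries K bool).

(** Read off on an object of rank one, where both residues vanish. *)
Lemma g_nil : g [::] = 1.
Proof.
have l0 := @low_0 K 1 1; have := act_low hp hg l0 l0 => /(_ ord0 ord0 isT).
rewrite mxE /act big_ord1 (big_pred1 [tuple]) => [|v]; last first.
  by apply: esym; apply/eqP; apply: tuple0.
rewrite big_nil !mxE eqxx mulr1 => /eqP.
by rewrite subr_eq0 => /eqP.
Qed.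

Lemma letter_low d (x : bool) : low 1 (lmul d (letter K x)).
Proof. exact: lmul_low. Qed.

Lemma C_nil : (C : ncseries K bool) [::] = 0. Proof. by rewrite /= !oppr0 addr0. Qed.

Lemma eq_series f h : (forall d, lmul d f = lmul d h) -> f = h.
Proof. by move=> e; apply/ncseriesP => w; apply: (lmul_inj (e (size w))). Qed.

Theorem inversion_relation_g : inversion_relation g.
Proof.
apply: eq_series => d; rewrite lmulM !(lmul_subst false) // (act_inv hp hg) //; try exact: letter_low.
by rewrite lmul1.
Qed.

Let h := subst g C A * subst g B C * subst g A B.
Let b := subst g B A * B * subst g A B.

(** M is only available in each truncation, being built from [chi]; its square comes from a series,
    which inherits the commutation relations. *)
Lemma h_lmul d : exists M : 'M[K]_(size (wordlist bool d)),
  [/\ lmul d h = M *m M, M *m lmul d A = lmul d A *m M & M *m lmul d b = lmul d b *m M].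
Proof.
have lA : low 1 (lmul d A) by apply: letter_low.
have lB : low 1 (lmul d B) by apply: letter_low.
have lC : low 1 (lmul d C) by rewrite lmulD !lmulN; apply: lowB => //; apply: lowN.
have s : lmul d A + lmul d B + lmul d C = 0 by rewrite -!lmulD -opprD subrr lmul0.
exists (hex_monodromy (lmul d A) (lmul d B) (lmul d C)); split.
- rewrite -(hexagon_sq hp hg lA lB lC s) !lmulM !(lmul_subst false) //; exact: C_nil.
- exact: (hex_comm0 hp hg).
- have -> : lmul d b = invmx (act g (lmul d A) (lmul d B)) *m lmul d B *m act g (lmul d A) (lmul d B).
    rewrite !lmulM !(lmul_subst false) //; congr (_ *m _ *m _).
    have [u _ _] := frob_act hp hg lA lB.
    by apply: (can_inj (mulmxK u)); rewrite mulVmx // (act_inv hp hg).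
  exact: (hex_comm1 hp hg).
Qed.

Lemma h_comm : h * A = A * h /\ h * b = b * h.
Proof.
split; apply: eq_series => d; have [M [hM cA cb]] := h_lmul d; rewrite (lmulM d h) [RHS](lmulM d _ h) hM.
  by rewrite -mulmxA cA mulmxA cA mulmxA.
by rewrite -mulmxA cb mulmxA cb mulmxA.
Qed.

Lemma b_low : [/\ b [::] = 0, b [:: false] = 0 & b [:: true] = 1].
Proof.
have M1 f1 f2 x : (f1 * f2 : ncseries K bool) [:: x] = f1 [::] * f2 [:: x] + f1 [:: x] * f2 [::].
  by rewrite ncsM big_ord_recl big_ord1.
rewrite /b !M1 !ncs_nilM !subst_nil g_nil /= !(mulr0, mul0r, mul1r, mulr1, add0r, addr0).
by [].
Qed.

Theorem hexagon_series : h = 1.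
Proof.
have [cA cb] := h_comm; have [b0 b1 b2] := b_low.
apply/eqP; rewrite -subr_eq0; apply/eqP; apply: (comm_trivial _ b0 b1 b2).
- by rewrite ncsD ncsN ncs1 /h !ncs_nilM !subst_nil g_nil !mulr1 subrr.
- by rewrite mulrBl mulrBr cA mul1r mulr1.
- by rewrite mulrBl mulrBr cb mul1r mulr1.
Qed.

Lemma hexagon_relation_g : hexagon_relation g.
Proof. exact: hexagon_series. Qed.
End SeriesIdentities.

(** * Evaluation of series at triangular matrices *)

Section Evaluation.
Variables (K : fieldType) (N : nat) (A B : 'M[K]_N).
Hypotheses (lA : low 1 A) (lB : low 1 B).

Definition mword (X Y : 'M[K]_N) (v : seq bool) : 'M[K]_N := \prod_(i <- v) if i then Y else X.

Lemma mword_cons X Y x v : mword X Y (x :: v) = (if x then Y else X) *m mword X Y v.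
Proof. by rewrite /mword big_cons. Qed.

Lemma mword_low X Y v : low 1 X -> low 1 Y -> low (size v) (mword X Y v).
Proof.
move=> lX lY; elim: v => [|x v IH].
  rewrite /mword big_nil => i j; rewrite addn0 mxE; case: eqP => // ->.
  by rewrite ltnn.
by rewrite mword_cons; apply: lowSM => //; case: x.
Qed.

Lemma act_wide (phi : ncseries K bool) X Y m : low 1 X -> low 1 Y -> (N <= m)%N ->
  act phi X Y = \sum_(k < m) \sum_(v : k.-tuple bool) phi v *: mword X Y v.
Proof.
move=> lX lY Nm; rewrite /act (big_ord_widen m (fun k => \sum_(v : k.-tuple bool) phi v *: mword X Y v) Nm).
rewrite big_mkcond; apply: eq_bigr => k _; case: ltnP => // h.
rewrite big1 // => v _; rewrite (low_full (lowW _ (mword_low (v := v) lX lY))) ?scaler0 //.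
by rewrite size_tuple.
Qed.

Local Notation n := (size (wordlist bool N)).

Lemma letter_word (x : bool) v : letter K x * word K v = word K (x :: v).
Proof.
apply/ncseriesP => -[|y u]; first by rewrite ncs_nilM mul0r.
rewrite ncsM big_ord_recl take0 mul0r add0r big_ord_recl /= take0 drop0 big1 => [|t _]; last first.
  by rewrite /= eqseq_cons; case: u t => [[]//|z u] t; rewrite andbF mul0r.
by rewrite addr0 !eqseq_cons eqxx andbT; case: (y == x) => /=; rewrite ?mul1r ?mul0r.
Qed.

Section Column.
Variable c : 'I_N.
(** The word v is sent to v(A, B) applied to the c-th basis vector. This intertwines left
    multiplication by the letters with A and B; truncation does no harm, as words longer than N act
    by zero. *)
Definition evmx : 'M[K]_(N, n) := \matrix_(i, j) mword A B (wd j) i c.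

Lemma evmx_letter x : evmx *m lmul N (letter K x) = (if x then B else A) *m evmx.
Proof.
apply/matrixP => i j; rewrite [LHS]mxE.
have -> : ((if x then B else A) *m evmx) i j = mword A B (x :: wd j) i c.
  by rewrite mword_cons !mxE; apply: eq_bigr => k _; rewrite [evmx _ _]mxE.
transitivity (\sum_(k < n) (x :: wd j == wd k)%:R * mword A B (wd k) i c).
  by apply: eq_bigr => k _; rewrite !mxE letter_word mulrC eq_sym.
have [h|h] := leqP (size (x :: wd j)) N; first exact: (sum_wd (fun v => mword A B v i c) h).
rewrite (low_full (lowW (ltnW h) (mword_low (v := x :: wd j) lA lB))) mxE big1 // => k _.
by case: eqP => [e|]; rewrite ?mul0r //; have := size_wd k; rewrite -e leqNgt h.
Qed.

Lemma evmx_act (phi : ncseries K bool) (LX LY : 'M[K]_n) X Y : low 1 X -> low 1 Y ->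
  evmx *m LX = X *m evmx -> evmx *m LY = Y *m evmx ->
  evmx *m act phi LX LY = act phi X Y *m evmx.
Proof.
move=> lX lY hX hY; rewrite (act_wide phi lX lY (ltnW (wordlist_size true N))).
rewrite /act mulmx_sumr mulmx_suml; apply: eq_bigr => k _.
rewrite mulmx_sumr mulmx_suml; apply: eq_bigr => v _.
rewrite -scalemxAr -scalemxAl; congr (_ *: _).
elim: (tval v) => [|x s IH]; first by rewrite /mword !big_nil mulmx1 mul1mx.
rewrite mword_cons big_cons [evmx *m _]mulmxA; case: x; rewrite ?hX ?hY -!mulmxA IH //.
Qed.
End Column.
End Evaluation.

Section ChiAct.
Variables (p : nat) (hp : prime p) (K : padicField p).
Variables (Fs : forall E : micUni K, frobPullback E) (g : ncseries K bool).
Hypothesis hg : is_frobenius_dR_path Fs g.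
Variables (N : nat) (A B C : 'M[K]_N).
Hypotheses (lA : low 1 A) (lB : low 1 B) (lC : low 1 C) (s : A + B + C = 0).

(** The identity of series is carried over by [evmx], whose column at the empty word is the c-th
    basis vector. *)
Lemma hexagon_act : act g C A *m act g B C *m act g A B = 1%:M.
Proof.
apply/matrixP => i c.
pose R := evmx A B c.
have hA : R *m lmul N (letter K false) = A *m R by exact: (evmx_letter lA lB c false).
have hB : R *m lmul N (letter K true) = B *m R by exact: (evmx_letter lA lB c true).
have eC : C = - A - B by rewrite -opprD; apply/eqP; rewrite -addr_eq0 -s; apply/eqP; exact: addrC.
have hC : R *m lmul N (- letter K false - letter K true) = C *m R.
  by rewrite lmulD !lmulN mulmxDr !mulmxN hA hB eC mulmxDl !mulNmx.
have h : act g C A *m act g B C *m act g A B *m R = R.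
  rewrite -[RHS]mulmx1 -(lmul1 K bool N) -(hexagon_series hp hg) !lmulM !(lmul_subst false) //; try exact: C_nil.
  rewrite -!mulmxA; rewrite (mulmxA R) (evmx_act g lC lA hC hA) -mulmxA; congr (_ *m _).
  rewrite (mulmxA R) (evmx_act g lB lC hB hC) -mulmxA; congr (_ *m _).
  by rewrite (evmx_act g lA lB hA hB).
have [j hj] := wdP (leq0n N : (size ([::] : seq bool) <= N)%N).
have Rj k : R k j = (k == c)%:R by rewrite mxE hj /mword big_nil mxE.
move: (act g C A *m _ *m _) h => T /(congr1 (fun T : 'M[K]_(N, _) => T i j)).
rewrite Rj => e; rewrite [RHS]mxE -e.
rewrite mxE (bigD1 c) //= Rj eqxx mulr1 big1 ?addr0 // => k kc.
by rewrite Rj (negbTE kc) mulr0.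
Qed.

(** Now M is a unipotent involution, so M = 1; thus chi(C, A) chi(A, B) = chi(B, C)^-1 = chi(A,
    C). *)
Lemma chi_act : chi A C = act g A B.
Proof.
have M1 : hex_monodromy A B C = 1%:M.
  apply: (unitri_involution hp); last exact: (hex_monodromy_low hp).
  by rewrite -(hexagon_sq hp hg lA lB lC s) hexagon_act.
have uy : chi B C \in unitmx by apply: (chi_unit hp).
apply: (can_inj (mulmxK uy)).
have -> : A = - B - C by apply/eqP; rewrite -opprD -addr_eq0 addrA s.
rewrite (chi_flip hp lB lC).
have -> : - B - C = A by apply/eqP; rewrite eq_sym -opprD -addr_eq0 addrA s.
rewrite (act_chi hp hg lA lB s); apply: esym; apply: mulmx1C.
by rewrite mulmxA.
Qed.
End ChiAct.

(** * The pentagon for matrices *)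

Section ConjUnitri.
Variables (p : nat) (hp : prime p) (K : padicField p) (N : nat).
Implicit Types (X Y Z U : 'M[K]_N).

Definition uconj X Y := exists2 U, low 1 (U - 1%:M) & X *m U = U *m Y.

Lemma uconj_refl X : uconj X X.
Proof. by exists 1%:M; rewrite ?subrr ?mulmx1 ?mul1mx //; apply: low_0. Qed.

Lemma uconj_trans Y X Z : uconj X Y -> uconj Y Z -> uconj X Z.
Proof.
move=> [U lU hU] [V lV hV]; exists (U *m V); first exact: low_mulmx1.
by rewrite mulmxA hU -(mulmxA U Y) hV mulmxA.
Qed.

Lemma uconj_sym U X Y : low 1 (U - 1%:M) -> Y *m U = U *m X -> uconj X Y.
Proof.
move=> lU h; have uU := unimx_unit lU; exists (invmx U); first exact: low_invmx1.
by apply: (can_inj (mulmxK uU)); apply: (can_inj (mulKmx uU)); rewrite !mulmxA mulmxKV // mulmxV // mul1mx h.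
Qed.

(** Unipotent conjugation does not change the leading term of X - 1 along the subdiagonals, while
    inversion changes its sign. *)
Lemma uconj_inv_eq1 X Y : low 1 (X - 1%:M) -> X *m Y = 1%:M -> uconj X Y -> X = 1%:M.
Proof.
move=> lX hY [U lU hU].
have e : X *m U *m X = U by rewrite hU -mulmxA (mulmx1C hY) mulmx1.
pose D := X - 1%:M; pose V := U - 1%:M.
have n2 : 2 != 0 :> K by apply: natr_neq0.
have eX : X = D + 1%:M by rewrite subrK.
have eU : U = V + 1%:M by rewrite subrK.
have lD : low 1 D := lX.
have lV : low 1 V := lU.
clearbody D V.
have lD0 : low 0 U.
  rewrite eU; apply: lowD; first exact: lowW lV.
  by move=> i j ij; rewrite mxE; case: eqP ij => // ->; rewrite addn0 ltnn.
(* This is X U X = U expanded at X = 1 + D and U = 1 + V; each term on the right lies below D in the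
   filtration. *)
have eD : D = (- 2^-1) *: (D *m V + V *m D + D *m U *m D).
  have e1 : D *m U *m D + D *m U + U *m D = 0.
    have : (D + 1%:M) *m U *m (D + 1%:M) = U by rewrite -eX.
    rewrite !mulmxDr !mulmxDl !mul1mx !mulmx1.
    move: (U *m D) (D *m U) (D *m U *m D) => c b a h.
    have -> : a + b + c = (a + c + (b + U)) - U by apply/matrixP => i j; rewrite !mxE; ring.
    by rewrite h subrr.
  have e2 : D *m U = D *m V + D by rewrite {1}eU mulmxDr mulmx1.
  have e3 : U *m D = V *m D + D by rewrite {1}eU mulmxDl mul1mx.
  move: e1; rewrite e2 e3.
  move: (D) (V *m D) (D *m V) ((D *m V + D) *m D) => D' b a c h.
  apply/eqP; rewrite -subr_eq0; apply/eqP.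
  have -> : D' - - 2^-1 *: (a + b + c) = 2^-1 *: (c + (a + D') + (b + D')).
    by apply/matrixP => i j; rewrite !mxE; field.
  by rewrite h scaler0.
have main k : low k.+1 D.
  elim: k => // k IH; rewrite eD; apply: lowZ; apply: lowD; last first.
    by apply: lowMS lD; have := lowM IH lD0; rewrite addn0.
  by apply: lowD; [apply: lowMS | apply: lowSM].
by rewrite eX (low_full (lowW (leqnSn N) (main N))) add0r.
Qed.
End ConjUnitri.

Section Pentagon.
Variables (p : nat) (hp : prime p) (K : padicField p).
Variables (Fs : forall E : micUni K, frobPullback E) (g : ncseries K bool).
Hypothesis hg : is_frobenius_dR_path Fs g.
Variable N : nat.
Implicit Types (X Y Z W z : 'M[K]_N) (e : nat -> nat -> 'M[K]_N).
Local Notation G := (act g).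

(** g is a ratio of two values of [chi], each invariant under central shifts. *)
Lemma act_shift0 X Y z : low 1 X -> low 1 Y -> low 1 z -> z *m X = X *m z -> z *m Y = Y *m z ->
  G (X + z) Y = G X Y.
Proof.
move=> lX lY lz zX zY.
have [_ h _] := frob_act hp hg lX lY; have [_ h' _] := frob_act hp hg (lowD lX lz) lY.
apply: (can_inj (mulKmx (chi_unit hp lY lX))); rewrite h.
by rewrite -(chi_shift1 hp lY lX lz zY zX) h' (chi_shift0 hp lX lY lz zX zY).
Qed.

Lemma act_shift1 X Y z : low 1 X -> low 1 Y -> low 1 z -> z *m X = X *m z -> z *m Y = Y *m z ->
  G X (Y + z) = G X Y.
Proof.
move=> lX lY lz zX zY.
have [_ h _] := frob_act hp hg lX lY; have [_ h' _] := frob_act hp hg lX (lowD lY lz).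
apply: (can_inj (mulKmx (chi_unit hp lY lX))); rewrite h.
by rewrite -(chi_shift0 hp lY lX lz zY zX) h' (chi_shift1 hp lX lY lz zX zY).
Qed.

Section Triple.
Variables X Y Z W : 'M[K]_N.
Hypotheses (lX : low 1 X) (lY : low 1 Y) (lZ : low 1 Z) (lW : low 1 W) (s : X + Y + Z = W).
Hypotheses (cX : W *m X = X *m W) (cY : W *m Y = Y *m W).

(** W commutes with X and Y, so subtracting it from Y brings the sum to zero without affecting g. *)
Lemma chi_triple : chi X Z = G X Y.
Proof.
have e : X + (Y - W) + Z = 0 by rewrite -s; apply/matrixP => i j; rewrite !mxE; ring.
rewrite (chi_act hp hg lX (lowB lY lW) lZ e); apply: act_shift1 => //; first exact: lowN.
  by rewrite mulNmx mulmxN cX.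
by rewrite mulNmx mulmxN cY.
Qed.

Lemma hexagon_triple : G Z X *m G Y Z *m G X Y = 1%:M.
Proof.
have e : X + Y + (Z - W) = 0 by rewrite -s; apply/matrixP => i j; rewrite !mxE; ring.
have cZ : - W *m Z = Z *m - W.
  have -> : Z = W - X - Y by rewrite -s; apply/matrixP => i j; rewrite !mxE; ring.
  by rewrite !mulNmx !mulmxN !mulmxBr !mulmxBl cX cY.
have h := hexagon_act hp hg lX lY (lowB lZ lW) e.
rewrite -[RHS]h act_shift0 ?act_shift1 //; try exact: lowN; by rewrite mulNmx mulmxN ?cX ?cY.
Qed.
End Triple.

(** Indices are natural numbers, so that a relabelling is given by a list. *)
Record braid5 e : Prop := Braid5 {
  braid_low : forall i j, low 1 (e i j);
  braid_sym : forall i j, e i j = e j i;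
  braid_diag : forall i, e i i = 0;
  braid_row : forall i, (i < 5)%N -> \sum_(j <- iota 0 5) e i j = 0;
  braid_comm : forall i j k l, all (gtn 5) [:: i; j; k; l] -> uniq [:: i; j; k; l] ->
    e i j *m e k l = e k l *m e i j
}.

Definition relab (s : seq nat) e i j := e (nth 0%N s i) (nth 0%N s j).

Lemma braid5_relab s e : perm_eq s (iota 0 5) -> braid5 e -> braid5 (relab s e).
Proof.
move=> hs [h1 h2 h3 h4 h5]; have ss : size s = 5%N by rewrite (perm_size hs) size_iota.
have lt5 i : (i < 5)%N -> (nth 0%N s i < 5)%N.
  move=> i5; have : nth 0%N s i \in iota 0 5 by rewrite -(perm_mem hs) mem_nth ?ss.
  by rewrite mem_iota.
split; rewrite /relab => //.
- move=> i i5; rewrite -[RHS](h4 _ (lt5 i i5)).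
  have eqs : map (nth 0%N s) (iota 0 5) = s by rewrite -{1}ss -/(mkseq _ _) mkseq_nth.
  have gen (F : nat -> 'M[K]_N) : \sum_(j <- iota 0 5) F (nth 0%N s j) = \sum_(j <- s) F j.
    by rewrite -{2}eqs big_map.
  by rewrite (gen (fun j => e (nth 0%N s i) j)); apply: perm_big.
- move=> i j k l hl ul; apply: h5.
    by move: hl => /= /and5P [hi hj hk hl _]; rewrite !lt5.
  rewrite -[[:: nth _ _ i; _; _; _]]/(map (nth 0%N s) [:: i; j; k; l]) map_inj_in_uniq //.
  have us : uniq s by rewrite (perm_uniq hs) iota_uniq.
  move=> x y hx hy /eqP; rewrite nth_uniq ?ss; first by move/eqP.
  + by move/allP: hl => /(_ _ hx).
  + by move/allP: hl => /(_ _ hy).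
  + exact: us.
Qed.

(** The sum of the rows a, b, c minus the rows d, f is twice the identity. *)
Lemma braid_sum3 e a b c d f : braid5 e -> perm_eq [:: a; b; c; d; f] (iota 0 5) ->
  e a b + e b c + e a c = e d f.
Proof.
move=> [h1 h2 h3 h4 h5] hs.
have row x : x \in [:: a; b; c; d; f] -> e x a + e x b + e x c + e x d + e x f = 0.
  rewrite (perm_mem hs) mem_iota => hx; rewrite -[RHS](h4 x hx) -(perm_big _ hs) /=.
  by rewrite !big_cons big_nil addr0 !addrA.
have n2 : 2 != 0 :> K by apply: natr_neq0.
apply/matrixP => i j; apply: (mulfI n2).
have ent x : x \in [:: a; b; c; d; f] -> e x a i j + e x b i j + e x c i j + e x d i j + e x f i j = 0.
  by move=> /row/(congr1 (fun T : 'M[K]_N => T i j)); rewrite !mxE.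
move: (ent a) (ent b) (ent c) (ent d) (ent f); rewrite !inE !eqxx !orbT => /(_ isT) ea /(_ isT) eb /(_ isT) ec /(_ isT) ed /(_ isT) ef.
move: ea eb ec ed ef.
rewrite !h3 !mxE (h2 b a) (h2 c a) (h2 c b) (h2 d a) (h2 d b) (h2 d c) (h2 f a) (h2 f b) (h2 f c) (h2 f d).
move: (e a b i j) (e a c i j) (e a d i j) (e a f i j) (e b c i j) (e b d i j) (e b f i j) (e c d i j) (e c f i j) (e d f i j).
move=> ab ac ad af bc bd bf cd cf df r1 r2 r3 r4 r5.
apply/eqP; rewrite -subr_eq0; apply/eqP.
have -> : 2 * (ab + bc + ac) - 2 * df = (0 + ab + ac + ad + af) + (ab + 0 + bc + bd + bf) + (ac + bc + 0 + cd + cf)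
   - (ad + bd + cd + 0 + df) - (af + bf + cf + df + 0) by ring.
by rewrite r1 r2 r3 r4 r5; ring.
Qed.

(** The sum of the three generators on a, b, c is e_df, which commutes with them, so [chi_triple]
    applies. *)
Lemma braid_chi e a b c d f : braid5 e -> perm_eq [:: a; b; c; d; f] (iota 0 5) ->
  chi (e a b) (e b c) = G (e a b) (e a c).
Proof.
move=> he hs; have := braid_sum3 he hs => s3.
have [h1 h2 h3 h4 h5] := he.
have al : all (gtn 5) [:: a; b; c; d; f] by rewrite (perm_all _ hs).
have un : uniq [:: a; b; c; d; f] by rewrite (perm_uniq hs).
apply: (chi_triple (W := e d f)) => //.
- by rewrite -s3 addrAC.
- by apply: h5; [move: al => /=; lia | move: un; rewrite /= !inE; lia].
- by apply: h5; [move: al => /=; lia | move: un; rewrite /= !inE; lia].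
Qed.
End Pentagon.

(** The factor b is solved from the six-term equation; two three-term relations and the inverses
    then collapse the product. *)
Lemma pentagon_algebra (R : comPzRingType) N (a b c d f f' k l m m' q r r' s s' t u : 'M[R]_N) :
  f *m f' = 1%:M -> d *m k *m s = 1%:M -> s *m s' = 1%:M -> q *m a *m r' = 1%:M -> r' *m r = 1%:M ->
  m' *m m = 1%:M -> m *m r *m b = t *m s *m u -> u *m c = 1%:M -> t *m l = 1%:M ->
  (a *m b *m c *m d *m f) *m (f' *m k *m l *m m *m q) = 1%:M.
Proof.
move=> ff dks ss qar rr mm h uc tl.
have dk : d *m k = s' by rewrite -[d *m k]mulmx1 -ss mulmxA dks mul1mx.
have eb : b = r' *m m' *m t *m s *m u.
  rewrite -[LHS]mul1mx -rr -[r' *m r]mulmx1.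
  rewrite -!mulmxA; congr (_ *m _); rewrite mul1mx.
  by rewrite -[r *m b]mul1mx -mm -[m' *m m *m _]mulmxA [m *m (r *m b)]mulmxA h !mulmxA.
have e1 : b *m c *m d *m k *m l *m m = r'.
  rewrite -[b *m c *m d *m k]mulmxA dk eb -!mulmxA (mulmxA u) uc mul1mx (mulmxA s) ss mul1mx (mulmxA t) tl mul1mx.
  by rewrite mm mulmx1.
have -> : (a *m b *m c *m d *m f) *m (f' *m k *m l *m m *m q) = a *m (b *m c *m d *m k *m l *m m) *m q.
  by rewrite -!mulmxA (mulmxA f) ff mul1mx.
by rewrite e1; apply: mulmx1C; rewrite mulmxA.
Qed.

Section Pentagon.
Variables (p : nat) (hp : prime p) (K : padicField p).
Variables (Fs : forall E : micUni K, frobPullback E) (g : ncseries K bool).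
Hypothesis hg : is_frobenius_dR_path Fs g.
Variable N : nat.
Implicit Types (e : nat -> nat -> 'M[K]_N).
Local Notation G := (act g).

Definition penta e a b c d f : 'M[K]_N :=
  G (e c d) (e d f) *m G (e f a) (e a b) *m G (e b c) (e c d) *m G (e d f) (e f a) *m G (e a b) (e b c).

Section Braid.
Variable e : nat -> nat -> 'M[K]_N.
Hypothesis he : braid5 e.

Lemma GV i j k l : G (e i j) (e k l) *m G (e k l) (e i j) = 1%:M.
Proof. by apply: (act_inv hp hg); apply: braid_low he _ _. Qed.

Lemma penta_rev a b c d f : penta e f d c b a *m penta e a b c d f = 1%:M.
Proof.
rewrite /penta (braid_sym he c b) (braid_sym he b a) (braid_sym he a f) (braid_sym he f d) (braid_sym he d c).
have V i j k l : G (e i j) (e k l) *m G (e k l) (e i j) = 1%:M by apply: GV.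
rewrite -!mulmxA.
by rewrite (mulmxA (G (e d f) (e c d))) V mul1mx (mulmxA (G (e a b) (e f a))) V mul1mx
  (mulmxA (G (e c d) (e b c))) V mul1mx (mulmxA (G (e f a) (e d f))) V mul1mx V.
Qed.

Lemma penta_low a b c d f : low 1 (penta e a b c d f - 1%:M).
Proof.
by do 4 (apply: low_mulmx1; last by apply: (act_low hp hg); apply: braid_low he _ _);
  apply: (act_low hp hg); apply: braid_low he _ _.
Qed.

Lemma penta_rot a b c d f : uconj (penta e a b c d f) (penta e b c d f a).
Proof.
apply: (uconj_sym (U := G (e d f) (e f a) *m G (e a b) (e b c))).
  by apply: low_mulmx1; apply: (act_low hp hg); apply: braid_low he _ _.
by rewrite /penta !mulmxA.
Qed.

Lemma hex a b c d f : perm_eq [:: a; b; c; d; f] (iota 0 5) ->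
  G (e c a) (e a b) *m G (e b c) (e c a) *m G (e a b) (e b c) = 1%:M.
Proof.
move=> hs; have s3 := braid_sum3 hp he hs.
have al : all (gtn 5) [:: a; b; c; d; f] by rewrite (perm_all _ hs).
have un : uniq [:: a; b; c; d; f] by rewrite (perm_uniq hs).
have l := braid_low he; rewrite (braid_sym he c a).
apply: (hexagon_triple hp hg (W := e d f)) => //.
- by apply: (braid_comm he); [move: al => /=; lia | move: un; rewrite /= !inE; lia].
- by apply: (braid_comm he); [move: al => /=; lia | move: un; rewrite /= !inE; lia].
Qed.

Lemma chi_shift_sum a b c d f Z : perm_eq [:: a; b; c; d; f] (iota 0 5) ->
  low 1 Z -> e a c *m Z = Z *m e a c -> chi (e a b + e b c) Z = chi (e d f) Z.
Proof.
move=> hs lZ cZ; have s3 := braid_sum3 hp he hs.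
have al : all (gtn 5) [:: a; b; c; d; f] by rewrite (perm_all _ hs).
have un : uniq [:: a; b; c; d; f] by rewrite (perm_uniq hs).
have l := braid_low he.
have -> : e a b + e b c = e d f + - e a c by rewrite -s3 addrK.
apply: (chi_shift0 hp) => //; first exact: lowN.
- rewrite mulNmx mulmxN; congr (- _).
  by apply: (braid_comm he); [move: al => /=; lia | move: un; rewrite /= !inE; lia].
- by rewrite mulNmx mulmxN cZ.
Qed.

(** e_ab commutes with e_df, which is e_ab + e_bc + e_ac. *)
Lemma br_sum a b c d f : perm_eq [:: a; b; c; d; f] (iota 0 5) ->
  br (e a b) (e b c) + br (e a b) (e a c) = 0.
Proof.
move=> hs; have s3 := braid_sum3 hp he hs.
have al : all (gtn 5) [:: a; b; c; d; f] by rewrite (perm_all _ hs).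
have un : uniq [:: a; b; c; d; f] by rewrite (perm_uniq hs).
have cm : e d f *m e a b = e a b *m e d f.
  by apply: (braid_comm he); [move: al => /=; lia | move: un; rewrite /= !inE; lia].
move: cm; rewrite -s3 /br !mulmxDl !mulmxDr.
move: (e a b *m e a b) (e a b *m e b c) (e b c *m e a b) (e a b *m e a c) (e a c *m e a b) => x y z w v h.
have -> : y - z + (w - v) = (x + y + w) - (x + z + v) by apply/matrixP => i j; rewrite !mxE; ring.
by rewrite h subrr.
Qed.

Lemma br_anti (A B : 'M[K]_N) : br A B = - br B A.
Proof. by rewrite /br opprB. Qed.

(** The KZ connection on the chart has residues e_01, e_34, e_12, e_23, e_13 along x = 0, y = 0, x =
    1, y = 1, x y = 1. The two ways around the hexagon from (0, 0) to (oo, oo) give two products of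
    three values of [chi]; each value is one of g by [braid_chi], if necessary after a central
    shift. *)
Lemma six_term :
  G (e 0 2) (e 0 3) *m G (e 3 4) (e 1 4) *m G (e 0 1) (e 0 2) =
  G (e 2 4) (e 1 4) *m G (e 0 1) (e 0 3) *m G (e 3 4) (e 2 4).
Proof.
have sy := braid_sym he; have l := braid_low he.
have cm i j k m : all (gtn 5) [:: i; j; k; m] -> uniq [:: i; j; k; m] -> br (e i j) (e k m) = 0.
  by move=> h h'; rewrite /br (braid_comm he h h') subrr.
have fl : flat (e 0 1) (e 3 4) (e 1 2) (e 2 3) (e 1 3).
  split; split; try exact: cm.
  - have row : e 3 0 + e 3 1 + e 3 2 + e 3 4 = 0.
      have := braid_row he (isT : (3 < 5)%N); rewrite /= !big_cons big_nil (braid_diag he) addr0 add0r.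
      by rewrite !addrA.
    have b1 := @br_sum 1 3 0 2 4 isT; have b2 := @br_sum 1 3 2 0 4 isT.
    have b3 := @br_sum 2 1 3 0 4 isT.
    have : br (e 1 3) (e 3 0 + e 3 1 + e 3 2 + e 3 4) = 0 by rewrite row /br mulmx0 mul0mx subrr.
    have brD (A B D : 'M[K]_N) : br A (B + D) = br A B + br A D.
      by rewrite /br mulmxDr mulmxDl opprD addrACA.
    have brN : br (e 1 3) (e 3 1) = 0 by rewrite (sy 3 1) /br subrr.
    move: b1 b2 b3; rewrite !brD brN (sy 3 2) (sy 3 0) (sy 1 0) (sy 2 1) (br_anti (e 1 3) (e 0 1)) (br_anti (e 1 3) (e 1 2)).
    move: (br _ _) (br _ _) (br _ _) (br _ _) (br _ _) (br _ _) => x y z w v t.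
    move=> r1 r2 r3 r4; apply/matrixP => i j.
    move: (congr1 (fun T : 'M[K]_N => T i j) r1) (congr1 (fun T : 'M[K]_N => T i j) r2)
      (congr1 (fun T : 'M[K]_N => T i j) r3) (congr1 (fun T : 'M[K]_N => T i j) r4).
    rewrite !mxE; move: (x i j) (y i j) (z i j) (w i j) (v i j) (t i j) => x' y' z' w' v' t'.
    move=> q1 q2 q3 q4; have -> : v' + x' - y' = (t' + 0 + w' + x') - (t' - v') - (w' - z') - (z' + y') by ring.
    by rewrite q1 q2 q3 q4; ring.
  - by have := @br_sum 2 1 3 0 4 isT; rewrite (sy 2 1).
  - have := @br_sum 2 3 1 0 4 isT; rewrite (sy 3 1) (sy 2 1) (br_anti (e 2 3)) (br_anti (e 2 3)) -opprD.
    by move/eqP; rewrite oppr_eq0 => /eqP.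
have [V [uV [[h1 h2 h3] [h4 h5 h6]]]] := chart_edges hp (l 0 1) (l 3 4) (l 1 2) (l 2 3) (l 1 3) fl.
have L2 i j k m : low 1 (e i j + e k m) by apply: lowD.
move/(chi_edge hp (l _ _) (l _ _)): h1 => h1; move/(chi_edge hp (L2 _ _ _ _) (l _ _)): h2 => h2.
move/(chi_edge hp (L2 _ _ _ _) (l _ _)): h3 => h3; move/(chi_edge hp (L2 _ _ _ _) (l _ _)): h4 => h4.
move/(chi_edge hp (l _ _) (l _ _)): h5 => h5; move/(chi_edge hp (l _ _) (l _ _)): h6 => h6.
have cm' i j k m : all (gtn 5) [:: i; j; k; m] -> uniq [:: i; j; k; m] -> e i j *m e k m = e k m *m e i j.
  exact: (braid_comm he).
apply: (can_inj (mulmxK (unimx_unit (uV true true true)))).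
have c1 : chi (e 0 1) (e 1 2) = G (e 0 1) (e 0 2) := @braid_chi _ hp _ _ _ hg _ _ 0 1 2 3 4 he isT.
have c2 : chi (e 0 1 + e 1 2) (e 1 3) = G (e 3 4) (e 1 4).
  rewrite (@chi_shift_sum 0 1 2 3 4) //; last by apply: cm'.
  by rewrite (sy 3 4) (sy 1 3) (sy 1 4); apply: (@braid_chi _ hp _ _ _ hg _ _ 4 3 1 0 2).
have c3 : chi (e 3 4 + e 1 3) (e 2 3) = G (e 0 2) (e 0 3).
  rewrite addrC (@chi_shift_sum 1 3 4 0 2) //; last by apply: cm'.
  by apply: (@braid_chi _ hp _ _ _ hg _ _ 0 2 3 1 4).
have c4 : chi (e 0 1 + e 1 3) (e 1 2) = G (e 2 4) (e 1 4).
  rewrite (@chi_shift_sum 0 1 3 2 4) //; last by apply: cm'.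
  by rewrite (sy 2 4) (sy 1 2) (sy 1 4); apply: (@braid_chi _ hp _ _ _ hg _ _ 4 2 1 0 3).
have c5 : chi (e 0 1) (e 1 3) = G (e 0 1) (e 0 3) := @braid_chi _ hp _ _ _ hg _ _ 0 1 3 2 4 he isT.
have c6 : chi (e 3 4) (e 2 3) = G (e 3 4) (e 2 4).
  by rewrite (sy 3 4) (sy 2 3) (sy 2 4); apply: (@braid_chi _ hp _ _ _ hg _ _ 4 3 2 0 1).
rewrite -!c1 -!c2 -!c3 -!c4 -!c5 -!c6.
by rewrite -!mulmxA -h1 -h2 -h3 -h6 -h5 -h4.
Qed.

(** The product for (3, 1, 4, 2, 0) is inverse to that for (0, 2, 4, 1, 3) by reversal, and to that
    for (0, 2, 4, 3, 1) by [six_term] and two hexagons. *)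
Lemma penta_swap0 : penta e 0 2 4 3 1 = penta e 0 2 4 1 3.
Proof.
have sy := braid_sym he.
have h : penta e 0 2 4 3 1 *m penta e 3 1 4 2 0 = 1%:M.
  rewrite /penta (sy 4 3) (sy 3 1) (sy 1 0) (sy 4 2) (sy 2 0).
  have hx1 : G (e 1 3) (e 0 1) *m G (e 0 3) (e 1 3) *m G (e 0 1) (e 0 3) = 1%:M.
    by have := @hex 1 0 3 2 4 isT; rewrite (sy 3 1) (sy 1 0).
  have hx2 : G (e 1 3) (e 1 4) *m G (e 3 4) (e 1 3) *m G (e 1 4) (e 3 4) = 1%:M.
    by have := @hex 1 4 3 0 2 isT; rewrite (sy 3 1) (sy 4 3).
  by apply: (pentagon_algebra _ hx1 _ hx2 _ _ six_term); apply: GV.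
have h' := penta_rev 0 2 4 1 3.
by rewrite -[LHS]mulmx1 -h' mulmxA h mul1mx.
Qed.
End Braid.

Section Relabel.
Variable e : nat -> nat -> 'M[K]_N.
Hypothesis he : braid5 e.

Lemma penta_swap a b c d f : perm_eq [:: a; b; c; d; f] (iota 0 5) ->
  penta e a b c d f = penta e a b c f d.
Proof.
move=> hs; have ht : perm_eq [:: a; f; b; d; c] (iota 0 5).
  by rewrite -(permPr hs); apply/permP => P /=; lia.
exact: (penta_swap0 (braid5_relab ht he)).
Qed.

Theorem penta_eq1 : penta e 0 1 2 3 4 = 1%:M.
Proof.
apply: (uconj_inv_eq1 hp (penta_low he _ _ _ _ _) (mulmx1C (penta_rev he 0 1 2 3 4))).
(* Rotations and exchanges of the last two indices lead from (0, 1, 2, 3, 4) to (4, 3, 2, 1, 0). *)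
apply: uconj_trans (penta_rot he 0 1 2 3 4) _; rewrite (@penta_swap 1 2 3 4 0) //.
apply: uconj_trans (penta_rot he 1 2 3 0 4) _; rewrite (@penta_swap 2 3 0 4 1) //.
apply: uconj_trans (penta_rot he 2 3 0 1 4) _; apply: uconj_trans (penta_rot he 3 0 1 4 2) _.
rewrite (@penta_swap 0 1 4 2 3) //.
apply: uconj_trans (penta_rot he 0 1 4 3 2) _; apply: uconj_trans (penta_rot he 1 4 3 2 0) _.
rewrite (@penta_swap 4 3 2 0 1) //; exact: uconj_refl.
Qed.
End Relabel.
End Pentagon.

(** * Series modulo an ideal *)

(** Among the matrices with all rows in D, one of maximal rank spans D. *)
Lemma subspace_mx (F : fieldType) n (D : 'rV[F]_n -> Prop) :
  D 0 -> (forall u v, D u -> D v -> D (u + v)) -> (forall c u, D u -> D (c *: u)) ->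
  exists M : 'M[F]_n, forall u, D u <-> (u <= M)%MS.
Proof.
move=> D0 DD DZ.
have Dsum (I : Type) (s : seq I) (f : I -> 'rV[F]_n) : (forall i, D (f i)) -> D (\sum_(i <- s) f i).
  by move=> h; elim: s => [|i s IH]; rewrite ?big_nil // big_cons; apply: DD.
have Dsub m (M : 'M[F]_(m, n)) : (forall i, D (row i M)) -> forall u, (u <= M)%MS -> D u.
  move=> h u /submxP [w ->]; rewrite mulmx_sum_row; apply: Dsum => i; exact: DZ.
pose P r := `[< exists M : 'M[F]_n, (forall i, D (row i M)) /\ \rank M = r >].
have ex : exists r, P r.
  by exists 0%N; apply/asboolP; exists 0; split; [move=> i; rewrite row0 | rewrite mxrank0].
have bd r : P r -> (r <= n)%N by move=> /asboolP [M [_ <-]]; apply: rank_leq_row.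
case: (ex_maxnP ex bd) => r /asboolP [M [hM rM]] mx; exists M => u; split; last exact: Dsub.
move=> Du; have hMu i : D (row i (M + u)%MS).
  have /sub_addsmxP [[w1 w2] /= ->] : (row i (M + u)%MS <= M + u)%MS by apply: row_sub.
  apply: DD; first exact: Dsub hM _ (submxMl _ _).
  by rewrite [w2]mx11_scalar mul_scalar_mx; apply: DZ.
have rk : (\rank (M + u)%MS <= \rank M)%N by rewrite rM; apply: mx; apply/asboolP; exists (M + u)%MS.
have /mxrank_leqif_sup [h1 h2] := addsmxSl M u.
have : \rank M == \rank (M + u)%MS by rewrite eqn_leq h1.
by rewrite h2; apply: submx_trans; apply: addsmxSr.
Qed.

Lemma mul_col0 (F : fieldType) m n (A : 'M[F]_(m, n)) : (forall v : 'cV[F]_n, A *m v = 0) -> A = 0.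
Proof.
move=> h; apply/matrixP => i j; have := congr1 (fun T : 'cV[F]_m => T i 0) (h (delta_mx j 0)).
by rewrite -colE !mxE.
Qed.

Section IdealRep.
Variables (K : fieldType) (X : finType) (x0 : X) (S : ncseries K X -> Prop).
Implicit Types (f g h r : ncseries K X).
Hypothesis hS : forall r, S r -> exists m, forall w, size w != m -> r w = 0.
Local Notation I := (two_sided_ideal S).

Lemma idealMl f h : I h -> I (f * h).
Proof.
elim=> [|h1 h2 _ i1 _ i2|f' r g' Sr]; first by rewrite mulr0; apply: Ideal0.
  by rewrite mulrDr; apply: IdealD.
by rewrite !mulrA; apply: IdealM.
Qed.

Lemma ideal_sum (T : Type) (s : seq T) (F : T -> ncseries K X) : (forall i, I (F i)) -> I (\sum_(i <- s) F i).
Proof.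
move=> hF; elim: s => [|i s IH]; first by rewrite big_nil; apply: Ideal0.
by rewrite big_cons; apply: IdealD.
Qed.

Definition hom k f : ncseries K X := NcSeries (fun w => if size w == k then f w else 0).

Lemma homM k f g : hom k (f * g) = \sum_(i < k.+1) hom i f * hom (k - i)%N g.
Proof.
apply/ncseriesP => w.
have sumE (s : seq 'I_k.+1) F : (\sum_(i <- s) F i : ncseries K X) w = \sum_(i <- s) (F i : ncseries K X) w.
  by elim: s => [|i s IH]; rewrite ?big_nil // !big_cons ncsD IH.
have -> : hom k (f * g) w = if size w == k then (f * g) w else 0 by [].
rewrite sumE; case: eqP => [<-|wk].
  rewrite ncsM; apply: eq_bigr => i _; rewrite ncsM (bigD1 i) //= size_take_min size_drop.
  have iw : (i <= size w)%N by rewrite -ltnS.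
  rewrite (minn_idPl iw) !eqxx big1 ?addr0 // => t ti.
  have tw : (t <= size w)%N by rewrite -ltnS.
  rewrite size_take_min (minn_idPl tw); case: eqP => [e|]; last by rewrite mul0r.
  by move: ti; rewrite -val_eqE /= e eqxx.
rewrite big1 // => i _; rewrite ncsM big1 // => t _ /=.
have tw : (t <= size w)%N by rewrite -ltnS.
have ik : (i <= k)%N by rewrite -ltnS.
rewrite size_take_min size_drop (minn_idPl tw); case: eqP => [ti|]; rewrite ?mul0r //.
case: eqP => [e|]; rewrite ?mulr0 //; case: wk; move: e tw ik; rewrite ti => e iw ik.
by rewrite -(subnK iw) e subnK.
Qed.

Lemma ideal_hom k f : I f -> I (hom k f).
Proof.
elim=> [|f1 f2 _ i1 _ i2|f' r g' Sr].
- have -> : hom k 0 = 0 by apply/ncseriesP => w /=; case: ifP.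
  exact: Ideal0.
- have -> : hom k (f1 + f2) = hom k f1 + hom k f2 by apply/ncseriesP => w /=; case: ifP; rewrite ?addr0.
  exact: IdealD.
have [m hm] := hS Sr.
have hr i : hom i r = if i == m then r else 0.
  apply/ncseriesP => w /=; case: eqP => [<-|wi]; case: eqP => [e|e] //=.
  - by apply: hm; apply/eqP.
  - by symmetry; apply: hm; apply/eqP => e'; apply: wi; rewrite e' e.
rewrite homM; apply: ideal_sum => i; rewrite homM mulr_suml; apply: ideal_sum => j.
rewrite hr; case: ifP => _; first exact: IdealM.
by rewrite mulr0 mul0r; apply: Ideal0.
Qed.

Definition scal (c : K) : ncseries K X := NcSeries (fun w => if w == [::] then c else 0).
Lemma scalM c f w : (scal c * f) w = c * f w.
Proof.
rewrite ncsM big_ord_recl take0 drop0 /= big1 ?addr0 // => t _.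
by case: w t => [[]//|x w] t; rewrite mul0r.
Qed.

Variable d : nat.
Local Notation n := (size (wordlist X d)).
Local Notation L := (lmul d).
Local Notation col := (tcol d).

Definition idcol (v : 'cV[K]_n) := exists2 f, I f & v = col f.

Lemma tcolD f g : col (f + g) = col f + col g.
Proof. by apply/matrixP => i j; rewrite !mxE. Qed.

Lemma idcol0 : idcol 0.
Proof. by exists 0; [apply: Ideal0 | apply/matrixP => i j; rewrite !mxE]. Qed.
Lemma idcolD u v : idcol u -> idcol v -> idcol (u + v).
Proof.
by move=> [f If ->] [g Ig ->]; exists (f + g); [apply: IdealD | rewrite tcolD].
Qed.
Lemma idcolZ c v : idcol v -> idcol (c *: v).
Proof.
move=> [f If ->]; exists (scal c * f); first exact: idealMl.
by apply/matrixP => i j; rewrite [LHS]mxE [RHS]mxE scalM mxE.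
Qed.
Lemma idcol_sum (T : Type) (s : seq T) (F : T -> 'cV[K]_n) : (forall i, idcol (F i)) -> idcol (\sum_(i <- s) F i).
Proof.
move=> hF; elim: s => [|i s IH]; first by rewrite big_nil; apply: idcol0.
by rewrite big_cons; apply: idcolD.
Qed.
Lemma idcolL f v : idcol v -> idcol (L f *m v).
Proof. by move=> [h Ih ->]; exists (f * h); [apply: idealMl | rewrite lmul_col]. Qed.

Lemma tcol_surj (v : 'cV[K]_n) : exists h, v = col h.
Proof.
exists (NcSeries (fun w => \sum_j v j 0 * (w == wd j)%:R)); apply/matrixP => i j; rewrite !mxE /=.
rewrite (bigD1 i) //= eqxx mulr1 big1 ?addr0 ?ord1 // => k ki.
by rewrite (inj_eq (@wd_inj _ _)) eq_sym (negbTE ki) mulr0.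
Qed.

Definition degproj k : 'M[K]_n := \matrix_(i, j) ((i == j) && (size (wd i) == k))%:R.

Lemma degproj_col k f : degproj k *m col f = col (hom k f).
Proof.
apply/matrixP => i j; rewrite !mxE (bigD1 i) //= !mxE eqxx big1 ?addr0 => [|l li].
  by rewrite /=; case: eqP; rewrite ?mul1r ?mul0r.
by rewrite mxE eq_sym (negbTE li) mul0r.
Qed.

Lemma degproj_sum : \sum_(k < d.+1) degproj k = 1%:M.
Proof.
apply/matrixP => i j; rewrite summxE mxE.
have si : (size (wd i) < d.+1)%N by rewrite ltnS size_wd.
rewrite (bigD1 (Ordinal si)) //= mxE eqxx andbT big1 ?addr0 // => k ki.
rewrite mxE; case: eqP => //= _; case: eqP => // e.
by case/eqP: ki; apply: val_inj; rewrite /= e.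
Qed.

Lemma degproj_id k : degproj k *m degproj k = degproj k.
Proof.
apply/matrixP => i j; rewrite !mxE (bigD1 i) //= big1 ?addr0 => [|l li].
  by rewrite !mxE eqxx /=; case: (size _ == k); rewrite ?mul1r ?mul0r // andbF.
by rewrite mxE eq_sym (negbTE li) mul0r.
Qed.

Lemma idcol_degproj k v : idcol v -> idcol (degproj k *m v).
Proof. by move=> [f If ->]; exists (hom k f); [apply: ideal_hom | rewrite degproj_col]. Qed.

(** The truncated ideal is homogeneous, so a projector with this kernel can be replaced by its
    degree-preserving part. Preserving degrees keeps the letters strictly triangular on the
    quotient. *)
Lemma exists_graded_projector : exists pi : 'M[K]_n,
  [/\ forall v, idcol v -> pi *m v = 0, forall v, idcol (v - pi *m v)
    & forall i j, size (wd i) != size (wd j) -> pi i j = 0].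
Proof.
have [M hM] : exists M : 'M[K]_n, forall u : 'rV[K]_n, idcol u^T <-> (u <= M)%MS.
  apply: subspace_mx; first by rewrite trmx0; apply: idcol0.
    by move=> u v iu iv; rewrite raddfD; apply: idcolD.
  by move=> c u iu; rewrite linearZ; apply: idcolZ.
(* [pinvmx M *m M] is the identity on the row space of M; the transpose of its complement kills the
   ideal. *)
pose p0 : 'M[K]_n := (1%:M - pinvmx M *m M)^T.
have p0I v : idcol v -> p0 *m v = 0.
  rewrite -[v]trmxK => /hM h; rewrite /p0 -trmx_mul mulmxBr mulmx1 mulmxA mulmxKpV // subrr.
  by rewrite trmx0.
have p0D v : idcol (v - p0 *m v).
  have -> : v - p0 *m v = (v^T *m pinvmx M *m M)^T.
    by rewrite -[in p0 *m v](trmxK v) /p0 -trmx_mul mulmxBr mulmx1 mulmxA raddfB /= trmxK subKr.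
  by apply/hM; rewrite submxMl.
exists (\sum_(k < d.+1) degproj k *m p0 *m degproj k); split.
- move=> v iv; rewrite mulmx_suml big1 // => k _; rewrite -!mulmxA p0I ?mulmx0 //.
  exact: idcol_degproj.
- move=> v; have -> : v - (\sum_(k < d.+1) degproj k *m p0 *m degproj k) *m v =
    \sum_(k < d.+1) degproj k *m (degproj k *m v - p0 *m (degproj k *m v)).
    rewrite -[v in LHS]mul1mx -{1}degproj_sum !mulmx_suml -sumrB; apply: eq_bigr => k _.
    by rewrite mulmxBr !mulmxA degproj_id mulmx1.
  by apply: idcol_sum => k; apply: idcol_degproj.
move=> i j ij; rewrite summxE big1 // => k _; rewrite mxE big1 // => l _.
rewrite [degproj k l j]mxE; case: eqP => [->|]; rewrite ?mulr0 //=.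
case: eqP => [e|]; rewrite ?mulr0 // mulr1 mxE big1 // => m _.
rewrite mxE; case: eqP => [<-|]; rewrite ?mul0r //=.
by case: eqP => [e'|]; rewrite ?mul0r //; move: ij; rewrite e e' eqxx.
Qed.
End IdealRep.

(** * The quotient by the ideal as a space of matrices *)

Section QuotientRep.
Variables (K : fieldType) (X : finType) (x0 : X) (S : ncseries K X -> Prop) (d : nat).
Implicit Types (f g h r a b : ncseries K X).
Local Notation I := (two_sided_ideal S).
Local Notation n := (size (wordlist X d)).
Local Notation L := (lmul d).
Variable pi : 'M[K]_n.
Hypothesis pi0 : forall v, idcol S v -> pi *m v = 0.
Hypothesis piD : forall v, idcol S (v - pi *m v).
Hypothesis piG : forall i j, size (wd i) != size (wd j) -> pi i j = 0.

(** The quotient is realized as the image of [pi] inside truncated series; the unit series is thus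
    represented by [pi], not by the identity matrix. *)
Definition qrep f : 'M[K]_n := pi *m L f.

Lemma pi_idem : pi *m pi = pi.
Proof.
apply/eqP; rewrite -subr_eq0 -opprB oppr_eq0; apply/eqP; apply: mul_col0 => v.
by rewrite -[X in X - _]mulmx1 -mulmxBr -mulmxA mulmxBl mul1mx pi0.
Qed.

Lemma pi_lmul f : pi *m L f *m pi = pi *m L f.
Proof.
apply/eqP; rewrite -subr_eq0 -opprB oppr_eq0; apply/eqP; apply: mul_col0 => v.
rewrite -[X in X - _]mulmx1 -mulmxBr -mulmxA mulmxBl mul1mx -mulmxA pi0 //.
exact: idcolL.
Qed.

Lemma qrepM f g : qrep (f * g) = qrep f *m qrep g.
Proof. by rewrite /qrep lmulM !mulmxA pi_lmul. Qed.

Lemma qrepD f g : qrep (f + g) = qrep f + qrep g.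
Proof. by rewrite /qrep lmulD mulmxDr. Qed.
Lemma qrepN f : qrep (- f) = - qrep f.
Proof. by rewrite /qrep lmulN mulmxN. Qed.
Lemma qrep0 : qrep 0 = 0.
Proof. by rewrite /qrep lmul0 mulmx0. Qed.
Lemma qrep_sum (T : Type) (s : seq T) (F : T -> ncseries K X) : qrep (\sum_(i <- s) F i) = \sum_(i <- s) qrep (F i).
Proof. by apply: (big_morph qrep qrepD qrep0). Qed.

Lemma qrep_rel r : S r -> qrep r = 0.
Proof.
move=> Sr; apply: mul_col0 => v; have [h ->] := tcol_surj v.
rewrite /qrep -mulmxA lmul_col pi0 //; exists (r * h) => //.
by rewrite -[r]mul1r; apply: IdealM.
Qed.

Lemma qrep_low f : f [::] = 0 -> low 1 (qrep f).
Proof.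
move=> f0 i j; rewrite addn1 ltnS => /wd_sorted ij; rewrite mxE big1 // => l _.
have [e|ne] := eqVneq (size (wd i)) (size (wd l)); last by rewrite piG ?mul0r.
by rewrite (lmul_size f0) ?mulr0 // -e.
Qed.

(** The empty word contributes the identity matrix on one side and [pi] on the other; multiplying by
    [pi] on the left reconciles them. *)
Lemma pi_act (phi : ncseries K bool) a b : a [::] = 0 -> b [::] = 0 ->
  pi *m act phi (qrep a) (qrep b) = qrep (subst phi a b).
Proof.
move=> a0 b0; rewrite /qrep (lmul_subst x0) // /act !mulmx_sumr; apply: eq_bigr => k _.
rewrite !mulmx_sumr; apply: eq_bigr => v _; rewrite -!scalemxAr; congr (_ *: _).
elim: (tval v) => [|x s IH]; first by rewrite !big_nil.
rewrite !big_cons.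
have H f T T' : pi *m T = pi *m T' -> pi *m (pi *m L f *m T) = pi *m (L f *m T').
  by move=> h; rewrite !mulmxA pi_idem -pi_lmul -[in LHS]mulmxA h mulmxA pi_lmul.
by case: x; apply: H.
Qed.

Lemma pi_mul (T : 'M[K]_n) f g : pi *m T = qrep g -> qrep f *m T = qrep (f * g).
Proof. by move=> h; rewrite qrepM -h mulmxA /qrep pi_lmul. Qed.

Lemma qrep_eq1 f : qrep f = pi -> exists2 h, I h & forall w, (size w <= d)%N -> (f - 1) w = h w.
Proof.
move=> h.
have e : pi *m tcol d (f - 1) = 0.
  rewrite -[f - 1]mulr1 -lmul_col mulmxA -/(qrep (f - 1)) qrepD qrepN h /qrep lmul1 mulmx1 subrr.
  exact: mul0mx.
have := piD (tcol d (f - 1)); rewrite e subr0 => -[h' Ih' eh]; exists h' => //.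
exact: tcol_eq eh.
Qed.
End QuotientRep.

(** * The pentagon relation for series *)

Section Final.
Variables (p : nat) (hp : prime p) (K : padicField p).
Variables (Fs : forall E : micUni K, frobPullback E) (g : ncseries K bool).
Hypothesis hg : is_frobenius_dR_path Fs g.

Lemma pentagon_rel_homogeneous (r : ncseries K ('I_5 * 'I_5)%type) : pentagon_rel r ->
  exists m, forall w, size w != m -> r w = 0.
Proof.
have e1 i j w : size w != 1%N -> ee K i j w = 0.
  by move=> hw; rewrite /ee /letter /=; case: eqP => [e|//]; rewrite e eqxx in hw.
have e2 i j k l w : size w != 2%N -> (ee K i j * ee K k l) w = 0.
  move=> hw; rewrite ncsM big1 // => t _; have [ht|ht] := eqVneq (size (take t w)) 1%N; last by rewrite e1 ?mul0r.
  rewrite [X in _ * X]e1 ?mulr0 //; apply: contra hw => /eqP h.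
  by rewrite -[w](cat_take_drop t) size_cat ht h.
case=> [i|i j|i|i j k l _].
- by exists 1%N => w hw; apply: e1.
- by exists 1%N => w hw; rewrite ncsD ncsN !e1 ?subrr.
- exists 1%N => w hw; elim/big_ind: _ => // [x y hx hy|j _]; last exact: e1.
  by rewrite ncsD hx hy addr0.
- by exists 2%N => w hw; rewrite ncsD ncsN !e2 ?subrr.
Qed.

Lemma pentagon_relation_g : pentagon_relation g.
Proof.
move=> d; pose e (i j : nat) : ncseries K ('I_5 * 'I_5)%type := ee K (inord i) (inord j).
have [pi [pi0 piD piG]] := exists_graded_projector (@pentagon_rel_homogeneous) d.
have e0 i j : e i j [::] = 0 by [].
pose q i j := qrep pi (e i j).
have rel := qrep_rel pi0.
have br : braid5 q.
  split.
  - by move=> i j; apply: qrep_low.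
  - move=> i j; apply/eqP; rewrite -subr_eq0 -qrepN -qrepD; apply/eqP; apply: rel; exact: PRsym.
  - by move=> i; apply: rel; apply: PRdiag.
  - move=> i i5; rewrite /q -qrep_sum; apply: rel.
    have -> : \sum_(j <- iota 0 5) e i j = \sum_j ee K (inord i) j.
      rewrite -[iota 0 5]/(index_iota 0 5) big_mkord; apply: eq_bigr => j _.
      by rewrite /e inord_val.
    exact: PRsum.
  move=> i j k l hl ul; rewrite /q -!(qrepM pi0 piD).
  apply/eqP; rewrite -subr_eq0 -qrepN -qrepD; apply/eqP; apply: rel; apply: PRcomm.
  rewrite -setI_eq0; apply/eqP/setP => x; rewrite !inE; apply/negP => /andP [].
  have v m : (m < 5)%N -> nat_of_ord (inord m : 'I_5) = m by move=> h; rewrite inordK.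
  move: hl ul => /= /and5P [hi hj hk hll _]; rewrite !inE.
  rewrite -!val_eqE /= !v //; lia.
have := penta_eq1 hp hg br; rewrite /penta => P1.
have pa i j k l : pi *m act g (q i j) (q k l) = qrep pi (subst g (e i j) (e k l)).
  by apply: (pi_act (ord0, ord0)) => //.
have [|h Ih hh] := @qrep_eq1 _ _ _ _ _ piD (subst g (e 2%N 3%N) (e 3%N 4%N) * subst g (e 4%N 0%N) (e 0%N 1%N) *
     subst g (e 1%N 2%N) (e 2%N 3%N) * subst g (e 3%N 4%N) (e 4%N 0%N) *
     subst g (e 0%N 1%N) (e 1%N 2%N)).
  (* [pi] is moved through the product of matrices from the left, turning each factor into the
     corresponding series. *)
  rewrite -[RHS]mulmx1 -P1 !mulmxA pa; by do ![rewrite (pi_mul pi0 piD _ (pa _ _ _ _))].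
by exists h; split.
Qed.
End Final.

Theorem mainTheorem1 (p : nat) (hp : prime p) (Qp : padicField p)
    (Fs : forall E : micUni Qp, frobPullback E) (g : ncseries Qp bool)
    (hg : is_frobenius_dR_path Fs g) :
  GRT1 g.
Proof.
split; [exact: (inversion_relation_g hp hg) | exact: (hexagon_relation_g hp hg) | exact: (pentagon_relation_g hp hg)].
Qed.
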